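(* Let $d\ge2$, let $B$ be the open unit ball about the origin in $\mathbb{C}^d$ and let $f=(f_n:B\to B)_{n\in\mathbb{N}}$ be a sequence of injective holomorphic maps such that $$M^{-1}|z|\le |f_n(z)|\le \Lambda|z|,\qquad \forall z\in B,\ \forall n\in\mathbb{N},$$ where $0<\Lambda<1<M$. Assume that the bunching condition $$\Lambda^{2+\epsilon(d)}M<1$$ holds, where $\epsilon(2)=1/14$ and $$\epsilon(d)=\frac{2^{d-1}-1}{2^{2d(d-1)^2}-2^{d(d-1)^2}-2^{d-1}+1},\qquad\forall d\ge3.$$ Then the abstract basin of attraction $Wf$ is biholomorphic to $\mathbb{C}^d$.
   Context: $\mathbb{N}=\{0,1,2,\dots\}$. For a sequence $f=(f_n:U_n\to U_{n+1})_{n\in\mathbb{N}}$ of injective holomorphic maps between $d$-dimensional complex manifolds, the abstract basin of attraction $Wf$ is the inductive limit of the sequence $(f_n)$ with the induced holomorphic structure. Concretely, $Wf$ is the quotient of $$\Bigl\{(z_n)_{n\ge m}\in\prod_{n\ge m}U_n\ \Big|\ m\in\mathbb{N},\ z_{n+1}=f_n(z_n)\ \forall n\ge m\Bigr\}$$ by the relation identifying $z$ and $z'$ if $z_n=z'_n$ for all $n$ large enough. Its complex structure is the one for which the maps $f_{\infty,m}:U_m\hookrightarrow Wf$, $z\mapsto[(f_{n,m}(z))_{n\ge m}]$, with $f_{n,m}=f_{n-1}\circ\dots\circ f_m$ and $f_{m,m}=\mathrm{id}$, are open holomorphic inclusions. *)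

(* Defs.v *)
From HB Require Import structures.
From mathcomp Require Import all_boot all_order all_algebra.
From mathcomp Require Import complex.
From mathcomp Require Import all_classical all_reals all_analysis.

Set Implicit Arguments.
Unset Strict Implicit.
Unset Printing Implicit Defensive.

Import Order.TTheory GRing.Theory Num.Theory.
Import numFieldNormedType.Exports.

Local Open Scope classical_set_scope.
Local Open Scope ring_scope.

(* The field of complex numbers, typed as a [numFieldType] so that the topology
   of a [numFieldType] is inferred on it. *)
Definition Cplx (R : realType) : numFieldType := R[i].

(* The library norm on row vectors is the sup norm; it is used here only
   through its topology and its notion of Frechet differentiability. *)
Notation "''C[' R ]_ d" := 'rV[Cplx R]_d
  (at level 8, R at level 200, d at level 2, format "''C[' R ]_ d") : type_scope.

Definition enorm (R : realType) (d : nat) (z : 'C[R]_d) : R :=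
  Num.sqrt (\sum_(j < d) (complex.Re (z ord0 j) ^+ 2 + complex.Im (z ord0 j) ^+ 2)).

Definition unit_ball (R : realType) (d : nat) : set 'C[R]_d :=
  [set z | enorm z < 1].

(* Complex Frechet differentiability; meant for open [U]. *)
Definition holomorphic_on (R : realType) (d e : nat) (U : set 'C[R]_d)
    (g : 'C[R]_d -> 'C[R]_e) : Prop :=
  forall z, U z -> differentiable g z.

(* An atlas is presented by its inverse charts, from subsets of C^d to the
   space; the manifold axioms are in [is_complex_manifold]. *)
Record chartedSpace (R : realType) (d : nat) := ChartedSpace {
  carrier :> topologicalType;
  chart_index : Type;
  chart_dom : chart_index -> set 'C[R]_d;
  chart_inv : forall i, chart_dom i -> carrier }.

(* The local expression of [F] in the charts [i] and [j] is holomorphic: it is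
   given, wherever it is defined, by a map [g] differentiable there. *)
Definition local_holomorphic (R : realType) (d e : nat)
    (X : chartedSpace R d) (Y : chartedSpace R e) (F : X -> Y)
    (i : chart_index X) (j : chart_index Y) : Prop :=
  exists g : 'C[R]_d -> 'C[R]_e,
    forall (z : chart_dom i) (w : chart_dom j), F (chart_inv z) = chart_inv w ->
      g (\val z) = \val w /\ differentiable g (\val z).

Definition is_complex_manifold (R : realType) (d : nat)
    (X : chartedSpace R d) : Prop :=
  [/\ hausdorff_space X /\ @second_countable X,
      forall i : chart_index X, open (chart_dom i),
      forall i : chart_index X, [/\ injective (@chart_inv R d X i),
        continuous (@chart_inv R d X i) &
        forall A : set (chart_dom i), open A -> open (@chart_inv R d X i @` A)],
      forall x : X, exists (i : chart_index X) (z : chart_dom i), chart_inv z = x &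
      forall i j : chart_index X, local_holomorphic (fun x : X => x) i j].

Definition holomorphic_map (R : realType) (d e : nat)
    (X : chartedSpace R d) (Y : chartedSpace R e) (F : X -> Y) : Prop :=
  continuous F /\ forall i j, local_holomorphic F i j.

Definition biholomorphic (R : realType) (d e : nat)
    (X : chartedSpace R d) (Y : chartedSpace R e) : Prop :=
  [/\ is_complex_manifold X, is_complex_manifold Y &
      exists (F : X -> Y) (G : Y -> X),
        [/\ cancel F G, cancel G F, holomorphic_map F & holomorphic_map G]].

Definition complex_space (R : realType) (d : nat) : chartedSpace R d :=
  @ChartedSpace R d 'C[R]_d unit (fun=> setT) (fun _ z => \val z).

Section Basin.
Variables (R : realType) (d : nat) (U : nat -> set 'C[R]_d).
Variable f : forall n, {injfun U n >-> U n.+1}.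

(* The sequence [(z_n)_(n >= start)]; the values [pt n] for [n < start] are
   irrelevant, and are forgotten in the quotient below. *)
Record tail_orbit := TailOrbit {
  start : nat;
  pt : nat -> 'C[R]_d;
  ptP : forall n, (start <= n)%N -> U n (pt n) /\ pt n.+1 = f n (pt n) }.

HB.instance Definition _ := gen_eqMixin tail_orbit.
HB.instance Definition _ := gen_choiceMixin tail_orbit.

Definition tail_eq : rel tail_orbit :=
  fun z z' => `[< \forall n \near \oo, pt z n = pt z' n >].

Fact tail_eq_refl : reflexive tail_eq.
Proof. by move=> z; apply/asboolP; apply: nearW. Qed.

Fact tail_eq_sym : symmetric tail_eq.
Proof.
by move=> z z'; apply/asboolP/asboolP; apply: filterS => n ->.
Qed.

Fact tail_eq_trans : transitive tail_eq.
Proof.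
move=> y x z /asboolP xy /asboolP yz; apply/asboolP.
by apply: filterS2 xy yz => n -> ->.
Qed.

Canonical tail_equiv := EquivRel tail_eq tail_eq_refl tail_eq_sym tail_eq_trans.

Local Open Scope quotient_scope.

Definition basin_set := {eq_quot tail_equiv}.
HB.instance Definition _ := Choice.on basin_set.

(* [f_iter m k] is [f_(m+k) \o ... \o f_m] with [k] factors, i.e. the map from
   [U m] to [U (m + k)]. *)
Fixpoint f_iter (m k : nat) (z : 'C[R]_d) : 'C[R]_d :=
  if k is k'.+1 then f (m + k') (f_iter m k' z) else z.

Fact f_iter_orbit (m : nat) (z : U m) n : (m <= n)%N ->
  U n (f_iter m (n - m) (\val z)) /\
  f_iter m (n.+1 - m) (\val z) = f n (f_iter m (n - m) (\val z)).
Proof.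
move=> mn.
have [k ->] : exists k, n = (m + k)%N by exists (n - m)%N; rewrite subnKC.
have -> : ((m + k).+1 - m)%N = k.+1 by rewrite -addnS addKn.
rewrite addKn; split => //.
elim: k => [|k IH]; first by rewrite addn0; exact: set_valP.
by rewrite addnS; exact: funS.
Qed.

Definition f_infty (m : nat) (z : U m) : basin_set :=
  \pi_basin_set (TailOrbit (@f_iter_orbit m z)).

Definition basin_open (A : set basin_set) : Prop :=
  forall m, open (@f_infty m @^-1` A).

Fact basin_openT : basin_open setT.
Proof. by move=> m; rewrite preimage_setT; exact: openT. Qed.

Fact basin_openI : setI_closed basin_open.
Proof. by move=> A B oA oB m; rewrite preimage_setI; exact: openI. Qed.

Fact basin_open_bigU (I : Type) (A : I -> set basin_set) :
  (forall i, basin_open (A i)) -> basin_open (\bigcup_i A i).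
Proof.
by move=> oA m; rewrite preimage_bigcup; apply: bigcup_open => i _; exact: oA.
Qed.

(* The inductive limit topology. *)
HB.instance Definition _ := isOpenTopological.Build basin_set
  basin_openT basin_openI basin_open_bigU.

Definition abstract_basin : chartedSpace R d :=
  @ChartedSpace R d basin_set nat U f_infty.

End Basin.

Definition bunching_eps (R : realType) (d : nat) : R :=
  if d == 2%N then 1 / 14
  else (2 ^+ (d - 1) - 1) /
       (2 ^+ (2 * d * (d - 1) ^ 2) - 2 ^+ (d * (d - 1) ^ 2) - 2 ^+ (d - 1) + 1).

(* Main.v *)
Require Import Defs.
From HB Require Import structures.
From mathcomp Require Import all_boot all_order all_algebra.
From mathcomp Require Import complex.
From mathcomp Require Import all_classical all_reals all_analysis.
From mathcomp Require Import perm.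
From mathcomp Require Import ring lra zify.
Set Implicit Arguments.
Unset Strict Implicit.
Unset Printing Implicit Defensive.
Import Order.TTheory GRing.Theory Num.Theory.
Import numFieldNormedType.Exports.
Local Open Scope classical_set_scope.
Local Open Scope ring_scope.

(** The maps [f n] are conjugated, near the origin, to polynomial automorphisms [g n]
    of C^d that are linear except along a sparse sequence of times and whose basin of
    attraction is all of C^d; then [Wf] is identified with C^d by
    [z |-> g_0^-1 (... g_(n-1)^-1 (h n z_n))], where [h n] is the conjugation.

    Put [D = 2^d]. Since [3 D eps(d) <= 1], bunching provides [al > 1] with
    [Lambda <= al^(-6D)] and [M < al^(12D+2)]. Hence [M Lambda^2 <= al^2], so bilinear maps
    pulled back along the linear parts grow by at most [al^2] per step, while after a rescaling
    by [al^((3D-2)n)] cubic terms are contracted, and the conjugation converges as soon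
    as the 2-jets of [f n] and [g n] are conjugated up to an error of size [al^(-3n)].

    At the times [2N], [N = D^k], the quadratic terms coming from later times are disposed of
    as follows. Gaussian elimination with complete pivoting writes the product of
    the linear parts over [2N, 3N) as [X diag Y] with [X], [Y] bounded together with
    their inverses in terms of [d] only. The monomials of the [i]-th coordinate in the frame [X]
    that do not involve the [i]-th variable form the 2-jet of a composition of [d]
    shears, of degree [D], which is made part of [g_(2N)]. The other monomials
    are left to the conjugation, except for those coming from beyond time [3N]: these are damped
    by the operator norm of the product, hence negligible. As the jumps are
    [2 D^k], the contraction between two jumps beats the degree [D] of the shears, and every
    orbit of [g] tends to 0.

    The inverse of the resulting bijection is holomorphic because an injective
    holomorphic map has invertible derivative (Osgood). This is proved by induction on [d] from
    one-variable Cauchy theory, itself obtained from Goursat's lemma. *)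

(** * Real-valued norms, limits of geometric sequences, first-order expansions *)

Section RealNorm.
Context {R : realType}.
Local Notation C := (Cplx R).

(** As [M * Lam ^+ 2] may exceed 1, the series that removes quadratic terms by pulling them back
    from the future diverges. It is cut at the next jump, and the jump has to absorb what the cut
    loses. Shears at every step would raise the degree faster than the linear parts contract, hence
    the sparse times.

    The constants balance as follows. Just after the jump at [2 N] the quadratic term of the
    conjugation carries contributions from as late as [3 D N], hence has size [al^(6 D N - 4 N)],
    which is [al^((3 D - 2) n)] at [n = 2 N]: this dictates the rescaling. At a jump, the part from
    beyond [3 N] has size [al^(6 D N - 6 N)] there and is damped by [Lam^N <= al^(-6 D N)], which
    leaves [al^(-3 n)]. Rescaled cubic terms contract because [(12 D + 2) + 2 (3 D - 2) < 3 (6 D)],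
    the 2-jet error because [al^2 al^(-3) < 1].

    Damping is delicate because a pull-back multiplies by the inverse of the product of the linear
    parts, of norm up to [M^N]. In the adapted frame the large entries of that inverse cancel
    against the small entries of the product for every monomial that is not a shear. *)

Definition cr (r : R) : C := real_complex R r.

(* The library norm of a [normedModType C] is [C]-valued. *)
Definition nr (V : normedModType C) (x : V) : R := complex.Re (`|x| : R[i]).

Lemma cr_le (r s : R) : (cr r <= cr s) = (r <= s). Proof. exact: lecR. Qed.
Lemma cr_lt (r s : R) : (cr r < cr s) = (r < s). Proof. exact: ltcR. Qed.
Lemma crD (r s : R) : cr (r + s) = cr r + cr s. Proof. exact: rmorphD. Qed.
Lemma crM (r s : R) : cr (r * s) = cr r * cr s. Proof. exact: rmorphM. Qed.
Lemma crN (r : R) : cr (- r) = - cr r. Proof. exact: rmorphN. Qed.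
Lemma crB (r s : R) : cr (r - s) = cr r - cr s. Proof. exact: rmorphB. Qed.
Lemma cr0 : cr 0 = 0. Proof. by []. Qed.
Lemma cr1 : cr 1 = 1. Proof. by []. Qed.
Lemma crV (r : R) : cr (r^-1) = (cr r)^-1. Proof. exact: fmorphV. Qed.
Lemma cr_inj : injective cr. Proof. exact: complexI. Qed.

Section V.
Variable V : normedModType C.
Implicit Types x y : V.

Lemma nrE x : `|x| = cr (nr x).
Proof. by rewrite /cr /nr RRe_real // ger0_real // normr_ge0. Qed.

Lemma nr_ge0 x : 0 <= nr x.
Proof. by rewrite -cr_le -nrE; exact: normr_ge0. Qed.

Lemma nr0 : nr (0 : V) = 0.
Proof. by apply: cr_inj; rewrite -nrE normr0. Qed.

Lemma nr0_eq0 x : nr x = 0 -> x = 0.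
Proof. by move=> h; apply: normr0_eq0; rewrite nrE h. Qed.

Lemma nr_eq0 x : (nr x == 0) = (x == 0).
Proof. by apply/eqP/eqP => [/nr0_eq0//|->]; exact: nr0. Qed.

Lemma nr_gt0 x : (0 < nr x) = (x != 0).
Proof. by rewrite lt_def nr_ge0 andbT nr_eq0. Qed.

Lemma nrD x y : nr (x + y) <= nr x + nr y.
Proof. by rewrite -cr_le crD -!nrE; exact: ler_normD. Qed.

Lemma nrN x : nr (- x) = nr x.
Proof. by apply: cr_inj; rewrite -!nrE normrN. Qed.

Lemma nrBC x y : nr (x - y) = nr (y - x).
Proof. by rewrite -nrN opprB. Qed.

Lemma nrB x y : nr (x - y) <= nr x + nr y.
Proof. by rewrite -(nrN y); exact: nrD. Qed.

Lemma nr_tri x y z : nr (x - z) <= nr (x - y) + nr (y - z).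
Proof. by rewrite -(subrKA y x (- z)); exact: nrD. Qed.

Lemma nr_sub x y : nr x - nr y <= nr (x - y).
Proof. by rewrite lerBlDr -{1}(subrK y x); exact: nrD. Qed.

Lemma nrZ (a : C) x : nr (a *: x) = nr (a : C) * nr x.
Proof. by apply: cr_inj; rewrite crM -!nrE normrZ. Qed.

Lemma nr_sum I (r : seq I) (P : pred I) (F : I -> V) :
  nr (\sum_(i <- r | P i) F i) <= \sum_(i <- r | P i) nr (F i).
Proof.
elim/big_rec2: _ => [|i a b _ h]; first by rewrite nr0.
by apply: le_trans (nrD _ _) _; rewrite lerD2l.
Qed.

Lemma nr_norm_lt x e : (`|x| < cr e) = (nr x < e).
Proof. by rewrite nrE cr_lt. Qed.

Lemma gt0_cr (e : C) : 0 < e -> exists2 r : R, 0 < r & e = cr r.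
Proof.
move=> e0; exists (complex.Re e); last by rewrite /cr RRe_real // gtr0_real.
by rewrite -cr_lt /cr RRe_real // gtr0_real.
Qed.

Lemma nbhs_nr x (A : set V) :
  nbhs x A <-> exists2 e : R, 0 < e & forall y, nr (y - x) < e -> A y.
Proof.
split.
  move/nbhs_ballP => [e /= /gt0_cr[r r0 ->] h]; exists r => // y yx.
  by apply: h; rewrite -ball_normE /= nr_norm_lt nrBC.
move=> [e e0 h]; apply/nbhs_ballP; exists (cr e); first by rewrite /= -cr0 cr_lt.
by move=> y; rewrite -ball_normE /= nr_norm_lt nrBC; exact: h.
Qed.

End V.

Lemma nrM (a b : C) : nr (a * b) = nr a * nr b.
Proof. by apply: cr_inj; rewrite crM -!nrE normrM. Qed.
Lemma nr1 : nr (1 : C) = 1.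
Proof. by apply: cr_inj; rewrite -nrE normr1. Qed.
Lemma nrX (a : C) n : nr (a ^+ n) = nr a ^+ n.
Proof. by elim: n => [|n ih]; rewrite ?expr0 ?nr1// !exprS nrM ih. Qed.
Lemma nrV (a : C) : nr (a^-1) = (nr a)^-1.
Proof. by apply: cr_inj; rewrite crV -!nrE normfV. Qed.
Lemma nr_cr (r : R) : nr (cr r) = `|r|.
Proof.
apply: cr_inj; rewrite -nrE; case: (lerP 0 r) => r0.
  by rewrite (ger0_norm r0) ger0_norm //; move: r0; rewrite -cr_le cr0.
rewrite (ltr0_norm r0) ltr0_norm ?crN //.
by move: r0; rewrite -cr_lt cr0.
Qed.
Lemma nr_Re (a : C) : `|complex.Re (a : R[i])| <= nr a.
Proof. by rewrite -cr_le -nrE; exact: normc_ge_Re. Qed.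
Lemma nr_i : nr ('i%C : C) = 1.
Proof.
by rewrite /nr normc_def /= expr0n /= expr1n add0r sqrtr1.
Qed.
Lemma nr_Im (a : C) : `|complex.Im (a : R[i])| <= nr a.
Proof.
have -> : nr a = nr (a * ('i%C : C)).
  by rewrite nrM nr_i mulr1.
apply: le_trans (nr_Re _); by rewrite -normrN -ReiNIm.
Qed.
Lemma nr_ReIm (a : C) : nr a <= `|complex.Re (a : R[i])| + `|complex.Im (a : R[i])|.
Proof.
rewrite {1}(complexE a); apply: le_trans (nrD _ _) _.
by rewrite nrM nr_i mul1r -!nr_cr.
Qed.

Lemma nr_mx_entry m n (A : 'M[C]_(m, n)) i j : nr (A i j) <= nr A.
Proof.
rewrite -cr_le -!nrE [leRHS]/Num.norm /= mx_normE -[leLHS]nngE num_le.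
exact: (@le_bigmax _ _ _ _ (fun ij => (`|A ij.1 ij.2|%:nng)) (i, j)).
Qed.

Lemma nr_mx_le m n (A : 'M[C]_(m, n)) k : 0 <= k ->
  (forall i j, nr (A i j) <= k) -> nr A <= k.
Proof.
move=> k0 h; rewrite -cr_le -nrE.
have [->|] := eqVneq `|A| 0; first by rewrite -cr0 cr_le.
by move=> /mx_norm_neq0[[i j] /= e]; rewrite [leLHS]/Num.norm /= e nrE cr_le.
Qed.

Lemma nr_mulmx m n p (A : 'M[C]_(m, n)) (B : 'M[C]_(n, p)) :
  nr (A *m B) <= n%:R * (nr A * nr B).
Proof.
apply: nr_mx_le => [|i j]; first by rewrite !mulr_ge0 ?nr_ge0.
rewrite mxE; apply: le_trans (nr_sum _ _ _) _.
apply: le_trans (_ : \sum_(k < n) nr A * nr B <= _); last first.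
  by rewrite sumr_const card_ord mulr_natl.
by apply: ler_sum => k _; rewrite nrM; apply: ler_pM; rewrite ?nr_ge0 ?nr_mx_entry.
Qed.

(** With [e n] the tail of the geometric series, the intervals [[v n - e n, v n + e n]] are nested.
    The supremum of the left ends lies in all of them, which gives the limit together with the
    rate. *)
Lemma geo_limit_R (v : nat -> R) (K q : R) : 0 <= q -> q < 1 ->
  (forall n, `|v n.+1 - v n| <= K * q ^+ n) ->
  exists l, forall n, `|v n - l| <= K * q ^+ n / (1 - q).
Proof.
move=> q0 q1 h.
have q1' : 0 < 1 - q by lra.
pose e n := K * q ^+ n / (1 - q).
have e_rec n : e n = K * q ^+ n + e n.+1.
  by rewrite /e exprS; field; lra.
pose a n := v n - e n; pose b n := v n + e n.
have a_inc n k : a n <= a (n + k)%N.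
  elim: k => [|k ih]; first by rewrite addn0.
  apply: le_trans ih _; rewrite addnS /a (e_rec (n + k)%N).
  by move: (h (n + k)%N); rewrite ler_norml => /andP[]; lra.
have b_dec n k : b (n + k)%N <= b n.
  elim: k => [|k ih]; first by rewrite addn0.
  apply: le_trans ih; rewrite addnS /b (e_rec (n + k)%N).
  by move: (h (n + k)%N); rewrite ler_norml => /andP[]; lra.
have e0 n : 0 <= e n.
  rewrite /e divr_ge0 ?(ltW q1') //; apply: le_trans (h n); exact: normr_ge0.
have ab n m : a n <= b m.
  apply: le_trans (a_inc n m) _; rewrite addnC; apply: le_trans (b_dec m n).
  by rewrite /a /b; move: (e0 (m + n)%N); lra.
have hs : has_sup (range a).
  split; first by exists (a 0%N), 0%N.
  by exists (b 0%N) => _ [n _ <-].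
exists (sup (range a)) => n.
have h1 : a n <= sup (range a) by apply: sup_upper_bound => //; exists n.
have h2 : sup (range a) <= b n.
  by apply: ge_sup => [|_ [m _ <-]]; [exact: hs.1|exact: ab].
by rewrite ler_norml; move: h1 h2; rewrite /a /b -/(e n); lra.
Qed.

Lemma ReB (a b : C) : complex.Re (a - b : R[i]) = complex.Re (a : R[i]) - complex.Re (b : R[i]).
Proof. by case: a b => [? ?] [? ?]. Qed.
Lemma ImB (a b : C) : complex.Im (a - b : R[i]) = complex.Im (a : R[i]) - complex.Im (b : R[i]).
Proof. by case: a b => [? ?] [? ?]. Qed.
Lemma geo_limit_C (v : nat -> C) (K q : R) : 0 <= q -> q < 1 ->
  (forall n, nr (v n.+1 - v n) <= K * q ^+ n) ->
  exists l, forall n, nr (v n - l) <= 2 * (K * q ^+ n / (1 - q)).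
Proof.
move=> q0 q1 h.
have [x hx] : exists x, forall n, `|complex.Re (v n : R[i]) - x| <= K * q ^+ n / (1 - q).
  apply: geo_limit_R => // n; apply: le_trans (h n).
  by rewrite -ReB; exact: nr_Re.
have [y hy] : exists x, forall n, `|complex.Im (v n : R[i]) - x| <= K * q ^+ n / (1 - q).
  apply: geo_limit_R => // n; apply: le_trans (h n).
  by rewrite -ImB; exact: nr_Im.
exists (Complex x y) => n; apply: le_trans (nr_ReIm _) _.
by rewrite ReB ImB mulr_natl mulr2n; exact: lerD.
Qed.

Lemma geo_limit_mx m p (v : nat -> 'M[C]_(m, p)) (K q : R) : 0 <= q -> q < 1 ->
  (forall n, nr (v n.+1 - v n) <= K * q ^+ n) ->
  exists l, forall n, nr (v n - l) <= 2 * (K * q ^+ n / (1 - q)).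
Proof.
move=> q0 q1 h.
have /choice[l hl] : forall ij : 'I_m * 'I_p, exists l, forall n,
    nr (v n ij.1 ij.2 - l) <= 2 * (K * q ^+ n / (1 - q)).
  move=> [i j]; apply: geo_limit_C => // n /=; apply: le_trans (h n).
  by apply: le_trans (nr_mx_entry _ i j); rewrite !mxE.
exists (\matrix_(i, j) l (i, j)) => n; apply: nr_mx_le => [|i j].
  rewrite mulr_ge0 // divr_ge0 //; last by lra.
  by apply: le_trans (h n); exact: nr_ge0.
by rewrite !mxE; exact: (hl (i, j)).
Qed.

Lemma geo_small (K q e : R) : 0 <= q -> q < 1 -> 0 < e ->
  exists n, forall m, (n <= m)%N -> K * q ^+ m < e.
Proof.
move=> q0 q1 e0.
have [n hn] : exists n : nat, `|K| * q ^+ n < e.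
  have [->|K0] := eqVneq K 0; first by exists 0%N; rewrite normr0 mul0r.
  have : (fun n => q ^+ n) @ \oo --> (0 : R) by apply: cvg_expr; rewrite ger0_norm.
  move=> /cvgrPdist_lt /(_ (e / `|K|)); rewrite divr_gt0 ?normr_gt0 // => /(_ isT) [n _ hn].
  exists n; rewrite mulrC -ltr_pdivlMr ?normr_gt0 //.
  by apply: le_lt_trans (hn n (leqnn n)); rewrite sub0r normrN ler_norm.
exists n => m nm; apply: le_lt_trans hn.
apply: le_trans (_ : `|K| * q ^+ m <= _).
  by apply: ler_wpM2r; [exact: exprn_ge0|exact: ler_norm].
by apply: ler_wpM2l => //; rewrite ler_wiXn2l // ltW.
Qed.

(** The common form of the passages to the limit below: an estimate is proved up to a multiple of a
    small [e], which is then dropped. *)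
Lemma le_small (x y K : R) : 0 <= K -> (forall e, 0 < e -> e <= 1 -> x <= y + K * e) -> x <= y.
Proof.
move=> K0 h; apply/ler_addgt0Pr => e e0.
pose d := Num.min 1 (e / (K + 1)).
have d0 : 0 < d by rewrite lt_min ltr01 divr_gt0 //; lra.
apply: le_trans (h d d0 _) _; first by rewrite ge_min lexx.
rewrite lerD2l; apply: le_trans (_ : K * (e / (K + 1)) <= _).
  by apply: ler_wpM2l => //; rewrite ge_min lexx orbT.
rewrite mulrA ler_pdivrMr; last by lra.
by rewrite mulrC; apply: ler_wpM2l; lra.
Qed.

Lemma nr_small_eq (V : normedModType C) (x y : V) (K : R) : 0 <= K ->
  (forall e, 0 < e -> e <= 1 -> nr (x - y) <= K * e) -> x = y.
Proof.
move=> K0 h; apply/eqP; rewrite -subr_eq0 -nr_eq0 eq_le nr_ge0 andbT.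
by apply: (le_small K0) => e e0 e1; rewrite add0r; exact: h.
Qed.

Section Diff.
Variables V W : normedModType C.
Implicit Types (f : V -> W) (z : V).

(* [L] is not required to be linear. *)
Definition hasd f z (L : V -> W) := forall e : R, 0 < e -> exists2 r : R, 0 < r &
  forall w, nr w < r -> nr (f (z + w) - f z - L w) <= e * nr w.

Lemma hasd_diff f z : differentiable f z -> hasd f z ('d f z).
Proof.
move=> /diff_locallyP[_ /eqaddoP h] e e0.
have e0' : 0 < cr e by rewrite -cr0 cr_lt.
have /nbhs_nr[r r0 hr] := h _ e0'; exists r => // w wr.
have := hr w; rewrite subr0 => /(_ wr) /=.
rewrite /shift /= !fctE /= nrE [`|w|]nrE -crM cr_le => h'.
by rewrite [z + w]addrC -addrA -opprD.
Qed.

(** The bound [K] supplies the continuity of [L], which [differentiable] demands besides the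
    expansion. *)
Lemma hasd_linear_bounded f z (L : {linear V -> W}) K :
  (forall w, nr (L w) <= K * nr w) -> hasd f z L ->
  differentiable f z /\ 'd f z = L :> (V -> W).
Proof.
move=> hK h.
have cL : continuous L.
  apply/linear_bounded_continuous; apply/linear_boundedP.
  exists (cr (`|K|)); split; first by rewrite ger0_real // -cr0 cr_le normr_ge0.
  move=> r hr x; apply: le_trans (_ : cr (`|K|) * `|x| <= _).
    rewrite !nrE -crM cr_le; apply: le_trans (hK _) _.
    by apply: ler_wpM2r (ler_norm _); exact: nr_ge0.
  by apply: ler_wpM2r (ltW hr); exact: normr_ge0.
have e : f \o shift z = cst (f z) + L +o_ 0 id.
  apply/eqaddoP => _ /gt0_cr[e e0 ->].
  have [r r0 hr] := h e e0; apply/nbhs_nr; exists r => // w; rewrite subr0 => /hr.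
  by rewrite /shift /= !fctE /= nrE [`|w|]nrE -crM cr_le -addrA -opprD [w + z]addrC.
have e2 := diff_unique cL e.
split => //; apply/diff_locallyP; split; first by rewrite e2.
by rewrite e2.
Qed.

End Diff.
End RealNorm.

(** * Curves in the complex plane: derivatives, mean value inequality, antiderivatives *)

Section RealCurves.
Context {R : realType}.
Local Notation C := (Cplx R).
Implicit Types (g G : R -> C) (x y : R).

Lemma is_derive_eps (f : R -> R) x df : is_derive x 1 f df <->
  forall e : R, 0 < e -> exists2 r : R, 0 < r & forall h, `|h| < r ->
    `|f (x + h) - f x - h * df| <= e * `|h|.
Proof.
split.
  move=> [hd hv] e e0.
  have hc : (fun h => h^-1 *: ((f \o shift x) (h *: 1) - f x)) @ 0^' --> df.
    by rewrite -hv; exact: hd.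
  move/cvgrPdist_le : hc => /(_ e e0) /nbhs_ballP[r /= r0 hr].
  exists r => // h hr'; have [->|h0] := eqVneq h 0.
    by rewrite addr0 subrr mul0r subr0 normr0 mulr0.
  have := hr h; rewrite /ball /= sub0r normrN => /(_ hr' h0).
  rewrite /= [h *: 1]mulr1 /shift /= [h + x]addrC => hh.
  have -> : f (x + h) - f x - h * df = - (h * (df - h^-1 * (f (x + h) - f x))).
    by field.
  by rewrite normrN normrM mulrC; apply: ler_wpM2r.
move=> h.
have hc : (fun h => h^-1 *: ((f \o shift x) (h *: 1) - f x)) @ 0^' --> df.
  apply/cvgrPdist_le => e e0; have [r r0 hr] := h e e0.
  apply/nbhs_ballP; exists r => // k; rewrite /ball /= sub0r normrN => kr k0.
  have := hr k kr; rewrite /= [k *: 1]mulr1 /shift /= [k + x]addrC => hh.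
  rewrite -(@ler_pM2r _ `|k|) ?normr_gt0 // -normrM.
  apply: le_trans hh; rewrite -normrN le_eqVlt; apply/orP; left; apply/eqP.
  by congr `|_|; rewrite /GRing.scale /=; field.
by split; [apply/cvg_ex; exists df|exact: cvg_lim hc].
Qed.

(** The derivative of a curve with a real parameter, spelled out by its expansion because [Cplx R]
    is here a normed space over itself and not over [R]. *)
Definition rder g x (v : C) := forall e : R, 0 < e -> exists2 r : R, 0 < r &
  forall h, `|h| < r -> nr (g (x + h) - g x - cr h * v) <= e * `|h|.

Lemma rder_Re g x v : rder g x v ->
  is_derive x 1 (fun t => complex.Re (g t : R[i])) (complex.Re (v : R[i])).
Proof.
move=> h; apply/is_derive_eps => e e0; have [r r0 hr] := h e e0; exists r => // k kr.
apply: le_trans (hr k kr); apply: le_trans (nr_Re _).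
rewrite !ReB; suff -> : complex.Re (cr k * v : R[i]) = k * complex.Re (v : R[i]) by [].
by case: (v) => a b /=; rewrite mul0r subr0.
Qed.

Lemma rder_ReIm (f1 f2 : R -> R) x (a b : R) :
  is_derive x 1 f1 a -> is_derive x 1 f2 b ->
  rder (fun t => Complex (f1 t) (f2 t)) x (Complex a b).
Proof.
move=> /is_derive_eps h1 /is_derive_eps h2 e e0.
have e20 : 0 < e / 2 by rewrite divr_gt0.
have [r1 r10 hr1] := h1 _ e20; have [r2 r20 hr2] := h2 _ e20.
exists (Num.min r1 r2); first by rewrite lt_min r10.
move=> k; rewrite lt_min => /andP[k1 k2]; apply: le_trans (nr_ReIm _) _.
rewrite !ReB !ImB /= !mul0r subr0 addr0.
rewrite [e](_ : e = e / 2 + e / 2); last by field.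
by rewrite mulrDl; apply: lerD; [exact: hr1|exact: hr2].
Qed.

Lemma rderD g1 g2 x v1 v2 : rder g1 x v1 -> rder g2 x v2 ->
  rder (fun t => g1 t + g2 t) x (v1 + v2).
Proof.
move=> h1 h2 e e0; have e20 : 0 < e / 2 by rewrite divr_gt0.
have [r1 r10 hr1] := h1 _ e20; have [r2 r20 hr2] := h2 _ e20.
exists (Num.min r1 r2); first by rewrite lt_min r10.
move=> k; rewrite lt_min => /andP[k1 k2].
have -> : g1 (x + k) + g2 (x + k) - (g1 x + g2 x) - cr k * (v1 + v2) =
  (g1 (x + k) - g1 x - cr k * v1) + (g2 (x + k) - g2 x - cr k * v2) by ring.
apply: le_trans (nrD _ _) _; rewrite [e](_ : e = e / 2 + e / 2); last by field.
by rewrite mulrDl; apply: lerD; [exact: hr1|exact: hr2].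
Qed.

Lemma rder_comp (F : C -> C) g x l v : hasd F (g x) (fun w => w * l) -> rder g x v ->
  rder (F \o g) x (v * l).
Proof.
move=> hF hg e e0.
pose N := nr v + 1.
have N0 : 0 < N by rewrite /N; have := nr_ge0 v; lra.
pose L := nr l + 1.
have L0 : 0 < L by rewrite /L; have := nr_ge0 l; lra.
have [r1 r10 hr1] := hF (e / (2 * N)) (divr_gt0 e0 (mulr_gt0 (ltr0Sn _ 1) N0)).
have m0 : 0 < Num.min 1 (e / (2 * L)).
  by rewrite lt_min ltr01 divr_gt0 // mulr_gt0.
have [r2 r20 hr2] := hg _ m0.
  exists (Num.min r2 (r1 / N)); first by rewrite lt_min r20 divr_gt0.
  move=> h; rewrite lt_min => /andP[h1 h2].
  have := hr2 h h1; set w := g (x + h) - g x => hw.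
  have hw1 : nr w <= N * `|h|.
    rewrite -(subrK (cr h * v) w) /N mulrDl mul1r addrC.
    apply: le_trans (nrD _ _) _.
    rewrite nrM nr_cr mulrC; apply: lerD => //; apply: le_trans hw _.
    by rewrite -[leRHS]mul1r ler_wpM2r // ge_min lexx.
  have hw2 : nr w < r1.
    by apply: le_lt_trans hw1 _; rewrite mulrC -ltr_pdivlMr.
  have ew : g x + w = g (x + h) by rewrite /w addrC subrK.
  have := hr1 w hw2; rewrite ew => hF1.
  have -> : (F \o g) (x + h) - (F \o g) x - cr h * (v * l) =
     (F (g (x + h)) - F (g x) - w * l) + (w - cr h * v) * l by rewrite /=; ring.
  apply: le_trans (nrD _ _) _; rewrite [e](_ : e = e / 2 + e / 2); last by field.
  rewrite [leRHS]mulrDl; apply: lerD.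
    apply: le_trans hF1 _; apply: le_trans (_ : e / (2 * N) * (N * `|h|) <= _).
      by apply: ler_wpM2l => //; rewrite divr_ge0 ?mulr_ge0 ?ltW.
    by rewrite le_eqVlt; apply/orP; left; apply/eqP; field; lra.
  rewrite nrM; apply: le_trans (_ : (e / (2 * L) * `|h|) * L <= _).
    apply: ler_pM; rewrite ?nr_ge0 //; last by rewrite /L; lra.
    by apply: le_trans hw _; rewrite ler_wpM2r // ge_min lexx orbT.
  by rewrite le_eqVlt; apply/orP; left; apply/eqP; field; lra.
Qed.

Lemma hasd_affine (a b z : C) : hasd (fun w => a * w + b) z (fun w => w * a).
Proof.
move=> e e0; exists 1 => // w _.
rewrite (_ : _ - _ = 0) ?nr0 ?mulr_ge0 ?nr_ge0 ?ltW //; ring.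
Qed.

Lemma rderZ (a : C) g x v : rder g x v -> rder (fun t => a * g t) x (a * v).
Proof.
move=> h; rewrite [a * v]mulrC.
have := rder_comp (hasd_affine a 0 (g x)) h.
by congr (rder _ x _); apply/funext => t /=; rewrite addr0.
Qed.

Lemma rder_cst (a : C) x : rder (fun=> a) x 0.
Proof.
by move=> e e0; exists 1 => // h _; rewrite subrr mulr0 subr0 nr0 mulr_ge0 // ltW.
Qed.

Lemma rder_id (x : R) : rder cr x 1.
Proof.
move=> e e0; exists 1 => // h _.
by rewrite crD (_ : _ - _ = 0) ?nr0 ?mulr_ge0 // ?ltW //; ring.
Qed.

Lemma rderB g1 g2 x v1 v2 : rder g1 x v1 -> rder g2 x v2 ->
  rder (fun t => g1 t - g2 t) x (v1 - v2).
Proof.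
move=> h1 h2; have := rderD h1 (rderZ (-1) h2).
rewrite mulN1r; congr (rder _ x _); apply/funext => t; by rewrite mulN1r.
Qed.

(** Multiplication by the unit number [c] that turns the increment into a positive real reduces the
    claim to the mean value theorem for a real part. *)
Lemma rder_mvt g (v : R -> C) (a b K : R) : a <= b ->
  (forall x, a <= x <= b -> rder g x (v x)) ->
  (forall x, a <= x <= b -> nr (v x) <= K) ->
  nr (g b - g a) <= K * (b - a).
Proof.
move=> ab hd hK.
have [e0|n0] := eqVneq (g b - g a) 0.
  rewrite e0 nr0 mulr_ge0 ?subr_ge0 //.
  by apply: le_trans (hK a _); rewrite ?nr_ge0 ?lexx.
pose c : C := cr (nr (g b - g a)) / (g b - g a).
have nc : nr c = 1.
  by rewrite /c nrM nrV nr_cr ger0_norm ?nr_ge0 // divff // nr_eq0.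
have hd' x : a <= x <= b ->
    is_derive x 1 (fun t => complex.Re (c * g t : R[i])) (complex.Re (c * v x : R[i])).
  by move=> xab; apply: rder_Re; apply: rderZ; exact: hd.
have [||x xab e] := @MVT_segment R (fun t => complex.Re (c * g t : R[i]))
   (fun x => complex.Re (c * v x : R[i])) a b ab.
- move=> x; rewrite in_itv /= => /andP[h1 h2]; apply: hd'.
  by rewrite (ltW h1) (ltW h2).
- apply: derivable_within_continuous => x; rewrite in_itv /= => xab.
  by have [] := hd' x xab.
have -> : nr (g b - g a) = complex.Re (c * g b : R[i]) - complex.Re (c * g a : R[i]).
  by rewrite -ReB -mulrBr /c divfK.
rewrite e; apply: ler_wpM2r; first by rewrite subr_ge0.
apply: le_trans (ler_norm _) _; apply: le_trans (nr_Re _) _.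
rewrite nrM nc mul1r; apply: hK; by rewrite in_itv /= in xab.
Qed.

Lemma continuous_nrP (V W : normedModType C) (f : V -> W) z :
  {for z, continuous f} <-> forall e : R, 0 < e ->
  exists2 r : R, 0 < r & forall w, nr (w - z) < r -> nr (f w - f z) < e.
Proof.
split.
  move=> h e e0; have : nbhs (f z) [set w | nr (w - f z) < e] by apply/nbhs_nr; exists e.
  by move=> /h /nbhs_nr.
move=> h A /nbhs_nr[e e0 he]; have [r r0 hr] := h e e0; apply/nbhs_nr.
by exists r => // y /hr /he.
Qed.

Lemma rcontP (g : R -> C) x :
  {for x, continuous g} <-> forall e : R, 0 < e ->
  exists2 r : R, 0 < r & forall y, `|y - x| < r -> nr (g y - g x) < e.
Proof.
split.
  move=> h e e0; have : nbhs (g x) [set w | nr (w - g x) < e] by apply/nbhs_nr; exists e.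
  move=> /h /nbhs_ballP[r /= r0 hr]; exists r => // y yr; apply: hr.
  by rewrite /ball /= distrC.
move=> h A /nbhs_nr[e e0 he]; have [r r0 hr] := h e e0; apply/nbhs_ballP.
by exists r => // y; rewrite /ball /= distrC => /hr /he.
Qed.

Lemma ReC_continuous (g : R -> C) : continuous g ->
  continuous (fun t => complex.Re (g t : R[i])) /\
  continuous (fun t => complex.Im (g t : R[i])).
Proof.
move=> h; split=> x; apply/cvgrPdist_lt => e e0.
  have /rcontP /(_ e e0)[r r0 hr] := h x; apply/nbhs_ballP; exists r => // y.
  rewrite /ball /= distrC => /hr h'; rewrite distrC; apply: le_lt_trans h'.
  by rewrite -ReB; exact: nr_Re.
have /rcontP /(_ e e0)[r r0 hr] := h x; apply/nbhs_ballP; exists r => // y.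
rewrite /ball /= distrC => /hr h'; rewrite distrC; apply: le_lt_trans h'.
by rewrite -ImB; exact: nr_Im.
Qed.

(** The integral from [a] is differentiated to the right of [a] only; this is the origin of the
    hypotheses [a0 < x0] and [a0 < y0] on the rectangles below. *)
Lemma antiderivative_R (g : R -> R) a : continuous g ->
  exists G : R -> R, forall x, a < x -> is_derive x 1 G (g x).
Proof.
move=> cg.
exists (fun x => \int[lebesgue_measure]_(t in [set` Interval (BLeft a) (BRight x)]) g t)%R => x ax.
have xu : x < x + 1 by rewrite ltrDl.
have := @continuous_FTC1 R g (BLeft a) x (x + 1) xu.
case.
- apply: continuous_compact_integrable; first exact: segment_compact.
  exact: continuous_subspaceT.
- by rewrite lte_fin.
- exact: cg.
- by move=> h1 h2; split; [exact: h1|rewrite -derive1E h2].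
Qed.

Lemma antiderivative (g : R -> C) a : continuous g ->
  exists G : R -> C, forall x, a < x -> rder G x (g x).
Proof.
move=> /ReC_continuous[c1 c2].
have [G1 h1] := antiderivative_R a c1.
have [G2 h2] := antiderivative_R a c2.
exists (fun x => Complex (G1 x) (G2 x)) => x ax.
have := rder_ReIm (h1 x ax) (h2 x ax).
by congr (rder _ x _); case: (g x).
Qed.

End RealCurves.

(** * Goursat's lemma and the Cauchy-Taylor expansion *)

Section Goursat.
Context {R : realType}.
Local Notation C := (Cplx R).
Local Notation ii := ('i%C : C).

Definition cx (x y : R) : C := cr x + ii * cr y.

Lemma cxE (z : C) : exists x y, z = cx x y.
Proof. by exists (complex.Re (z : R[i])), (complex.Im (z : R[i])); exact: complexE. Qed.

Lemma cx_sub x y x' y' : nr (cx x y - cx x' y') <= `|x - x'| + `|y - y'|.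
Proof.
have -> : cx x y - cx x' y' = cr (x - x') + ii * cr (y - y') by rewrite /cx !crB; ring.
by apply: le_trans (nrD _ _) _; rewrite nrM nr_i mul1r !nr_cr.
Qed.

Lemma cx_abs x y : `|x| <= nr (cx x y) /\ `|y| <= nr (cx x y).
Proof.
have hRe : complex.Re (cx x y : R[i]) = x by rewrite /= !mul0r mulr0 subr0 addr0.
have hIm : complex.Im (cx x y : R[i]) = y by rewrite /= mul0r mul1r !add0r.
by split; [rewrite -{1}hRe; exact: nr_Re | rewrite -{1}hIm; exact: nr_Im].
Qed.

Lemma cx_mono x y x' y' : `|x'| <= `|x| -> `|y'| <= `|y| -> nr (cx x' y') <= nr (cx x y).
Proof.
move=> hx hy.
have e a b : nr (cx a b) = Num.sqrt (a ^+ 2 + b ^+ 2).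
  have hRe : complex.Re (cx a b : R[i]) = a by rewrite /= !mul0r mulr0 subr0 addr0.
  have hIm : complex.Im (cx a b : R[i]) = b by rewrite /= mul0r mul1r !add0r.
  by rewrite /nr normc_def hRe hIm.
rewrite !e ler_wsqrtr // lerD //.
  by rewrite -[x' ^+ 2]real_normK ?num_real // -[x ^+ 2]real_normK ?num_real // ler_sqr ?nnegrE.
by rewrite -[y' ^+ 2]real_normK ?num_real // -[y ^+ 2]real_normK ?num_real // ler_sqr ?nnegrE.
Qed.

Variables (f : C -> C) (a0 : R) (H V : R -> R -> C).
Hypothesis fH : forall y x, a0 < x -> rder (H y) x (f (cx x y)).
Hypothesis fV : forall x y, a0 < y -> rder (V x) y (f (cx x y)).

(* The integral of [f] over the boundary of a rectangle; integrals over segments are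
   differences of the antiderivatives [H y] and [V x], so that no integral is needed. *)
Definition W x0 x1 y0 y1 : C :=
  (H y0 x1 - H y0 x0) + ii * (V x1 y1 - V x1 y0) -
  (H y1 x1 - H y1 x0) - ii * (V x0 y1 - V x0 y0).

(** An affine function has a primitive, so its boundary integral vanishes; the mean value inequality
    on the four sides then sees only the deviation [eta]. *)
Lemma W_affine x0 x1 y0 y1 (al be : C) (eta : R) :
  a0 < x0 -> a0 < y0 -> x0 <= x1 -> y0 <= y1 ->
  (forall x y, x0 <= x <= x1 -> y0 <= y <= y1 -> nr (f (cx x y) - (al + be * cx x y)) <= eta) ->
  nr (W x0 x1 y0 y1) <= 2 * eta * ((x1 - x0) + (y1 - y0)).
Proof.
move=> ax ay x01 y01 h.
pose h2 : C := 2^-1.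
have two0 : (2 : C) != 0 by rewrite pnatr_eq0.
have i0 : ii != 0 by rewrite -nr_eq0 nr_i oner_eq0.
(* [A] is the primitive [al z + be z^2 / 2] on a horizontal line and [B] the same primitive divided
   by [i] on a vertical line, each up to a term constant along the line. *)
pose A (y x : R) : C := al * cr x + be * (cr x * cr x * h2 + ii * cr x * cr y).
pose B (x y : R) : C := al * cr y + be * (cr x * cr y + ii * cr y * cr y * h2).
have sq x : rder (fun t => cr t * cr t * h2) x (cr x).
  have hs : hasd (fun w : C => w * w * h2) (cr x) (fun w => w * cr x).
    move=> e e0; exists e => // w we.
    have -> : (cr x + w) * (cr x + w) * h2 - cr x * cr x * h2 - w * cr x = (w * w) * h2.
      by rewrite /h2; field.
    rewrite !nrM; have h2n : nr h2 <= 1.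
      rewrite /h2 nrV (_ : (2 : C) = cr 2) ?nr_cr ?ger0_norm //; last by rewrite /cr raddfMn.
      by rewrite invf_le1 // ler1n.
    apply: le_trans (_ : nr w * nr w * 1 <= _).
      by apply: ler_wpM2l => //; rewrite mulr_ge0 ?nr_ge0.
    by rewrite mulr1; apply: ler_wpM2r (ltW we); exact: nr_ge0.
  by have := rder_comp hs (rder_id x); rewrite mul1r.
have hA y x : rder (A y) x (al + be * cx x y).
  have := rderD (rderZ al (rder_id x))
     (rderZ be (rderD (sq x) (rderZ (ii * cr y) (rder_id x)))).
  rewrite !mulr1; congr (rder _ x _); apply/funext => t; rewrite /A; ring.
have hB x y : rder (B x) y (ii^-1 * (ii * (al + be * cx x y))).
  rewrite mulKf //.
  have := rderD (rderZ al (rder_id y))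
     (rderZ be (rderD (rderZ (cr x) (rder_id y)) (rderZ ii (sq y)))).
  rewrite !mulr1; congr (rder _ y _); apply/funext => t; rewrite /B; ring.
have bH y : y0 <= y <= y1 -> nr ((H y x1 - A y x1) - (H y x0 - A y x0)) <= eta * (x1 - x0).
  move=> hy; apply: (@rder_mvt _ (fun x => H y x - A y x) (fun x => f (cx x y) - (al + be * cx x y)) _ _ _ x01).
    move=> x /andP[hx _]; apply: rderB (hA _ _); apply: fH; exact: lt_le_trans ax hx.
  by move=> x hx; exact: h.
have bV x : x0 <= x <= x1 -> nr ((V x y1 - B x y1) - (V x y0 - B x y0)) <= eta * (y1 - y0).
  move=> hx; apply: (@rder_mvt _ (fun y => V x y - B x y) (fun y => f (cx x y) - (al + be * cx x y)) _ _ _ y01).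
    move=> y /andP[hy _]; apply: rderB; first by apply: fV; exact: lt_le_trans ay hy.
    by have := hB x y; rewrite mulKf.
  by move=> y hy; exact: h.
have -> : W x0 x1 y0 y1 =
   ((H y0 x1 - A y0 x1) - (H y0 x0 - A y0 x0)) -
   ((H y1 x1 - A y1 x1) - (H y1 x0 - A y1 x0)) +
   ii * (((V x1 y1 - B x1 y1) - (V x1 y0 - B x1 y0)) -
   ((V x0 y1 - B x0 y1) - (V x0 y0 - B x0 y0))).
  rewrite /W /A /B; have ii2 : ii * ii = -1 by rewrite -expr2 sqr_i.
  ring: ii2.
apply: le_trans (nrD _ _) _; rewrite nrM nr_i mul1r.
have hx0 : x0 <= x0 <= x1 by rewrite lexx. have hx1 : x0 <= x1 <= x1 by rewrite lexx andbT.
have hy0 : y0 <= y0 <= y1 by rewrite lexx. have hy1 : y0 <= y1 <= y1 by rewrite lexx andbT.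
have := nrB (((H y0 x1 - A y0 x1) - (H y0 x0 - A y0 x0))) (((H y1 x1 - A y1 x1) - (H y1 x0 - A y1 x0))).
have := nrB ((V x1 y1 - B x1 y1) - (V x1 y0 - B x1 y0)) ((V x0 y1 - B x0 y1) - (V x0 y0 - B x0 y0)).
move: (bH _ hy0) (bH _ hy1) (bV _ hx0) (bV _ hx1).
lra.
Qed.

Lemma Wx x0 x1 x2 y0 y1 : W x0 x2 y0 y1 = W x0 x1 y0 y1 + W x1 x2 y0 y1.
Proof. rewrite /W; ring. Qed.
Lemma Wy x0 x1 y0 y1 y2 : W x0 x1 y0 y2 = W x0 x1 y0 y1 + W x0 x1 y1 y2.
Proof. rewrite /W; ring. Qed.
Lemma Wx0 x y0 y1 : W x x y0 y1 = 0. Proof. rewrite /W; ring. Qed.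
Lemma Wy0 x0 x1 y : W x0 x1 y y = 0. Proof. rewrite /W; ring. Qed.
Lemma WxN x0 x1 y0 y1 : W x1 x0 y0 y1 = - W x0 x1 y0 y1. Proof. rewrite /W; ring. Qed.
Lemma WyN x0 x1 y0 y1 : W x0 x1 y1 y0 = - W x0 x1 y0 y1. Proof. rewrite /W; ring. Qed.

Local Notation quad := (R * R * (R * R))%type.
Let Wq (q : quad) := W q.1.1 q.1.2 q.2.1 q.2.2.

Let good (q : quad) := q.1.1 <= q.1.2 /\ q.2.1 <= q.2.2.

Let step (q q' : quad) := [/\ q.1.1 <= q'.1.1, q'.1.2 <= q.1.2, q.2.1 <= q'.2.1 & q'.2.2 <= q.2.2]
  /\ [/\ q'.1.2 - q'.1.1 = (q.1.2 - q.1.1) / 2, q'.2.2 - q'.2.1 = (q.2.2 - q.2.1) / 2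
  & nr (Wq q) <= 4 * nr (Wq q')].

Let seg_right (t x h : R) : 0 <= h -> x <= t <= x + h -> `|t - x| <= `|h|.
Proof. by move=> h0 /andP[h1 h2]; rewrite !ger0_norm ?subr_ge0 // lerBlDl. Qed.

Let seg_left (t x h : R) : h < 0 -> x + h <= t <= x -> `|t - x| <= `|h|.
Proof.
move=> h0 /andP[h1 h2]; have tx : t - x <= 0 by rewrite subr_le0.
by rewrite (ltr0_norm h0) (ler0_norm tx) lerN2 lerBrDl.
Qed.

(** Some quarter carries at least a quarter of the integral. The implication stands under the
    existential so that [choice] gives a total map that can be iterated. *)
Lemma bisect q : exists q', good q -> step q q'.
Proof.
case: q => [[x0 x1] [y0 y1]].
pose xm := (x0 + x1) / 2; pose ym := (y0 + y1) / 2.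
have e : Wq ((x0, x1), (y0, y1)) = Wq ((x0, xm), (y0, ym)) + Wq ((xm, x1), (y0, ym)) +
    (Wq ((x0, xm), (ym, y1)) + Wq ((xm, x1), (ym, y1))).
  by rewrite /Wq /=; rewrite -!Wx -Wy.
have := nrD (Wq ((x0, xm), (y0, ym)) + Wq ((xm, x1), (y0, ym)))
   (Wq ((x0, xm), (ym, y1)) + Wq ((xm, x1), (ym, y1))).
rewrite -e => h1.
have h2 := nrD (Wq ((x0, xm), (y0, ym))) (Wq ((xm, x1), (y0, ym))).
have h3 := nrD (Wq ((x0, xm), (ym, y1))) (Wq ((xm, x1), (ym, y1))).
have [c1|c1] := lerP (nr (Wq ((x0, x1), (y0, y1)))) (4 * nr (Wq ((x0, xm), (y0, ym)))).
  exists ((x0, xm), (y0, ym)) => -[/= g1 g2]; clear -g1 g2 c1; split; split => //=; rewrite ?/xm ?/ym; lra.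
have [c2|c2] := lerP (nr (Wq ((x0, x1), (y0, y1)))) (4 * nr (Wq ((xm, x1), (y0, ym)))).
  exists ((xm, x1), (y0, ym)) => -[/= g1 g2]; clear -g1 g2 c2; split; split => //=; rewrite ?/xm ?/ym; lra.
have [c3|c3] := lerP (nr (Wq ((x0, x1), (y0, y1)))) (4 * nr (Wq ((x0, xm), (ym, y1)))).
  exists ((x0, xm), (ym, y1)) => -[/= g1 g2]; clear -g1 g2 c3; split; split => //=; rewrite ?/xm ?/ym; lra.
exists ((xm, x1), (ym, y1)) => -[/= g1 g2]; clear -g1 g2 h1 h2 h3 c1 c2 c3; split; split => //=; rewrite ?/xm ?/ym; lra.
Qed.

Definition cdiff (u : C -> C) (z : C) := exists l, hasd u z (fun w => w * l).

(** By bisection the n-th rectangle keeps at least [4^-n] of the integral. Near the common point [f]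
    is affine up to [e] times the distance, and [W_affine] bounds the same quantity by
    [2 e (p / 2^n)^2], with [p] half the perimeter. *)
Lemma goursat x0 x1 y0 y1 : a0 < x0 -> a0 < y0 -> x0 <= x1 -> y0 <= y1 ->
  (forall x y, x0 <= x <= x1 -> y0 <= y <= y1 -> cdiff f (cx x y)) ->
  W x0 x1 y0 y1 = 0.
Proof.
move=> ax ay x01 y01 hd.
have [nxt hn] := choice bisect.
pose Q n := iter n nxt ((x0, x1), (y0, y1)).
have gs n : good (Q n) /\ step (Q n) (Q n.+1).
  have hst m : good (Q m) -> step (Q m) (Q m.+1) by move=> g; exact: hn.
  have g : good (Q n).
    elim: n => [|n ih]; first by split.
    have [[s1 s2 s3 s4] [s5 s6 _]] := hst n ih; case: ih => i1 i2.
    by rewrite /good; split; lra.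
  by split => //; exact: hst.
pose X0 n := (Q n).1.1; pose X1 n := (Q n).1.2.
pose Y0 n := (Q n).2.1; pose Y1 n := (Q n).2.2.
have mono n k : [/\ X0 n <= X0 (n + k)%N, X1 (n + k)%N <= X1 n,
    Y0 n <= Y0 (n + k)%N & Y1 (n + k)%N <= Y1 n].
  elim: k => [|k [i1 i2 i3 i4]]; first by rewrite addn0.
  rewrite addnS; have [_ [[s1 s2 s3 s4] _]] := gs (n + k)%N.
  by split; [exact: le_trans s1|exact: le_trans i2|exact: le_trans s3|exact: le_trans i4].
have lx n m : X0 n <= X1 m.
  have [h1 _ _ _] := mono n m; have [_ h2 _ _] := mono m n.
  have [[h3 _] _] := gs (n + m)%N; rewrite addnC in h2.
  by apply: le_trans h1 _; apply: le_trans h3 h2.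
have ly n m : Y0 n <= Y1 m.
  have [_ _ h1 _] := mono n m; have [_ _ _ h2] := mono m n.
  have [[_ h3] _] := gs (n + m)%N; rewrite addnC in h2.
  by apply: le_trans h1 _; apply: le_trans h3 h2.
pose xs := sup (range X0); pose ys := sup (range Y0).
have hsx : has_sup (range X0).
  by split; [exists (X0 0%N), 0%N|exists (X1 0%N) => _ [n _ <-]].
have hsy : has_sup (range Y0).
  by split; [exists (Y0 0%N), 0%N|exists (Y1 0%N) => _ [n _ <-]].
have xsP n : X0 n <= xs <= X1 n.
  apply/andP; split; first by apply: sup_upper_bound => //; exists n.
  by apply: ge_sup => [|_ [m _ <-]]; [exact: hsx.1|exact: lx].
have ysP n : Y0 n <= ys <= Y1 n.
  apply/andP; split; first by apply: sup_upper_bound => //; exists n.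
  by apply: ge_sup => [|_ [m _ <-]]; [exact: hsy.1|exact: ly].
pose p := (x1 - x0) + (y1 - y0).
have p0 : 0 <= p by rewrite /p; lra.
have size n : (X1 n - X0 n) + (Y1 n - Y0 n) = p / 2 ^+ n.
  elim: n => [|n ih]; first by rewrite expr0 divr1.
  have [_ [_ [s5 s6 _]]] := gs n.
  rewrite /X1 /X0 /Y1 /Y0 s5 s6 exprSr invfM mulrA -ih /X1 /X0 /Y1 /Y0.
  by rewrite [RHS]mulrDl.
have Wn n : nr (W x0 x1 y0 y1) <= 4 ^+ n * nr (Wq (Q n)).
  elim: n => [|n ih]; first by rewrite expr0 mul1r.
  have [_ [_ [_ _ s7]]] := gs n; apply: le_trans ih _.
  by rewrite exprSr -mulrA; apply: ler_wpM2l s7; exact: exprn_ge0.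
have [l hl] := hd xs ys (xsP 0%N) (ysP 0%N).
apply: (@nr_small_eq _ _ (W x0 x1 y0 y1) 0 (2 * p ^+ 2)); first by rewrite mulr_ge0 ?exprn_ge0.
move=> e e0 _; rewrite subr0.
have [r r0 hr] := hl e e0.
have q0 : (0 : R) <= 2^-1 by rewrite invr_ge0.
have q1 : (2^-1 : R) < 1 by rewrite invf_lt1 // ltr1n.
have [n hn'] := geo_small p q0 q1 r0.
have {}hn' := hn' n (leqnn n); rewrite exprVn in hn'.
apply: le_trans (Wn n) _.
have eta0 : 0 <= e * (p / 2 ^+ n) by rewrite mulr_ge0 ?divr_ge0 ?exprn_ge0 // ltW.
have := @W_affine (X0 n) (X1 n) (Y0 n) (Y1 n) (f (cx xs ys) - cx xs ys * l) l (e * (p / 2 ^+ n)).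
have [m1 m2 m3 m4] := mono 0%N n; rewrite add0n in m1 m2 m3 m4.
have [[g1 g2] _] := gs n.
move=> /(_ (lt_le_trans ax m1) (lt_le_trans ay m3) g1 g2) hW.
apply: le_trans (_ : 4 ^+ n * (2 * (e * (p / 2 ^+ n)) * (p / 2 ^+ n)) <= _).
  apply: ler_wpM2l; first exact: exprn_ge0.
  rewrite -{2}size; apply: hW => x y hx hy.
  have hnr : nr (cx x y - cx xs ys) <= p / 2 ^+ n.
    apply: le_trans (cx_sub _ _ _ _) _; rewrite -size; apply: lerD; rewrite ler_norml.
      by move: hx (xsP n) => /andP[u1 u2] /andP[u3 u4]; lra.
    by move: hy (ysP n) => /andP[u1 u2] /andP[u3 u4]; lra.
  have := hr (cx x y - cx xs ys) (le_lt_trans hnr hn').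
  rewrite [cx xs ys + _]addrC subrK => h'.
  have -> : f (cx x y) - (f (cx xs ys) - cx xs ys * l + l * cx x y) =
     f (cx x y) - f (cx xs ys) - (cx x y - cx xs ys) * l by ring.
  by apply: le_trans h' _; apply: ler_wpM2l => //; exact: ltW.
rewrite (_ : 4 = 2 * 2 :> R); last by rewrite -natrM.
rewrite exprMn le_eqVlt; apply/orP; left; apply/eqP; field.
by rewrite expf_neq0.
Qed.

Let clip_lo (x z D : R) : 0 < D -> x <= z ->
  [/\ x <= Num.max x (z - D), Num.max x (z - D) <= z & Num.max x (z - D) = x \/ Num.max x (z - D) < z].
Proof. by move=> D0 xz; case: (lerP x (z - D)) => h; split; lra. Qed.

Let clip_hi (x z D : R) : 0 < D -> z <= x ->
  [/\ z <= Num.min x (z + D), Num.min x (z + D) <= x & Num.min x (z + D) = x \/ z < Num.min x (z + D)].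
Proof. by move=> D0 xz; case: (lerP x (z + D)) => h; split; lra. Qed.

Let dist_box (x z D : R) : z - D <= x -> x <= z + D -> `|x - z| <= D.
Proof. by rewrite ler_norml; lra. Qed.

Let two_thirds (D r : R) : 0 < r -> D <= r / 3 -> D + D < r.
Proof. lra. Qed.

Let box_perimeter (e D xa xb ya yb z w t : R) : 0 < D -> D <= e -> z - D <= xa -> xb <= z + D ->
  w - D <= ya -> yb <= w + D -> t <= 2 * 1 * ((xb - xa) + (yb - ya)) -> t <= 16 * e.
Proof. lra. Qed.

(** The exceptional point will be the singularity of a difference quotient. A box of size [D] around
    [c] is cut out: each of the four other pieces avoids [c] or is degenerate, and on the box [f]
    stays within 1 of [f c], so its contribution is of order [e]. *)
Lemma goursat_pt (c : C) x0 x1 y0 y1 : a0 < x0 -> a0 < y0 -> x0 <= x1 -> y0 <= y1 ->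
  {for c, continuous f} ->
  (forall x y, x0 <= x <= x1 -> y0 <= y <= y1 -> cx x y <> c -> cdiff f (cx x y)) ->
  W x0 x1 y0 y1 = 0.
Proof.
move=> ax ay x01 y01 /continuous_nrP fc hd.
have [c1 [c2 ec]] := cxE c.
have neq x y : (x != c1) || (y != c2) -> cx x y <> c.
  rewrite ec => h e.
  have := cx_abs (x - c1) (y - c2).
  have -> : cx (x - c1) (y - c2) = cx x y - cx c1 c2 by rewrite /cx !crB; ring.
  rewrite e subrr nr0 !normr_le0 !subr_eq0 => -[e1 e2].
  by move: h; rewrite e1 e2.
apply: (@nr_small_eq _ _ _ 0 16) => // e e0 e1; rewrite subr0.
have [hx|hx] := boolP (x0 <= c1 <= x1); last first.
  suff -> : W x0 x1 y0 y1 = 0 by rewrite nr0 mulr_ge0 // ltW.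
  apply: goursat => // x y hx' hy; apply: hd => //; apply: neq.
  by apply/orP; left; apply: contraNneq hx => <-.
have [hy|hy] := boolP (y0 <= c2 <= y1); last first.
  suff -> : W x0 x1 y0 y1 = 0 by rewrite nr0 mulr_ge0 // ltW.
  apply: goursat => // x y hx' hy'; apply: hd => //; apply: neq.
  by apply/orP; right; apply: contraNneq hy => <-.
have [r r0 hr] := fc 1 ltr01.
pose D := Num.min e (r / 3).
have D0 : 0 < D by rewrite lt_min e0 divr_gt0.
have De : D <= e by rewrite ge_min lexx.
have Dr : D <= r / 3 by rewrite ge_min lexx orbT.
pose xa := Num.max x0 (c1 - D); pose xb := Num.min x1 (c1 + D).
pose ya := Num.max y0 (c2 - D); pose yb := Num.min y1 (c2 + D).
have [xa0 xac Rxa] : [/\ x0 <= xa, xa <= c1 & xa = x0 \/ xa < c1].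
  by case/andP: hx => hx _; exact: clip_lo.
have [c1b xb1 Rxb] : [/\ c1 <= xb, xb <= x1 & xb = x1 \/ c1 < xb].
  by case/andP: hx => _ hx; exact: clip_hi.
have [ya0 yac Rya] : [/\ y0 <= ya, ya <= c2 & ya = y0 \/ ya < c2].
  by case/andP: hy => hy _; exact: clip_lo.
have [c2b yb1 Ryb] : [/\ c2 <= yb, yb <= y1 & yb = y1 \/ c2 < yb].
  by case/andP: hy => _ hy; exact: clip_hi.
have Dxa : c1 - D <= xa by rewrite le_max lexx orbT.
have Dya : c2 - D <= ya by rewrite le_max lexx orbT.
have Dxb : xb <= c1 + D by rewrite ge_min lexx orbT.
have Dyb : yb <= c2 + D by rewrite ge_min lexx orbT.
have xab := le_trans xac c1b; have yab := le_trans yac c2b.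
have axa := lt_le_trans ax xa0; have aya := lt_le_trans ay ya0.
clearbody xa xb ya yb.
have w1 : W x0 xa y0 y1 = 0.
  case: Rxa => [->|h]; first exact: Wx0.
  apply: goursat ax ay xa0 y01 _ => x y /andP[u1 u2] hy'; apply: hd hy' _.
    by rewrite u1 (le_trans u2 (le_trans xab xb1)).
  by apply: neq; rewrite lt_eqF // (le_lt_trans u2 h).
have w2 : W xb x1 y0 y1 = 0.
  case: Rxb => [->|h]; first exact: Wx0.
  apply: goursat (lt_le_trans axa xab) ay xb1 y01 _ => x y /andP[u1 u2] hy'; apply: hd hy' _.
    by rewrite u2 (le_trans (le_trans xa0 xab) u1).
  by apply: neq; rewrite gt_eqF // (lt_le_trans h u1).
have hxx x : xa <= x <= xb -> x0 <= x <= x1.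
  by move=> /andP[u1 u2]; rewrite (le_trans xa0 u1) (le_trans u2 xb1).
have w3 : W xa xb y0 ya = 0.
  case: Rya => [->|h]; first exact: Wy0.
  apply: goursat axa ay xab ya0 _ => x y /hxx hx' /andP[u1 u2]; apply: hd hx' _ _.
    by rewrite u1 (le_trans u2 (le_trans yab yb1)).
  by apply: neq; rewrite orbC lt_eqF // (le_lt_trans u2 h).
have w4 : W xa xb yb y1 = 0.
  case: Ryb => [->|h]; first exact: Wy0.
  apply: goursat axa (lt_le_trans aya yab) xab yb1 _ => x y /hxx hx' /andP[u1 u2]; apply: hd hx' _ _.
    by rewrite u2 (le_trans (le_trans ya0 yab) u1).
  by apply: neq; rewrite orbC gt_eqF // (lt_le_trans h u1).
have w5 : nr (W xa xb ya yb) <= 2 * 1 * ((xb - xa) + (yb - ya)).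
  apply: (@W_affine _ _ _ _ (f c) 0 1 axa aya xab yab) => x y /andP[u1 u2] /andP[u3 u4].
  rewrite mul0r addr0; apply/ltW/hr; rewrite ec.
  apply: le_lt_trans (cx_sub _ _ _ _) _.
  have hx' : `|x - c1| <= D by exact: dist_box (le_trans Dxa u1) (le_trans u2 Dxb).
  have hy' : `|y - c2| <= D by exact: dist_box (le_trans Dya u3) (le_trans u4 Dyb).
  by apply: le_lt_trans (lerD hx' hy') _; exact: two_thirds.
rewrite (Wx x0 xa x1) (Wx xa xb x1) (Wy xa xb y0 ya y1) (Wy xa xb ya yb y1) w1 w2 w3 w4.
rewrite !add0r !addr0; exact: box_perimeter D0 De Dxa Dxb Dya Dyb w5.
Qed.

(** A disc around 0 contains a rectangle as soon as it contains the corners, since the modulus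
    increases with those of the real and imaginary parts. Reversed sides only change the sign of
    [W]. *)
Lemma goursat_any (c : C) (rho : R) x y x' y' : (forall z, {for z, continuous f}) ->
  (forall z, nr z < rho -> z <> c -> cdiff f z) -> rho <= - a0 ->
  nr (cx x y) < rho -> nr (cx x' y') < rho -> nr (cx x y') < rho -> nr (cx x' y) < rho ->
  W x x' y y' = 0.
Proof.
move=> fc hd ra n1 n2 n3 n4.
wlog xx : x x' n1 n2 n3 n4 / x <= x'.
  move=> h; have [xx|xx] := lerP x x'; first exact: h.
  by rewrite WxN h ?oppr0 // ltW.
wlog yy : y y' n1 n2 n3 n4 / y <= y'.
  move=> h; have [yy|yy] := lerP y y'; first exact: h.
  by rewrite WyN h ?oppr0 // ltW.
have lo u v : nr (cx u v) < rho -> a0 < u /\ a0 < v.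
  move=> h; have [h1 h2] := cx_abs u v.
  have := le_lt_trans h1 h; have := le_lt_trans h2 h; rewrite !ltr_norml => /andP[? _] /andP[? _].
  by split; lra.
have [lx ly] := lo _ _ n1.
apply: (@goursat_pt c) => // u v hu hv; apply: hd.
have aux (p q w : R) : p <= w <= q -> `|w| <= `|p| \/ `|w| <= `|q|.
  move=> /andP[pw wq]; have [w0|w0] := lerP 0 w.
    by right; rewrite !ger0_norm //; exact: le_trans wq.
  by left; rewrite !ltr0_norm ?lerN2 //; exact: le_lt_trans w0.
case: (aux _ _ _ hu) => hu'; case: (aux _ _ _ hv) => hv'.
- exact: le_lt_trans (cx_mono hu' hv') n1.
- exact: le_lt_trans (cx_mono hu' hv') n3.
- exact: le_lt_trans (cx_mono hu' hv') n4.
- exact: le_lt_trans (cx_mono hu' hv') n2.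
Qed.

(** [F] integrates [f] along the real axis and then vertically. Goursat's lemma on the rectangle
    over [[x, x + h]] between heights 0 and [y] turns an increment of [F] into an integral along two
    sides of a small box at [z], where [f] is nearly constant. *)
Lemma primitive_disc (c : C) (rho : R) : (forall z, {for z, continuous f}) ->
  (forall z, nr z < rho -> z <> c -> cdiff f z) -> rho <= - a0 ->
  exists F : C -> C, forall z, nr z < rho -> hasd F z (fun w => w * f z).
Proof.
move=> fc hd ra.
pose F (z : C) := let x := complex.Re (z : R[i]) in let y := complex.Im (z : R[i]) in
  (H 0 x - H 0 0) + ii * (V x y - V x 0).
have FE x y : F (cx x y) = (H 0 x - H 0 0) + ii * (V x y - V x 0).
  have hRe : complex.Re (cx x y : R[i]) = x by rewrite /= !mul0r mulr0 subr0 addr0.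
  have hIm : complex.Im (cx x y : R[i]) = y by rewrite /= mul0r mul1r !add0r.
  by rewrite /F hRe hIm.
have cx_lt u v u' v' : nr (cx u v) < rho -> `|u'| <= `|u| -> `|v'| <= `|v| -> nr (cx u' v') < rho.
  by move=> h h1 h2; apply: le_lt_trans (cx_mono h1 h2) h.
have lo u v : nr (cx u v) < rho -> a0 < u /\ a0 < v.
  move=> h; have [h1 h2] := cx_abs u v.
  have := le_lt_trans h1 h; have := le_lt_trans h2 h; rewrite !ltr_norml => /andP[? _] /andP[? _].
  by split; lra.
exists F => z zr e e0.
have [x [y ez]] := cxE z.
have e40 : 0 < e / 4 by rewrite divr_gt0.
have /continuous_nrP /(_ _ e40)[r r0 hr] := fc z.
exists (Num.min (r / 4) ((rho - nr z) / 4)).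
  by rewrite lt_min !divr_gt0 // subr_gt0.
move=> w; rewrite lt_min => /andP[wr1 wr2].
have [h [k ew]] := cxE w.
have [ah ak] := cx_abs h k; rewrite -ew in ah ak.
have in_ball u v : `|u| <= `|h| -> `|v| <= `|k| ->
    nr (cx (x + u) (y + v)) < rho /\ nr (cx (x + u) (y + v) - z) < r.
  move=> hu hv.
  have h1 : nr (cx (x + u) (y + v) - z) <= `|u| + `|v|.
    rewrite ez; apply: le_trans (cx_sub _ _ _ _) _.
    by rewrite [X in `|X| + _]addrAC [X in _ + `|X|]addrAC !subrr !add0r.
  split; last by lra.
  by have := nr_sub (cx (x + u) (y + v)) z; lra.
have := @goursat_any c rho x (0 : R) (x + h) y fc hd ra.
have b0 : `|h| <= `|h| by []. have b1 : `|k| <= `|k| by [].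
have z0 (u : R) : `|0 : R| <= `|u| by rewrite normr0 normr_ge0.
have [ih _] := in_ball h 0 b0 (z0 _); rewrite addr0 in ih.
have [i0 _] := in_ball 0 0 (z0 _) (z0 _); rewrite !addr0 in i0.
move=> /(_ (cx_lt _ _ _ _ i0 (lexx _) (z0 _)) ih i0 (cx_lt _ _ _ _ ih (lexx _) (z0 _))) W0.
have Fd : F (z + w) - F z = (H y (x + h) - H y x) + ii * (V (x + h) (y + k) - V (x + h) y).
  have -> : z + w = cx (x + h) (y + k) by rewrite ez ew /cx !crD; ring.
  rewrite ez !FE -[RHS]addr0 -W0 /W; ring.
have mH : nr ((H y (x + h) - cr (x + h) * f z) - (H y x - cr x * f z)) <= e / 4 * `|h|.
  have hdv t : `|t - x| <= `|h| ->
     rder (fun t => H y t - cr t * f z) t (f (cx t y) - f z) /\ nr (f (cx t y) - f z) <= e / 4.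
    move=> ht; have [j1 j2] := in_ball (t - x) 0 ht (z0 _).
    rewrite addr0 addrC subrK in j1 j2.
    split; last exact/ltW/hr.
    apply: rderB; first by apply: fH; have [] := lo _ _ j1.
    have := rderZ (f z) (rder_id t); rewrite mulr1.
    by congr (rder _ t _); apply/funext => s; rewrite mulrC.
  have [h0|h0] := lerP 0 h.
    rewrite (_ : `|h| = (x + h) - x); last by rewrite ger0_norm //; ring.
    apply: (@rder_mvt _ (fun t => H y t - cr t * f z) (fun t => f (cx t y) - f z)); first lra.
      by move=> t ht; apply: (hdv t _).1; exact: seg_right ht.
    by move=> t ht; apply: (hdv t _).2; exact: seg_right ht.
  rewrite nrBC (_ : `|h| = x - (x + h)); last by rewrite ltr0_norm //; ring.
  apply: (@rder_mvt _ (fun t => H y t - cr t * f z) (fun t => f (cx t y) - f z)); first lra.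
    by move=> t ht; apply: (hdv t _).1; exact: seg_left ht.
  by move=> t ht; apply: (hdv t _).2; exact: seg_left ht.
have mV : nr ((V (x + h) (y + k) - cr (y + k) * f z) - (V (x + h) y - cr y * f z)) <= e / 4 * `|k|.
  have hdv t : `|t - y| <= `|k| ->
     rder (fun t => V (x + h) t - cr t * f z) t (f (cx (x + h) t) - f z) /\
     nr (f (cx (x + h) t) - f z) <= e / 4.
    move=> ht; have [j1 j2] := in_ball h (t - y) (lexx _) ht.
    rewrite [y + _]addrC subrK in j1 j2.
    split; last exact/ltW/hr.
    apply: rderB; first by apply: fV; have [] := lo _ _ j1.
    have := rderZ (f z) (rder_id t); rewrite mulr1.
    by congr (rder _ t _); apply/funext => s; rewrite mulrC.
  have [h0|h0] := lerP 0 k.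
    rewrite (_ : `|k| = (y + k) - y); last by rewrite ger0_norm //; ring.
    apply: (@rder_mvt _ (fun t => V (x + h) t - cr t * f z) (fun t => f (cx (x + h) t) - f z)); first lra.
      by move=> t ht; apply: (hdv t _).1; exact: seg_right ht.
    by move=> t ht; apply: (hdv t _).2; exact: seg_right ht.
  rewrite nrBC (_ : `|k| = y - (y + k)); last by rewrite ltr0_norm //; ring.
  apply: (@rder_mvt _ (fun t => V (x + h) t - cr t * f z) (fun t => f (cx (x + h) t) - f z)); first lra.
    by move=> t ht; apply: (hdv t _).1; exact: seg_left ht.
  by move=> t ht; apply: (hdv t _).2; exact: seg_left ht.
rewrite Fd.
have -> : (H y (x + h) - H y x) + ii * (V (x + h) (y + k) - V (x + h) y) - w * f z =
  ((H y (x + h) - cr (x + h) * f z) - (H y x - cr x * f z)) +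
  ii * ((V (x + h) (y + k) - cr (y + k) * f z) - (V (x + h) y - cr y * f z)).
  rewrite ew /cx !crD; ring.
apply: le_trans (nrD _ _) _; rewrite nrM nr_i mul1r.
have : e / 4 * `|h| <= e / 4 * nr w by apply: ler_wpM2l => //; exact: ltW.
have : e / 4 * `|k| <= e / 4 * nr w by apply: ler_wpM2l => //; exact: ltW.
have : 0 <= e * nr w by rewrite mulr_ge0 ?nr_ge0 // ltW.
lra.
Qed.

End Goursat.

Section Cauchy.
Context {R : realType}.
Local Notation C := (Cplx R).
Local Notation ii := ('i%C : C).

Lemma hasd_local (V W : normedModType C) (f g : V -> W) z L (r : R) : 0 < r ->
  (forall w, nr (w - z) < r -> f w = g w) -> hasd f z L -> hasd g z L.
Proof.
move=> r0 e h eps eps0; have [s s0 hs] := h eps eps0.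
exists (Num.min r s); first by rewrite lt_min r0.
move=> w; rewrite lt_min => /andP[wr ws].
by rewrite -!e ?subrr ?nr0 ?(addrC z) ?addrK // [w + z]addrC; exact: hs.
Qed.

Lemma lin_pack (V W : lmodType C) (f : V -> W) : linear f ->
  exists g : {linear V -> W}, g = f :> (V -> W).
Proof.
move=> hf; pose m := GRing.isLinear.Build C V W *:%R f hf.
by exists (HB.pack f m : {linear V -> W}).
Qed.

Lemma for_contM (T : topologicalType) (f g : T -> C) z :
  {for z, continuous f} -> {for z, continuous g} -> {for z, continuous (fun w => f w * g w)}.
Proof. by move=> h1 h2; exact: cvgM h1 h2. Qed.

Lemma for_contV (T : topologicalType) (f : T -> C) z :
  f z != 0 -> {for z, continuous f} -> {for z, continuous (fun w => (f w)^-1)}.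
Proof. by move=> h1 h2; exact: cvgV h1 h2. Qed.

Lemma for_contB (T : topologicalType) (f g : T -> C) z :
  {for z, continuous f} -> {for z, continuous g} -> {for z, continuous (fun w => f w - g w)}.
Proof. by move=> h1 h2; exact: cvgB h1 h2. Qed.

Lemma for_cont_id (z : C) : {for z, continuous (fun w : C => w)}.
Proof. by move=> A. Qed.

Lemma for_cont_cst (T : topologicalType) (c : C) z : {for z, continuous (fun w : T => c)}.
Proof. exact: cst_continuous. Qed.

Lemma exprn_cont k : continuous (fun z : C => z ^+ k).
Proof.
elim: k => [|k ih] z.
  have -> : (fun z : C => z ^+ 0) = (fun=> 1) by apply/funext => w; rewrite expr0.
  exact: cst_continuous.
have -> : (fun z : C => z ^+ k.+1) = (fun z => z * z ^+ k).
  by apply/funext => w; rewrite exprS.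
exact: (@for_contM C (fun w : C => w) (fun w => w ^+ k) z (@for_cont_id z) (ih z)).
Qed.

Lemma cdiffP (u : C -> C) z : differentiable u z <-> cdiff u z.
Proof.
split.
  move=> h; exists ('d u z 1); apply: (_ : hasd u z (fun w => w * 'd u z 1)).
  have -> : (fun w : C => w * 'd u z 1) = 'd u z.
    by apply/funext => w; rewrite -[in RHS](mulr1 w) -[w * 1]/(w *: (1 : C)) linearZ.
  exact: hasd_diff.
move=> [l hl].
have [|L eL] := @lin_pack C C (fun w => w * l).
  by move=> k x y; rewrite mulrDl scalerAl.
apply: (@hasd_linear_bounded _ _ _ u z L (nr l) _ _).1 => [w|]; rewrite eL //.
by rewrite nrM mulrC.
Qed.

Definition expi (t : R) : C := Complex (cos t) (sin t).

Lemma nr_expi t : nr (expi t) = 1.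
Proof. by rewrite /nr normc_def /= cos2Dsin2 sqrtr1. Qed.

Lemma expiD s t : expi (s + t) = expi s * expi t.
Proof. by apply/eqP; rewrite eq_complex /= cosD sinD [X in _ && (X == _)]addrC !eqxx. Qed.

Lemma expi0 : expi 0 = 1.
Proof. by rewrite /expi cos0 sin0. Qed.

Lemma expi2pi : expi (pi *+ 2) = 1.
Proof. by rewrite /expi cos2pi sin2pi. Qed.

Lemma expi_neq0 t : expi t != 0.
Proof. by rewrite -nr_eq0 nr_expi oner_eq0. Qed.

Lemma expiV t : (expi t)^-1 = expi (- t).
Proof.
apply: (mulfI (expi_neq0 t)); rewrite mulfV ?expi_neq0 //.
by rewrite -expiD subrr expi0.
Qed.

Lemma expiX t n : expi t ^+ n = expi (n%:R * t).
Proof.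
elim: n => [|n ih]; first by rewrite expr0 mul0r expi0.
by rewrite exprS ih -expiD -[n.+1]addn1 natrD mulrDl mul1r addrC.
Qed.

Lemma rder_expi t : rder expi t (ii * expi t).
Proof.
have -> : ii * expi t = Complex (- sin t) (cos t).
  by apply/eqP; rewrite eq_complex /= !mul0r !mul1r sub0r add0r !eqxx.
exact: rder_ReIm (is_derive_cos t) (is_derive_sin t).
Qed.

Lemma rder_scale (g : R -> C) (k t : R) v : rder g (k * t) v ->
  rder (fun s => g (k * s)) t (cr k * v).
Proof.
move=> h e e0; pose K := `|k| + 1.
have K0 : 0 < K by rewrite /K ltr_wpDl.
have [r r0 hr] := h (e / K) (divr_gt0 e0 K0).
exists (r / K); first exact: divr_gt0.
move=> s sr; have sk : `|k * s| <= K * `|s|.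
  by rewrite normrM ler_wpM2r // /K lerDl.
have := hr (k * s); rewrite -mulrDr => h'.
rewrite mulrA -crM [s * k]mulrC; apply: le_trans (h' _) _.
  by apply: le_lt_trans sk _; rewrite mulrC -ltr_pdivlMr.
apply: le_trans (_ : e / K * (K * `|s|) <= _).
  by apply: ler_wpM2l sk; rewrite divr_ge0 ?ltW.
by rewrite mulrA divfK // gt_eqF.
Qed.

Lemma expi_continuous : continuous expi.
Proof.
move=> t; apply/rcontP => e e0.
have [r r0 hr] := rder_expi t (ltr01 : 0 < 1 :> R).
exists (Num.min r (e / 2)); first by rewrite lt_min r0 divr_gt0.
move=> s; rewrite lt_min => /andP[s1 s2].
have := hr (s - t) s1; rewrite [t + _]addrC subrK mul1r => h.
rewrite -(subrK (cr (s - t) * (ii * expi t)) (expi s - expi t)).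
apply: le_lt_trans (nrD _ _) _.
by rewrite !nrM nr_i nr_expi nr_cr !mulr1; lra.
Qed.

Local Notation tpi := (pi *+ 2 : R).
Lemma tpi_gt0 : 0 < tpi. Proof. by rewrite pmulrn_lgt0 // pi_gt0. Qed.
Hint Resolve tpi_gt0 : core.

(* [m] is the mean of [g] over a period, again expressed by an antiderivative. *)
Definition avgP (g : R -> C) (m : C) := exists2 G : R -> C,
  (forall t, 0 <= t <= tpi -> rder G t (g t)) & G tpi - G 0 = cr tpi * m.

Lemma avg_ex g : continuous g -> exists m, avgP g m.
Proof.
move=> /(antiderivative (-1))[G hG].
exists ((G tpi - G 0) / cr tpi); exists G => [t /andP[t0 _]|].
  by apply: hG; apply: lt_le_trans t0; rewrite ltrN10.
by rewrite mulrC divfK // -cr0 (inj_eq cr_inj) gt_eqF.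
Qed.

Lemma avg_lin g1 g2 m1 m2 a b : avgP g1 m1 -> avgP g2 m2 ->
  avgP (fun t => a * g1 t + b * g2 t) (a * m1 + b * m2).
Proof.
move=> [G1 h1 e1] [G2 h2 e2]; exists (fun t => a * G1 t + b * G2 t).
  by move=> t ht; apply: rderD; apply: rderZ; [exact: h1|exact: h2].
by rewrite [RHS]mulrDr ![cr _ * (_ * _)]mulrCA -e1 -e2; ring.
Qed.

Lemma avg_ext g1 g2 m : (forall t, g1 t = g2 t) -> avgP g1 m -> avgP g2 m.
Proof. by move=> /funext ->. Qed.

Lemma avg_sum n (g : nat -> R -> C) (m a : nat -> C) : (forall j, avgP (g j) (m j)) ->
  avgP (fun t => \sum_(j < n) a j * g j t) (\sum_(j < n) a j * m j).
Proof.
move=> h; elim: n => [|n ih].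
  exists (fun=> 0) => [t _|]; last by rewrite big_ord0 subrr mulr0.
  by rewrite big_ord0; exact: rder_cst.
rewrite big_ord_recr /=; have := avg_lin 1 (a n) ih (h n); rewrite mul1r.
by apply: avg_ext => t; rewrite big_ord_recr /= mul1r.
Qed.

Lemma avg_bound g m K : avgP g m -> (forall t, nr (g t) <= K) -> nr m <= K.
Proof.
move=> [G hG e] hK.
have := rder_mvt (ltW tpi_gt0) hG (fun t _ => hK t).
rewrite e nrM nr_cr ger0_norm ?(ltW tpi_gt0) // subr0 mulrC.
by rewrite ler_pM2r.
Qed.

Lemma avg_expi j : avgP (fun t => (expi t ^+ j.+1)^-1) 0.
Proof.
pose k : R := - j.+1%:R.
have k0 : k != 0 by rewrite oppr_eq0 pnatr_eq0.
have ck0 : cr k * ii != 0.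
  by rewrite mulf_neq0 // ?(inj_eq cr_inj _ 0) // -nr_eq0 nr_i oner_eq0.
have e t : (expi t ^+ j.+1)^-1 = expi (k * t) by rewrite expiX expiV mulNr.
exists (fun t => (cr k * ii)^-1 * expi (k * t)) => [t _|].
  rewrite e; have := rderZ (cr k * ii)^-1 (rder_scale (rder_expi (k * t))).
  by rewrite [cr k * (_ * _)]mulrA mulKf.
have -> : expi (k * tpi) = 1 by rewrite -e expi2pi expr1n invr1.
by rewrite mulr0 expi0 subrr mulr0.
Qed.

Section Disc.
Variables (f : C -> C) (c : C) (rho r : R).
Hypothesis (r0 : 0 < r) (rrho : r < rho).
Hypothesis fc : continuous f.
Hypothesis fd : forall z, nr z < rho -> z <> c -> cdiff f z.

Let gam t : C := cr r * expi t.

Lemma nr_gam t : nr (gam t) = r.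
Proof. by rewrite nrM nr_cr nr_expi mulr1 gtr0_norm. Qed.

(** Up to a constant this is the integral of [f] along the circle: [F (gam t) / i] is an
    antiderivative taking the same value at both ends of the period. *)
Lemma circle_zero : avgP (fun t => f (gam t) * gam t) 0.
Proof.
have cH y : continuous (fun x => f (cx x y)).
  move=> x; apply: (@continuous_comp _ _ _ (fun x => cx x y) f); last exact: fc.
  apply/rcontP => e e0; exists e => // x' hx'.
  by apply: le_lt_trans (cx_sub _ _ _ _) _; rewrite subrr normr0 addr0.
have cV x : continuous (fun y => f (cx x y)).
  move=> y; apply: (@continuous_comp _ _ _ (fun y => cx x y) f); last exact: fc.
  apply/rcontP => e e0; exists e => // x' hx'.
  by apply: le_lt_trans (cx_sub _ _ _ _) _; rewrite subrr normr0 add0r.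
have [H hH] := choice (fun y => antiderivative (- rho) (cH y)).
have [V hV] := choice (fun x => antiderivative (- rho) (cV x)).
have [|F hF] := primitive_disc hH hV fc fd; first by rewrite opprK.
exists (fun t => ii^-1 * F (gam t)) => [t _|].
  have := rderZ ii^-1 (rder_comp (hF (gam t) _) (rderZ (cr r) (rder_expi t))).
  rewrite nr_gam => /(_ rrho); congr (rder _ _ _).
  rewrite [cr r * _]mulrCA -mulrA mulKf; last by rewrite -nr_eq0 nr_i oner_eq0.
  by rewrite mulrC.
by rewrite /gam expi2pi expi0 subrr mulr0.
Qed.

End Disc.

Section CauchyFormula.
Variables (f : C -> C) (rho r K : R).
Hypothesis (r0 : 0 < r) (rrho : r < rho).
Hypothesis fc : continuous f.
Hypothesis fd : forall z, nr z < rho -> cdiff f z.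
Hypothesis fK : forall z, nr z = r -> nr (f z) <= K.

Let gam t : C := cr r * expi t.
Let gam_neq0 t : gam t != 0.
Proof. by rewrite -nr_eq0 (nr_gam r0) gt_eqF. Qed.
Let cgam : continuous gam.
Proof. by move=> t; apply: cvgM; [exact: cvg_cst|exact: expi_continuous]. Qed.

(** The Cauchy kernel as a finite geometric sum with a remainder that is again a multiple of the
    kernel. Both the mean of the kernel and Taylor's formula are read off from it. *)
Lemma geo_identity (z a : C) k : z != 0 -> z - a != 0 ->
  z / (z - a) = \sum_(j < k) a ^+ j * (z ^+ j)^-1 + a ^+ k * (z ^+ k)^-1 * (z / (z - a)).
Proof.
move=> z0 za; elim: k => [|k ih].
  by rewrite big_ord0 add0r !expr0 invr1 !mul1r.
rewrite big_ord_recr /= {1}ih -addrA; congr (_ + _).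
rewrite !exprS !invfM; field; rewrite z0 za /=.
by rewrite expf_neq0.
Qed.

Lemma rem_bound (a : C) k t : nr a < r ->
  nr (a ^+ k * (gam t ^+ k)^-1 * (gam t / (gam t - a))) <= (nr a / r) ^+ k * (r / (r - nr a)).
Proof.
move=> ar; rewrite (nrM (_ * _) (_ / _)) (nrM (_ ^+ _)) (nrM (gam t)) !nrV !nrX (nr_gam r0) expr_div_n.
apply: ler_wpM2l; first by rewrite mulr_ge0 ?invr_ge0 ?exprn_ge0 ?nr_ge0 // ltW.
apply: ler_wpM2l; first exact: ltW.
rewrite lef_pV2 ?posrE; [| |by rewrite subr_gt0].
  by have := nr_sub (gam t) a; rewrite (nr_gam r0).
rewrite nr_gt0 subr_eq0; apply: contraTneq ar => <-; by rewrite (nr_gam r0) ltxx.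
Qed.

Let gam_neqa a t : nr a < r -> gam t - a != 0.
Proof. by move=> ar; rewrite subr_eq0; apply: contraTneq ar => <-; rewrite (nr_gam r0) ltxx. Qed.

Let avg_gamV j : avgP (fun t => (gam t ^+ j)^-1) (if j == 0%N then 1 else 0).
Proof.
case: j => [|j] /=.
  exists cr => [t _|]; first by rewrite expr0 invr1; exact: rder_id.
  by rewrite cr0 subr0 mulr1.
have := avg_lin ((cr r ^+ j.+1)^-1) 0 (avg_expi j) (avg_expi j).
rewrite !mulr0 addr0; apply: avg_ext => t.
by rewrite mul0r addr0 /gam exprMn invfM.
Qed.

Let cont_frac a (g : R -> C) k : nr a < r -> continuous g ->
  continuous (fun t => g t * (gam t ^+ k)^-1 * (gam t / (gam t - a))).
Proof.
move=> ar cg t; apply: cvgM.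
  apply: cvgM; first exact: cg.
  apply: cvgV; first by rewrite expf_neq0.
  by apply: (@continuous_comp _ _ _ gam (fun z : C => z ^+ k)); [exact: cgam|exact: exprn_cont].
apply: cvgM; first exact: cgam.
apply: cvgV; first exact: gam_neqa.
by apply: cvgB; [exact: cgam|exact: cvg_cst].
Qed.

(** In the geometric expansion only the term of index 0 has a nonzero mean, and the remainder is
    uniformly small. *)
Lemma avg_kernel a : nr a < r -> avgP (fun t => gam t / (gam t - a)) 1.
Proof.
move=> ar.
have c1 : continuous (fun t : R => 1 : C) by move=> t; exact: cvg_cst.
have [m hm] : exists m, avgP (fun t => gam t / (gam t - a)) m.
  apply: avg_ex; have := @cont_frac a _ 0 ar c1.
  have -> // : (fun t => gam t / (gam t - a)) = (fun t => 1 / gam t ^+ 0 * (gam t / (gam t - a))).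
  by apply/funext => t; rewrite expr0 invr1 !mul1r.
suff <- : m = 1 by [].
have ar1 : nr a / r < 1 by rewrite ltr_pdivrMr // mul1r.
have ar0 : 0 <= nr a / r by rewrite divr_ge0 ?nr_ge0 // ltW.
apply: (@nr_small_eq _ _ _ _ 1) => // e e0 _; rewrite mul1r.
have [n hn] := geo_small (r / (r - nr a)) ar0 ar1 e0.
have {}hn := hn n.+1 (leqnSn n).
apply: le_trans (ltW hn); rewrite mulrC.
have [m' hm'] := avg_ex (@cont_frac a _ n.+1 ar c1).
have := avg_lin 1 (-1) hm (avg_sum n.+1 (fun j => a ^+ j) avg_gamV).
rewrite big_ord_recl /= expr0 !mulr1 big1 ?addr0; last by move=> i _; rewrite mulr0.
rewrite mul1r mulN1r => h; apply: (avg_bound h) => t.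
rewrite mul1r mulN1r {1}(geo_identity n.+1 (gam_neq0 t) (gam_neqa t ar)) addrAC subrr add0r.
exact: rem_bound.
Qed.

(** The difference quotient [q] of [f] at [a], completed by the derivative [l], is continuous
    everywhere and differentiable off [a]; [circle_zero] with exceptional point [a] applies to
    it. *)
Lemma cauchy_formula a : nr a < r -> avgP (fun t => f (gam t) * (gam t / (gam t - a))) (f a).
Proof.
move=> ar.
have [l hl] := fd (lt_trans ar rrho).
pose q z := if z == a then l else (f z - f a) / (z - a).
have qE z : z != a -> q z = (f z - f a) / (z - a) by rewrite /q => /negbTE ->.
have near_ne z w : z != a -> nr (w - z) < nr (z - a) -> w != a.
  by move=> za; apply: contraTneq => ->; rewrite nrBC ltxx.
have qd z : z != a -> differentiable f z -> differentiable q z.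
  move=> za df; apply/cdiffP.
  have /cdiffP[l' hl'] : differentiable (fun w : C => (f w - f a) * (w - a)^-1) z.
    apply: differentiableM; first by apply: differentiableB.
    apply: differentiableV; last by rewrite subr_eq0.
    by apply: differentiableB.
  exists l'; apply: (hasd_local (r := nr (z - a)) _ _ hl').
    by rewrite nr_gt0 subr_eq0.
  by move=> w wz; rewrite qE //; exact: near_ne wz.
have qc : continuous q.
  move=> z; have [->|za] := eqVneq z a.
    apply/continuous_nrP => e e0.
    have e20 : 0 < e / 2 by rewrite divr_gt0.
    have [s s0 hs] := hl _ e20; exists s => // w ws.
    have [->|wa] := eqVneq w a; first by rewrite subrr nr0.
    rewrite qE // /q eqxx.
    have wa0 : 0 < nr (w - a) by rewrite nr_gt0 subr_eq0.
    have := hs (w - a) ws; rewrite [a + _]addrC subrK => h.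
    have -> : (f w - f a) / (w - a) - l = (f w - f a - (w - a) * l) / (w - a).
      by field; rewrite subr_eq0.
    rewrite nrM nrV ltr_pdivrMr //; apply: le_lt_trans h _.
    by rewrite ltr_pM2r //; lra.
  have h1 : {for z, continuous (fun w : C => (f w - f a) * (w - a)^-1)}.
    apply: for_contM; first by apply: for_contB; [exact: fc|exact: for_cont_cst].
    apply: for_contV; first by rewrite subr_eq0.
    by apply: for_contB; [exact: for_cont_id|exact: for_cont_cst].
  apply/continuous_nrP => e e0.
  have /continuous_nrP /(_ e e0)[s s0 hs] := h1.
  exists (Num.min s (nr (z - a))); first by rewrite lt_min s0 nr_gt0 subr_eq0.
  move=> w; rewrite lt_min => /andP[w1 w2].
  by rewrite !qE //; [exact: hs|exact: near_ne w2].
have qz := @circle_zero q a rho r r0 rrho qc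
   (fun z hz za => (cdiffP q z).1 (qd z (introN eqP za) ((cdiffP f z).2 (fd hz)))).
have := avg_lin 1 (f a) qz (avg_kernel ar); rewrite mulr0 add0r mulr1.
apply: avg_ext => t; rewrite -/(gam t) qE; last by rewrite -subr_eq0 gam_neqa.
by field; exact: gam_neqa.
Qed.

(** The coefficients are the means of [f] times the negative powers of [gam]; averaging
    [geo_identity] against [f] gives expansion and remainder at once. *)
Lemma cauchy_taylor_cont : exists c : nat -> C,
  (forall j, nr (c j) <= K / r ^+ j) /\
  forall k a, nr a < r ->
   nr (f a - \sum_(j < k) c j * a ^+ j) <= K * ((nr a / r) ^+ k * (r / (r - nr a))).
Proof.
have cfg : continuous (fun t => f (gam t)).
  by move=> t; apply: (@continuous_comp _ _ _ gam f); [exact: cgam|exact: fc].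
have ex j : exists m, avgP (fun t => f (gam t) * (gam t ^+ j)^-1) m.
  apply: avg_ex => t; apply: cvgM; first exact: cfg.
  apply: cvgV; first by rewrite expf_neq0.
  by apply: (@continuous_comp _ _ _ gam (fun z : C => z ^+ j)); [exact: cgam|exact: exprn_cont].
have [c hc] := choice ex; exists c; split.
  move=> j; apply: (avg_bound (hc j)) => t; rewrite nrM nrV nrX (nr_gam r0).
  by apply: ler_wpM2r; [rewrite invr_ge0 exprn_ge0 // ltW|apply: fK; exact: nr_gam].
move=> k a ar.
have K0 : 0 <= K by apply: le_trans (fK (nr_gam r0 0)); exact: nr_ge0.
have := avg_lin 1 (-1) (cauchy_formula ar) (avg_sum k (fun j => a ^+ j) hc).
rewrite mul1r mulN1r => h.
have -> : \sum_(j < k) c j * a ^+ j = \sum_(j < k) a ^+ j * c j.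
  by apply: eq_bigr => j _; rewrite mulrC.
apply: (avg_bound h) => t; rewrite mul1r mulN1r.
rewrite {1}(geo_identity k (gam_neq0 t) (gam_neqa t ar)) mulrDr mulr_sumr.
have -> : \sum_(i < k) f (gam t) * (a ^+ i * (gam t ^+ i)^-1) =
   \sum_(j < k) a ^+ j * (f (gam t) * (gam t ^+ j)^-1).
  by apply: eq_bigr => j _; rewrite mulrCA.
rewrite addrAC subrr add0r nrM; apply: ler_pM; rewrite ?nr_ge0 //.
  by apply: fK; exact: nr_gam.
exact: rem_bound.
Qed.

End CauchyFormula.

(** The preceding section asks for continuity on the whole plane. It is obtained by composing [u]
    with the radial retraction [ret] onto a disc of radius [s] between [r] and [rho]. *)
Theorem cauchy_taylor (u : C -> C) (rho r K : R) : 0 < r -> r < rho ->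
  (forall z, nr z < rho -> differentiable u z) ->
  (forall z, nr z = r -> nr (u z) <= K) ->
  exists c : nat -> C, (forall j, nr (c j) <= K / r ^+ j) /\
  forall k a, nr a < r ->
   nr (u a - \sum_(j < k) c j * a ^+ j) <= K * ((nr a / r) ^+ k * (r / (r - nr a))).
Proof.
move=> r0 rrho ud uK.
pose s := (r + rho) / 2.
have rs : r < s by rewrite /s; lra.
have s0 : 0 < s by lra.
have srho : s < rho by rewrite /s; lra.
pose m (z : C) : R := Num.max 1 (nr z / s).
have m1 z : 1 <= m z by rewrite le_max lexx.
have m0 z : cr (m z) != 0 by rewrite -cr0 (inj_eq cr_inj) gt_eqF // (lt_le_trans ltr01).
pose ret z := z * (cr (m z))^-1.
have ret_id z : nr z <= s -> ret z = z.
  move=> zs; rewrite /ret /m max_l ?cr1 ?invr1 ?mulr1 //.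
  by rewrite ler_pdivrMr // mul1r.
have ret_le z : nr (ret z) <= s.
  rewrite /ret nrM nrV nr_cr ger0_norm; last by apply: le_trans (m1 z).
  rewrite ler_pdivrMr; last by apply: lt_le_trans (m1 z).
  by rewrite mulrC -ler_pdivrMr // le_max lexx orbT.
have cm z : {for z, continuous (fun w => cr (m w))}.
  apply/continuous_nrP => e e0; exists (e * s); first exact: mulr_gt0.
  move=> w ws; rewrite -crB nr_cr.
  have : `|nr w / s - nr z / s| < e.
    rewrite -mulrBl normrM normfV (gtr0_norm s0) ltr_pdivrMr //.
    apply: le_lt_trans ws; rewrite ler_norml.
    by have := nr_sub w z; have := nr_sub z w; rewrite nrBC; lra.
  rewrite !ltr_norml /m; case: (lerP 1 (nr w / s)); case: (lerP 1 (nr z / s)); lra.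
have cret : continuous ret.
  by move=> z; exact: (for_contM (@for_cont_id z) (@for_contV _ _ z (m0 z) (cm z))).
have cf : continuous (u \o ret).
  move=> z; apply: continuous_comp; first exact: cret.
  by apply: differentiable_continuous; apply: ud; apply: le_lt_trans (ret_le z) srho.
have fd z : nr z < s -> cdiff (u \o ret) z.
  move=> zs; have /cdiffP[l hl] := ud z (lt_trans zs srho); exists l.
  apply: (hasd_local (r := s - nr z) _ _ hl); first by rewrite subr_gt0.
  move=> w wz /=; rewrite ret_id //; have := nr_sub w z; lra.
have fK z : nr z = r -> nr ((u \o ret) z) <= K.
  by move=> zr; rewrite /= ret_id ?uK // zr ltW.
have [c [c1 c2]] := cauchy_taylor_cont r0 rs cf fd fK.
exists c; split => // k a ar; have := c2 k a ar; rewrite /= ret_id //.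
by apply/ltW; apply: lt_trans ar rs.
Qed.

End Cauchy.

(** * Cauchy estimates and maximum principle in one variable *)

Section OneVarEstimates.
Context {R : realType}.
Local Notation C := (Cplx R).

Lemma diff_scal (u : C -> C) z w : differentiable u z -> 'd u z w = w * 'd u z 1.
Proof. by move=> _; rewrite -{1}(mulr1 w) -[w * 1]/(w *: (1 : C)) linearZ. Qed.

Section Taylor.
Variables (u : C -> C) (rho r K : R).
Hypothesis (r0 : 0 < r) (rrho : r < rho).
Hypothesis ud : forall z, nr z < rho -> differentiable u z.
Hypothesis uK : forall z, nr z = r -> nr (u z) <= K.

Lemma K_ge0 : 0 <= K.
Proof.
have : nr (cr r) = r by rewrite nr_cr gtr0_norm.
by move=> /uK; apply: le_trans; exact: nr_ge0.
Qed.

(** On the half disc the factor [r / (r - nr a)] is at most 2. The coefficient of index 1 is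
    identified by comparing the Taylor and the differential expansions at a small real point. *)
Lemma taylor_half : exists c : nat -> C,
  [/\ c 0%N = u 0, c 1%N = 'd u 0 1, (forall j, nr (c j) <= K / r ^+ j) &
  forall k (a : C), nr a <= r / 2 ->
   nr (u a - \sum_(j < k) c j * a ^+ j) <= 2 * K * (nr a / r) ^+ k].
Proof.
have K0 := K_ge0; have r0' := r0.
have [c [c1 c2]] := cauchy_taylor r0 rrho ud uK.
have h k (a : C) : nr a <= r / 2 -> nr (u a - \sum_(j < k) c j * a ^+ j) <= 2 * K * (nr a / r) ^+ k.
  move=> ar; apply: le_trans (c2 k a _) _; first lra.
  rewrite [2 * K]mulrC -mulrA; apply: ler_wpM2l => //.
  rewrite mulrC; apply: ler_wpM2r; first by rewrite exprn_ge0 // divr_ge0 ?nr_ge0 // ltW.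
  by rewrite ler_pdivrMr; lra.
have e0 : c 0%N = u 0.
  have := h 1%N 0; rewrite nr0 mul0r expr1 mulr0 big_ord1 expr0 mulr1 => h'.
  apply/esym/eqP; rewrite -subr_eq0 -nr_eq0 eq_le nr_ge0 andbT; apply: h'; lra.
exists c; split => //.
have hd := hasd_diff (ud (_ : nr (0 : C) < rho)).
rewrite nr0 in hd; have {}hd := hd (lt_trans r0 rrho).
apply: (@nr_small_eq _ _ _ _ 1) => // e ep _; rewrite mul1r.
have [s s0 hs] := hd (e / 2) (divr_gt0 ep (ltr0Sn _ 1)).
pose B := 2 * K / r ^+ 2 + 1.
have B0 : 0 < B.
  by rewrite /B ltr_wpDl // divr_ge0 ?mulr_ge0 ?exprn_ge0 // ltW.
pose t : R := Num.min (s / 2) (Num.min (r / 2) (e / 2 / B)).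
have t0 : 0 < t by rewrite !lt_min !divr_gt0.
have ts : t < s by rewrite /t gt_min; apply/orP; left; lra.
have tr : t <= r / 2 by rewrite !ge_min lexx orbT.
have te : t <= e / 2 / B by rewrite !ge_min lexx !orbT.
pose a := cr t.
have na : nr a = t by rewrite nr_cr gtr0_norm.
have h1 := hs a; rewrite na add0r in h1; have {}h1 := h1 ts.
have h2 := h 2%N a; rewrite na in h2; have {}h2 := h2 tr.
rewrite !big_ord_recl big_ord0 addr0 /= expr0 mulr1 e0 /bump /= expr1 in h2.
rewrite (diff_scal a (ud _)) in h1; last by rewrite nr0 (lt_trans r0).
rewrite -(@ler_pM2r _ t) // -{1}na -nrM.
have -> : (c 1%N - 'd u 0 1) * a = (u a - u 0 - a * 'd u 0 1) - (u a - (u 0 + c 1%N * a)) by ring.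
apply: le_trans (nrB _ _) _.
apply: le_trans (lerD h1 h2) _.
have : 2 * K * (t / r) ^+ 2 <= e / 2 * t.
  rewrite expr_div_n mulrA -mulrAC expr2 mulrA; apply: ler_wpM2r; first exact: ltW.
  apply: le_trans (_ : B * t <= _).
    by apply: ler_wpM2r; [exact: ltW|rewrite /B lerDl].
  by rewrite mulrC -ler_pdivlMr.
lra.
Qed.

Lemma max_principle : nr (u 0) <= K.
Proof. by have [c [<- _ h _]] := taylor_half; have := h 0%N; rewrite expr0 divr1. Qed.

Lemma cauchy_d1 : nr ('d u 0 1) <= K / r.
Proof. by have [c [_ <- h _]] := taylor_half; have := h 1%N; rewrite expr1. Qed.

Lemma second_order (a : C) : nr a <= r / 2 ->
  nr (u a - u 0 - a * 'd u 0 1) <= 2 * K * (nr a / r) ^+ 2.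
Proof.
have [c [<- <- _ h]] := taylor_half => /(h 2%N).
by rewrite !big_ord_recl big_ord0 addr0 /= expr0 mulr1 /bump /= expr1 opprD addrA mulrC [a * _]mulrC.
Qed.

End Taylor.
End OneVarEstimates.

(** * Several complex variables: Cauchy estimates and the inverse function theorem *)

Section SeveralVars.
Context {R : realType}.
Local Notation C := (Cplx R).

(** Homogeneity lets the two maps be compared at small real multiples of [w]. *)
Lemma hasd_uniq (V W : normedModType C) (f : V -> W) z (L M : V -> W) :
  hasd f z L -> hasd f z M -> forall w,
  (forall (k : C) x, L (k *: x) = k *: L x) -> (forall (k : C) x, M (k *: x) = k *: M x) ->
  L w = M w.
Proof.
move=> hL hM w ZL ZM.
have [->|w0] := eqVneq w 0.
  by rewrite -(scale0r (0 : V)) ZL ZM !scale0r.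
have nw : 0 < nr w by rewrite nr_gt0.
apply: (@nr_small_eq _ _ _ _ (2 * nr w)) => [|e e0 _]; first by rewrite mulr_ge0 ?nr_ge0.
have [r r0 hr] := hL e e0; have [s s0 hs] := hM e e0.
pose t := Num.min r s / 2 / nr w.
have m0 : 0 < Num.min r s by rewrite lt_min r0.
have t0 : 0 < t by rewrite !divr_gt0.
have ntw : nr (cr t *: w) < Num.min r s.
  by rewrite nrZ nr_cr gtr0_norm // /t divfK ?gt_eqF //; lra.
move: ntw; rewrite lt_min => /andP[/hr h1 /hs h2].
rewrite -(@ler_pM2l _ t) // -{1}(gtr0_norm t0) -nr_cr -nrZ scalerBr -ZL -ZM.
set D := f (z + _) - f z in h1 h2.
have -> : L (cr t *: w) - M (cr t *: w) = (D - M (cr t *: w)) - (D - L (cr t *: w)).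
  by rewrite opprB [RHS]addrC addrA subrK.
apply: le_trans (nrB _ _) _; move: h1 h2; rewrite nrZ nr_cr gtr0_norm //; lra.
Qed.

Lemma hasd_val (V W : normedModType C) (f : V -> W) z (L : V -> W) w :
  differentiable f z -> hasd f z L -> (forall (k : C) x, L (k *: x) = k *: L x) -> 'd f z w = L w.
Proof. by move=> /hasd_diff h1 h2 ZL; apply: (hasd_uniq h1 h2) => // k x; rewrite linearZ. Qed.

Lemma zmod6 (V : zmodType) (A B a b l m : V) :
  A + B - (a + b) - (l + m) = (A - a - l) + (B - b - m).
Proof. by rewrite [RHS]addrACA [A - a + _]addrACA -!opprD. Qed.

Lemma hasdD (V W : normedModType C) (f g : V -> W) z L M :
  hasd f z L -> hasd g z M -> hasd (fun w => f w + g w) z (fun w => L w + M w).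
Proof.
move=> h1 h2 e e0; have e20 : 0 < e / 2 by rewrite divr_gt0.
have [r1 r10 hr1] := h1 _ e20; have [r2 r20 hr2] := h2 _ e20.
exists (Num.min r1 r2); first by rewrite lt_min r10.
move=> w; rewrite lt_min => /andP[/hr1 w1 /hr2 w2].
by rewrite zmod6; apply: le_trans (nrD _ _) _; lra.
Qed.

Lemma hasdZ (V W : normedModType C) (f : V -> W) z L (a : C) :
  hasd f z L -> hasd (fun w => a *: f w) z (fun w => a *: L w).
Proof.
move=> h e e0; have n0 : 0 < nr a + 1 by rewrite ltr_wpDl ?nr_ge0.
have [r r0 hr] := h _ (divr_gt0 e0 n0); exists r => // w /hr wr.
rewrite -!scalerBr nrZ; apply: le_trans (_ : (nr a + 1) * (e / (nr a + 1) * nr w) <= _).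
  by apply: ler_pM; rewrite ?nr_ge0 // lerDl.
by rewrite mulrA mulrCA divff ?mulr1 // gt_eqF.
Qed.

Lemma hasdB (V W : normedModType C) (f g : V -> W) z L M :
  hasd f z L -> hasd g z M -> hasd (fun w => f w - g w) z (fun w => L w - M w).
Proof.
move=> h1 /(hasdZ (-1)) h2; have := hasdD h1 h2.
by under eq_fun do rewrite scaleN1r; under [X in hasd _ _ X]eq_fun do rewrite scaleN1r.
Qed.

Section Est.
Variables (V : normedModType C) (e : nat).
Variables (f : V -> 'rV[C]_e) (z0 : V) (rho K : R).
Hypothesis (rho0 : 0 < rho).
Hypothesis fd : forall z, nr (z - z0) < rho -> differentiable f z.
Hypothesis fK : forall z, nr (z - z0) < rho -> nr (f z) <= K.

(** Restricting to a complex line and to one coordinate is how all one-variable estimates are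
    carried over to several variables. *)
Lemma line_coord (g : V -> 'rV[C]_e) (w z : V) (t : C) j : differentiable g (z + t *: w) ->
  differentiable (fun t : C => g (z + t *: w) ord0 j) t /\
  'd (fun t : C => g (z + t *: w) ord0 j) t 1 = 'd g (z + t *: w) w ord0 j.
Proof.
move=> dg; pose u (t : C) := g (z + t *: w) ord0 j.
pose l : C := 'd g (z + t *: w) w ord0 j.
have h : hasd u t (fun s => s * l).
  move=> ep ep0; pose N := nr w + 1.
  have N0 : 0 < N by rewrite /N ltr_wpDl ?nr_ge0.
  have [r r0 hr] := hasd_diff dg (divr_gt0 ep0 N0).
  exists (r / N); first exact: divr_gt0.
  move=> s; rewrite ltr_pdivlMr // => sr.
  have sw : nr (s *: w) <= nr s * N.
    by rewrite nrZ; apply: ler_wpM2l; [exact: nr_ge0|rewrite /N; lra].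
  have -> : u (t + s) - u t - s * l =
     (g (z + t *: w + s *: w) - g (z + t *: w) - 'd g (z + t *: w) (s *: w)) ord0 j.
    have e1 : z + (t + s) *: w = z + t *: w + s *: w by rewrite scalerDl addrA.
    have e2 : 'd g (z + t *: w) (s *: w) = s *: 'd g (z + t *: w) w by rewrite linearZ.
    by rewrite /u /l e1 e2 !mxE.
  apply: le_trans (nr_mx_entry _ _ _) _; apply: le_trans (hr _ (le_lt_trans sw sr)) _.
  apply: le_trans (_ : ep / N * (nr s * N) <= _).
    by apply: ler_wpM2l sw; rewrite divr_ge0 // ltW.
  by rewrite mulrCA divfK ?gt_eqF // mulrC.
have du : differentiable u t by apply/cdiffP; exists l.
split => //; have := hasd_uniq (hasd_diff du) h 1; rewrite mul1r; apply.
  by move=> k x; rewrite linearZ.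
by move=> k x; rewrite scalerAl.
Qed.

Lemma dbound z w : nr (z - z0) < rho / 2 -> nr ('d f z w) <= 4 * K / rho * nr w.
Proof.
have rho0' := rho0.
move=> zr.
have K0 : 0 <= K by apply: le_trans (nr_ge0 _) (fK (_ : nr (z0 - z0) < rho)); rewrite subrr nr0.
have [->|w0] := eqVneq w 0; first by rewrite linear0 !nr0 mulr0.
have nw : 0 < nr w by rewrite nr_gt0.
apply: nr_mx_le => [|i j]; first by rewrite !mulr_ge0 ?nr_ge0 ?invr_ge0 // ltW.
rewrite ord1.
pose u (t : C) := f (z + t *: w) ord0 j.
have inb (t : C) : nr t < rho / 2 / nr w -> nr (z + t *: w - z0) < rho.
  rewrite ltr_pdivlMr // => h; rewrite addrAC; apply: le_lt_trans (nrD _ _) _.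
  by rewrite nrZ; lra.
have hl t : nr t < rho / 2 / nr w -> _ := fun h => line_coord j (fd (inb t h)).
(* The line stays in the ball for parameters below [rho / 2 / nr w]; Cauchy's estimate is applied on
   a strictly smaller circle, which gives the factor 4. *)
have r40 : 0 < rho / 4 / nr w by rewrite !divr_gt0.
have r42 : rho / 4 / nr w < rho / 2 / nr w by rewrite ltr_pM2r ?invr_gt0 //; lra.
have := @cauchy_d1 _ u (rho / 2 / nr w) (rho / 4 / nr w) K r40 r42 (fun t h => (hl t h).1) _.
have h0 : nr (0 : C) < rho / 2 / nr w by rewrite nr0 !divr_gt0.
rewrite (hl 0 h0).2 scale0r addr0 => h.
have -> : 4 * K / rho * nr w = K / (rho / 4 / nr w) by field; rewrite !gt_eqF.
apply: h => t ht; apply: le_trans (nr_mx_entry _ _ _) (fK (inb t _)); by rewrite ht.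
Qed.

Lemma dsecond z w : nr (z - z0) < rho / 2 -> nr w <= rho / 8 ->
  nr (f (z + w) - f z - 'd f z w) <= 32 * K / rho ^+ 2 * nr w ^+ 2.
Proof.
have rho0' := rho0; move=> zr wr.
have K0 : 0 <= K by apply: le_trans (nr_ge0 _) (fK (_ : nr (z0 - z0) < rho)); rewrite subrr nr0.
have [->|w0] := eqVneq w 0; first by rewrite linear0 addr0 subrr subr0 !nr0 expr0n mulr0.
have nw : 0 < nr w by rewrite nr_gt0.
apply: nr_mx_le => [|i j]; first by rewrite !mulr_ge0 ?invr_ge0 ?exprn_ge0 ?nr_ge0 // ltW.
rewrite ord1.
pose u (t : C) := f (z + t *: w) ord0 j.
have inb (t : C) : nr t < rho / 2 / nr w -> nr (z + t *: w - z0) < rho.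
  rewrite ltr_pdivlMr // => h; rewrite addrAC; apply: le_lt_trans (nrD _ _) _.
  by rewrite nrZ; lra.
have hl t : nr t < rho / 2 / nr w -> _ := fun h => line_coord j (fd (inb t h)).
have r40 : 0 < rho / 4 / nr w by rewrite !divr_gt0.
have r42 : rho / 4 / nr w < rho / 2 / nr w by rewrite ltr_pM2r ?invr_gt0 //; lra.
have := @second_order _ u (rho / 2 / nr w) (rho / 4 / nr w) K r40 r42 (fun t h => (hl t h).1) _ 1.
have h0 : nr (0 : C) < rho / 2 / nr w by rewrite nr0 !divr_gt0.
rewrite (hl 0 h0).2 /u scale0r addr0 scale1r nr1 mul1r => h.
have -> : 32 * K / rho ^+ 2 * nr w ^+ 2 = 2 * K * (1 / (rho / 4 / nr w)) ^+ 2 by field; rewrite !gt_eqF.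
rewrite !mxE; apply: h.
  by move=> t ht; apply: le_trans (nr_mx_entry _ _ _) (fK (inb t _)); rewrite ht.
by rewrite -[_ / 2]mulrAC ler_pdivlMr // mul1r; lra.
Qed.

(** Points at distance at most [rho / 8] are compared by the second-order expansion, points further
    apart by the crude bound [2 * K]. *)
Lemma dlip z w : nr (z - z0) < rho / 2 -> nr (w - z0) < rho / 2 ->
  nr (f z - f w) <= 16 * K / rho * nr (z - w).
Proof.
have rho0' := rho0.
move=> zr wr.
have K0 : 0 <= K by apply: le_trans (nr_ge0 _) (fK (_ : nr (z0 - z0) < rho)); rewrite subrr nr0.
have [h|h] := lerP (nr (z - w)) (rho / 8).
  have := dsecond wr h; have := dbound (z - w) wr; rewrite [w + _]addrC subrK.
  set D := 'd f w (z - w) => h1 h2.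
  rewrite -(subrK D (f z - f w)); apply: le_trans (nrD _ _) _.
  have h3 : 32 * K / rho ^+ 2 * nr (z - w) ^+ 2 <= 4 * K / rho * nr (z - w).
    rewrite [nr (z - w) ^+ 2]expr2 mulrA; apply: ler_wpM2r; first exact: nr_ge0.
    apply: le_trans (_ : 32 * K / rho ^+ 2 * (rho / 8) <= _).
      by apply: ler_wpM2l => //; rewrite !mulr_ge0 ?invr_ge0 ?exprn_ge0 // ltW.
    by rewrite le_eqVlt; apply/orP; left; apply/eqP; field; rewrite gt_eqF.
  have -> : 16 * K / rho * nr (z - w) = 4 * (4 * K / rho * nr (z - w)) by ring.
  have : 0 <= 4 * K / rho * nr (z - w) by rewrite !mulr_ge0 ?nr_ge0 ?invr_ge0 // ltW.
  lra.
have z1 : nr (f z) <= K by apply: fK; lra.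
have w1 : nr (f w) <= K by apply: fK; lra.
apply: le_trans (nrB _ _) _; apply: le_trans (_ : 16 * K / rho * (rho / 8) <= _).
  have -> : 16 * K / rho * (rho / 8) = 2 * K by field; rewrite gt_eqF.
  lra.
by apply: ler_wpM2l (ltW h); rewrite !mulr_ge0 ?invr_ge0 // ltW.
Qed.

Lemma dbound_hasd z w L : nr (z - z0) < rho / 2 -> hasd f z L ->
  (forall (k : C) x, L (k *: x) = k *: L x) -> nr (L w) <= 4 * K / rho * nr w.
Proof.
have rho0' := rho0; move=> zr hL ZL; rewrite -(hasd_val _ _ hL ZL); first exact: dbound.
by apply: fd; lra.
Qed.

End Est.

(** Cauchy's estimate on the ball of radius [2 * r], where [g] is at most [K * (2 * r) ^+ 2]: the
    Lipschitz constant is of order [K * r], hence small with [r]. *)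
Lemma small_lip d (g : 'rV[C]_d -> 'rV[C]_d) (rho K r : R) : 0 < r -> 2 * r <= rho -> 0 <= K ->
  (forall z, nr z < rho -> differentiable g z) ->
  (forall z, nr z < rho -> nr (g z) <= K * nr z ^+ 2) ->
  forall z w, nr z < r -> nr w < r -> nr (g z - g w) <= 32 * K * r * nr (z - w).
Proof.
move=> r0 rr K0 gd gK z w zr wr.
have r20 : 0 < 2 * r by lra.
have := @dlip _ d g 0 (2 * r) (K * (2 * r) ^+ 2) r20 _ _ z w; rewrite !subr0.
have -> : 16 * (K * (2 * r) ^+ 2) / (2 * r) = 32 * K * r by field; rewrite gt_eqF.
apply; [| |by rewrite mulrAC divff ?mul1r|by rewrite mulrAC divff ?mul1r].
  by move=> y; rewrite subr0 => hy; apply: gd; exact: lt_le_trans rr.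
move=> y; rewrite subr0 => hy; apply: le_trans (gK y _) _; first exact: lt_le_trans rr.
by apply: ler_wpM2l => //; rewrite ler_sqr ?nnegrE ?nr_ge0 ?(ltW r20) // ltW.
Qed.

Lemma linear_rV_bounded d (W : normedModType C) (L : {linear 'rV[C]_d -> W}) w :
  nr (L w) <= (\sum_j nr (L (delta_mx ord0 j))) * nr w.
Proof.
rewrite {1}(row_sum_delta w) linear_sum; apply: le_trans (nr_sum _ _ _) _.
rewrite mulr_suml; apply: ler_sum => j _; rewrite linearZ nrZ mulrC.
by apply: ler_wpM2l; [exact: nr_ge0|exact: nr_mx_entry].
Qed.

Lemma hasd_rV d (W : normedModType C) (f : 'rV[C]_d -> W) z (L : {linear 'rV[C]_d -> W}) :
  hasd f z L -> differentiable f z /\ 'd f z = L :> ('rV[C]_d -> W).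
Proof. exact: hasd_linear_bounded (linear_rV_bounded L). Qed.

Lemma hasd_sq (V W : normedModType C) (f : V -> W) z (L : V -> W) (r K : R) : 0 < r -> 0 <= K ->
  (forall w, nr w <= r -> nr (f (z + w) - f z - L w) <= K * nr w ^+ 2) -> hasd f z L.
Proof.
move=> r0 K0 h e e0; exists (Num.min r (e / (K + 1))).
  by rewrite lt_min r0 divr_gt0 // ltr_wpDl.
move=> w; rewrite lt_min => /andP[w1 w2]; apply: le_trans (h w (ltW w1)) _.
rewrite expr2 mulrA; apply: ler_wpM2r; first exact: nr_ge0.
apply: le_trans (_ : K * (e / (K + 1)) <= _); first by apply: ler_wpM2l => //; exact: ltW.
by rewrite mulrA ler_pdivrMr ?ltr_wpDl // mulrC; apply: ler_wpM2l; lra.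
Qed.

(** Weierstrass's theorem with a geometric rate. Cauchy's estimate applied to consecutive
    differences makes the Jacobian matrices converge, and the second-order remainder, uniform in
    [N], passes to the limit. *)
Lemma holo_limit d e (F : nat -> 'rV[C]_d -> 'rV[C]_e) (f : 'rV[C]_d -> 'rV[C]_e) z0 (rho K A q : R) :
  0 < rho -> 0 <= q -> q < 1 ->
  (forall N z, nr (z - z0) < rho -> differentiable (F N) z) ->
  (forall N z, nr (z - z0) < rho -> nr (F N z) <= K) ->
  (forall N z, nr (z - z0) < rho -> nr (F N z - f z) <= A * q ^+ N) ->
  forall z, nr (z - z0) < rho / 2 -> differentiable f z.
Proof.
move=> rho0 q0 q1 Fd FK Ff z zr.
have zr' : nr (z - z0) < rho by lra.
have A0 : 0 <= A.
  by have := Ff 0%N z zr'; rewrite expr0 mulr1; apply: le_trans; exact: nr_ge0.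
have K0 : 0 <= K by have := FK 0%N z zr'; apply: le_trans; exact: nr_ge0.
pose L N := lin1_mx ('d (F N) z).
have dL N w : 'd (F N) z w = w *m L N by rewrite /L mul_rV_lin1.
have hF N : hasd (F N) z (fun w => w *m L N).
  by have := hasd_diff (Fd N z zr'); congr (hasd _ _ _); apply/funext => w; rewrite dL.
have hL N : nr (L N.+1 - L N) <= (8 * A / rho) * q ^+ N.
  apply: nr_mx_le => [|i j]; first by rewrite !mulr_ge0 ?invr_ge0 ?exprn_ge0 // ltW.
  pose G y := F N.+1 y - F N y.
  have Gd y : nr (y - z0) < rho -> differentiable G y.
    by move=> yr; apply: differentiableB; exact: Fd.
  have hG : hasd G z (fun w => w *m (L N.+1 - L N)).
    have := hasdB (hF N.+1) (hF N); congr (hasd _ _ _).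
    by apply/funext => w; rewrite mulmxBr.
  have -> : (L N.+1 - L N) i j = ((delta_mx ord0 i : 'rV_d) *m (L N.+1 - L N)) ord0 j.
    by rewrite -rowE [in RHS]mxE.
  apply: le_trans (nr_mx_entry _ _ _) _.
  have := @dbound_hasd _ _ G z0 rho (2 * A * q ^+ N) rho0 Gd _ z (delta_mx ord0 i) _ zr hG.
  have d1 : nr (delta_mx ord0 i : 'rV[C]_d) <= 1.
    by apply: nr_mx_le => // a b; rewrite mxE; case: (_ && _); rewrite ?nr0 ?nr1.
  move=> h; apply: le_trans (h _ _) _; last first.
  - rewrite -[leRHS]mulr1; have -> : 4 * (2 * A * q ^+ N) / rho = 8 * A / rho * q ^+ N by ring.
    by apply: ler_wpM2l => //; rewrite !mulr_ge0 ?invr_ge0 ?exprn_ge0 // ltW.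
  - by move=> k x; rewrite scalemxAl.
  - move=> y yr; apply: le_trans (nr_tri _ (f y) _) _.
    have := Ff N.+1 y yr; have := Ff N y yr; rewrite [nr (F N y - _)]nrBC.
    have : A * q ^+ N.+1 <= A * q ^+ N.
      by apply: ler_wpM2l => //; rewrite exprS ler_piMl ?exprn_ge0 // ltW.
    lra.
have [Li hLi] := geo_limit_mx q0 q1 hL.
apply: (@hasd_rV d _ f z (mulmxr Li) _).1.
apply: (@hasd_sq _ _ _ _ _ (rho / 8) (32 * K / rho ^+ 2)); first by rewrite divr_gt0.
  by rewrite !mulr_ge0 ?invr_ge0 ?exprn_ge0 // ltW.
move=> w wr /=.
have wr' : nr (z + w - z0) < rho.
  by rewrite addrAC; apply: le_lt_trans (nrD _ _) _; lra.
pose B := 2 * A + d%:R * (nr w * (2 * (8 * A / rho / (1 - q)))).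
have B0 : 0 <= B.
  have q1' : 0 < 1 - q by lra.
  by rewrite /B addr_ge0 ?mulr_ge0 ?nr_ge0 ?invr_ge0 ?(ltW rho0) ?(ltW q1') // mulr_ge0.
apply: (le_small B0) => ep ep0 _.
have [N hN] := geo_small 1 q0 q1 ep0.
have {}hN := hN N (leqnn N); rewrite mul1r in hN.
have h1 := @dsecond _ _ (F N) z0 rho K rho0 (Fd N) (FK N) z w zr wr.
have h2 := Ff N (z + w) wr'; have h3 := Ff N z zr'; have h4 := hLi N.
have h5 : nr (w *m (L N - Li)) <= d%:R * (nr w * (2 * (8 * A / rho * q ^+ N / (1 - q)))).
  apply: le_trans (nr_mulmx _ _) _; apply: ler_wpM2l => //.
  by apply: ler_wpM2l => //; exact: nr_ge0.
rewrite dL in h1.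
have -> : f (z + w) - f z - w *m Li =
  (F N (z + w) - F N z - w *m L N) - (F N (z + w) - f (z + w)) + (F N z - f z) +
  w *m (L N - Li).
  rewrite mulmxBr; move: (f _) (f z) (F N _) (F N z) (w *m Li) (w *m L N) => x1 x2 x3 x4 x5 x6.
  by apply/rowP => j; rewrite !mxE; ring.
apply: le_trans (nrD _ _) _; apply: le_trans (lerD (nrD _ _) (lexx _)) _.
apply: le_trans (lerD (lerD (nrB _ _) (lexx _)) (lexx _)) _.
have : B * q ^+ N <= B * ep by apply: ler_wpM2l => //; exact: ltW.
have -> : B * q ^+ N = A * q ^+ N + A * q ^+ N +
   d%:R * (nr w * (2 * (8 * A / rho * q ^+ N / (1 - q)))) by rewrite /B; ring.
lra.
Qed.

(** The directional derivative is the limit, at a geometric rate, of the holomorphic difference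
    quotients with steps [T * 2^-N], so [holo_limit] applies. *)
Lemma dd_diff d e (f : 'rV[C]_d -> 'rV[C]_e) z0 (rho : R) v : 0 < rho ->
  (forall z, nr (z - z0) < rho -> differentiable f z) ->
  differentiable (fun z => 'd f z v) z0.
Proof.
move=> rho0 fd.
have z00 : nr (z0 - z0) < rho by rewrite subrr nr0.
have /continuous_nrP /(_ 1 ltr01)[s s0 hs] := differentiable_continuous (fd _ z00).
pose r := Num.min rho s; have r0 : 0 < r by rewrite lt_min rho0.
have rr z : nr (z - z0) < r -> differentiable f z /\ nr (f z) <= nr (f z0) + 1.
  rewrite lt_min => /andP[/fd h1 /hs h2]; split => //.
  by have := nr_sub (f z) (f z0); lra.
have {}fd z (h : nr (z - z0) < r) := (rr z h).1.
have fK z (h : nr (z - z0) < r) := (rr z h).2.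
set K := nr (f z0) + 1 in fK.
have K0 : 0 <= K by rewrite /K addr_ge0 ?nr_ge0.
pose T := r / 8 / (nr v + 1).
have v0 : 0 < nr v + 1 by rewrite ltr_wpDl ?nr_ge0.
have T0 : 0 < T by rewrite !divr_gt0.
pose t N := T * 2^-1 ^+ N.
have h20 : (0 : R) <= 2^-1 by rewrite invr_ge0.
have h21 : (2^-1 : R) < 1 by rewrite invf_lt1 // ltr1n.
have t0 N : 0 < t N by rewrite mulr_gt0 // exprn_gt0 // invr_gt0.
have tT N : t N <= T by rewrite ler_piMr ?(ltW T0) // exprn_ile1 // ltW.
have tv N : nr (cr (t N) *: v) <= r / 8.
  rewrite nrZ nr_cr gtr0_norm //; apply: le_trans (_ : T * (nr v + 1) <= _).
    by apply: ler_pM; rewrite ?nr_ge0 ?(ltW (t0 _)) //; lra.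
  by rewrite divfK // gt_eqF.
pose F N z := (cr (t N))^-1 *: (f (z + cr (t N) *: v) - f z).
have inb N z : nr (z - z0) < r / 2 -> nr (z + cr (t N) *: v - z0) < r.
  by move=> h; rewrite addrAC; apply: le_lt_trans (nrD _ _) _; have := tv N; lra.
have Fest N z : nr (z - z0) < r / 2 ->
   nr (F N z - 'd f z v) <= (32 * K / r ^+ 2 * nr v ^+ 2 * T) * 2^-1 ^+ N.
  move=> zr; have := @dsecond _ _ f z0 r K r0 fd fK z (cr (t N) *: v) zr (tv N).
  have ct : cr (t N) != 0 by rewrite -cr0 (inj_eq cr_inj) gt_eqF.
  have -> : F N z - 'd f z v = (cr (t N))^-1 *: (f (z + cr (t N) *: v) - f z - 'd f z (cr (t N) *: v)).
    by rewrite linearZ [in RHS]scalerBr scalerA mulVf // scale1r.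
  rewrite (nrZ (cr (t N)) v) nr_cr (gtr0_norm (t0 N)) => h.
  rewrite nrZ nrV nr_cr (gtr0_norm (t0 N)).
  rewrite mulrC ler_pdivrMr //; apply: le_trans h _.
  by rewrite le_eqVlt /t; apply/orP; left; apply/eqP; field; rewrite gt_eqF.
have r20 : 0 < r / 2 by rewrite divr_gt0.
apply: (@holo_limit d e F (fun z => 'd f z v) z0 (r / 2) (32 * K / r ^+ 2 * nr v ^+ 2 * T + 4 * K / r * nr v) _ _ r20 h20 h21 _ _ Fest).
- move=> N z zr.
  have d1 : differentiable (fun z => f (z + cr (t N) *: v)) z.
    have [|L eL] := @lin_pack R 'rV[C]_d 'rV[C]_e (fun w => 'd f (z + cr (t N) *: v) w).
      by move=> k x y; rewrite linearP.
    apply: (@hasd_rV _ _ _ _ L _).1; rewrite eL => ep ep0.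
    have [p p0 hp] := hasd_diff (fd _ (inb N z zr)) ep0; exists p => // w /hp.
    by rewrite [z + w + _]addrAC.
  apply: differentiableZ; apply: differentiableB => //.
  by apply: fd; lra.
- move=> N z zr; have := Fest N z zr => h.
  rewrite -(subrK ('d f z v) (F N z)); apply: le_trans (nrD _ _) _; apply: lerD.
    apply: le_trans h _; rewrite ler_piMr ?exprn_ile1 ?(ltW h21) //.
    by rewrite !mulr_ge0 ?invr_ge0 ?exprn_ge0 ?nr_ge0 // ltW.
  exact: (dbound r0 fd fK).
- by rewrite subrr nr0 !divr_gt0.
Qed.

End SeveralVars.

(** * The holomorphic inverse function theorem *)

Section InverseFunction.
Context {R : realType}.
Local Notation C := (Cplx R).

Section Lip.
Variables (d : nat) (phi : 'rV[C]_d -> 'rV[C]_d) (r : R).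
Hypothesis r_gt0 : 0 < r.
Hypothesis phi0 : phi 0 = 0.
Hypothesis phi_lip : forall z w, nr z < r -> nr w < r ->
  nr (phi z - phi w - (z - w)) <= nr (z - w) / 2.

Lemma lip_lower z w : nr z < r -> nr w < r -> nr (z - w) <= 2 * nr (phi z - phi w).
Proof.
move=> zr wr; have h := phi_lip zr wr; rewrite (nrBC (phi z - phi w) (z - w)) in h.
by have := nr_sub (z - w) (phi z - phi w); lra.
Qed.

Lemma lip_inj z w : nr z < r -> nr w < r -> phi z = phi w -> z = w.
Proof.
move=> zr wr e; have := lip_lower zr wr; rewrite e subrr nr0 mulr0 => h.
by apply/eqP; rewrite -subr_eq0 -nr_eq0 eq_le nr_ge0 h.
Qed.

(** The map [z - phi z + y] contracts by 1/2, and its iterates from 0 never leave the ball of radius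
    [2 * nr y]. *)
Lemma lip_surj y : nr y < r / 2 -> exists2 z, nr z <= 2 * nr y & phi z = y.
Proof.
move=> yr; have r0 := r_gt0.
pose x n := iter n (fun z => z - phi z + y) 0.
have xS n : x n.+1 = x n - phi (x n) + y by [].
have xb n : nr (x n) <= 2 * nr y.
  elim: n => [|n ih]; first by rewrite /x /= nr0 mulr_ge0 ?nr_ge0.
  rewrite xS; apply: le_trans (nrD _ _) _.
  have := @phi_lip (x n) 0; rewrite phi0 !subr0 nr0 nrBC => h.
  have := h _ r0; have hx : nr (x n) < r by lra.
  by move=> /(_ hx); lra.
have xr n : nr (x n) < r by have := xb n; lra.
have xd n : nr (x n.+1 - x n) <= nr y * 2^-1 ^+ n.
  elim: n => [|n ih].
    by rewrite xS /x /= phi0 !subr0 add0r expr0 mulr1.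
  have -> : x n.+2 - x n.+1 = - (phi (x n.+1) - phi (x n) - (x n.+1 - x n)).
    have ey : y = x n.+1 - x n + phi (x n).
      rewrite (xS n); move: (x n) (phi _) => b p.
      by apply/rowP => j; rewrite !mxE; ring.
    rewrite (xS n.+1) [X in _ + X - _]ey.
    move: (x n.+1) (x n) (phi _) (phi _) => a b p q.
    by apply/rowP => j; rewrite !mxE; ring.
  rewrite nrN; apply: le_trans (phi_lip (xr _) (xr _)) _.
  by rewrite exprSr mulrA; apply: ler_wpM2r; rewrite ?invr_ge0.
have h20 : (0 : R) <= 2^-1 by rewrite invr_ge0.
have h21 : (2^-1 : R) < 1 by rewrite invf_lt1 // ltr1n.
have [z hz] := geo_limit_mx h20 h21 xd.
pose B := 2 * (nr y / (1 - 2^-1)).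
have B0 : 0 <= B by rewrite /B mulr_ge0 // divr_ge0 ?nr_ge0 // subr_ge0 ltW.
have {}hz n : nr (x n - z) <= B * 2^-1 ^+ n.
  by apply: le_trans (hz n) _; rewrite /B le_eqVlt; apply/orP; left; apply/eqP; ring.
have zb : nr z <= 2 * nr y.
  apply: (le_small B0) => e e0 _; have [n hn] := geo_small B h20 h21 (mulr_gt0 e0 (ltr01 : 0 < 1 :> R)).
  have [m hm] := geo_small 1 h20 h21 e0; have {}hm := hm m (leqnn m).
  have := nr_sub z (x m); rewrite nrBC => h; have := hz m; have := xb m.
  have : B * 2^-1 ^+ m <= B * e by apply: ler_wpM2l => //; rewrite mul1r in hm; exact: ltW.
  lra.
exists z => //; have zr : nr z < r by lra.
apply: (@nr_small_eq _ _ _ _ (4 * B)) => [|e e0 _]; first by rewrite mulr_ge0.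
have [m hm] := geo_small 1 h20 h21 e0.
have hm0 := hm m (leqnn m); have hm1 := hm m.+1 (leqnSn m); rewrite !mul1r in hm0 hm1.
have h1 : B * 2^-1 ^+ m <= B * e by apply: ler_wpM2l => //; exact: ltW.
have h2 : B * 2^-1 ^+ m.+1 <= B * e by apply: ler_wpM2l => //; exact: ltW.
have := phi_lip zr (xr m); have := hz m; have := hz m.+1.
have -> : phi z - y = (phi z - phi (x m) - (z - x m)) + (z - x m.+1).
  rewrite xS; move: (x m) (phi _) (phi _) => a b p.
  by apply/rowP => j; rewrite !mxE; ring.
rewrite [nr (x m - z)]nrBC [nr (x m.+1 - z)]nrBC => h3 h4 h5.
by have hp := mulr_ge0 B0 (ltW e0); apply: le_trans (nrD _ _) _; lra.
Qed.

End Lip.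

Lemma lin1_mxE d e (L : {linear 'rV[C]_d -> 'rV[C]_e}) w : w *m lin1_mx L = L w.
Proof. exact: mul_rV_lin1. Qed.

Lemma injective_unitmx d (A : 'M[C]_d) : (forall v : 'rV[C]_d, v *m A = 0 -> v = 0) -> A \in unitmx.
Proof.
move=> h; rewrite -row_free_unit -kermx_eq0.
by apply/eqP/row_matrixP => i; rewrite row0; apply: h; rewrite -row_mul mulmx_ker row0.
Qed.

Lemma hasd_comp (U V W : normedModType C) (f : U -> V) (g : V -> W) z L M K :
  0 <= K -> (forall w, nr (M w) <= K * nr w) -> (forall x y, M (x - y) = M x - M y) ->
  (forall w, nr (L w) <= K * nr w) ->
  hasd f z L -> hasd g (f z) M -> hasd (g \o f) z (M \o L).
Proof.
move=> K0 MK MB LK hf hg e e0.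
have K10 : 0 < K + 1 by lra.
have e10 : 0 < e / (2 * (K + 1)) by rewrite divr_gt0 // mulr_gt0.
have [r r0 hr] := hg _ e10.
pose ep := Num.min 1 (e / (2 * (K + 1))).
have ep0 : 0 < ep by rewrite lt_min ltr01.
have [s s0 hs] := hf _ ep0.
exists (Num.min s (r / (K + 1))); first by rewrite lt_min s0 divr_gt0.
move=> w; rewrite lt_min ltr_pdivlMr // => /andP[/hs ws wr].
set k := f (z + w) - f z in ws.
have nk : nr k <= (K + 1) * nr w.
  rewrite -(subrK (L w) k); apply: le_trans (nrD _ _) _.
  rewrite mulrDl mul1r addrC; apply: lerD => //; apply: le_trans ws _.
  by rewrite -[leRHS]mul1r; apply: ler_wpM2r; [exact: nr_ge0|rewrite ge_min lexx].
have kr : nr k < r by apply: le_lt_trans nk _; rewrite mulrC.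
have := hr k kr; have -> : f z + k = f (z + w) by rewrite addrC subrK.
move=> h1.
have -> : (g \o f) (z + w) - (g \o f) z - (M \o L) w =
   (g (f (z + w)) - g (f z) - M k) + M (k - L w).
  by rewrite (MB k) /= [RHS]addrA subrK.
apply: le_trans (nrD _ _) _.
have h2 : nr (M (k - L w)) <= K * (ep * nr w).
  by apply: le_trans (MK _) _; apply: ler_wpM2l.
have h3 : K * (ep * nr w) <= e / 2 * nr w.
  rewrite mulrA; apply: ler_wpM2r; first exact: nr_ge0.
  apply: le_trans (_ : (K + 1) * (e / (2 * (K + 1))) <= _).
    apply: ler_pM => //; [exact: ltW|lra|by rewrite ge_min lexx orbT].
  by rewrite le_eqVlt; apply/orP; left; apply/eqP; field; rewrite gt_eqF.
have h4 : e / (2 * (K + 1)) * nr k <= e / 2 * nr w.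
  apply: le_trans (_ : e / (2 * (K + 1)) * ((K + 1) * nr w) <= _).
    by apply: ler_wpM2l nk; exact: ltW.
  by rewrite le_eqVlt; apply/orP; left; apply/eqP; field; rewrite gt_eqF.
lra.
Qed.

Lemma diff_comp_val d e p (f : 'rV[C]_d -> 'rV[C]_e) (g : 'rV[C]_e -> 'rV[C]_p) z w :
  differentiable f z -> differentiable g (f z) ->
  differentiable (g \o f) z /\ 'd (g \o f) z w = 'd g (f z) ('d f z w).
Proof.
move=> df dg; have dgf := differentiable_comp df dg; split => //.
pose K := (\sum_j nr ('d f z (delta_mx ord0 j))) + (\sum_j nr ('d g (f z) (delta_mx ord0 j))).
have K1 : 0 <= \sum_j nr ('d f z (delta_mx ord0 j)) by apply: sumr_ge0 => *; exact: nr_ge0.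
have K2 : 0 <= \sum_j nr ('d g (f z) (delta_mx ord0 j)) by apply: sumr_ge0 => *; exact: nr_ge0.
have h := @hasd_comp _ _ _ f g z ('d f z) ('d g (f z)) K _ _ _ _ (hasd_diff df) (hasd_diff dg).
rewrite (hasd_val w dgf (h _ _ _ _)) //.
- by rewrite /K addr_ge0.
- move=> v; apply: le_trans (linear_rV_bounded _ _) _.
  by apply: ler_wpM2r; [exact: nr_ge0|rewrite /K lerDr].
- by move=> x y; rewrite linearB.
- move=> v; apply: le_trans (linear_rV_bounded _ _) _.
  by apply: ler_wpM2r; [exact: nr_ge0|rewrite /K lerDl].
- by move=> k x /=; rewrite !linearZ.
Qed.

Lemma diff_mulmxr d e (A : 'M[C]_(d, e)) (z : 'rV[C]_d) : differentiable (mulmx^~ A) z.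
Proof.
apply: (@hasd_rV _ _ _ _ z (mulmxr A) _).1 => ep ep0; exists 1 => // w _.
by rewrite /= mulmxDl (addrC (z *m A)) addrK subrr nr0 mulr_ge0 ?nr_ge0 // ltW.
Qed.

Lemma diff_mulmxr_val d e (A : 'M[C]_(d, e)) (z w : 'rV[C]_d) : 'd (mulmx^~ A) z w = w *m A.
Proof.
have h : hasd (mulmx^~ A) z (mulmxr A).
  move=> ep ep0; exists 1 => // v _.
  by rewrite /= mulmxDl (addrC (z *m A)) addrK subrr nr0 mulr_ge0 ?nr_ge0 // ltW.
by rewrite (hasd_rV h).2.
Qed.

Lemma diff_affine d e (A : 'M[C]_(d, e)) (b z : 'rV[C]_d) :
  differentiable (fun y => (y - b) *m A) z.
Proof.
apply: (@hasd_rV _ _ _ _ z (mulmxr A) _).1 => ep ep0; exists 1 => // w _.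
by rewrite /= -mulmxBl opprB addrA subrK addrAC subrr add0r subrr nr0 mulr_ge0 ?nr_ge0 // ltW.
Qed.

Section LipInverse.
Variables (d : nat) (phi psi : 'rV[C]_d -> 'rV[C]_d) (r : R).
Hypothesis phi_lip : forall z w, nr z < r -> nr w < r ->
  nr (phi z - phi w - (z - w)) <= nr (z - w) / 2.
Hypothesis phi_d : forall z, nr z < r -> differentiable phi z.

(** In the limit the Lipschitz bound says that the derivative of [phi] is within 1/2 of the
    identity, hence invertible. As [psi] is 2-Lipschitz at [y], the expansion of [phi] at [psi y]
    can be inverted to first order. *)
Lemma lip_inverse_diff y (s : R) : 0 < s ->
  (forall x, nr (x - y) < s -> nr (psi x) < r /\ phi (psi x) = x) -> differentiable psi y.
Proof.
move=> s0 hpsi.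
have h0 : nr (y - y) < s by rewrite subrr nr0.
have [zr ez] := hpsi y h0.
set z := psi y in zr ez.
have dz := phi_d zr; have hz := hasd_diff dz.
have low v : nr ('d phi z v - v) <= nr v / 2.
  have v10 : 0 < nr v + 1 by rewrite ltr_wpDl ?nr_ge0.
  apply: (@le_small _ _ _ (nr v)); first exact: nr_ge0.
  move=> e e0 _; have [p p0 hp] := hz e e0.
  pose t := Num.min p (r - nr z) / (nr v + 1) / 2.
  have m0 : 0 < Num.min p (r - nr z) by rewrite lt_min p0 subr_gt0.
  have t0 : 0 < t by rewrite !divr_gt0.
  have ntv : nr (cr t *: v) < Num.min p (r - nr z).
    rewrite nrZ nr_cr gtr0_norm //; apply: le_lt_trans (_ : t * (nr v + 1) < _).
      by apply: ler_wpM2l; [exact: ltW|lra].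
    by rewrite /t mulrAC divfK ?gt_eqF //; lra.
  move: ntv; rewrite lt_min => /andP[/hp h1 h2].
  have h3 : nr (z + cr t *: v) < r by apply: le_lt_trans (nrD _ _) _; lra.
  have := phi_lip h3 zr; rewrite [z + _ - z]addrAC subrr add0r => h4.
  rewrite -(@ler_pM2l _ t) // -{1}(gtr0_norm t0) -nr_cr -nrZ scalerBr -linearZ.
  set D := phi _ - phi z in h1 h4.
  have -> : 'd phi z (cr t *: v) - cr t *: v = (D - cr t *: v) - (D - 'd phi z (cr t *: v)).
    by rewrite opprB [RHS]addrC addrA subrK.
  apply: le_trans (nrB _ _) _; move: h1 h4; rewrite nrZ nr_cr gtr0_norm //.
  have -> : t * (nr v / 2 + nr v * e) = t * nr v / 2 + e * (t * nr v) by ring.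
  lra.
pose B := lin1_mx ('d phi z).
have BE v : v *m B = 'd phi z v by rewrite /B lin1_mxE.
have uB : B \in unitmx.
  apply: injective_unitmx => v; rewrite BE => e; have := low v; rewrite e sub0r nrN => h.
  by apply: nr0_eq0; apply/eqP; rewrite eq_le nr_ge0 andbT; lra.
have psi_lip x : nr (x - y) < s -> nr (psi x - z) <= 2 * nr (x - y).
  by move=> /hpsi[h1 h2]; have := lip_lower phi_lip h1 zr; rewrite h2 ez.
apply: (@hasd_rV _ _ _ _ y (mulmxr (invmx B)) _).1 => e e0.
pose K := d%:R * nr (invmx B) + 1.
have K0 : 0 < K by rewrite /K ltr_wpDl // mulr_ge0 ?nr_ge0.
have e20 : 0 < e / (2 * K) by rewrite divr_gt0 // mulr_gt0.
have [p p0 hp] := hz _ e20.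
exists (Num.min s (p / 2)); first by rewrite lt_min s0 divr_gt0.
move=> w; rewrite lt_min => /andP[ws wp].
have ws' : nr (y + w - y) < s by rewrite addrAC subrr add0r.
have := psi_lip _ ws'; rewrite addrAC subrr add0r.
have [_] := hpsi _ ws'.
set k := psi (y + w) - z => hk nk.
have := hp k (_ : nr k < p); have -> : z + k = psi (y + w) by rewrite addrC subrK.
have -> : phi (psi (y + w)) - phi z = w by rewrite hk ez addrAC subrr add0r.
move=> h1.
have {}h1 := h1 (_ : nr k < p).
have -> : psi (y + w) - z - mulmxr (invmx B) w = - ((w - k *m B) *m invmx B).
  by rewrite mulmxBl mulmxK // opprB.
rewrite nrN; apply: le_trans (nr_mulmx _ _) _.
have {}h1 : nr (w - 'd phi z k) <= e / (2 * K) * nr k by apply: h1; lra.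
rewrite BE mulrCA mulrC; apply: le_trans (_ : e / (2 * K) * nr k * K <= _).
  rewrite [leRHS]mulrC; apply: ler_pM; rewrite ?mulr_ge0 ?nr_ge0 //; rewrite /K; lra.
apply: le_trans (_ : e / (2 * K) * (2 * nr w) * K <= _).
  by apply: ler_wpM2r; [exact: ltW|apply: ler_wpM2l => //; exact: ltW].
by rewrite le_eqVlt; apply/orP; left; apply/eqP; field; rewrite gt_eqF.
Qed.

End LipInverse.

Lemma quad_bound d (g : 'rV[C]_d -> 'rV[C]_d) (rho : R) : 0 < rho ->
  (forall z, nr z < rho -> differentiable g z) -> g 0 = 0 -> (forall v, 'd g 0 v = 0) ->
  exists2 s : R, 0 < s & exists2 K : R, 0 <= K & s <= rho /\ forall z, nr z < s -> nr (g z) <= K * nr z ^+ 2.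
Proof.
move=> rho0 gd g0 dg0.
have z00 : nr (0 : 'rV[C]_d) < rho by rewrite nr0.
have /continuous_nrP /(_ 1 ltr01)[s s0 hs] := differentiable_continuous (gd _ z00).
pose r := Num.min rho s; have r0 : 0 < r by rewrite lt_min rho0.
have rr z : nr (z - 0) < r -> differentiable g z /\ nr (g z) <= 1.
  by rewrite lt_min subr0 => /andP[/gd h1 h2]; split => //; have := hs z; rewrite subr0 g0 subr0 => /(_ h2)/ltW.
exists (r / 8); first by rewrite divr_gt0.
exists (32 * 1 / r ^+ 2); first by rewrite !mulr_ge0 ?invr_ge0 ?exprn_ge0 // ltW.
have rrho : r <= rho by rewrite ge_min lexx.
split => [|z zr]; first lra.
have := @dsecond _ _ _ g 0 r 1 r0 (fun z h => (rr z h).1) (fun z h => (rr z h).2) 0 z.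
rewrite subrr nr0 add0r g0 subr0 dg0 subr0; apply; [by rewrite divr_gt0|exact: ltW].
Qed.

(** Translating and dividing by the derivative gives a map [phi] equal to the identity up to a
    quadratic term [g], which is 1/2-Lipschitz on a small ball. Injectivity on the ball of radius
    [tau] is kept in the conclusion in order to identify preimages later. *)
Theorem inverse_function d (f : 'rV[C]_d -> 'rV[C]_d) a (rho : R) : 0 < rho ->
  (forall z, nr (z - a) < rho -> differentiable f z) ->
  (forall v, 'd f a v = 0 -> v = 0) ->
  exists tau sig : R, exists psi : 'rV[C]_d -> 'rV[C]_d,
  [/\ 0 < tau <= rho, 0 < sig,
    (forall y, nr (y - f a) < sig -> [/\ nr (psi y - a) < tau, f (psi y) = y & differentiable psi y]) &
    (forall z w, nr (z - a) < tau -> nr (w - a) < tau -> f z = f w -> z = w)].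
Proof.
move=> rho0 fd fi.
have da : differentiable f a by apply: fd; rewrite subrr nr0.
pose A := lin1_mx ('d f a).
have AE v : v *m A = 'd f a v by rewrite /A lin1_mxE.
have uA : A \in unitmx by apply: injective_unitmx => v; rewrite AE; exact: fi.
pose phi z := (f (a + z) - f a) *m invmx A.
have phi_hd z : nr z < rho -> hasd phi z (fun v => 'd f (a + z) v *m invmx A).
  move=> zr.
  have h : hasd (fun z => f (a + z) - f a) z ('d f (a + z)).
    have dz : differentiable f (a + z) by apply: fd; rewrite addrAC subrr add0r.
    move=> e e0; have [p p0 hp] := hasd_diff dz e0; exists p => // w /hp.
    by rewrite addrA opprB addrA subrK.
  have dz : differentiable f (a + z) by apply: fd; rewrite addrAC subrr add0r.
  pose K := (\sum_j nr ('d f (a + z) (delta_mx ord0 j))) + d%:R * nr (invmx A).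
  have K1 : 0 <= \sum_j nr ('d f (a + z) (delta_mx ord0 j)) by apply: sumr_ge0 => *; exact: nr_ge0.
  have K2 : 0 <= d%:R * nr (invmx A) by rewrite mulr_ge0 ?nr_ge0.
  have hm (y : 'rV[C]_d) : hasd (mulmx^~ (invmx A)) y (mulmx^~ (invmx A)).
    by have := hasd_diff (diff_mulmxr (invmx A) y); congr (hasd _ _ _); apply/funext => w; rewrite diff_mulmxr_val.
  apply: (@hasd_comp _ _ _ (fun z => f (a + z) - f a) (mulmx^~ (invmx A)) z _ _ K _ _ _ _ h (hm _)).
  - by rewrite /K addr_ge0.
  - move=> w; apply: le_trans (nr_mulmx _ _) _; rewrite mulrCA mulrC; apply: ler_wpM2r; first exact: nr_ge0.
    by rewrite /K lerDr.
  - by move=> x y; rewrite mulmxBl.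
  - move=> w; apply: le_trans (linear_rV_bounded _ _) _; apply: ler_wpM2r; first exact: nr_ge0.
    by rewrite /K lerDl.
have phi_d z : nr z < rho -> differentiable phi z.
  move=> zr; have h := phi_hd z zr.
  have [|L eL] := @lin_pack R 'rV[C]_d 'rV[C]_d (fun v => 'd f (a + z) v *m invmx A).
    by move=> k x y; rewrite linearP mulmxDl scalemxAl.
  by rewrite -eL in h; exact: (hasd_rV h).1.
pose g z := phi z - z.
have gd z : nr z < rho -> differentiable g z.
  by move=> zr; apply: differentiableB; [exact: phi_d|exact: (@ex_diff _ _ _ _ _ _ _ (is_diff_id z))].
have g0 : g 0 = 0 by rewrite /g /phi addr0 subrr mul0mx subrr.
have hid : hasd (fun z : 'rV[C]_d => z) 0 (fun w => w).
  by move=> e e0; exists 1 => // w _; rewrite add0r subr0 subrr nr0 mulr_ge0 ?nr_ge0 // ltW.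
have z00 : nr (0 : 'rV[C]_d) < rho by rewrite nr0.
have dg0 v : 'd g 0 v = 0.
  have h := hasdB (phi_hd 0 z00) hid.
  rewrite (hasd_val v (gd _ z00) h) => [|k x].
    by rewrite addr0 -AE mulmxK // subrr.
  by rewrite addr0 linearZ scalerBr scalemxAl.
have [s s0 [K K0 [srho hK]]] := quad_bound rho0 gd g0 dg0.
pose r := Num.min (s / 2) (1 / (64 * K + 1)).
have K10 : 0 < 64 * K + 1 by lra.
have r0 : 0 < r by rewrite lt_min !divr_gt0.
have rs : 2 * r <= s.
  have : r <= s / 2 by rewrite ge_min lexx.
  lra.
have rK : 32 * K * r <= 1 / 2.
  have : r * (64 * K + 1) <= 1 by rewrite -ler_pdivlMr // ge_min lexx orbT.
  by have := ltW r0; nra.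
have rrho : r < rho by lra.
have lip z w : nr z < r -> nr w < r -> nr (phi z - phi w - (z - w)) <= nr (z - w) / 2.
  move=> zr wr; have := small_lip r0 rs K0 (fun z h => gd z (lt_le_trans h srho)) hK zr wr.
  rewrite /g => h.
  have -> : phi z - phi w - (z - w) = phi z - z - (phi w - w).
    by move: (phi z) (phi w) => p q; apply/rowP => j; rewrite !mxE; ring.
  apply: le_trans h _; rewrite [leRHS]mulrC; apply: ler_wpM2r; first exact: nr_ge0.
  lra.
have phi0 : phi 0 = 0 by rewrite /phi addr0 subrr mul0mx.
have /choice[ps hps] : forall y, exists z, nr y < r / 2 -> nr z <= 2 * nr y /\ phi z = y.
  move=> y; have [yr|yr] := ltrP (nr y) (r / 2); last by exists 0.
  by have [z h1 h2] := lip_surj r0 phi0 lip yr; exists z.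
pose KA := d%:R * nr (invmx A) + 1.
have KA0 : 0 < KA by rewrite /KA ltr_wpDl // mulr_ge0 ?nr_ge0.
exists r, (r / 2 / KA), (fun y => a + ps ((y - f a) *m invmx A)).
have nA (v : 'rV[C]_d) : nr (v *m invmx A) <= KA * nr v.
  apply: le_trans (nr_mulmx _ _) _; rewrite mulrCA mulrC; apply: ler_wpM2r; first exact: nr_ge0.
  by rewrite /KA lerDl.
have small y : nr (y - f a) < r / 2 / KA -> nr ((y - f a) *m invmx A) < r / 2.
  by rewrite ltr_pdivlMr // => h; apply: le_lt_trans (nA _) _; rewrite mulrC.
split.
- by rewrite r0 ltW.
- by rewrite !divr_gt0.
- move=> y /small yr; have [h1 h2] := hps _ yr; split.
  + by rewrite addrAC subrr add0r; lra.
  + have : phi (ps ((y - f a) *m invmx A)) *m A = (y - f a) *m invmx A *m A by rewrite h2.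
    by rewrite /phi !mulmxKV // => /(congr1 (fun x => x + f a)); rewrite !subrK.
  + have d1 : differentiable ps ((y - f a) *m invmx A).
      apply: (@lip_inverse_diff d phi ps r lip (fun z h => phi_d z (lt_trans h rrho)) _ (r / 2 - nr ((y - f a) *m invmx A))).
        by rewrite subr_gt0.
      move=> x hx; have := nr_sub x ((y - f a) *m invmx A) => hx'.
      by have [|h3 h4] := hps x; [lra|split => //; lra].
    apply: differentiableD; first exact: differentiable_cst.
    exact: (diff_comp_val 0 (diff_affine (invmx A) (f a) y) d1).1.
- move=> z w zr wr e.
  have : z - a = w - a.
    apply: (lip_inj lip zr wr); by rewrite /phi ![a + _]addrC !subrK e.
  by move=> /(congr1 (fun x => x + a)); rewrite !subrK.
Qed.

End InverseFunction.

(** * Osgood's theorem *)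

Section ScalarHolo.
Context {R : realType}.
Local Notation C := (Cplx R).

Lemma nr_const_mx (c : C) : nr (const_mx c : 'rV[C]_1) = nr c.
Proof.
apply/eqP; rewrite eq_le; apply/andP; split.
  by apply: nr_mx_le; [exact: nr_ge0|move=> i j; rewrite mxE].
by have := nr_mx_entry (const_mx c : 'rV[C]_1) 0 0; rewrite mxE.
Qed.

(** Scalar functions are treated as rows of length 1, so that the vector-valued estimates apply to
    them. *)
Lemma hasd_const_mx d (h : 'rV[C]_d -> C) z L :
  hasd h z L -> hasd (fun z => const_mx (h z) : 'rV[C]_1) z (fun w => const_mx (L w)).
Proof.
move=> hL e e0; have [r r0 hr] := hL e e0; exists r => // w /hr.
suff -> : (const_mx (h (z + w)) - const_mx (h z) - const_mx (L w) : 'rV[C]_1) =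
   const_mx (h (z + w) - h z - L w) by rewrite nr_const_mx.
by apply/rowP => j; rewrite !mxE.
Qed.

Lemma scal_diff d (h : 'rV[C]_d -> C) z : differentiable h z ->
  differentiable (fun z => const_mx (h z) : 'rV[C]_1) z /\
  forall v, 'd (fun z => const_mx (h z) : 'rV[C]_1) z v = const_mx ('d h z v).
Proof.
move=> dh; have hh := hasd_const_mx (hasd_diff dh).
have [|L eL] := @lin_pack R 'rV[C]_d 'rV[C]_1 (fun v => const_mx ('d h z v)).
  by move=> k x y; apply/rowP => j; rewrite linearP !mxE.
have hL : hasd (fun z => const_mx (h z) : 'rV[C]_1) z L by rewrite eL.
by have [h1 h2] := hasd_rV hL; split => // v; rewrite h2 eL.
Qed.

Lemma const_mx_diff d (h : 'rV[C]_d -> C) (G : 'rV[C]_d -> 'rV[C]_1) z0 (rho : R) : 0 < rho ->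
  (forall z, nr (z - z0) < rho -> G z = const_mx (h z)) -> differentiable G z0 ->
  differentiable h z0.
Proof.
move=> rho0 GE dG.
have z00 : nr (z0 - z0) < rho by rewrite subrr nr0.
have := hasd_diff dG; move: ('d G z0) => D hD.
have [|L eL] := @lin_pack R 'rV[C]_d C (fun w => D w 0 0).
  by move=> k x y; rewrite linearP !mxE.
apply: (hasd_rV (L := L) _).1; rewrite eL => e e0; have [r r0 hr] := hD e e0.
exists (Num.min r rho); first by rewrite lt_min r0.
move=> w; rewrite lt_min => /andP[/hr wr wrho].
apply: le_trans wr; apply: le_trans (nr_mx_entry _ 0 0).
have zw : nr (z0 + w - z0) < rho by rewrite addrAC subrr add0r.
by rewrite (GE _ zw) (GE _ z00) !mxE.
Qed.

Lemma scal_dd d (h : 'rV[C]_d -> C) z0 (rho : R) v : 0 < rho ->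
  (forall z, nr (z - z0) < rho -> differentiable h z) ->
  differentiable (fun z => 'd h z v) z0.
Proof.
move=> rho0 hd.
have h1 := dd_diff v rho0 (fun z hz => (scal_diff (hd z hz)).1).
exact: (const_mx_diff rho0 (fun z hz => (scal_diff (hd z hz)).2 v) h1).
Qed.

Lemma scal_lip d (h : 'rV[C]_d -> C) z0 (rho : R) : 0 < rho ->
  (forall z, nr (z - z0) < rho -> differentiable h z) ->
  exists r L : R, [/\ 0 < r, r <= rho, 0 <= L,
   forall z w, nr (z - z0) < r -> nr (w - z0) < r -> nr (h z - h w) <= L * nr (z - w) &
   forall z, nr (z - z0) < r -> nr (h z) <= L].
Proof.
move=> rho0 hd; have z00 : nr (z0 - z0) < rho by rewrite subrr nr0.
have /continuous_nrP /(_ 1 ltr01)[s s0 hs] := differentiable_continuous (hd _ z00).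
pose r := Num.min rho s; have r0 : 0 < r by rewrite lt_min rho0.
have rr z : nr (z - z0) < r -> differentiable (fun z => const_mx (h z) : 'rV[C]_1) z /\
    nr (const_mx (h z) : 'rV[C]_1) <= nr (h z0) + 1.
  rewrite lt_min => /andP[/hd h1 /hs h2]; split; first by have [] := scal_diff h1.
  by rewrite nr_const_mx; have := nr_sub (h z) (h z0); lra.
set K := nr (h z0) + 1 in rr.
have K0 : 0 <= K by rewrite /K addr_ge0 ?nr_ge0.
have LK : 0 <= 16 * K / r by rewrite !mulr_ge0 ?invr_ge0 // ltW.
exists (r / 2), (16 * K / r + K); split.
- by rewrite divr_gt0.
- by have : r <= rho by [rewrite ge_min lexx]; lra.
- by rewrite addr_ge0.
- move=> z w zr wr.
  have := dlip r0 (fun z h => (rr z h).1) (fun z h => (rr z h).2) zr wr.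
  have -> : (const_mx (h z) - const_mx (h w) : 'rV[C]_1) = const_mx (h z - h w).
    by apply/rowP => j; rewrite !mxE.
  rewrite nr_const_mx => hh; apply: le_trans hh _.
  by apply: ler_wpM2r; [exact: nr_ge0|lra].
- move=> z zr; have [|_] := rr z; first lra.
  by rewrite nr_const_mx; lra.
Qed.

Lemma scal_line d (h : 'rV[C]_d -> C) (z v : 'rV[C]_d) (t : C) : differentiable h (z + t *: v) ->
  differentiable (fun t : C => h (z + t *: v)) t /\
  'd (fun t : C => h (z + t *: v)) t 1 = 'd h (z + t *: v) v.
Proof.
move=> dh; have [h1 h2] := scal_diff dh.
have := @line_coord _ _ 1 _ v z t 0 h1; rewrite h2 !mxE.
by have -> : (fun t0 : C => (const_mx (h (z + t0 *: v)) : 'rV[C]_1) 0 0) = (fun t0 => h (z + t0 *: v))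
   by apply/funext => s; rewrite mxE.
Qed.

Lemma diff_fsum (V : normedModType C) (I : Type) (s : seq I) (F : I -> V -> C) z :
  (forall i, differentiable (F i) z) -> differentiable (fun z => \sum_(i <- s) F i z) z.
Proof.
move=> h; elim: s => [|i s ih].
  have -> : (fun z => \sum_(i <- [::]) F i z) = (fun=> 0) by apply/funext => w; rewrite big_nil.
  exact: differentiable_cst.
have -> : (fun z => \sum_(j <- i :: s) F j z) = (fun z => F i z + \sum_(j <- s) F j z).
  by apply/funext => w; rewrite big_cons.
exact: differentiableD.
Qed.

Lemma diff_fprod (V : normedModType C) (I : Type) (s : seq I) (F : I -> V -> C) z :
  (forall i, differentiable (F i) z) -> differentiable (fun z => \prod_(i <- s) F i z) z.
Proof.
move=> h; elim: s => [|i s ih].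
  have -> : (fun z => \prod_(i <- [::]) F i z) = (fun=> 1) by apply/funext => w; rewrite big_nil.
  exact: differentiable_cst.
have -> : (fun z => \prod_(j <- i :: s) F j z) = (fun z => F i z * \prod_(j <- s) F j z).
  by apply/funext => w; rewrite big_cons.
exact: differentiableM.
Qed.

Lemma rV_coord_diff d e (g : 'rV[C]_d -> 'rV[C]_e) z j : differentiable g z ->
  differentiable (fun z => g z ord0 j : C) z /\ forall v, 'd (fun z => g z ord0 j : C) z v = 'd g z v ord0 j.
Proof.
move=> dg; have h := hasd_diff dg.
have [|L eL] := @lin_pack R 'rV[C]_d C (fun v => 'd g z v ord0 j).
  by move=> k x y; rewrite linearP !mxE.
have hL : hasd (fun z => g z ord0 j : C) z L.
  rewrite eL => e' e0; have [r r0 hr] := h e' e0; exists r => // w /hr wr.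
  by apply: le_trans wr; apply: le_trans (nr_mx_entry _ 0 j); rewrite !mxE.
by have [h1 h2] := hasd_rV hL; split => // v; rewrite h2 eL.
Qed.

Lemma jac_det_diff d (f : 'rV[C]_d -> 'rV[C]_d) z0 (rho : R) : 0 < rho ->
  (forall z, nr (z - z0) < rho -> differentiable f z) ->
  differentiable (fun z => \det (lin1_mx ('d f z)) : C) z0.
Proof.
move=> rho0 fd; rewrite /determinant.
apply: (@diff_fsum _ _ (index_enum _) (fun (s : 'S_d) z => (-1) ^+ s * \prod_i lin1_mx ('d f z) i (s i))) => s.
apply: (@differentiableM _ _ (fun=> (-1) ^+ s) (fun z => \prod_i lin1_mx ('d f z) i (s i))).
  exact: differentiable_cst.
apply: (@diff_fprod _ _ (index_enum _) (fun i z => lin1_mx ('d f z) i (s i))) => i.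
have := (rV_coord_diff (s i) (dd_diff (delta_mx 0 i) rho0 fd)).1.
congr (differentiable _ _); apply/funext => z.
by rewrite -[in LHS]lin1_mxE -rowE mxE.
Qed.

Lemma det_neq0_inj d (L : {linear 'rV[C]_d -> 'rV[C]_d}) v : \det (lin1_mx L) != 0 -> L v = 0 -> v = 0.
Proof.
move=> h Lv; have u : lin1_mx L \in unitmx by rewrite unitmxE unitfE.
by rewrite -[v](mulmxK u) lin1_mxE Lv mul0mx.
Qed.

(** The first nonzero Taylor coefficient at 0 governs [u] near 0. It exists by the identity
    principle: if all coefficients vanished, the remainder bound would force [u t1 = 0]. *)
Lemma lower_bound (u : C -> C) (rho K : R) t1 :
  (forall t, nr t < rho -> differentiable u t) -> (forall t, nr t < rho -> nr (u t) <= K) ->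
  nr t1 < rho -> u t1 != 0 ->
  exists (c0 : C) (m : nat) (s B : R), [/\ c0 != 0, 0 < s, s < rho, 0 <= B &
    forall t, nr t <= s -> nr (u t - c0 * t ^+ m) <= B * nr t ^+ m.+1].
Proof.
move=> ud uK t1r ut1.
pose r := (nr t1 + rho) / 2.
have rho0 : 0 < rho by apply: le_lt_trans (nr_ge0 _) t1r.
have r0 : 0 < r by rewrite /r; have := nr_ge0 t1; lra.
have rrho : r < rho by rewrite /r; lra.
have t1r' : nr t1 < r by rewrite /r; lra.
have uK' z : nr z = r -> nr (u z) <= K by move=> e; apply: uK; rewrite e.
have K0 : 0 <= K by apply: (K_ge0 r0 uK').
have [c [_ hc]] := cauchy_taylor r0 rrho ud uK'.
have [m0 cm0] : exists m, c m != 0.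
  apply: contrapT => hn.
  have c0 m : c m = 0 by apply: contrapT => /eqP cm; apply: hn; exists m.
  move/negP: ut1; apply; apply/eqP.
  have q0 : 0 <= nr t1 / r by rewrite divr_ge0 ?nr_ge0 // ltW.
  have q1 : nr t1 / r < 1 by rewrite ltr_pdivrMr // mul1r.
  apply: (@nr_small_eq _ _ _ _ 1) => // e e0 _; rewrite mul1r subr0.
  have [n hn'] := geo_small (K * (r / (r - nr t1))) q0 q1 e0.
  have := hc n t1 t1r'; rewrite big1; last by move=> i _; rewrite c0 mul0r.
  rewrite subr0 => h; apply: le_trans h _; apply/ltW.
  by have := hn' n (leqnn n); rewrite mulrAC mulrA.
pose P m := c m != 0.
have exP : exists m, P m by exists m0.
case: (ex_minnP exP) => m cm mmin.
exists (c m), m, (r / 2), (2 * K / r ^+ m.+1); split => //.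
- by rewrite divr_gt0.
- lra.
- by rewrite !mulr_ge0 ?invr_ge0 ?exprn_ge0 // ltW.
move=> t tr.
have := hc m.+1 t; rewrite big_ord_recr /= big1 ?add0r; last first.
  move=> i _; suff -> : c i = 0 by rewrite mul0r.
  by apply: contrapT => /eqP ci; have := mmin i ci; rewrite leqNgt ltn_ord.
move=> h; apply: le_trans (h _) _; first lra.
apply: le_trans (_ : K * ((nr t / r) ^+ m.+1 * 2) <= _).
  apply: ler_wpM2l => //; apply: ler_wpM2l; first by rewrite exprn_ge0 // divr_ge0 ?nr_ge0 // ltW.
  by rewrite ler_pdivrMr; lra.
by rewrite expr_div_n le_eqVlt; apply/orP; left; apply/eqP; ring.
Qed.

Lemma lower_bound' (u : C -> C) (rho K : R) t1 :
  (forall t, nr t < rho -> differentiable u t) -> (forall t, nr t < rho -> nr (u t) <= K) ->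
  nr t1 < rho -> u t1 != 0 ->
  exists (c : R) (m : nat) (s : R), [/\ 0 < c, 0 < s, s < rho &
    forall t, nr t <= s -> c * nr t ^+ m <= nr (u t)].
Proof.
move=> ud uK t1r ut1; have [c0 [m [s [B [c00 s0 srho B0 h]]]]] := lower_bound ud uK t1r ut1.
have nc : 0 < nr c0 by rewrite nr_gt0.
exists (nr c0 / 2), m, (Num.min s (nr c0 / 2 / (B + 1))).
have B10 : 0 < B + 1 by lra.
split; [by rewrite divr_gt0|by rewrite lt_min s0 !divr_gt0|by rewrite gt_min srho|].
move=> t; rewrite le_min => /andP[ts tB].
have := h t ts; rewrite nrBC => h1.
have := nr_sub (c0 * t ^+ m) (u t); rewrite nrM nrX => h2.
have h3 : B * nr t ^+ m.+1 <= nr c0 / 2 * nr t ^+ m.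
  rewrite exprS mulrA; apply: ler_wpM2r; first by rewrite exprn_ge0 ?nr_ge0.
  apply: le_trans (_ : (B + 1) * nr t <= _); first by apply: ler_wpM2r; [exact: nr_ge0|lra].
  by rewrite mulrC -ler_pdivlMr.
have : nr c0 * nr t ^+ m = nr c0 / 2 * nr t ^+ m + nr c0 / 2 * nr t ^+ m by field.
lra.
Qed.

(** If all derivatives vanished at 0, integration along radii would show, by induction on [n] for
    all [k] at once, that [u k] is of order [nr t ^+ n]; this contradicts [lower_bound']. *)
Lemma der_order (u : nat -> C -> C) (rho K : R) t1 :
  (forall k t, nr t < rho -> differentiable (u k) t) ->
  (forall k t, nr t < rho -> 'd (u k) t 1 = u k.+1 t) ->
  (forall t, nr t < rho -> nr (u 0%N t) <= K) -> nr t1 < rho -> u 0%N t1 != 0 ->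
  exists k, u k 0 != 0.
Proof.
move=> ud ud' uK t1r ut1; apply: contrapT => hn.
have u0 k : u k 0 = 0 by apply: contrapT => /eqP uk; apply: hn; exists k.
have [c [m [s [c0 s0 srho h]]]] := lower_bound' (ud 0%N) uK t1r ut1.
have rho0 : 0 < rho by lra.
have P n k : exists B s : R, [/\ 0 < s, s < rho, 0 <= B & forall t, nr t <= s -> nr (u k t) <= B * nr t ^+ n].
  elim: n k => [|n ih] k.
    have h0 : nr (0 : C) < rho by rewrite nr0.
    have /continuous_nrP /(_ 1 ltr01)[r r0 hr] := differentiable_continuous (ud k 0 h0).
    exists 1, (Num.min r rho / 2); have m0 : 0 < Num.min r rho by rewrite lt_min r0.
    have m1 : Num.min r rho <= rho by rewrite ge_min lexx orbT.
    have m2 : Num.min r rho <= r by rewrite ge_min lexx.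
    split; [by rewrite divr_gt0|lra|by []|] => t ts; rewrite expr0 mul1r.
    by have := hr t; rewrite u0 !subr0 => hh; apply/ltW/hh; lra.
  have [B [s' [s'0 s'rho B0 hB]]] := ih k.+1; exists B, s'; split => // t ts.
  have sm x : 0 <= x <= 1 -> nr (t * cr x) <= nr t.
    by move=> /andP[x0 x1]; rewrite nrM nr_cr ger0_norm // ler_piMr ?nr_ge0.
  have := @rder_mvt _ (fun x => u k (t * cr x)) (fun x => t * u k.+1 (t * cr x)) 0 1
     (nr t * (B * nr t ^+ n)) ler01 _ _.
  rewrite cr0 cr1 mulr0 mulr1 u0 !subr0 mulr1 exprS mulrCA; apply.
    move=> x x01; have xr : nr (t * cr x) < rho by apply: le_lt_trans (sm x x01) _; lra.
    have := rder_comp (_ : hasd (u k) (t * cr x) (fun w => w * u k.+1 (t * cr x))) (rderZ t (rder_id x)).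
    rewrite mulr1; apply; rewrite -ud' //.
    have := hasd_diff (ud k _ xr); congr (hasd _ _ _).
    by apply/funext => w; rewrite diff_scal //; exact: ud.
  move=> x x01; rewrite nrM [leRHS]mulrCA; apply: ler_wpM2l; first exact: nr_ge0.
  apply: le_trans (hB _ _) _; first exact: le_trans (sm x x01) ts.
  by apply: ler_wpM2l => //; rewrite lerXn2r ?nnegrE ?nr_ge0 // sm.
have [B [s' [s'0 s'rho B0 hB]]] := P m.+1 0%N.
pose t := Num.min (Num.min s s') (c / 2 / (B + 1)).
have B10 : 0 < B + 1 by lra.
have t0 : 0 < t by rewrite !lt_min s0 s'0 !divr_gt0.
have nt : nr (cr t) = t by rewrite nr_cr gtr0_norm.
have := hB (cr t); have := h (cr t); rewrite nt.
have ts : t <= s by rewrite !ge_min lexx.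
have ts' : t <= s' by rewrite !ge_min lexx orbT.
have tc : t <= c / 2 / (B + 1) by rewrite !ge_min lexx orbT.
move=> /(_ ts) h1 /(_ ts') h2; have := le_trans h1 h2.
rewrite exprS mulrA ler_pM2r ?exprn_gt0 // leNgt => /negP; apply.
apply: le_lt_trans (_ : (B + 1) * t < _); first by apply: ler_wpM2r; [exact: ltW|lra].
rewrite mulrC; apply: le_lt_trans (_ : c / 2 < _); last lra.
by rewrite -ler_pdivlMr.
Qed.

Section ZeroPersistence.
Variables (d : nat) (h : 'rV[C]_d -> C) (p v : 'rV[C]_d) (rho : R).
Hypothesis rho0 : 0 < rho.
Hypothesis hd : forall z, nr (z - p) < rho -> differentiable h z.
Hypothesis hp : h p = 0.

(** A form of Hurwitz's theorem. Without a zero on the disc through [z] in the direction [v], the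
    maximum principle holds for the inverse of [h]; but on a circle [h] is at least about [mu],
    while at the centre it is close to [h p = 0]. *)
Lemma zero_persist (c : R) m (s : R) : 0 < c -> 0 < s ->
  (forall t : C, nr t <= s -> c * nr t ^+ m <= nr (h (p + t *: v))) ->
  forall r : R, 0 < r -> exists2 del : R, 0 < del &
    forall z, nr (z - p) < del -> exists2 t : C, nr t < r & h (z + t *: v) = 0.
Proof.
move=> c0 s0 low r r0.
have [rh [L [rh0 rhrho L0 hL _]]] := scal_lip rho0 hd.
have v0 : 0 < nr v + 1 by rewrite ltr_wpDl ?nr_ge0.
pose q := Num.min (Num.min r s) (rh / 2 / (nr v + 1)).
have q0 : 0 < q by rewrite !lt_min r0 s0 !divr_gt0.
have qr : q <= r by rewrite !ge_min lexx.
have qs : q <= s by rewrite !ge_min lexx orbT.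
have qv : q <= rh / 2 / (nr v + 1) by rewrite !ge_min lexx orbT.
have tv (t : C) : nr t < q -> nr (t *: v) < rh / 2.
  move=> tq; rewrite nrZ; apply: le_lt_trans (_ : nr t * (nr v + 1) < _).
    by apply: ler_wpM2l; [exact: nr_ge0|lra].
  by rewrite -ltr_pdivlMr //; exact: lt_le_trans qv.
pose mu := c * (q / 2) ^+ m.
have mu0 : 0 < mu by rewrite mulr_gt0 // exprn_gt0 // divr_gt0.
have L10 : 0 < L + 1 by lra.
exists (Num.min (rh / 2) (mu / 2 / (L + 1))); first by rewrite lt_min !divr_gt0.
move=> z; rewrite lt_min => /andP[z1 z2].
apply: contrapT => hn.
have nz (t : C) : nr t < q -> h (z + t *: v) != 0.
  move=> tq; apply/eqP => e; apply: hn; exists t => //; exact: lt_le_trans qr.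
have inb (t : C) : nr t < q -> nr (z + t *: v - p) < rh.
  by move=> /tv tq; rewrite addrAC; apply: le_lt_trans (nrD _ _) _; lra.
have inp (t : C) : nr t < q -> nr (p + t *: v - p) < rh.
  by move=> /tv tq; rewrite addrAC subrr add0r; lra.
have close (t : C) : nr t < q -> nr (h (z + t *: v) - h (p + t *: v)) < mu / 2.
  move=> tq; apply: le_lt_trans (hL _ _ (inb t tq) (inp t tq)) _.
  rewrite opprD addrACA subrr addr0.
  apply: le_lt_trans (_ : (L + 1) * nr (z - p) < _).
    by apply: ler_wpM2r; [exact: nr_ge0|lra].
  by rewrite mulrC -ltr_pdivlMr.
pose g (t : C) := (h (z + t *: v))^-1.
have gd (t : C) : nr t < q -> differentiable g t.
  move=> tq; apply: differentiableV; last exact: nz.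
  by apply: (scal_line _).1; apply: hd; apply: lt_le_trans (inb t tq) rhrho.
have gK (t : C) : nr t = q / 2 -> nr (g t) <= (mu / 2)^-1.
  move=> te; have tq : nr t < q by rewrite te; lra.
  rewrite nrV lef_pV2 ?posrE ?divr_gt0 ?nr_gt0 ?nz //.
  have := low t; rewrite te -/mu => /(_ _) h1; have {}h1 := h1 (_ : q / 2 <= s).
  have := nr_sub (h (p + t *: v)) (h (z + t *: v)); rewrite nrBC => h2; have := close t tq.
  have qs2 : q / 2 <= s by lra.
  by have := h1 qs2; lra.
have q20 : 0 < q / 2 by rewrite divr_gt0.
have q2q : q / 2 < q by lra.
have n0 : nr (0 : C) < q by rewrite nr0.
have := max_principle q20 q2q gd gK.
rewrite /g nrV lef_pV2 ?posrE ?divr_gt0 ?nr_gt0 ?nz // scale0r addr0.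
by have := close 0 n0; rewrite !scale0r !addr0 hp subr0; lra.
Qed.

End ZeroPersistence.

End ScalarHolo.

Section Osgood.
Context {R : realType}.
Local Notation C := (Cplx R).

Definition jac_inj_at d (f : 'rV[C]_d -> 'rV[C]_d) a := forall v, 'd f a v = 0 -> v = 0.

Lemma rder_line d e (F : 'rV[C]_d -> 'rV[C]_e) (b w : 'rV[C]_d) (x : R) j :
  differentiable F (b + cr x *: w) ->
  rder (fun t => F (b + cr t *: w) ord0 j) x ('d F (b + cr x *: w) w ord0 j).
Proof.
move=> dF; have [h1 h2] := line_coord j dF; rewrite -h2.
have hh : hasd (fun t : C => F (b + t *: w) ord0 j) (cr x)
   (fun s => s * 'd (fun t : C => F (b + t *: w) ord0 j) (cr x) 1).
  have := hasd_diff h1; congr (hasd _ _ _).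
  by apply/funext => s; rewrite diff_scal.
by have := rder_comp hh (rder_id x); rewrite mul1r.
Qed.

Lemma section_diff d e (psi : 'rV[C]_d -> 'rV[C]_e) (zeta : 'rV[C]_e -> 'rV[C]_d) b a (s : R) w :
  psi b = a -> differentiable psi b -> differentiable zeta a -> 0 < s ->
  (forall y, nr (y - b) < s -> zeta (psi y) = y) -> 'd zeta a ('d psi b w) = w.
Proof.
move=> <- dpsi dz s0 h.
have [h1 h2] := diff_comp_val w dpsi dz; rewrite -h2.
have hb : zeta (psi b) = b by apply: h; rewrite subrr nr0.
have hid : hasd (zeta \o psi) b (fun w => w).
  move=> e' e0; exists s => // x xs.
  have hx : zeta (psi (b + x)) = b + x by apply: h; rewrite addrAC subrr add0r.
  by rewrite /= hx hb (addrC b) addrK subrr nr0 mulr_ge0 ?nr_ge0 // ltW.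
by rewrite (hasd_uniq (hasd_diff h1) hid) // => k x; rewrite linearZ.
Qed.

Lemma comp_diff0 d e p (psi : 'rV[C]_d -> 'rV[C]_e) (f : 'rV[C]_e -> 'rV[C]_p) b a v w :
  differentiable psi b -> psi b = a -> differentiable f a ->
  'd psi b w = v -> 'd f a v = 0 -> 'd (f \o psi) b w = 0.
Proof.
by move=> dpsi <- dfa <- e0; apply: etrans (diff_comp_val w dpsi dfa).2 e0.
Qed.

Section Slice.
Variable n : nat.
Hypothesis IH : forall (f : 'rV[C]_n -> 'rV[C]_n) a (rho : R), 0 < rho ->
  (forall z, nr (z - a) < rho -> differentiable f z) ->
  (forall z w, nr (z - a) < rho -> nr (w - a) < rho -> f z = f w -> z = w) ->
  jac_inj_at f a.

Variables (f : 'rV[C]_n.+1 -> 'rV[C]_n.+1) (a : 'rV[C]_n.+1) (rho : R).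
Hypothesis rho0 : 0 < rho.
Hypothesis fd : forall z, nr (z - a) < rho -> differentiable f z.
Hypothesis fi : forall z w, nr (z - a) < rho -> nr (w - a) < rho -> f z = f w -> z = w.

(** Moving [z] along [v] makes [l (zeta z) = u z]. Thus [zeta] is a local coordinate system in which
    the level sets of [u] are hyperplanes. *)
Lemma straighten (u : 'rV[C]_n.+1 -> C) (l : {linear 'rV[C]_n.+1 -> C}) (v : 'rV[C]_n.+1) p (r : R) :
  0 < r -> (forall z, nr (z - p) < r -> differentiable u z) ->
  l v = 1 -> 'd u p v != 0 ->
  exists tau sig : R, exists psi : 'rV[C]_n.+1 -> 'rV[C]_n.+1,
  let zeta z := z + (u z - l z) *: v in
  [/\ 0 < tau <= r, 0 < sig,
    (forall y, nr (y - zeta p) < sig -> [/\ nr (psi y - p) < tau, zeta (psi y) = y & differentiable psi y]),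
    (forall z w, nr (z - p) < tau -> nr (w - p) < tau -> zeta z = zeta w -> z = w) &
    [/\ psi (zeta p) = p, jac_inj_at zeta p, differentiable zeta p &
        forall x, 'd zeta p x = x + ('d u p x - l x) *: v]].
Proof.
move=> r0 ud lv duv; pose zeta z := z + (u z - l z) *: v.
have lh z : hasd l z l.
  by move=> e e0; exists 1 => // w _; rewrite linearD [l z + _]addrC addrK subrr nr0 mulr_ge0 ?nr_ge0 // ltW.
have zh z : nr (z - p) < r -> hasd zeta z (fun x => x + ('d u z x - l x) *: v).
  move=> zr; have h1 := hasdB (hasd_diff (ud z zr)) (lh z).
  have h2 : hasd (fun z => (u z - l z) *: v) z (fun x => ('d u z x - l x) *: v).
    move=> e e0; have n0 : 0 < nr v + 1 by rewrite ltr_wpDl ?nr_ge0.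
    have [s s0 hs] := h1 _ (divr_gt0 e0 n0); exists s => // w /hs ws.
    rewrite -!scalerBl nrZ; apply: le_trans (_ : e / (nr v + 1) * nr w * (nr v + 1) <= _).
      by apply: ler_pM; rewrite ?nr_ge0 // lerDl.
    by rewrite mulrAC divfK // gt_eqF.
  have h3 : hasd (fun z : 'rV[C]_n.+1 => z) z (fun w => w).
    by move=> e e0; exists 1 => // w _; rewrite [z + w]addrC addrK subrr nr0 mulr_ge0 ?nr_ge0 // ltW.
  exact: hasdD h3 h2.
have zd z : nr (z - p) < r -> differentiable zeta z /\ forall x, 'd zeta z x = x + ('d u z x - l x) *: v.
  move=> zr; have h := zh z zr.
  have [|L eL] := @lin_pack R 'rV[C]_n.+1 'rV[C]_n.+1 (fun x => x + ('d u z x - l x) *: v).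
    move=> k x y.
    have e : 'd u z (k *: x + y) - l (k *: x + y) = k * ('d u z x - l x) + ('d u z y - l y).
      have -> : 'd u z (k *: x + y) = k * 'd u z x + 'd u z y := linearP _ _ _ _.
      have -> : l (k *: x + y) = k * l x + l y := linearP l k x y.
      by ring.
    by rewrite e scalerDl -scalerA scalerDr addrACA.
  rewrite -eL in h; have [h1 h2] := hasd_rV h; split => // x; by rewrite h2 eL.
have pp : nr (p - p) < r by rewrite subrr nr0.
have inj : jac_inj_at zeta p.
  move=> x; rewrite (zd p pp).2 => e.
  have ex : x = (l x - 'd u p x) *: v by rewrite -opprB scaleNr; apply/eqP; rewrite -addr_eq0 e.
  have lx : l x = l x - 'd u p x.
    have lc (c : C) : l (c *: v) = c by rewrite linearZ lv; exact: mulr1.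
    by have := congr1 l ex; rewrite lc.
  have d0 : 'd u p x = 0 by move/eqP: lx; rewrite -[X in X == _]addr0 (inj_eq (addrI _)) eq_sym oppr_eq0 => /eqP.
  have : (l x - 'd u p x) * 'd u p v = 0 by rewrite -[LHS]/((l x - 'd u p x) *: 'd u p v) -linearZ -ex.
  by move/eqP; rewrite mulf_eq0 (negbTE duv) orbF => /eqP c0; rewrite ex c0 scale0r.
have [tau [sig [psi [taur sig0 h1 h2]]]] := inverse_function r0 (fun z h => (zd z h).1) inj.
have [zdp1 zdp2] := zd p pp.
have psip : psi (zeta p) = p.
  have [|k1 k2 _] := h1 (zeta p); first by rewrite subrr nr0.
  by apply: (h2 _ _ k1 _ k2); rewrite subrr nr0; case/andP: taur.
exists tau, sig, psi; exact: (And5 taur sig0 h1 h2 (And4 psip inj zdp1 zdp2)).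
Qed.

(** A component [u] of [f] with nonzero derivative is taken as [i]-th coordinate. Then [f] preserves
    the slices of that coordinate, and the induction hypothesis applies to the injective map [G] on
    one slice. A kernel vector of the derivative is tangent to the slice, hence zero. *)
Lemma osgood_slice v0 : 'd f a v0 != 0 -> jac_inj_at f a.
Proof.
move=> dv0; have rho0' := rho0.
have aa : nr (a - a) < rho by rewrite subrr nr0.
have [j dj] : exists j, 'd f a v0 ord0 j != 0.
  apply: contrapT => hn; move/negP: dv0; apply; apply/eqP/rowP => j; rewrite mxE.
  by apply: contrapT => /eqP h; apply: hn; exists j.
have [i di] : exists i, 'd f a (delta_mx 0 i) ord0 j != 0.
  apply: contrapT => hn; move/negP: dj; apply; apply/eqP.
  rewrite (row_sum_delta v0) linear_sum summxE big1 // => i _.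
  rewrite linearZ mxE; suff -> : 'd f a (delta_mx 0 i) ord0 j = 0 by rewrite mulr0.
  by apply: contrapT => /eqP h; apply: hn; exists i.
have [|l el] := @lin_pack R 'rV[C]_n.+1 C (fun x => x ord0 i); first by move=> k x y; rewrite !mxE.
pose u (z : 'rV[C]_n.+1) : C := f z ord0 j.
have ud z (h : nr (z - a) < rho) := rV_coord_diff j (fd h).
have lv : l (delta_mx 0 i) = 1 by rewrite el mxE !eqxx.
have duv : 'd u a (delta_mx 0 i) != 0 by rewrite (ud a aa).2.
have [tau [sig [psi [/andP[tau0 taur] sig0 hpsi zinj [psia zji dzd dza]]]]] :=
  straighten rho0 (fun z h => (ud z h).1) lv duv.
set zeta := fun z => z + (u z - l z) *: delta_mx 0 i in hpsi zinj psia zji dzd dza.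
pose b := zeta a.
have zi z : zeta z ord0 i = u z by rewrite /zeta el !mxE !eqxx mulr1 addrC subrK.
have zk z k : zeta z ord0 (lift i k) = z ord0 (lift i k).
  by rewrite /zeta !mxE eqxx eq_sym (negbTE (neq_lift i k)) mulr0 addr0.
(* [S] inserts a zero at place [i], and [T] deletes the coordinate [j]. *)
pose S : 'M[C]_(n, n.+1) := \matrix_(k, m) (m == lift i k)%:R.
pose T : 'M[C]_(n.+1, n) := \matrix_(m, k) (m == lift j k)%:R.
have ST (x : 'rV[C]_n) k : (x *m S) ord0 (lift i k) = x ord0 k.
  rewrite mxE (bigD1 k) //= mxE eqxx mulr1 big1 ?addr0 // => m mk.
  by rewrite mxE (inj_eq (@lift_inj _ i)) eq_sym (negbTE mk) mulr0.
have Si (x : 'rV[C]_n) : (x *m S) ord0 i = 0.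
  by rewrite mxE big1 // => m _; rewrite mxE (negbTE (neq_lift i m)) mulr0.
have TT (x : 'rV[C]_n.+1) k : (x *m T) ord0 k = x ord0 (lift j k).
  rewrite mxE (bigD1 (lift j k)) //= mxE eqxx mulr1 big1 ?addr0 // => m mk.
  by rewrite mxE (negbTE mk) mulr0.
have nS : nr S <= 1.
  by apply: nr_mx_le => // k m; rewrite mxE; case: (_ == _); rewrite ?nr0 ?nr1.
pose F := f \o psi.
have Fd y : nr (y - b) < sig -> differentiable F y.
  move=> /hpsi[h1 _ h3]; apply: (diff_comp_val 0 h3 _).1.
  by apply: fd; exact: lt_le_trans taur.
have Fj y : nr (y - b) < sig -> F y ord0 j = y ord0 i.
  by move=> /hpsi[_ h2 _]; rewrite -{2}h2 zi.
have Finj y y' : nr (y - b) < sig -> nr (y' - b) < sig -> F y = F y' -> y = y'.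
  move=> /hpsi[h1 h2 _] /hpsi[h1' h2' _] e; rewrite -h2 -h2'; congr zeta.
  by apply: fi => //; exact: lt_le_trans taur.
pose s' := sig / (n%:R + 1).
have n10 : (0 : R) < n%:R + 1 by rewrite ltr_wpDl.
have s'0 : 0 < s' by rewrite divr_gt0.
have inb (x : 'rV[C]_n) : nr (x - 0) < s' -> nr (b + x *m S - b) < sig.
  rewrite subr0 addrAC subrr add0r ltr_pdivlMr // => h; apply: le_lt_trans (nr_mulmx _ _) _.
  apply: le_lt_trans h; rewrite mulrC; apply: ler_pM; rewrite ?mulr_ge0 ?nr_ge0 //; last lra.
  by rewrite ler_piMr ?nr_ge0.
pose G (x : 'rV[C]_n) := F (b + x *m S) *m T.
have affd (x : 'rV[C]_n) : differentiable (fun x : 'rV[C]_n => b + x *m S) x /\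
   forall w, 'd (fun x : 'rV[C]_n => b + x *m S) x w = w *m S.
  have h : hasd (fun x : 'rV[C]_n => b + x *m S) x (mulmxr S).
    by move=> e e0; exists 1 => // w _; rewrite /= mulmxDl addrA (addrC (b + x *m S)) addrK subrr nr0 mulr_ge0 ?nr_ge0 // ltW.
  by have [h1 h2] := hasd_rV h; split => // w; rewrite h2.
have Gd x : nr (x - 0) < s' -> differentiable G x /\ forall w, 'd G x w = 'd F (b + x *m S) (w *m S) *m T.
  move=> xs; have [k1 _] := diff_comp_val 0 (affd x).1 (Fd _ (inb x xs)).
  have k2 w := (diff_comp_val w (affd x).1 (Fd _ (inb x xs))).2.
  have [k3 _] := diff_comp_val 0 k1 (diff_mulmxr T _).
  have k4 w := (diff_comp_val w k1 (diff_mulmxr T _)).2.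
  split; first exact: k3.
  by move=> w; have := k4 w; rewrite k2 (affd x).2 diff_mulmxr_val.
have Ginj x x' : nr (x - 0) < s' -> nr (x' - 0) < s' -> G x = G x' -> x = x'.
  move=> xs xs' e.
  have eF : F (b + x *m S) = F (b + x' *m S).
    apply/rowP => m; have [->|mj] := eqVneq m j.
      by rewrite !Fj ?inb // ![(b + _) _ _]mxE !Si.
    have [k ->] : exists k, m = lift j k.
      by case: (unliftP j m) mj => [k ->|->]; [exists k|rewrite eqxx].
    by rewrite -!TT -[F _ *m T]/(G x) e.
  have := Finj _ _ (inb x xs) (inb x' xs') eF => /(addrI b) eS.
  by apply/rowP => k; rewrite -!ST eS.
have Gi := IH s'0 (fun x h => (Gd x h).1) Ginj.
have bb : nr (b - b) < sig by rewrite subrr nr0.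
have [_ zetapsi dpsi] := hpsi b bb.
have dz : differentiable zeta a.
  apply: differentiableD; first exact: (@ex_diff _ _ _ _ _ _ _ (is_diff_id a)).
  have hu : differentiable (fun z => u z - l z) a.
    apply: differentiableB; first exact: (ud a aa).1.
    by rewrite el; exact: differentiable_coord.
  exact: differentiableZl.
have zpsi_d w : 'd zeta a ('d psi b w) = w.
  apply: (section_diff w psia dpsi dz sig0) => y ys; by case: (hpsi y ys).
move=> v dfv; pose w := 'd zeta a v.
have wi : w ord0 i = 0.
  rewrite /w dza !mxE !eqxx mulr1 el addrC subrK.
  by rewrite (ud a aa).2 dfv mxE.
have psiw : 'd psi b w = v.
  apply/eqP; rewrite -subr_eq0; apply/eqP; apply: zji.
  by rewrite linearB zpsi_d subrr.
clearbody w; have dFw : 'd F b w = 0 := comp_diff0 dpsi psia (fd aa) psiw dfv.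
pose x : 'rV[C]_n := \row_k w ord0 (lift i k).
have xS : x *m S = w.
  apply/rowP => m; have [->|mj] := eqVneq m i; first by rewrite Si wi.
  have [k ->] : exists k, m = lift i k.
    by case: (unliftP i m) mj => [k ->|->]; [exists k|rewrite eqxx].
  by rewrite ST mxE.
have x0 : x = 0.
  apply: Gi; rewrite (Gd 0 _).2 ?subrr ?nr0 // mul0mx addr0 xS dFw.
  by rewrite mul0mx.
by rewrite -psiw -xS x0 mul0mx linear0.
Qed.

End Slice.
End Osgood.

Section Osgood2.
Context {R : realType}.
Local Notation C := (Cplx R).

Lemma const_segment d e (F : 'rV[C]_d -> 'rV[C]_e) (b w : 'rV[C]_d) :
  (forall x : R, 0 <= x <= 1 -> differentiable F (b + cr x *: w) /\ 'd F (b + cr x *: w) w = 0) ->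
  F (b + w) = F b.
Proof.
move=> h; apply/rowP => j.
have := @rder_mvt _ (fun t => F (b + cr t *: w) ord0 j) (fun=> 0) 0 1 0 ler01 _ _.
rewrite cr0 cr1 scale0r scale1r addr0 mul0r => /(_ _ _)/le_trans hh.
apply/eqP; rewrite -subr_eq0 -nr_eq0 eq_le nr_ge0 andbT.
apply: (hh 0) => // x x01; last by rewrite nr0.
have [h1 h2] := h x x01.
by have := @rder_line _ _ _ F b w x j h1; rewrite h2 mxE.
Qed.

Lemma jac_inj_det d (f : 'rV[C]_d -> 'rV[C]_d) a :
  jac_inj_at f a -> \det (lin1_mx ('d f a)) != 0.
Proof.
move=> h; rewrite -unitfE -unitmxE; apply: injective_unitmx => v; rewrite lin1_mxE; exact: h.
Qed.

Section Critical.
Variable d : nat.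
Variables (f : 'rV[C]_d.+1 -> 'rV[C]_d.+1) (a : 'rV[C]_d.+1) (rho : R).
Hypothesis rho0 : 0 < rho.
Hypothesis fd : forall z, nr (z - a) < rho -> differentiable f z.
Hypothesis fi : forall z w, nr (z - a) < rho -> nr (w - a) < rho -> f z = f w -> z = w.
Hypothesis crit : forall p v0, nr (p - a) < rho -> 'd f p v0 != 0 -> jac_inj_at f p.
Hypothesis da : forall v, 'd f a v = 0.

Let aa : nr (a - a) < rho. Proof. by rewrite subrr nr0. Qed.

Let one_neq0 : (const_mx 1 : 'rV[C]_d.+1) != 0.
Proof. by apply/eqP => /rowP /(_ 0) /eqP; rewrite !mxE oner_eq0. Qed.

(** Otherwise [crit] makes the derivative vanish on the whole ball, and [f] is constant along a
    segment, against injectivity. *)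
Lemma noncritical_near (r : R) : 0 < r -> r <= rho -> exists2 b, nr (b - a) < r & jac_inj_at f b.
Proof.
move=> r0 rrho; apply: contrapT => hn.
pose w : 'rV[C]_d.+1 := cr (r / 2) *: const_mx 1.
have r20 : 0 < r / 2 by rewrite divr_gt0.
have nw : nr w <= r / 2.
  rewrite nrZ nr_cr gtr0_norm // ler_piMr ?(ltW r20) //.
  by apply: nr_mx_le => // i j; rewrite mxE nr1.
have wn : w != 0.
  by rewrite scaler_eq0 negb_or one_neq0 andbT -nr_gt0 nr_cr gtr0_norm.
have inb x : 0 <= x <= 1 -> nr (a + cr x *: w - a) < r.
  move=> /andP[x0 x1]; rewrite addrAC subrr add0r nrZ nr_cr ger0_norm //.
  have h : x * nr w <= nr w by rewrite ler_piMl ?nr_ge0.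
  lra.
have e : f (a + w) = f a.
  apply: const_segment => x /inb xr; split; first by apply: fd; lra.
  apply: contrapT => /eqP h; apply: hn; exists (a + cr x *: w) => //.
  by apply: crit h; lra.
have aw : nr (a + w - a) < rho by rewrite addrAC subrr add0r; lra.
have := fi aw aa e; rewrite -[X in _ = X]addr0 => /addrI w0.
by rewrite w0 eqxx in wn.
Qed.

Let h z : C := \det (lin1_mx ('d f z)).

Let hd z : nr (z - a) < rho -> differentiable h z.
Proof.
move=> zr; have r0 : 0 < rho - nr (z - a) by rewrite subr_gt0.
apply: (jac_det_diff r0) => w wr; apply: fd; have := nr_tri w z a; lra.
Qed.

Let crit0 p v : nr (p - a) < rho -> h p = 0 -> 'd f p v = 0.
Proof.
move=> pr hp; apply: contrapT => /eqP n.
by move/eqP: hp; apply/negP; apply: jac_inj_det; apply: crit n.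
Qed.

Let ha : h a = 0.
Proof.
apply: contrapT => /eqP n; have := det_neq0_inj n (da (const_mx 1)).
by move/eqP; rewrite (negbTE one_neq0).
Qed.

(** This says that the dimension is at least 2: a coordinate hyperplane then contains a direction
    along which the zeros of [h] can be followed. *)
Hypothesis hE : forall i : 'I_d.+1, exists2 e : 'rV[C]_d.+1, e != 0 & e ord0 i = 0.

Fixpoint iter_dd (v : 'rV[C]_d.+1) k : 'rV[C]_d.+1 -> C :=
  if k is k'.+1 then fun z => 'd (iter_dd v k') z v else h.

Lemma iter_dd_diff v k z : nr (z - a) < rho -> differentiable (iter_dd v k) z.
Proof.
elim: k z => [|k ih] z zr; first exact: hd.
have r0 : 0 < rho - nr (z - a) by rewrite subr_gt0.
apply: (scal_dd _ r0) => w wr; apply: ih; have := nr_tri w z a; lra.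
Qed.

Lemma iter_dd_zero v k p (s : R) : (forall t : C, nr t < s -> nr (p + t *: v - a) < rho) ->
  (forall t : C, nr t < s -> h (p + t *: v) = 0) ->
  forall t : C, nr t < s -> iter_dd v k (p + t *: v) = 0.
Proof.
move=> inb h0; elim: k => [//|k ih] t ts /=.
have [h1 h2] := scal_line (iter_dd_diff v k (inb t ts)).
rewrite -h2; have st : 0 < s - nr t by rewrite subr_gt0.
have hz : hasd (fun t : C => iter_dd v k (p + t *: v)) t (fun=> 0).
  move=> ep ep0; exists (s - nr t) => // w ws.
  rewrite !ih // ?subrr ?nr0 ?mulr_ge0 ?nr_ge0 ?(ltW ep0) //.
  by have := nrD t w; lra.
by apply: (hasd_uniq (hasd_diff h1) hz) => [k' x|k' x]; rewrite ?linearZ ?scaler0.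
Qed.

(* [h] is the Jacobian determinant, and the derivative of [f] vanishes where [h] does. At a
   zero [p] of [h] where the order of vanishing in the direction [v] is minimal, the zeros of
   [h] near [p] lie in a graph over a hyperplane, and all of that graph consists of
   zeros. Then [f] is constant along a curve of zeros of [h], against injectivity. *)
Lemma critical_contra : False.
Proof.
have [r [L [r0 rrho L0 _ hL]]] := scal_lip rho0 hd.
have [b br jb] := noncritical_near r0 rrho.
have hb : h b != 0 := jac_inj_det jb.
pose v := b - a.
have vn : v != 0.
  by apply/eqP => /eqP; rewrite subr_eq0 => /eqP e; rewrite e ha eqxx in hb.
have nv : 0 < nr v by rewrite nr_gt0.
have vr : nr v < r by [].
have inb (t : C) : nr t < r / nr v -> nr (a + t *: v - a) < r.
  by move=> ts; rewrite addrAC subrr add0r nrZ -ltr_pdivlMr.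
have inb' (t : C) : nr t < r / nr v -> nr (a + t *: v - a) < rho.
  by move=> /inb; lra.
have [k hk] : exists k, iter_dd v k a != 0.
  have t1 : nr (1 : C) < r / nr v by rewrite nr1 ltr_pdivlMr // mul1r.
  have [|||||k] := @der_order _ (fun k t => iter_dd v k (a + t *: v)) (r / nr v) L 1.
  - move=> k t ts; exact: (scal_line (iter_dd_diff v k (inb' t ts))).1.
  - move=> k t ts; exact: (scal_line (iter_dd_diff v k (inb' t ts))).2.
  - by move=> t /inb; exact: hL.
  - exact: t1.
  - by rewrite scale1r addrC subrK.
  by rewrite scale0r addr0; exists k.
(* The order is minimized over all zeros in the ball and not at [a] alone. Hence the derivative [u]
   of the preceding order vanishes at every zero of [h] nearby. *)
pose P k := `[< exists p, [/\ nr (p - a) < r, h p = 0 & iter_dd v k p != 0] >].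
have exP : exists k, P k.
  by exists k; apply/asboolP; exists a; split=> //; rewrite subrr nr0.
case: (ex_minnP exP) => k' /asboolP[p [pr hp hkp]] kmin.
case: k' hkp kmin => [|k'] hkp kmin; first by rewrite /= hp eqxx in hkp.
pose u := iter_dd v k'.
have uZ z : nr (z - a) < r -> h z = 0 -> u z = 0.
  move=> zr hz; apply: contrapT => /eqP uz.
  have /kmin : P k' by apply/asboolP; exists z.
  by rewrite ltnn.
pose r1 := r - nr (p - a).
have r10 : 0 < r1 by rewrite subr_gt0.
have inr1 z : nr (z - p) < r1 -> nr (z - a) < r.
  by move=> h1; apply: le_lt_trans (nr_tri z p a) _; rewrite -ltrBrDr.
have inr1' z : nr (z - p) < r1 -> nr (z - a) < rho by move=> /inr1 h1; exact: lt_le_trans h1 rrho.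
have [i vi] : exists i, v ord0 i != 0.
  apply: contrapT => hn; move/negP: vn; apply; apply/eqP/rowP => i; rewrite [RHS]mxE.
  by apply: contrapT => /eqP hi; apply: hn; exists i.
have [e en0 ei] := hE i.
(* The kernel of [l] is a hyperplane transverse to [v]; it contains [e]. *)
have [|l el] := @lin_pack R 'rV[C]_d.+1 C (fun x => x ord0 i / v ord0 i).
  by move=> k0 x y; rewrite !mxE mulrDl -mulrA.
have lv : l v = 1 by rewrite el divff.
have le : l e = 0 by rewrite el ei mul0r.
have [tau [sig [psi []]]] :=
  straighten r10 (fun z hz => iter_dd_diff v k' (inr1' z hz)) lv hkp.
rewrite -/u; pose zeta (z : 'rV[C]_d.+1) : 'rV[C]_d.+1 := z + (u z - l z) *: v.
move=> /andP[tau0 taur] sig0 hpsi0 zinj0 [psip0 _ _ _].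
have hpsi y : nr (y - zeta p) < sig ->
  [/\ nr (psi y - p) < tau, zeta (psi y) = y & differentiable psi y] := hpsi0 y.
have zinj z w : nr (z - p) < tau -> nr (w - p) < tau -> zeta z = zeta w -> z = w := zinj0 z w.
have psip : psi (zeta p) = p := psip0.
move=> {hpsi0 zinj0 psip0}.
have lZ (c : C) x : l (c *: x) = c * l x by rewrite linearZ.
have lD x y : l (x + y) = l x + l y by rewrite linearD.
have lz z : l (zeta z) = u z by rewrite /zeta lD lZ lv mulr1 addrC subrK.
have zt z (t : C) : u (z + t *: v) = u z -> zeta (z + t *: v) = zeta z.
  move=> eu; rewrite /zeta eu lD lZ lv mulr1 -addrA -scalerDl; congr (_ + _ *: _); ring.
clearbody zeta.
have nv1 : 0 < nr v + 1 by rewrite ltr_wpDl ?nr_ge0.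
have tv (s : R) (t : C) : 0 < s -> nr t < s / (nr v + 1) -> nr (t *: v) < s.
  move=> s0; rewrite ltr_pdivlMr // => ts; rewrite nrZ; apply: le_lt_trans ts.
  by apply: ler_wpM2l; [exact: nr_ge0|rewrite lerDl].
pose s1 := r1 / (nr v + 1).
have s10 : 0 < s1 by rewrite divr_gt0.
have inp (t : C) : nr t < s1 -> nr (p + t *: v - p) < r1.
  by move=> /(tv _ _ r10); rewrite addrAC subrr add0r.
have [t1 t1s ht1] : exists2 t1 : C, nr t1 < s1 & h (p + t1 *: v) != 0.
  apply: contrapT => hn.
  have hz (t : C) : nr t < s1 -> h (p + t *: v) = 0.
    by move=> ts; apply: contrapT => /eqP ht; apply: hn; exists t.
  have n0 : nr (0 : C) < s1 by rewrite nr0.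
  have := @iter_dd_zero v k'.+1 p s1 (fun t ts => inr1' _ (inp t ts)) hz 0 n0.
  by rewrite scale0r addr0 => /eqP; rewrite (negbTE hkp).
have [c [m [s [c0 s0 ss1 low]]]] := @lower_bound' _ (fun t => h (p + t *: v)) s1 L t1
  (fun t ts => (scal_line (hd (inr1' _ (inp t ts)))).1) (fun t ts => hL _ (inr1 _ (inp t ts))) t1s ht1.
have t20 : 0 < tau / 2 by rewrite divr_gt0.
have [del del0 hdel] := zero_persist r10 (fun z hz => hd (inr1' _ hz)) hp c0 s0 low
  (divr_gt0 t20 nv1).
have y0 : nr (zeta p - zeta p) < sig by rewrite subrr nr0.
have [_ _ dpsi0] := hpsi _ y0.
have m0 : 0 < Num.min del (tau / 2) by rewrite lt_min del0.
have /continuous_nrP /(_ _ m0)[eta eta0 heta] := differentiable_continuous dpsi0.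
pose x1 := Num.min sig eta / 2 / (nr e + 1).
have me0 : 0 < Num.min sig eta by rewrite lt_min sig0.
have ne1 : 0 < nr e + 1 by rewrite ltr_wpDl ?nr_ge0.
have x10 : 0 < x1 by rewrite !divr_gt0.
pose w : 'rV[C]_d.+1 := cr x1 *: e.
have nw : nr w < Num.min sig eta.
  rewrite nrZ nr_cr gtr0_norm //; apply: le_lt_trans (_ : x1 * (nr e + 1) < _).
    by apply: ler_wpM2l; [exact: ltW|rewrite lerDl].
  by rewrite /x1 divfK ?gt_eqF // ltr_pdivrMr // ltr_pMr // ltr1n.
have inx (x : R) : 0 <= x <= 1 -> nr (zeta p + cr x *: w - zeta p) < Num.min sig eta.
  move=> /andP[x0 xle]; rewrite addrAC subrr add0r nrZ nr_cr ger0_norm //.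
  by apply: le_lt_trans nw; rewrite ler_piMl ?nr_ge0.
(* The point [q] lies on the zero set of [u], a graph in the direction [v]. By [zero_persist] some
   [q + t v] is a zero of [h], so [u] vanishes there too; as [zeta] takes the same value at both
   points, they coincide. *)
have curve (x : R) : 0 <= x <= 1 -> h (psi (zeta p + cr x *: w)) = 0.
  move=> /inx; rewrite lt_min => /andP[x2 x3].
  have [q1 q2 _] := hpsi _ x2; have := heta _ x3; rewrite psip lt_min => /andP[q3 q4].
  move: (psi _) q1 q2 q3 q4 => q q1 q2 q3 q4.
  have uq : u q = 0 by rewrite -lz q2 lD lz lZ lZ le !mulr0 addr0 (uZ p).
  have [t ts ht] := hdel q q3; have tvs := tv _ _ t20 ts.
  have qt : nr (q + t *: v - p) < tau.
    by rewrite addrAC; apply: le_lt_trans (nrD _ _) _; rewrite [tau]splitr; exact: ltrD.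
  have uqt : u (q + t *: v) = 0 by apply: uZ => //; apply: inr1; exact: lt_le_trans qt taur.
  by rewrite -(zinj _ _ qt q1 (zt _ _ _)) // uqt uq.
have key : f (psi (zeta p + w)) = f (psi (zeta p)).
  apply: (@const_segment _ _ (f \o psi)) => x x01.
  have := inx x x01; rewrite lt_min => /andP[x2 _]; have [q1 q2 q3] := hpsi _ x2.
  have qa : nr (psi (zeta p + cr x *: w) - a) < rho by apply: inr1'; exact: lt_le_trans q1 taur.
  have hq := curve x x01.
  split; first exact: (diff_comp_val 0 q3 (fd qa)).1.
  exact: comp_diff0 q3 (erefl _) (fd qa) (erefl _) (crit0 _ qa hq).
have h01 : 0 <= (1 : R) <= 1 by rewrite ler01 lexx.
have := inx 1 h01; rewrite cr1 scale1r lt_min => /andP[x2 _].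
have [q1 q2 _] := hpsi _ x2.
have qa : nr (psi (zeta p + w) - a) < rho by apply: inr1'; exact: lt_le_trans q1 taur.
have pa : nr (p - a) < rho by exact: lt_le_trans pr rrho.
rewrite psip in key; have ep := fi qa pa key.
move: q2; rewrite ep -[X in X = _]addr0 => /addrI w0.
have : w != 0 by rewrite scaler_eq0 negb_or en0 andbT -nr_gt0 nr_cr gtr0_norm.
by rewrite -w0 eqxx.
Qed.

End Critical.

Lemma diff_shift (g : C -> C) z1 t : differentiable g (z1 + t) ->
  differentiable (fun w => g (z1 + w)) t /\ 'd (fun w => g (z1 + w)) t 1 = 'd g (z1 + t) 1.
Proof.
move=> dg; have h : hasd (fun w => g (z1 + w)) t (fun w => w * 'd g (z1 + t) 1).
  have := hasd_diff dg; move=> h e e0; have [r r0 hr] := h e e0; exists r => // w /hr.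
  by rewrite addrA -diff_scal.
have h1 : differentiable (fun w => g (z1 + w)) t by apply/cdiffP; exists ('d g (z1 + t) 1).
have hZ (k x : C) : (k * x) * 'd g (z1 + t) 1 = k * (x * 'd g (z1 + t) 1) by rewrite mulrA.
split; first exact: h1.
transitivity (1 * 'd g (z1 + t) 1); last exact: mul1r.
exact: (hasd_val (1 : C) h1 h hZ).
Qed.

Lemma taylor3 (g : C -> C) z1 (r : R) : 0 < r -> (forall z, nr (z - z1) < r -> differentiable g z) ->
  exists2 c2 : C, True & exists B s : R, [/\ 0 < s, 0 <= B & forall w, nr w <= s ->
    nr (g (z1 + w) - g z1 - w * 'd g z1 1 - c2 * w ^+ 2) <= B * nr w ^+ 3].
Proof.
move=> r0 gd; have z11 : nr (z1 - z1) < r by rewrite subrr nr0.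
have /continuous_nrP /(_ 1 ltr01)[s s0 hs] := differentiable_continuous (gd _ z11).
pose q := Num.min r s; have q0 : 0 < q by rewrite lt_min r0.
have q20 : 0 < q / 2 by rewrite divr_gt0.
have q2q : q / 2 < q by lra.
have ud w : nr w < q -> differentiable (fun w => g (z1 + w)) w.
  by rewrite lt_min => /andP[wr _]; apply: (diff_shift _).1; apply: gd; rewrite addrAC subrr add0r.
have uK w : nr w = q / 2 -> nr (g (z1 + w)) <= nr (g z1) + 1.
  move=> e; have ws : nr w < s by rewrite e; apply: lt_le_trans q2q _; rewrite ge_min lexx orbT.
  have := hs (z1 + w); rewrite addrAC subrr add0r => /(_ ws).
  have := nr_sub (g (z1 + w)) (g z1); lra.
have [c [c0 c1 _ hc]] := taylor_half q20 q2q ud uK.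
exists (c 2%N) => //; exists (2 * (nr (g z1) + 1) / (q / 2) ^+ 3), (q / 2 / 2).
split; first by rewrite divr_gt0.
  by rewrite !mulr_ge0 ?invr_ge0 ?exprn_ge0 ?ltW // ltr_wpDl ?nr_ge0.
move=> w ws; have := hc 3%N w ws.
have := (@diff_shift g z1 0); rewrite !addr0 => /(_ (gd _ z11))[_ e1].
have -> : \sum_(j < 3) c j * w ^+ j = c 0%N + c 1%N * w + c 2%N * w ^+ 2.
  by rewrite !big_ord_recr big_ord0 /= add0r expr0 mulr1 expr1.
rewrite addr0 in c0; rewrite e1 in c1; rewrite c0 c1.
move=> h; suff -> : g (z1 + w) - g z1 - w * 'd g z1 1 - c 2%N * w ^+ 2 =
   g (z1 + w) - (g z1 + 'd g z1 1 * w + c 2%N * w ^+ 2).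
  by apply: le_trans h _; rewrite expr_div_n mulrA mulrAC.
by move: ('d g z1 1) => D; ring.
Qed.

(** For a noncritical [z1] near 0, injectivity leaves the difference quotient [q] of [g] at [z1]
    without zeros. The maximum principle for its inverse bounds [q 0] below by [mu], whereas [q 0]
    is small because the derivative of [g] vanishes at 0. *)
Lemma crit_scalar (g : C -> C) (rho : R) : 0 < rho ->
  (forall z, nr z < rho -> differentiable g z) ->
  (forall z w, nr z < rho -> nr w < rho -> g z = g w -> z = w) ->
  (forall r : R, 0 < r -> r <= rho -> exists2 z1, nr z1 < r & 'd g z1 1 != 0) ->
  'd g 0 1 = 0 -> False.
Proof.
move=> rho0 gd ginj gnc g'0.
have n0 : nr (0 : C) < rho by rewrite nr0.
have /continuous_nrP hc := differentiable_continuous (gd _ n0).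
have [r' r'0 hr'] := hc 1 ltr01.
pose r := Num.min rho r'; have r0 : 0 < r by rewrite lt_min rho0.
have rrho : r <= rho by rewrite ge_min lexx.
have rr' : r <= r' by rewrite ge_min lexx orbT.
have ud z : nr z < r -> differentiable (fun z => g z - g 0) z.
  by move=> zr; apply: differentiableB; [apply: gd; lra|exact: differentiable_cst].
have uK z : nr z < r -> nr (g z - g 0) <= 1.
  by move=> zr; apply/ltW/hr'; rewrite subr0; lra.
have nr2 : nr (cr (r / 2) : C) < r by rewrite nr_cr gtr0_norm ?divr_gt0 //; lra.
have un : g (cr (r / 2)) - g 0 != 0.
  rewrite subr_eq0; apply/eqP => /ginj e.
  have : nr (cr (r / 2) : C) = 0 by rewrite e ?nr0 //; lra.
  by rewrite nr_cr gtr0_norm ?divr_gt0 //; lra.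
have [c [m [s [c0 s0 sr low]]]] := lower_bound' ud uK nr2 un.
(* On the circle of radius [s] the numerator of [q] is at least [c * s ^+ m / 2] and the denominator
   at most [2 * s]. *)
pose mu := c * s ^+ m / 2 / (2 * s).
have mu0 : 0 < mu by rewrite /mu !divr_gt0 ?mulr_gt0 ?exprn_gt0.
have csm : 0 < c * s ^+ m / 2 by rewrite divr_gt0 // mulr_gt0 // exprn_gt0.
have [del1 del10 hdel1] := hc _ csm.
have [del2 del20 hdel2] := hasd_diff (gd _ n0) (divr_gt0 mu0 (ltr0Sn R 1)).
pose del := Num.min s (Num.min del1 del2).
have del0 : 0 < del by rewrite !lt_min s0 del10.
have dels : del <= s by rewrite ge_min lexx.
have [|z1] := gnc del del0; first by lra.
rewrite !lt_min => /and3P[z1s z11 z12] gz1.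
have z1n : z1 != 0 by apply/eqP => e; rewrite e g'0 eqxx in gz1.
have z1r : nr z1 < rho by lra.
pose q z := if z == z1 then 'd g z1 1 else (g z - g z1) * (z - z1)^-1.
have qn z : nr z < rho -> q z != 0.
  move=> zr; have [->|zz] := eqVneq z z1; first by rewrite /q eqxx.
  rewrite /q (negbTE zz); apply: mulf_neq0; rewrite ?invr_neq0 ?subr_eq0 //.
  by apply/eqP => /ginj e; rewrite e ?eqxx in zz.
have qd z : nr z < rho -> differentiable q z.
  move=> zr; have [->|zz] := eqVneq z z1.
    have rz : 0 < rho - nr z1 by rewrite subr_gt0.
    have [|c2 _ [B [s' [s'0 B0 hB]]]] := @taylor3 g z1 _ rz.
      move=> w wr; apply: gd; have := nrD (w - z1) z1; rewrite subrK; lra.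
    apply/cdiffP; exists c2; apply: (hasd_sq s'0 B0) => w ws.
    have [->|w0] := eqVneq w 0.
      by rewrite addr0 subrr mul0r subrr nr0 mulr_ge0 ?exprn_ge0 ?nr_ge0.
    have wn : 0 < nr w by rewrite nr_gt0.
    rewrite -(ler_pM2r wn) -mulrA -exprSr; apply: le_trans (hB w ws).
    rewrite -nrM /q eqxx; have -> : (z1 + w == z1) = false.
      by apply/negbTE; rewrite -[X in _ != X]addr0 (inj_eq (addrI _)).
    move: ('d g z1 1) => D; rewrite le_eqVlt; apply/orP; left; apply/eqP; congr nr.
    have -> : z1 + w - z1 = w by ring.
    by field.
  apply/cdiffP; have : differentiable (fun z => (g z - g z1) * (z - z1)^-1) z.
    apply: differentiableM.
      by apply: differentiableB; [exact: gd|exact: differentiable_cst].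
    apply: differentiableV; last by rewrite subr_eq0.
    by apply: differentiableB; [exact: (@ex_diff _ _ _ _ _ _ _ (is_diff_id z))|exact: differentiable_cst].
  move=> /cdiffP[l hl]; exists l.
  have nz : 0 < nr (z - z1) by rewrite nr_gt0 subr_eq0.
  apply: (hasd_local nz _ hl) => w ws; rewrite /q; case: eqVneq => // e.
  by rewrite e nrBC ltxx in ws.
have pd z : nr z < r -> differentiable (fun z => (q z)^-1) z.
  by move=> zr; apply: differentiableV; [apply: qd|apply: qn]; lra.
have pK z : nr z = s -> nr ((q z)^-1) <= mu^-1.
  move=> zs; have zr : nr z < rho by rewrite zs; lra.
  rewrite nrV lef_pV2 ?posrE ?nr_gt0 ?qn //.
  have zz : z != z1 by apply/eqP => e; rewrite e in zs; lra.
  rewrite /q (negbTE zz) nrM nrV.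
  have d0 : 0 < nr (z - z1) by rewrite nr_gt0 subr_eq0.
  rewrite ler_pdivlMr // /mu; apply: le_trans (_ : c * s ^+ m / 2 <= _).
    rewrite -[leRHS](@divfK _ (2 * s)) ?gt_eqF ?mulr_gt0 //.
    apply: ler_wpM2l; first by rewrite ltW // divr_gt0 // mulr_gt0.
    by have := nrB z z1; lra.
  have := low z; rewrite zs lexx => /(_ isT) h1.
  have := hdel1 z1; rewrite subr0 => /(_ z11) h2.
  have := nr_sub (g z - g 0) (g z1 - g 0); rewrite opprB addrA subrK.
  have : c * s ^+ m = c * s ^+ m / 2 + c * s ^+ m / 2 by field.
  lra.
have := max_principle s0 sr pd pK.
rewrite nrV lef_pV2 ?posrE ?nr_gt0 ?qn //.
rewrite /q eq_sym (negbTE z1n) sub0r nrM nrV nrN ler_pdivlMr ?nr_gt0 // nrBC.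
have := hdel2 z1 z12; rewrite add0r diff_scal ?g'0 ?mulr0 ?subr0; last exact: gd.
have : 0 < mu * nr z1 by rewrite mulr_gt0 // nr_gt0.
lra.
Qed.

(** By slicing, a point where the derivative is not injective has zero derivative. Such a point is
    excluded by [crit_scalar] in dimension 1, where there is no transverse direction, and by
    [critical_contra] in higher dimension. *)
Theorem osgood d (f : 'rV[C]_d -> 'rV[C]_d) a (rho : R) : 0 < rho ->
  (forall z, nr (z - a) < rho -> differentiable f z) ->
  (forall z w, nr (z - a) < rho -> nr (w - a) < rho -> f z = f w -> z = w) ->
  jac_inj_at f a.
Proof.
elim: d f a rho => [|d IH] f a rho rho0 fd fi.
  by move=> v _; apply/rowP => -[].
have crit p v0 : nr (p - a) < rho -> 'd f p v0 != 0 -> jac_inj_at f p.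
  move=> pr; have r0 : 0 < rho - nr (p - a) by rewrite subr_gt0.
  have inr z : nr (z - p) < rho - nr (p - a) -> nr (z - a) < rho.
    by have := nr_tri z p a; lra.
  apply: (osgood_slice IH r0) => [z /inr|z w /inr zr /inr wr]; first exact: fd.
  exact: fi.
apply: contrapT => hinj.
have aa : nr (a - a) < rho by rewrite subrr nr0.
have da v : 'd f a v = 0.
  by apply: contrapT => /eqP v0; apply: hinj; exact: crit v0.
case: d f a rho rho0 fd fi crit hinj aa da {IH} => [|d] f a rho rho0 fd fi crit hinj aa da.
  pose g (t : C) : C := f (a + t *: const_mx 1) ord0 ord0.
  have n1 (t : C) : nr (t *: (const_mx 1 : 'rV[C]_1)) = nr t.
    rewrite -(@nr_const_mx R t); congr nr; by apply/rowP => j; rewrite !mxE mulr1.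
  have inb (t : C) : nr t < rho -> nr (a + t *: const_mx 1 - a) < rho.
    by rewrite addrAC subrr add0r n1.
  have gl (t : C) : nr t < rho -> differentiable g t /\ 'd g t 1 = 'd f (a + t *: const_mx 1) (const_mx 1) ord0 ord0.
    by move=> tr; exact: (line_coord 0 (fd _ (inb t tr))).
  have row1 (x : 'rV[C]_1) : x = x ord0 ord0 *: const_mx 1.
    by apply/rowP => j; rewrite !ord1 !mxE mulr1.
  have g01 : 'd g 0 1 = 0.
    have [|_ ->] := gl 0; first by rewrite nr0.
    by rewrite scale0r addr0 da mxE.
  have key : (forall z w, nr z < rho -> nr w < rho -> g z = g w -> z = w).
    move=> z w zr wr; rewrite /g => e.
    have : f (a + z *: const_mx 1) = f (a + w *: const_mx 1).
      by apply/rowP => j; rewrite !ord1.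
    move=> /(fi _ _ (inb z zr) (inb w wr)) /addrI /rowP /(_ 0).
    by rewrite !mxE !mulr1.
  apply: (crit_scalar rho0 (fun t tr => (gl t tr).1) key _ g01).
  move=> r r0 rrho; have [b br jb] := noncritical_near rho0 fd fi crit r0 rrho.
  exists ((b - a) ord0 ord0).
    by rewrite -n1 -row1.
  rewrite (gl _ _).2; last by rewrite -n1 -row1; lra.
  rewrite -row1 addrC subrK; apply/eqP => e.
  have : 'd f b (const_mx 1) = 0 by rewrite (row1 ('d f b _)) e scale0r.
  by move=> /jb /rowP /(_ 0) /eqP; rewrite !mxE oner_eq0.
apply: (critical_contra rho0 fd fi crit da) => i.
exists (delta_mx 0 (lift i ord0)).
  by apply/eqP => /rowP /(_ (lift i ord0)) /eqP; rewrite !mxE !eqxx oner_eq0.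
by rewrite mxE eqxx (negbTE (neq_lift _ _)).
Qed.

End Osgood2.

(** * Bilinear maps and adapted frames *)

Section Euclid.
Context {R : realType}.
Local Notation C := (Cplx R).

Lemma cauchy_schwarz n (x y : 'I_n -> R) :
  (\sum_i x i * y i) ^+ 2 <= (\sum_i x i ^+ 2) * (\sum_i y i ^+ 2).
Proof.
set a := \sum_i x i ^+ 2; set b := \sum_i _ * _; set c := \sum_i y i ^+ 2.
have c0 : 0 <= c by apply: sumr_ge0 => i _; exact: sqr_ge0.
have key : 0 <= c * (a * c - b ^+ 2).
  have -> : c * (a * c - b ^+ 2) = \sum_i (c * x i - b * y i) ^+ 2.
    transitivity (\sum_i (c ^+ 2 * x i ^+ 2 - 2 * c * b * (x i * y i) + b ^+ 2 * y i ^+ 2)).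
      by rewrite !big_split /= sumrN -!mulr_sumr -/a -/b -/c; ring.
    by apply: eq_bigr => i _; ring.
  by apply: sumr_ge0 => i _; exact: sqr_ge0.
move: c0; rewrite le_eqVlt => /orP[/eqP c0|c0]; last by rewrite pmulr_rge0 // subr_ge0 in key.
have y0 i : y i = 0.
  have /eqP := esym c0; rewrite psumr_eq0 => [|j _]; last exact: sqr_ge0.
  by move=> /allP /(_ i); rewrite mem_index_enum => /(_ isT); rewrite sqrf_eq0 => /eqP.
rewrite -c0 mulr0 /b big1 ?expr0n // => i _; by rewrite y0 mulr0.
Qed.

Lemma l2_triangle n (x y : 'I_n -> R) :
  Num.sqrt (\sum_i (x i + y i) ^+ 2) <=
  Num.sqrt (\sum_i x i ^+ 2) + Num.sqrt (\sum_i y i ^+ 2).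
Proof.
have a0 : 0 <= \sum_i x i ^+ 2 by apply: sumr_ge0 => i _; exact: sqr_ge0.
have c0 : 0 <= \sum_i y i ^+ 2 by apply: sumr_ge0 => i _; exact: sqr_ge0.
rewrite -(@ler_pXn2r _ 2) ?nnegrE ?addr_ge0 ?sqrtr_ge0 //.
rewrite sqr_sqrtr; last by apply: sumr_ge0 => i _; exact: sqr_ge0.
rewrite sqrrD !sqr_sqrtr //.
have -> : \sum_i (x i + y i) ^+ 2 = \sum_i x i ^+ 2 + (\sum_i x i * y i) *+ 2 + \sum_i y i ^+ 2.
  by rewrite -sumrMnl -!big_split; apply: eq_bigr => i _; rewrite sqrrD.
rewrite lerD2r lerD2l lerMn2r /=.
rewrite -sqrtrM //; apply: le_trans (ler_norm _) _; rewrite -sqrtr_sqr.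
by apply: ler_wsqrtr; exact: cauchy_schwarz.
Qed.

Lemma nr_sqr (a : C) : nr a ^+ 2 = complex.Re (a : R[i]) ^+ 2 + complex.Im (a : R[i]) ^+ 2.
Proof. by rewrite /nr normc_def /= sqr_sqrtr // addr_ge0 // sqr_ge0. Qed.

Variable d : nat.
Local Notation V := 'rV[C]_d.
Local Notation en := (@enorm R d).
Implicit Types z w : V.

Lemma enE z : en z = Num.sqrt (\sum_j nr (z ord0 j : C) ^+ 2).
Proof. by congr Num.sqrt; apply: eq_bigr => j _; rewrite nr_sqr. Qed.

Lemma en_ge0 z : 0 <= en z. Proof. exact: sqrtr_ge0. Qed.

Lemma enD z w : en (z + w) <= en z + en w.
Proof.
rewrite !enE; apply: le_trans (l2_triangle _ _); apply: ler_wsqrtr.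
apply: ler_sum => j _; rewrite mxE lerXn2r ?nnegrE ?addr_ge0 ?nr_ge0 //; exact: nrD.
Qed.

Lemma enZ (k : C) z : en (k *: z) = nr k * en z.
Proof.
rewrite !enE -[nr k]ger0_norm ?nr_ge0 // -sqrtr_sqr -sqrtrM ?sqr_ge0 // mulr_sumr.
by congr Num.sqrt; apply: eq_bigr => j _; rewrite mxE nrM exprMn.
Qed.

Lemma en0 : en 0 = 0.
Proof. by rewrite -(scale0r (0 : V)) enZ nr0 mul0r. Qed.

Lemma enN z : en (- z) = en z.
Proof. by rewrite -scaleN1r enZ nrN nr1 mul1r. Qed.

Lemma enB z w : en (z - w) <= en z + en w.
Proof. by rewrite -(enN w); exact: enD. Qed.

Lemma enBC z w : en (z - w) = en (w - z).
Proof. by rewrite -enN opprB. Qed.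

Lemma en_sub z w : en z - en w <= en (z - w).
Proof. by rewrite lerBlDr -{1}(subrK w z); exact: enD. Qed.

Lemma nr_le_en z : nr z <= en z.
Proof.
apply: nr_mx_le; first exact: en_ge0.
move=> i j; rewrite ord1 enE -[leLHS]ger0_norm ?nr_ge0 // -sqrtr_sqr; apply: ler_wsqrtr.
by rewrite (bigD1 j) //= lerDl; apply: sumr_ge0 => *; exact: sqr_ge0.
Qed.

Lemma en_le_nr z : en z <= d%:R * nr z.
Proof.
rewrite enE; apply: (@le_trans _ _ (Num.sqrt ((d%:R * nr z) ^+ 2))); last first.
  by rewrite sqrtr_sqr ger0_norm ?mulr_ge0 ?nr_ge0.
apply: ler_wsqrtr; apply: le_trans (_ : \sum_(j < d) nr z ^+ 2 <= _).
  by apply: ler_sum => j _; rewrite lerXn2r ?nnegrE ?nr_ge0 // nr_mx_entry.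
rewrite sumr_const card_ord -[leLHS]mulr_natl exprMn.
apply: ler_wpM2r; first exact: sqr_ge0.
by rewrite -natrX ler_nat; case: (posnP d) => [->//|d0]; rewrite expnS leq_pmulr ?expn1.
Qed.

Lemma en_mulmx (A : 'M[C]_d) z : en (z *m A) <= d%:R * d%:R * nr A * en z.
Proof.
apply: le_trans (en_le_nr _) _; rewrite -!mulrA; apply: ler_wpM2l => //.
apply: le_trans (nr_mulmx _ _) _; apply: ler_wpM2l => //; rewrite mulrC.
by apply: ler_wpM2l; [exact: nr_ge0|exact: nr_le_en].
Qed.

Lemma en0_eq0 z : en z = 0 -> z = 0.
Proof.
move=> h; apply: nr0_eq0; apply/eqP; rewrite eq_le nr_ge0 andbT -h; exact: nr_le_en.
Qed.

End Euclid.

Section Bilinear.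
Context {R : realType}.
Local Notation C := (Cplx R).
Variable d : nat.
Local Notation V := 'rV[C]_d.
Local Notation en := (@enorm R d).

Definition bil (B : V -> V -> V) :=
  (forall (k : C) u u' v, B (k *: u + u') v = k *: B u v + B u' v) /\
  (forall (k : C) u v v', B u (k *: v + v') = k *: B u v + B u v').

Definition bbd (B : V -> V -> V) (K : R) := forall u v, en (B u v) <= K * (en u * en v).

Section Rules.
Variables (B : V -> V -> V) (hB : bil B).
Lemma bilDl u u' v : B (u + u') v = B u v + B u' v.
Proof. by have := hB.1 1 u u' v; rewrite !scale1r. Qed.
Lemma bilDr u v v' : B u (v + v') = B u v + B u v'.
Proof. by have := hB.2 1 u v v'; rewrite !scale1r. Qed.
Lemma bil0l v : B 0 v = 0.
Proof. by apply: (addrI (B 0 v)); rewrite -bilDl !addr0. Qed.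
Lemma bil0r v : B v 0 = 0.
Proof. by apply: (addrI (B v 0)); rewrite -bilDr !addr0. Qed.
Lemma bilZl (k : C) u v : B (k *: u) v = k *: B u v.
Proof. by have := hB.1 k u 0 v; rewrite bil0l !addr0. Qed.
Lemma bilZr (k : C) u v : B u (k *: v) = k *: B u v.
Proof. by have := hB.2 k u v 0; rewrite bil0r !addr0. Qed.
Lemma bilNl u v : B (- u) v = - B u v.
Proof. by apply: (addrI (B u v)); rewrite -bilDl !subrr bil0l. Qed.
Lemma bilNr u v : B u (- v) = - B u v.
Proof. by apply: (addrI (B u v)); rewrite -bilDr !subrr bil0r. Qed.
Lemma bilBl u u' v : B (u - u') v = B u v - B u' v.
Proof. by rewrite bilDl bilNl. Qed.
Lemma bilBr u v v' : B u (v - v') = B u v - B u v'.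
Proof. by rewrite bilDr bilNr. Qed.
End Rules.

Lemma bilD (B B' : V -> V -> V) : bil B -> bil B' -> bil (fun u v => B u v + B' u v).
Proof.
by move=> h h'; split=> k u u' v; rewrite ?(h.1, h'.1) ?(h.2, h'.2) scalerDr addrACA.
Qed.

Lemma bilN (B : V -> V -> V) : bil B -> bil (fun u v => - B u v).
Proof. by move=> h; split=> k u u' v; rewrite ?h.1 ?h.2 opprD scalerN. Qed.

Lemma bilB (B B' : V -> V -> V) : bil B -> bil B' -> bil (fun u v => B u v - B' u v).
Proof. by move=> h h'; exact: (bilD h (bilN h')). Qed.

Lemma bilS (c : C) (B : V -> V -> V) : bil B -> bil (fun u v => c *: B u v).
Proof. by move=> h; split=> k u u' v; rewrite ?h.1 ?h.2 scalerDr !scalerA [c * k]mulrC. Qed.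

Lemma bil0 : bil (fun _ _ => 0).
Proof. by split=> *; rewrite scaler0 addr0. Qed.

Lemma bbdN (B : V -> V -> V) K : bbd B K -> bbd (fun u v => - B u v) K.
Proof. by move=> h u v; rewrite enN. Qed.

Lemma bbdB (B B' : V -> V -> V) K K' : bbd B K -> bbd B' K' -> bbd (fun u v => B u v - B' u v) (K + K').
Proof. by move=> h h' u v; apply: le_trans (enB _ _) _; rewrite mulrDl lerD. Qed.

Lemma bbdS (c : C) (B : V -> V -> V) K : bbd B K -> bbd (fun u v => c *: B u v) (nr c * K).
Proof. by move=> h u v; rewrite enZ -mulrA; apply: ler_wpM2l; rewrite ?nr_ge0. Qed.

Lemma bbdW (B : V -> V -> V) K K' : K <= K' -> bbd B K -> bbd B K'.
Proof.
by move=> KK h u v; apply: le_trans (h u v) _; rewrite ler_wpM2r // mulr_ge0 ?en_ge0.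
Qed.

Lemma bbd0 : bbd (fun _ _ => 0) 0.
Proof. by move=> u v; rewrite en0 mul0r. Qed.

Lemma bbd_sandwich (B : V -> V -> V) (A A' A'' : 'M[C]_d) K c c' c'' : 0 <= K -> 0 <= c -> 0 <= c' -> 0 <= c'' ->
  (forall z, en (z *m A) <= c * en z) -> (forall z, en (z *m A') <= c' * en z) ->
  (forall z, en (z *m A'') <= c'' * en z) ->
  bbd B K -> bbd (fun u v => B (u *m A) (v *m A') *m A'') (c'' * (c * c') * K).
Proof.
move=> K0 c0 c'0 c''0 h h' h'' hB u v; apply: le_trans (h'' _) _.
rewrite -!mulrA; apply: ler_wpM2l => //; apply: le_trans (hB _ _) _.
rewrite mulrA [leRHS](_ : _ = K * ((c * en u) * (c' * en v))); last by ring.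
by rewrite -mulrA ler_wpM2l // ler_pM ?en_ge0.
Qed.

End Bilinear.

(** * Factorization of a matrix with uniformly invertible outer factors *)

Section Pivot.
Context {R : realType}.
Local Notation C := (Cplx R).

Definition biunit d (K : R) (X X' : 'M[C]_d) :=
  [/\ X *m X' = 1%:M, X' *m X = 1%:M, nr X <= K & nr X' <= K].

Lemma biunitM d K1 K2 (X X' Y Y' : 'M[C]_d) : biunit K1 X X' -> biunit K2 Y Y' ->
  biunit (d%:R * (K1 * K2)) (X *m Y) (Y' *m X').
Proof.
move=> [h1 h2 h3 h4] [k1 k2 k3 k4].
have a0 : 0 <= K1 := le_trans (nr_ge0 _) h3.
have b0 : 0 <= K2 := le_trans (nr_ge0 _) k3.
split.
- by rewrite mulmxA -(mulmxA X) k1 mulmx1.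
- by rewrite mulmxA -(mulmxA Y') h2 mulmx1.
- by apply: le_trans (nr_mulmx _ _) _; apply: ler_wpM2l => //; apply: ler_pM; rewrite ?nr_ge0.
by apply: le_trans (nr_mulmx _ _) _; apply: ler_wpM2l => //; rewrite mulrC; apply: ler_pM; rewrite ?nr_ge0.
Qed.

Lemma nr_block m n p q (A : 'M[C]_(m, n)) (B : 'M[C]_(m, p)) (D : 'M[C]_(q, n)) (E : 'M[C]_(q, p)) K :
  nr A <= K -> nr B <= K -> nr D <= K -> nr E <= K -> nr (block_mx A B D E) <= K.
Proof.
move=> h1 h2 h3 h4; apply: nr_mx_le; first exact: le_trans (nr_ge0 _) h1.
move=> i j; case: (split_ordP i) => i' ->; case: (split_ordP j) => j' ->;
  rewrite ?block_mxEul ?block_mxEur ?block_mxEdl ?block_mxEdr;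
  by apply: le_trans (nr_mx_entry _ _ _) _.
Qed.

Lemma nr_scalar1 d : nr (1%:M : 'M[C]_d) <= 1.
Proof. by apply: nr_mx_le => // i j; rewrite mxE; case: (_ == _); rewrite ?nr1 ?nr0. Qed.

Lemma biunit1 d : biunit 1 (1%:M : 'M[C]_d) 1%:M.
Proof. by split; rewrite ?mulmx1 ?nr_scalar1. Qed.

Lemma biunit_tperm d (i j : 'I_d) : biunit 1 (tperm_mx i j : 'M[C]_d) (tperm_mx i j).
Proof.
have h : tperm_mx i j *m tperm_mx i j = 1%:M :> 'M[C]_d.
  by rewrite -perm_mxM perm.tperm2 perm_mx1.
have n : nr (tperm_mx i j : 'M[C]_d) <= 1.
  by apply: nr_mx_le => // k l; rewrite !mxE; case: (_ == _); rewrite ?nr1 ?nr0.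
by split.
Qed.

Lemma biunit_lower d (c : 'cV[C]_d) : nr c <= 1 ->
  biunit 1 (block_mx 1%:M 0 c 1%:M : 'M[C]_(1 + d)) (block_mx 1%:M 0 (- c) 1%:M).
Proof.
move=> c1; split; rewrite ?mulmx_block ?mul0mx ?mulmx0 ?mulmx1 ?mul1mx ?addr0 ?add0r ?subrr ?addNr ?scalar_mx_block //.
  by apply: nr_block; rewrite ?nr_scalar1 ?nr0.
by apply: nr_block; rewrite ?nr_scalar1 ?nr0 ?nrN.
Qed.

Lemma biunit_upper d (c : 'rV[C]_d) : nr c <= 1 ->
  biunit 1 (block_mx 1%:M c 0 1%:M : 'M[C]_(1 + d)) (block_mx 1%:M (- c) 0 1%:M).
Proof.
move=> c1; split; rewrite ?mulmx_block ?mul0mx ?mulmx0 ?mulmx1 ?mul1mx ?addr0 ?add0r ?subrr ?addNr ?scalar_mx_block //.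
  by apply: nr_block; rewrite ?nr_scalar1 ?nr0.
by apply: nr_block; rewrite ?nr_scalar1 ?nr0 ?nrN.
Qed.

Lemma biunit_diag d K (X X' : 'M[C]_d) : 1 <= K -> biunit K X X' ->
  biunit K (block_mx 1%:M 0 0 X : 'M[C]_(1 + d)) (block_mx 1%:M 0 0 X').
Proof.
move=> K1 [h1 h2 h3 h4].
have n1 : nr (1%:M : 'M[C]_1) <= K by apply: le_trans K1; exact: nr_scalar1.
have n0 m p : nr (0 : 'M[C]_(m, p)) <= K by rewrite nr0; lra.
split; rewrite ?mulmx_block ?mul0mx ?mulmx0 ?mulmx1 ?mul1mx ?addr0 ?add0r ?h1 ?h2 ?scalar_mx_block //;
  exact: nr_block.
Qed.

Lemma mulmx_regroup n (P Q A1 A2 A3 A4 A5 : 'M[C]_n) :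
  P *m (A1 *m (A2 *m (A3 *m (A4 *m A5)))) *m Q = P *m (A1 *m A2) *m A3 *m (A4 *m A5 *m Q).
Proof. by rewrite -!mulmxA. Qed.

(** One elimination step with pivot [a], read backwards: the Schur complement is already factored as
    [X *m S *m Y]. *)
Lemma block_ldu d (a : C) (c : 'cV[C]_d) (r : 'rV[C]_d) (X S Y : 'M[C]_d) :
  block_mx 1%:M 0 c 1%:M *m (block_mx 1%:M 0 0 X *m (block_mx a%:M 0 0 S *m
    (block_mx 1%:M 0 0 Y *m block_mx 1%:M r 0 1%:M))) =
  block_mx a%:M (a *: r) (a *: c) (c *m (a *: r) + X *m S *m Y) :> 'M[C]_(1 + d).
Proof.
have e1 : block_mx 1%:M 0 0 Y *m block_mx 1%:M r 0 1%:M = block_mx 1%:M r 0 Y :> 'M[C]_(1 + d).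
  by rewrite mulmx_block !mul0mx !mul1mx !mulmx0 !mulmx1 !addr0 !add0r.
have e2 : block_mx a%:M 0 0 S *m block_mx 1%:M r 0 Y = block_mx a%:M (a *: r) 0 (S *m Y) :> 'M[C]_(1 + d).
  by rewrite mulmx_block !mul0mx !mulmx0 !mulmx1 !addr0 !add0r mul_scalar_mx.
have e3 : block_mx 1%:M 0 0 X *m block_mx a%:M (a *: r) 0 (S *m Y) =
   block_mx a%:M (a *: r) 0 (X *m S *m Y) :> 'M[C]_(1 + d).
  by rewrite mulmx_block !mul0mx !mulmx0 !mul1mx !addr0 !add0r mulmxA.
rewrite e1 e2 e3 mulmx_block !mul0mx !mulmx0 !mul1mx !addr0; congr block_mx.
exact: mul_mx_scalar.
Qed.

(* Gaussian elimination with complete pivoting: the multipliers are at most 1 in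
   modulus, so the two outer factors are bounded in terms of [d] alone. *)
Lemma pivot_decomposition d : exists2 K : R, 1 <= K & forall A : 'M[C]_d,
  exists X X' Y Y' (D : 'rV[C]_d), [/\ biunit K X X', biunit K Y Y' & A = X *m diag_mx D *m Y].
Proof.
elim: d => [|d [K K1 IH]].
  exists 1 => // A; exists 1%:M, 1%:M, 1%:M, 1%:M, 0; split; try exact: biunit1.
  by apply/matrixP => -[].
have dK (x y : R) : 1 <= x -> 1 <= y -> 1 <= d.+1%:R * (x * y).
  by move=> x1 y1; rewrite -[leLHS]mulr1 -[X in X * 1]mulr1 -mulrA; do !apply: ler_pM => //; rewrite ler1n.
pose K2 : R := d.+1%:R * (1 * (d.+1%:R * (1 * K))).
have K21 : 1 <= K2 by apply: (dK 1) => //; exact: (dK 1).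
exists K2 => //; change d.+1 with (1 + d)%N => A.
have [A0|A0] := eqVneq A 0.
  exists 1%:M, 1%:M, 1%:M, 1%:M, 0; split.
  - by have [h1 h2 h3 h4] := @biunit1 (1 + d); split => //; apply: le_trans K21.
  - by have [h1 h2 h3 h4] := @biunit1 (1 + d); split => //; apply: le_trans K21.
  - by rewrite linear0 mulmx0 mul0mx.
pose ij0 : 'I_(1 + d) * 'I_(1 + d) := (ord0, ord0).
pose ij := [arg max_(k > ij0) nr (A k.1 k.2 : C)]%O.
have hmax k l : nr (A k l) <= nr (A ij.1 ij.2).
  by rewrite /ij; case: arg_maxP => // m _ /(_ (k, l) isT).
set i := ij.1 in hmax; set j := ij.2 in hmax.
have a0 : A i j != 0.
  apply: contraNneq A0 => e; apply/eqP/matrixP => k l; rewrite [RHS]mxE.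
  by apply: nr0_eq0; apply/eqP; rewrite eq_le nr_ge0 andbT; have := hmax k l; rewrite e nr0.
pose P : 'M[C]_(1 + d) := tperm_mx i ord0; pose Q : 'M[C]_(1 + d) := tperm_mx j ord0.
have PP : P *m P = 1%:M by case: (biunit_tperm i ord0).
have QQ : Q *m Q = 1%:M by case: (biunit_tperm j ord0).
pose B := P *m A *m Q.
have Bkl k l : B k l = A (perm.tperm i ord0 k) (perm.tperm j ord0 l).
  by rewrite /B -xrowE -xcolE !mxE.
pose a := A i j.
have B00 : B ord0 ord0 = a by rewrite Bkl !perm.tpermR.
have Bmax k l : nr (B k l) <= nr a by rewrite Bkl; exact: hmax.
have defA : A = P *m B *m Q by rewrite /B !mulmxA PP mul1mx -mulmxA QQ mulmx1.
clearbody B.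
have na : 0 < nr a by rewrite nr_gt0.
pose r : 'rV[C]_d := a^-1 *: ursubmx B; pose c : 'cV[C]_d := a^-1 *: dlsubmx B.
have r1 : nr r <= 1.
  by apply: nr_mx_le => // k l; rewrite mxE nrM nrV mulrC ler_pdivrMr // mul1r !mxE; exact: Bmax.
have c1 : nr c <= 1.
  by apply: nr_mx_le => // k l; rewrite mxE nrM nrV mulrC ler_pdivrMr // mul1r !mxE; exact: Bmax.
have [X [X' [Y [Y' [D [hX hY hS]]]]]] := IH (drsubmx B - c *m ursubmx B).
have bX := biunitM (biunit_tperm i ord0) (biunitM (biunit_lower c1) (biunit_diag K1 hX)).
have bY' := biunitM (biunitM (biunit_diag K1 hY) (biunit_upper r1)) (biunit_tperm j ord0).
have bY : biunit K2 (block_mx 1%:M 0 0 Y *m block_mx 1%:M r 0 1%:M *m Q)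
   (Q *m (block_mx 1%:M (- r) 0 1%:M *m block_mx 1%:M 0 0 Y')).
  have [h1 h2 h3 h4] := bY'; split; [exact: h1|exact: h2| |].
    by apply: le_trans h3 _; rewrite /K2 le_eqVlt; apply/orP; left; apply/eqP; ring.
  by apply: le_trans h4 _; rewrite /K2 le_eqVlt; apply/orP; left; apply/eqP; ring.
eexists; eexists; eexists; eexists; exists (row_mx a%:M D); split; [exact: bX|exact: bY|].
have dg : diag_mx (row_mx a%:M D) = block_mx a%:M 0 0 (diag_mx D) :> 'M[C]_(1 + d).
  rewrite diag_mx_row; congr block_mx.
  by apply/matrixP => k l; rewrite !ord1 !mxE eqxx !mulr1n.
have ul : ulsubmx B = a%:M.
  by apply/matrixP => k l; rewrite !ord1 [RHS]mxE [RHS]mulr1n 2!mxE -B00; congr (B _ _); exact: val_inj.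
rewrite defA -[X in P *m X]submxK ul.
have -> : block_mx a%:M (ursubmx B) (dlsubmx B) (drsubmx B) =
   block_mx a%:M (a *: r) (a *: c) (c *m (a *: r) + X *m diag_mx D *m Y).
  by rewrite /r /c !scalerA divff // !scale1r -hS addrC subrK.
rewrite -block_ldu -dg; exact: mulmx_regroup.
Qed.

End Pivot.

(** * Shear part of a bilinear map in a frame and control of the complement *)

Section Frame.
Context {R : realType}.
Local Notation C := (Cplx R).
Variable d : nat.
Local Notation V := 'rV[C]_d.
Local Notation en := (@enorm R d).

Definition kill (i : 'I_d) (z : V) : V := \row_j (if j == i then 0 else z ord0 j).

Lemma row_lin n (c : C) (F G : 'I_n -> C) :
  \row_i (c * F i + G i) = c *: \row_i F i + \row_i G i.
Proof. by apply/rowP => i; rewrite !mxE. Qed.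

Lemma row_subl n (v : 'rV[C]_n) (F : 'I_n -> C) : v - \row_i F i = \row_i (v ord0 i - F i).
Proof. by apply/rowP => i; rewrite !mxE. Qed.

Lemma kill_lin i (k : C) z w : kill i (k *: z + w) = k *: kill i z + kill i w.
Proof.
by apply/rowP => j; rewrite !mxE; case: (j == i); rewrite ?mulr0 ?addr0.
Qed.

Lemma kill_sub i z : z - kill i z = z ord0 i *: delta_mx 0 i.
Proof.
apply/rowP => j; rewrite !mxE !eqxx /=; case: eqVneq => [->|_]; rewrite ?subr0 ?mulr1 //.
by rewrite subrr mulr0.
Qed.

Lemma en_kill i z : en (kill i z) <= en z.
Proof.
rewrite !enE; apply: ler_wsqrtr; apply: ler_sum => j _; rewrite mxE.
by case: (j == i); rewrite ?nr0 ?expr0n ?sqr_ge0.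
Qed.

Lemma nr_coord_en (z : V) i : nr (z ord0 i) <= en z.
Proof. exact: le_trans (nr_mx_entry _ _ _) (nr_le_en _). Qed.

Lemma en_row (F : 'I_d -> C) (K : R) : 0 <= K -> (forall i, nr (F i) <= K) ->
  en (\row_i F i) <= d%:R * K.
Proof.
move=> K0 h; apply: le_trans (en_le_nr _) _; apply: ler_wpM2l => //.
by apply: nr_mx_le => // i j; rewrite mxE.
Qed.

Lemma en_delta i : en (delta_mx 0 i) <= 1.
Proof.
rewrite enE (bigD1 i) //= mxE !eqxx nr1 expr1n big1 ?addr0 ?sqrtr1 // => j /negbTE ji.
by rewrite mxE ji andbF nr0 expr0n.
Qed.

Variables (X X' : 'M[C]_d) (k : R).
Hypothesis k1 : 1 <= k.
Hypothesis XX' : X *m X' = 1%:M.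
Hypothesis hX : forall z, en (z *m X) <= k * en z.
Hypothesis hX' : forall z, en (z *m X') <= k * en z.

Let k0 : 0 <= k. Proof. exact: le_trans ler01 k1. Qed.

(* In the frame [X], the i-th coordinate of the result ignores the i-th coordinates of the
   arguments, so that z + shear_part B z z is, to second order, a product of shears. *)
Definition shear_part (B : V -> V -> V) (u v : V) : V :=
  (\row_i (B (kill i (u *m X) *m X') (kill i (v *m X) *m X') *m X) ord0 i) *m X'.

Lemma bil_shear_part B : bil B -> bil (shear_part B).
Proof.
move=> hB; split=> c u u' v; rewrite /shear_part scalemxAl -mulmxDl -row_lin; congr (_ *m X');
  apply/rowP => i; rewrite [LHS]mxE [RHS]mxE mulmxDl -scalemxAl kill_lin mulmxDl -scalemxAl ?hB.1 ?hB.2;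
  by rewrite mulmxDl -scalemxAl [LHS]mxE [X in X + _]mxE.
Qed.

Lemma shear_partD B B' u v : shear_part (fun u v => B u v + B' u v) u v = shear_part B u v + shear_part B' u v.
Proof.
rewrite /shear_part -mulmxDl; congr (_ *m _); apply/rowP => i.
by rewrite [RHS]mxE ![(\row_i _) _ _]mxE mulmxDl [LHS]mxE.
Qed.

Lemma bbd_shear_part B K : 0 <= K -> bbd B K -> bbd (shear_part B) (d%:R * k ^+ 6 * K).
Proof.
move=> K0 hB u v; apply: le_trans (hX' _) _.
have e0 : 0 <= en u * en v by rewrite mulr_ge0 ?en_ge0.
have hk i z : en (kill i (z *m X) *m X') <= k ^+ 2 * en z.
  apply: le_trans (hX' _) _; rewrite expr2 -mulrA; apply: ler_wpM2l => //.
  exact: le_trans (en_kill _ _) (hX _).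
have := @en_row (fun i => (B (kill i (u *m X) *m X') (kill i (v *m X) *m X') *m X) ord0 i)
  (k ^+ 5 * K * (en u * en v)) _ _.
move=> h; apply: le_trans (_ : k * (d%:R * (k ^+ 5 * K * (en u * en v))) <= _).
  apply: ler_wpM2l => //; apply: h; first by rewrite !mulr_ge0 ?exprn_ge0 ?en_ge0.
  move=> i; apply: le_trans (nr_coord_en _ _) _; apply: le_trans (hX _) _.
  apply: le_trans (_ : k * (K * ((k ^+ 2 * en u) * (k ^+ 2 * en v))) <= _).
    apply: ler_wpM2l => //; apply: le_trans (hB _ _) _; apply: ler_wpM2l => //.
    by apply: ler_pM; rewrite ?en_ge0.
  by rewrite le_eqVlt; apply/orP; left; apply/eqP; ring.
by rewrite le_eqVlt; apply/orP; left; apply/eqP; ring.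
Qed.

Section Contract.
Variables (Y Y' A A' : 'M[C]_d) (D : V) (l : R).
Hypothesis YY' : Y *m Y' = 1%:M.
Hypothesis hY : forall z, en (z *m Y) <= k * en z.
Hypothesis hY' : forall z, en (z *m Y') <= k * en z.
Hypothesis AE : A = X *m diag_mx D *m Y.
Hypothesis X'X : X' *m X = 1%:M.
Hypothesis A'A : A' *m A = 1%:M.
Hypothesis l0 : 0 <= l.
Hypothesis hA : forall z, en (z *m A) <= l * en z.

(** From [A = X D Y] follows [Y' = A' X D]. Reading the [i]-th frame coordinate after [A'] costs the
    inverse of [D_i], which may be huge; it is paid by the [D_i] that [frame_delta] extracts from an
    argument. *)
Lemma frame_div (y : V) i : D ord0 i * (y *m A' *m X) ord0 i = (y *m Y') ord0 i.
Proof.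
have -> : Y' = A' *m X *m diag_mx D.
  by rewrite -[LHS]mul1mx -A'A AE -!mulmxA YY' mulmx1.
by rewrite !mulmxA mul_mx_diag mxE mulrC.
Qed.

Lemma frame_delta i : delta_mx 0 i *m X' *m A = D ord0 i *: (delta_mx 0 i *m Y) :> V.
Proof.
rewrite AE !mulmxA -(mulmxA _ X') X'X mulmx1 scalemxAl; congr (_ *m _).
by apply/rowP => j; rewrite mul_mx_diag !mxE /= mulrC; case: eqVneq => [->|]; rewrite ?mulr0.
Qed.

(* The monomials of [B] of which one factor is the i-th frame coordinate and whose
   value is read in the i-th frame coordinate: [D_i] cancels, a full factor of [A] remains. *)
Lemma frame_good_l B (c : C) w i : bil B ->
  (B (c *: delta_mx 0 i *m X' *m A) (w *m A) *m A' *m X) ord0 i =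
  c * (B (delta_mx 0 i *m Y) (w *m A) *m Y') ord0 i.
Proof.
move=> hB; rewrite -!scalemxAl frame_delta !(bilZl hB) -!scalemxAl.
by rewrite mxE; congr (c * _); rewrite mxE frame_div.
Qed.

Lemma frame_good_r B (c : C) w i : bil B ->
  (B (w *m A) (c *: delta_mx 0 i *m X' *m A) *m A' *m X) ord0 i =
  c * (B (w *m A) (delta_mx 0 i *m Y) *m Y') ord0 i.
Proof.
move=> hB; rewrite -!scalemxAl frame_delta !(bilZr hB) -!scalemxAl.
by rewrite mxE; congr (c * _); rewrite mxE frame_div.
Qed.

(** Each monomial outside the shear part has an argument along the frame vector of the coordinate in
    which it is read. There [A] and [A'] compensate each other, and the other argument keeps a full
    factor [l]; the norm of [A'] does not enter. *)
Lemma bbd_contract B K : bil B -> 0 <= K -> bbd B K ->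
  bbd (fun u v => B (u *m A) (v *m A) *m A' - shear_part (fun u v => B (u *m A) (v *m A) *m A') u v)
      (2 * d%:R * k ^+ 6 * l * K).
Proof.
move=> hB K0 bB u v.
pose F i := (B (u *m A) (v *m A) *m A' *m X) ord0 i -
   (B (kill i (u *m X) *m X' *m A) (kill i (v *m X) *m X' *m A) *m A' *m X) ord0 i.
have -> : B (u *m A) (v *m A) *m A' - shear_part (fun u v => B (u *m A) (v *m A) *m A') u v = (\row_i F i) *m X'.
  rewrite /shear_part -[X in X - _](mulmx1) -XX' mulmxA -mulmxBl; congr (_ *m _).
  exact: row_subl.
have e0 : 0 <= en u * en v by rewrite mulr_ge0 ?en_ge0.
(* The two arguments are replaced by their [kill]ed versions one after the other; each difference
   has one argument along the [i]-th frame vector. *)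
have FE i : F i = (u *m X) ord0 i * (B (delta_mx 0 i *m Y) (v *m A) *m Y') ord0 i +
   (v *m X) ord0 i * (B (kill i (u *m X) *m X' *m A) (delta_mx 0 i *m Y) *m Y') ord0 i.
  have su : u *m X *m X' = u by rewrite -mulmxA XX' mulmx1.
  have sv : v *m X *m X' = v by rewrite -mulmxA XX' mulmx1.
  have cB (x y : V) : ((x - y) *m A' *m X) ord0 i = (x *m A' *m X) ord0 i - (y *m A' *m X) ord0 i.
    by rewrite !mulmxBl [LHS]mxE [X in _ + X]mxE.
  have kE (w : V) : w *m X *m X' = w ->
      (w *m X) ord0 i *: delta_mx 0 i *m X' *m A = w *m A - kill i (w *m X) *m X' *m A.
    by move=> e; rewrite -kill_sub !mulmxBl e.
  have cl : (u *m X) ord0 i * (B (delta_mx 0 i *m Y) (v *m A) *m Y') ord0 i = _ :=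
    etrans (esym (frame_good_l _ _ _ hB)) (etrans (congr1 (fun x => (B x (v *m A) *m A' *m X) ord0 i) (kE u su))
      (etrans (congr1 (fun x => (x *m A' *m X) ord0 i) (bilBl hB _ _ _)) (cB _ _))).
  have ccr : (v *m X) ord0 i * (B (kill i (u *m X) *m X' *m A) (delta_mx 0 i *m Y) *m Y') ord0 i = _ :=
    etrans (esym (frame_good_r _ _ _ hB)) (etrans (congr1 (fun x => (B (kill i (u *m X) *m X' *m A) x *m A' *m X) ord0 i) (kE v sv))
      (etrans (congr1 (fun x => (x *m A' *m X) ord0 i) (bilBr hB _ _ _)) (cB _ _))).
  have sub3 (x y z : C) : x - z = (x - y) + (y - z) by rewrite addrA subrK.
  rewrite /F; exact: etrans (sub3 _ _ _) (esym (congr2 +%R cl ccr)).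
have Bl w w' i : en w <= k ^+ 2 * en w' -> nr ((B (delta_mx 0 i *m Y) (w *m A) *m Y') ord0 i) <= k ^+ 4 * l * K * en w'.
  move=> h; apply: le_trans (nr_coord_en _ _) _; apply: le_trans (hY' _) _.
  apply: le_trans (_ : k * (K * ((k * 1) * (l * (k ^+ 2 * en w')))) <= _).
    apply: ler_wpM2l => //; apply: le_trans (bB _ _) _; apply: ler_wpM2l => //.
    apply: ler_pM; rewrite ?en_ge0 //.
      by apply: le_trans (hY _) _; apply: ler_wpM2l => //; exact: en_delta.
    by apply: le_trans (hA _) _; apply: ler_wpM2l.
  by rewrite le_eqVlt; apply/orP; left; apply/eqP; ring.
have Br w w' i : en w <= k ^+ 2 * en w' -> nr ((B (w *m A) (delta_mx 0 i *m Y) *m Y') ord0 i) <= k ^+ 4 * l * K * en w'.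
  move=> h; apply: le_trans (nr_coord_en _ _) _; apply: le_trans (hY' _) _.
  apply: le_trans (_ : k * (K * ((l * (k ^+ 2 * en w')) * (k * 1))) <= _).
    apply: ler_wpM2l => //; apply: le_trans (bB _ _) _; apply: ler_wpM2l => //.
    apply: ler_pM; rewrite ?en_ge0 //.
      by apply: le_trans (hA _) _; apply: ler_wpM2l.
    by apply: le_trans (hY _) _; apply: ler_wpM2l => //; exact: en_delta.
  by rewrite le_eqVlt; apply/orP; left; apply/eqP; ring.
have k21 : 1 <= k ^+ 2 by apply: exprn_ege1.
have FK i : nr (F i) <= 2 * k ^+ 5 * l * K * (en u * en v).
  rewrite FE; apply: le_trans (nrD _ _) _; rewrite !nrM.
  apply: le_trans (_ : k * en u * (k ^+ 4 * l * K * en v) + k * en v * (k ^+ 4 * l * K * en u) <= _).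
    apply: lerD; apply: ler_pM; rewrite ?nr_ge0 //.
    - exact: le_trans (nr_coord_en _ _) (hX _).
    - by apply: Bl; rewrite ler_peMl ?en_ge0.
    - exact: le_trans (nr_coord_en _ _) (hX _).
    - apply: Br; apply: le_trans (hX' _) _; rewrite expr2 -mulrA; apply: ler_wpM2l => //.
      exact: le_trans (en_kill _ _) (hX _).
  by rewrite le_eqVlt; apply/orP; left; apply/eqP; ring.
apply: le_trans (hX' _) _.
apply: le_trans (_ : k * (d%:R * (2 * k ^+ 5 * l * K * (en u * en v))) <= _).
  by apply: ler_wpM2l => //; apply: en_row => //; rewrite !mulr_ge0 ?exprn_ge0 ?en_ge0.
by rewrite le_eqVlt; apply/orP; left; apply/eqP; ring.
Qed.

End Contract.
End Frame.

(** * The homological equation for the quadratic terms *)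

Section JumpArith.
Local Open Scope nat_scope.

Lemma jump_exp1 n N : n <= 2 * N -> 2 * (3 * N - n) = 2 * (2 * N - n) + 2 * N.
Proof. lia. Qed.

(** The origin of [3 * D - 2]: for [n] just above [2 * N] both sides agree up to a constant. The 6
    is the value of the left side at [n = 0], before the first jump. *)
Lemma jump_exp2 D N n : 1 < D -> 2 * N < n -> 2 * (3 * (D * N) - n) <= 6 + (3 * D - 2) * n.
Proof. nia. Qed.

Lemma jump_exp3 D n : 2 * (3 * D ^ 0 - n) <= 6 + (3 * D - 2) * n.
Proof. by rewrite expn0; apply: leq_trans (leq_addr _ _); lia. Qed.

Lemma jump_lt D N : 1 < D -> 0 < N -> (2 * N).+1 <= 2 * (D * N).
Proof. nia. Qed.

Lemma jump_lt3 D N : 1 < D -> 0 < N -> 2 * N < 2 * N + N <= 2 * (D * N).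
Proof. nia. Qed.

Lemma jump_exp4 D N : 1 < D -> 0 < N -> 2 + 2 * (3 * (D * N) - (2 * N).+1) <= (3 * D - 2) * (2 * N).
Proof. nia. Qed.

Lemma jump_exp5 D N : 1 < D -> 0 < N -> 2 * (D * N) - (2 * N).+1 = (N - 1) + (2 * (D * N) - (2 * N + N)).
Proof. nia. Qed.

(** The balance behind the hypothesis on [Lam]: what [N] linear steps gain equals the growth from
    time [3 D N] back to [3 N] plus the decay [3 n] wanted at [n = 2 N]. *)
Lemma jump_exp6 D N : 1 < D -> 6 * D * N = 2 * (3 * (D * N) - (2 * N + N)) + 3 * (2 * N).
Proof. nia. Qed.

Lemma jump_exp7 n N : n <= 2 * N -> n <> 2 * N -> 2 * N - n = (2 * N - n.+1).+1.
Proof. lia. Qed.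

Lemma jump_exp8 N : 0 < N -> N = 1 + (N - 1). Proof. lia. Qed.
Lemma jump_exp9 N : 0 < N -> (2 * N).+1 + (N - 1) = 2 * N + N. Proof. lia. Qed.

End JumpArith.

Section Jets.
Context {R : realType}.
Local Notation C := (Cplx R).
Variable d : nat.
Local Notation V := 'rV[C]_d.
Local Notation en := (@enorm R d).

Variables (A A' : nat -> 'M[C]_d) (B : nat -> V -> V -> V).
Variables (al Lam M K0 : R) (D : nat).
Hypothesis D2 : (1 < D)%N.
Hypothesis al1 : 1 < al.
Hypothesis Lam0 : 0 <= Lam.
Hypothesis LamD : Lam <= al^-1 ^+ (6 * D).
Hypothesis M0 : 0 <= M.
Hypothesis MD : M <= al ^+ (12 * D + 2).
Hypothesis K00 : 0 <= K0.
Hypothesis A'A : forall n, A' n *m A n = 1%:M.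
Hypothesis hA : forall n z, en (z *m A n) <= Lam * en z.
Hypothesis hA' : forall n z, en (z *m A' n) <= M * en z.
Hypothesis hB : forall n, bil (B n).
Hypothesis bB : forall n, bbd (B n) K0.

Let al0 : 0 < al. Proof. exact: lt_trans ltr01 al1. Qed.
Let be0 : 0 < al^-1. Proof. by rewrite invr_gt0. Qed.
Let alX n : 1 <= al ^+ n. Proof. by apply: exprn_ege1; exact: ltW. Qed.

Lemma pow_cancel n m : al ^+ n * al^-1 ^+ (n + m) = al^-1 ^+ m.
Proof. by rewrite exprD mulrA -exprMn divff ?gt_eqF // expr1n mul1r. Qed.

Lemma MLam2 : M * (Lam * Lam) <= al ^+ 2.
Proof.
apply: le_trans (_ : al ^+ (12 * D + 2) * (al^-1 ^+ (6 * D) * al^-1 ^+ (6 * D)) <= _).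
  apply: ler_pM => //; first exact: mulr_ge0.
  exact: ler_pM.
have -> : al ^+ (12 * D + 2) * (al^-1 ^+ (6 * D) * al^-1 ^+ (6 * D)) = al ^+ 2.
  rewrite -exprD; have -> : (6 * D + 6 * D = 12 * D)%N by lia.
  rewrite addnC exprD -mulrA.
  by have := pow_cancel (12 * D) 0; rewrite addn0 expr0 => ->; rewrite mulr1.
by [].
Qed.

(* If [Y] is the quadratic term of the conjugation at time [n + j], then [pull n j Y] is
   the one it must have at time [n] when the model is linear in between. *)
Fixpoint pull n j (Y : V -> V -> V) (u v : V) : V :=
  if j is j'.+1 then (pull n.+1 j' Y (u *m A n) (v *m A n) + B n u v) *m A' n else Y u v.

Lemma bil_pull n j Y : bil Y -> bil (pull n j Y).
Proof.
elim: j n => [//|j ih] n hY; have h := ih n.+1 hY.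
have e (k : C) (u v : V) : (k *: u + v) *m A n = k *: (u *m A n) + v *m A n.
  by rewrite mulmxDl scalemxAl.
by split=> k u u' v; rewrite /= e ?h.1 ?h.2 ?(hB n).1 ?(hB n).2;
  rewrite addrACA -scalerDr mulmxDl scalemxAl.
Qed.

(** Chosen so that [K + pullK] is multiplied by exactly [al ^+ 2] when [K] becomes
    [al ^+ 2 * K + M * K0]. *)
Definition pullK := M * K0 / (al ^+ 2 - 1).

Lemma al21 : 0 < al ^+ 2 - 1.
Proof. by rewrite subr_gt0 exprn_egt1. Qed.

Lemma pullK_ge0 : 0 <= pullK.
Proof. by rewrite divr_ge0 ?mulr_ge0 // ltW // al21. Qed.

Lemma bbd_pull1 n Y K : 0 <= K -> bbd Y K -> bbd (fun u v => (Y (u *m A n) (v *m A n) + B n u v) *m A' n) (al ^+ 2 * K + M * K0).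
Proof.
move=> K0' hY u v; rewrite mulmxDl; apply: le_trans (enD _ _) _; rewrite mulrDl.
have e0 : 0 <= en u * en v by rewrite mulr_ge0 ?en_ge0.
apply: lerD.
  apply: le_trans (bbd_sandwich K0' Lam0 Lam0 M0 (hA n) (hA n) (hA' n) hY u v) _.
  by apply: ler_wpM2r => //; apply: ler_wpM2r => //; exact: MLam2.
by apply: le_trans (hA' n _) _; rewrite -mulrA; apply: ler_wpM2l => //; exact: bB.
Qed.

Lemma bbd_pull n j Y K : 0 <= K -> bbd Y K -> bbd (pull n j Y) (al ^+ (2 * j) * (K + pullK)).
Proof.
move=> K0' hY; suff h : bbd (pull n j Y) (al ^+ (2 * j) * (K + pullK) - pullK).
  by apply: bbdW h; have := pullK_ge0; lra.
elim: j n => [|j ih] n; first by rewrite muln0 expr0 mul1r addrK.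
have e0 : 0 <= al ^+ (2 * j) * (K + pullK) - pullK.
  have p0 := pullK_ge0; have : K + pullK <= al ^+ (2 * j) * (K + pullK) by rewrite ler_peMl // addr_ge0.
  lra.
apply: bbdW (bbd_pull1 n e0 (ih n.+1)).
have e : M * K0 = pullK * (al ^+ 2 - 1) by rewrite /pullK divfK // gt_eqF // al21.
have -> : (2 * j.+1 = 2 + 2 * j)%N by rewrite mulnS.
rewrite e [al ^+ (2 + 2 * j)]exprD le_eqVlt; apply/orP; left; apply/eqP; ring.
Qed.

Lemma pull_cat n i j Y : pull n (i + j) Y = pull n i (pull (n + i) j Y).
Proof.
elim: i n => [|i ih] n; first by rewrite addn0.
by apply/funext => u; apply/funext => v; rewrite addSn /= ih addSnnS.
Qed.

Fixpoint lprod n j : 'M[C]_d := if j is j'.+1 then A n *m lprod n.+1 j' else 1%:M.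
Fixpoint lprod' n j : 'M[C]_d := if j is j'.+1 then lprod' n.+1 j' *m A' n else 1%:M.

Lemma lprodK n j : lprod' n j *m lprod n j = 1%:M.
Proof.
elim: j n => [|j ih] n /=; first by rewrite mulmx1.
by rewrite mulmxA -(mulmxA _ (A' n)) A'A mulmx1 ih.
Qed.

Lemma en_lprod n j z : en (z *m lprod n j) <= Lam ^+ j * en z.
Proof.
elim: j n z => [|j ih] n z /=; first by rewrite mulmx1 expr0 mul1r.
rewrite mulmxA; apply: le_trans (ih _ _) _; rewrite exprSr -mulrA.
by apply: ler_wpM2l; rewrite ?exprn_ge0.
Qed.

Definition zero2 (u v : V) : V := 0.

Lemma pull_affine n j Y u v :
  pull n j Y u v = Y (u *m lprod n j) (v *m lprod n j) *m lprod' n j + pull n j zero2 u v.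
Proof.
elim: j n u v => [|j ih] n u v /=; first by rewrite !mulmx1 addr0.
by rewrite ih !mulmxA -addrA mulmxDl.
Qed.

Lemma next_jump n : exists k, (n <= 2 * D ^ k)%N /\ forall k', (k' < k)%N -> (2 * D ^ k' < n)%N.
Proof.
have ex : exists k, (n <= 2 * D ^ k)%N.
  by exists n; have := ltn_expl n D2; lia.
case: (ex_minnP ex) => k nk kmin; exists k; split => // k' k'k.
by rewrite ltnNge; apply/negP => /kmin; rewrite leqNgt k'k.
Qed.

(* [P n] is the quadratic term of the conjugation, [K n] that of the model, and [T n] the
   error in the homological equation. At [n = 2 N], [K n] is the shear
   part of all that is transported to time [n], in the frame of the product of the [A]'s over
   [2 N, 3 N); what remains goes to [P n] if it originates before time [3 N], and is
   small and goes to [T n] otherwise. *)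
Lemma jets : exists (K1 : R) (P G K T : nat -> V -> V -> V) (X X' : nat -> 'M[C]_d), 1 <= K1 /\
  forall n,
  [/\ [/\ bil (P n), bil (G n), K n = shear_part (X n) (X' n) (G n) & T n = fun u v =>
        (P n.+1 (u *m A n) (v *m A n) + B n u v) *m A' n - K n u v - P n u v],
     [/\ X n *m X' n = 1%:M, X' n *m X n = 1%:M,
         forall z, en (z *m X n) <= K1 * en z & forall z, en (z *m X' n) <= K1 * en z],
     [/\ bbd (P n) (K1 * al ^+ ((3 * D - 2) * n)), bbd (G n) (K1 * al ^+ ((3 * D - 2) * n)) &
         bbd (T n) (K1 * al^-1 ^+ (3 * n))] &
     (forall k, n <> (2 * D ^ k)%N) -> G n = zero2].
Proof.
have [kk hkk] := choice next_jump.
have kkU n k : (n <= 2 * D ^ k)%N -> (forall k', (k' < k)%N -> (2 * D ^ k' < n)%N) -> kk n = k.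
  move=> h1 h2; have [h3 h4] := hkk n.
  have [e|e|//] := ltngtP (kk n) k; [have := h2 _ e|have := h4 _ e]; lia.
have kk_jump k : kk (2 * D ^ k)%N = k.
  by apply: kkU => // k' k'k; have := ltn_exp2l k' k D2; rewrite k'k; lia.
have kkS n : (forall k, n <> (2 * D ^ k)%N) -> kk n.+1 = kk n.
  move=> hn; have [h3 h4] := hkk n; apply: kkU => [|k' /h4]; last lia.
  by have := hn (kk n); lia.
have kk_after k n : (2 * D ^ k < n)%N -> (n <= 2 * D ^ k.+1)%N -> kk n = k.+1.
  move=> h1 h2; apply: kkU => // k'; rewrite ltnS => k'k.
  by have := leq_exp2l k' k D2; rewrite k'k; lia.
have [k0 k01 hk0] := @pivot_decomposition R d.
pose kap := d%:R * d%:R * k0 + 1.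
have kap1 : 1 <= kap by rewrite /kap lerDr !mulr_ge0 //; lra.
have bnd (X : 'M[C]_d) : nr X <= k0 -> forall z, en (z *m X) <= kap * en z.
  move=> hX z; apply: le_trans (en_mulmx _ _) _; apply: ler_wpM2r; first exact: en_ge0.
  have : d%:R * d%:R * nr X <= d%:R * d%:R * k0 by apply: ler_wpM2l => //; rewrite mulr_ge0.
  by rewrite /kap; lra.
(* At [n = 2 N] the half is [N], so the frames at time [n] are those of the product over
   [[2 N, 3 N)], without reference to the index [k]. *)
pose half n := n./2.
have /choice [X hX] n : exists X : 'M[C]_d, exists X' Y Y' Dg,
   [/\ biunit k0 X X', biunit k0 Y Y' & lprod n (half n) = X *m diag_mx Dg *m Y] by exact: hk0.
have /choice [X' hX'] n := hX n.
have hX2 n : [/\ X n *m X' n = 1%:M, X' n *m X n = 1%:M,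
  forall z, en (z *m X n) <= kap * en z & forall z, en (z *m X' n) <= kap * en z].
  have [Y [Y' [Dg [[h1 h2 h3 h4] _ _]]]] := hX' n; split => //; exact: bnd.
(* What originates in [[2 N, 3 N)], pulled back to the jump; [base] is the part of it that is not a
   shear. *)
pose S k := pull (2 * D ^ k)%N (D ^ k)%N zero2.
pose base k := fun u v => S k u v - shear_part (X (2 * D ^ k)%N) (X' (2 * D ^ k)%N) (S k) u v.
(* Between jumps the homological equation is solved exactly backwards from the next jump, so that
   [T n] vanishes there. *)
pose P n := pull n (2 * D ^ (kk n) - n)%N (base (kk n)).
pose isj n := `[< exists k, n = (2 * D ^ k)%N >].
pose Xn n := pull n 1 (P n.+1).
pose G n := if isj n then Xn n else zero2.
pose K n := shear_part (X n) (X' n) (G n).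
pose T n := fun u v => (P n.+1 (u *m A n) (v *m A n) + B n u v) *m A' n - K n u v - P n u v.
have bil_zero2 : bil zero2 by exact: bil0.
have bilS k : bil (S k) by apply: bil_pull.
have bil_base k : bil (base k) by apply: bilB => //; exact: bil_shear_part.
have bilP n : bil (P n) by apply: bil_pull.
have bilXn n : bil (Xn n) by apply: bil_pull.
have bilG n : bil (G n) by rewrite /G; case: (isj n).
pose c1 := d%:R * kap ^+ 6.
have c10 : 0 <= c1 by rewrite mulr_ge0 ?exprn_ge0 //; lra.
have p0 := pullK_ge0.
have bS k : bbd (S k) (al ^+ (2 * D ^ k) * pullK).
  by rewrite -[X in _ * X]add0r; apply: bbd_pull => //; exact: bbd0.
have bbase k : bbd (base k) ((1 + c1) * (al ^+ (2 * D ^ k) * pullK)).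
  have [h1 h2 h3 h4] := hX2 (2 * D ^ k)%N.
  have a0 : 0 <= al ^+ (2 * D ^ k) * pullK by rewrite mulr_ge0 ?exprn_ge0 // ltW.
  apply: bbdW (bbdB (bS k) (bbd_shear_part kap1 h3 h4 a0 (bS k))).
  by rewrite -/c1; lra.
pose c2 := (2 + c1) * pullK.
have c20 : 0 <= c2 by rewrite mulr_ge0 //; lra.
(* The size of a pull-back from time [3 * D ^ kk n]: [base] already carries [al ^+ (2 * D ^ kk n)],
   and transport from the jump to [n] adds the rest. *)
have bP n : bbd (P n) (c2 * al ^+ (2 * (3 * D ^ kk n - n))).
  have [h1 _] := hkk n.
  have a0 : 0 <= (1 + c1) * (al ^+ (2 * D ^ kk n) * pullK).
    by apply: mulr_ge0; [lra|apply: mulr_ge0 => //; exact: exprn_ge0 (ltW al0)].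
  apply: bbdW (bbd_pull n (2 * D ^ kk n - n) a0 (bbase (kk n))).
  rewrite (jump_exp1 h1).
  rewrite exprD [leRHS]mulrCA; apply: ler_wpM2l; first by rewrite exprn_ge0 // ltW.
  have := alX (2 * D ^ kk n); move: (al ^+ _) => x x1.
  have : pullK <= pullK * x by rewrite ler_peMr.
  have e : (2 + c1) * pullK * x = (1 + c1) * (x * pullK) + pullK * x by ring.
  by rewrite /c2 e lerD2l.
have D0 k : (0 < D ^ k)%N by rewrite expn_gt0 (ltnW D2).
have alle m n' : (m <= n')%N -> al ^+ m <= al ^+ n' by move=> h; rewrite ler_eXn2l.
have bP' n : bbd (P n) (c2 * al ^+ 6 * al ^+ ((3 * D - 2) * n)).
  apply: bbdW (bP n); rewrite -mulrA; apply: ler_wpM2l => //; rewrite -exprD; apply: alle.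
  have [h1 h2] := hkk n; case: (kk n) h1 h2 => [|k] h1 h2; first exact: jump_exp3.
  by rewrite expnS; apply: jump_exp2 => //; exact: h2.
have bXn k : bbd (Xn (2 * D ^ k)%N) ((c2 + M * K0) * al ^+ ((3 * D - 2) * (2 * D ^ k))).
  have e : kk (2 * D ^ k).+1 = k.+1.
    by apply: kk_after => //; rewrite expnS jump_lt.
  have h := bP (2 * D ^ k).+1; rewrite e in h.
  apply: bbdW (bbd_pull1 (2 * D ^ k) _ h); last by rewrite mulr_ge0 ?exprn_ge0 // ltW.
  rewrite mulrDl; apply: lerD; last by rewrite ler_peMr ?mulr_ge0.
  rewrite mulrCA; apply: ler_wpM2l => //; rewrite -exprD; apply: alle.
  by rewrite expnS jump_exp4.
pose c3 := 2 * d%:R * kap ^+ 6 * c2.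
have c30 : 0 <= c3.
  have -> : c3 = 2 * (c1 * c2) by rewrite /c3 /c1; ring.
  by apply: mulr_ge0 => //; exact: mulr_ge0.
pose K1 := kap + c2 * al ^+ 6 + (c2 + M * K0) + c3.
have a60 : 0 <= c2 * al ^+ 6 by rewrite mulr_ge0 ?exprn_ge0 // ltW.
have MK0 : 0 <= M * K0 by rewrite mulr_ge0.
have kapK : kap <= K1 by rewrite /K1; lra.
exists K1, P, G, K, T, X, X'; split; first by lra.
move=> n; split.
- by split.
- have [h1 h2 h3 h4] := hX2 n; split=> // z.
    by apply: le_trans (h3 z) _; apply: ler_wpM2r; rewrite ?en_ge0.
  by apply: le_trans (h4 z) _; apply: ler_wpM2r; rewrite ?en_ge0.
- have sn0 : 0 <= al ^+ ((3 * D - 2) * n) by rewrite exprn_ge0 // ltW.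
  have bn0 : 0 <= K1 * al^-1 ^+ (3 * n).
    by rewrite mulr_ge0 ?exprn_ge0 ?ltW //; lra.
  split.
  + by apply: bbdW (bP' n); apply: ler_wpM2r => //; rewrite /K1; lra.
  + rewrite /G /isj; case: asboolP => [[k ->]|_].
      by apply: bbdW (bXn k); apply: ler_wpM2r; [exact: exprn_ge0 (ltW al0)|rewrite /K1; lra].
    by apply: bbdW (@bbd0 R d); rewrite mulr_ge0 //; lra.
  have [[k ek]|hn] := pselect (exists k, n = (2 * D ^ k)%N); last first.
    have hn' k : n <> (2 * D ^ k)%N by move=> e; apply: hn; exists k.
    apply: bbdW bn0 _; suff -> : T n = zero2 by exact: bbd0.
    apply/funext => u; apply/funext => v; rewrite /T /K /G /isj asboolF // /P kkS //.
    have [h1 _] := hkk n.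
    rewrite (jump_exp7 h1 (hn' _)).
    rewrite /= addrAC subrr sub0r /shear_part.
    suff -> : \row_i (zero2 (kill i (u *m X n) *m X' n) (kill i (v *m X n) *m X' n) *m X n) ord0 i = 0.
      by rewrite mul0mx oppr0.
    by apply/rowP => i; rewrite /zero2 mxE mul0mx !mxE.
  rewrite ek; set N := (D ^ k)%N; set m := (2 * N)%N.
  have hfm : half m = N by rewrite /half /m mul2n doubleK.
  have N0 : (0 < N)%N := D0 k.
  have /andP[lt1 lt2] := jump_lt3 D2 N0.
  have em : kk (m + N)%N = k.+1 by apply: kk_after => //; rewrite expnS.
  have em1 : kk m.+1 = k.+1 by apply: kk_after => //; rewrite expnS jump_lt.
  (* The times [m + 1] and [m + N] have the same next jump, so one step back from [m + 1] is the
     same as [N] steps back from [m + N], to which the factorization over [[m, m + N)] applies. *)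
  have Xm : Xn m = pull m N (P (m + N)%N).
    rewrite {1}(jump_exp8 N0) pull_cat /Xn addn1; congr (pull m 1 _).
    rewrite /P em1 em expnS -/N (jump_exp5 D2 N0) pull_cat (jump_exp9 N0).
    by [].
  have [Y [Y' [Dg [[h1 h2 h3 h4] [g1 g2 g3 g4] hl]]]] := hX' m.
  have [_ _ hXm hXm'] := hX2 m; rewrite hfm in hl.
  pose F u v := P (m + N)%N (u *m lprod m N) (v *m lprod m N) *m lprod' m N.
  have XmE : Xn m = fun u v => F u v + S k u v.
    by rewrite Xm; apply/funext => u; apply/funext => v; rewrite pull_affine.
  (* The near part [S k] is shared out exactly between the shear and [base k]. The far part [F]
     loses its shear part to the model, and [bbd_contract] bounds what is left. *)
  have TE : T m = fun u v => F u v - shear_part (X m) (X' m) F u v.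
    apply/funext => u; apply/funext => v.
    have -> : T m u v = Xn m u v - K m u v - P m u v by [].
    have -> : P m = base k by rewrite /P /m kk_jump subnn.
    have Gm : G m = Xn m by rewrite /G /isj asboolT; [reflexivity|exists k].
    rewrite /K Gm XmE shear_partD /base -/N -/m opprB [LHS]addrA; move: (F u v) (S k u v) (shear_part _ _ F u v) (shear_part _ _ (S k) u v) => a b c e.
    by apply/rowP => j; rewrite !mxE; ring.
  rewrite TE.
  have cP0 : 0 <= c2 * al ^+ (2 * (3 * D ^ k.+1 - (m + N))).
    by rewrite mulr_ge0 // exprn_ge0 // ltW.
  have := bP (m + N)%N; rewrite em => bPm.
  have h := bbd_contract kap1 h1 hXm hXm' g1 (bnd _ g3) (bnd _ g4) hl h2 (lprodK m N)
    (exprn_ge0 N Lam0) (en_lprod m N) (bilP (m + N)%N) cP0 bPm.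
  apply: bbdW h; apply: le_trans (_ : c3 * al^-1 ^+ (3 * m) <= _); last first.
    by apply: ler_wpM2r; [exact: exprn_ge0 (ltW be0)|rewrite /K1; lra].
  have -> : 2 * d%:R * kap ^+ 6 * Lam ^+ N * (c2 * al ^+ (2 * (3 * D ^ k.+1 - (m + N)))) =
     c3 * (al ^+ (2 * (3 * D ^ k.+1 - (m + N))) * Lam ^+ N) by rewrite /c3; ring.
  apply: ler_wpM2l => //.
  apply: le_trans (_ : al ^+ (2 * (3 * D ^ k.+1 - (m + N))) * al^-1 ^+ (6 * D * N) <= _).
    apply: ler_wpM2l; first exact: exprn_ge0 (ltW al0).
    rewrite [al^-1 ^+ (6 * D * N)]exprM; apply: lerXn2r => //; rewrite nnegrE //.
    exact: exprn_ge0 (ltW be0).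
  by rewrite expnS -/N (jump_exp6 N D2) pow_cancel.
by move=> hn; rewrite /G /isj asboolF // => -[k /hn].
Qed.

End Jets.

(** * Polynomial automorphisms with a prescribed quadratic jet *)

Section Shears.
Context {R : realType}.
Local Notation C := (Cplx R).
Variable d : nat.
Local Notation V := 'rV[C]_d.
Local Notation en := (@enorm R d).

Lemma bil_quad_diff (B : V -> V -> V) K z : 0 <= K -> bil B -> bbd B K -> differentiable (fun z => B z z) z.
Proof.
move=> K0 hB bB.
have [|L eL] := @lin_pack R V V (fun w => B z w + B w z).
  by move=> k x y; rewrite hB.1 hB.2 scalerDr addrACA.
apply: (@hasd_rV _ _ _ _ z L _).1.
have hs : forall w, nr w <= 1 -> nr (B (z + w) (z + w) - B z z - L w) <= K * (d%:R * d%:R) * nr w ^+ 2.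
  move=> w _; rewrite eL.
  have -> : B (z + w) (z + w) - B z z - (B z w + B w z) = B w w.
    rewrite (bilDl hB) !(bilDr hB); move: (B z z) (B z w) (B w z) (B w w) => a b c e.
    by apply/rowP => j; rewrite !mxE; ring.
  apply: le_trans (nr_le_en _) _; apply: le_trans (bB _ _) _; rewrite -mulrA; apply: ler_wpM2l => //.
  apply: le_trans (_ : (d%:R * nr w) * (d%:R * nr w) <= _).
    by apply: ler_pM; rewrite ?en_ge0 ?en_le_nr.
  by rewrite le_eqVlt; apply/orP; left; apply/eqP; ring.
by apply: (hasd_sq ltr01 _ hs); rewrite !mulr_ge0.
Qed.

Lemma diff_id_add (B : V -> V -> V) K z : 0 <= K -> bil B -> bbd B K ->
  differentiable (fun z => z + B z z) z.
Proof.
move=> K0 hB bB; apply: differentiableD; first exact: (@ex_diff _ _ _ _ _ _ _ (is_diff_id z)).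
exact: bil_quad_diff K0 hB bB.
Qed.

Lemma diff_id_sub (B : V -> V -> V) K z : 0 <= K -> bil B -> bbd B K ->
  differentiable (fun z => z - B z z) z.
Proof. by move=> K0 hB bB; exact: (diff_id_add _ K0 (bilN hB) (bbdN bB)). Qed.

Lemma bil_quad_lip (B : V -> V -> V) K x y (r : R) : 0 <= K -> bil B -> bbd B K ->
  en x <= r -> en y <= r -> en (B x x - B y y) <= 2 * K * r * en (x - y).
Proof.
move=> K0 hB bB xr yr.
have -> : B x x - B y y = B (x - y) x + B y (x - y) by rewrite (bilBl hB) (bilBr hB) addrA subrK.
apply: le_trans (enD _ _) _.
apply: le_trans (_ : K * (en (x - y) * r) + K * (r * en (x - y)) <= _).
  apply: lerD; apply: le_trans (bB _ _) _; apply: ler_wpM2l => //; apply: ler_pM; rewrite ?en_ge0 //.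
by rewrite le_eqVlt; apply/orP; left; apply/eqP; ring.
Qed.

Section Chain.
Variables (b : 'I_d -> V -> V -> V) (Kf : R).
Hypothesis Kf0 : 0 <= Kf.
Hypothesis bb : forall i, bil (b i).
Hypothesis bK : forall i, bbd (b i) Kf.
(** The shear property: [b i] does not see the coordinate that it modifies, so a factor is inverted
    by a subtraction. *)
Hypothesis bS : forall i z w, b i (z + b i w w) (z + b i w w) = b i z z.
Hypothesis bS' : forall i z w, b i (z - b i w w) (z - b i w w) = b i z z.

Fixpoint chain (s : seq 'I_d) (z : V) : V :=
  if s is i :: s' then chain s' z + b i (chain s' z) (chain s' z) else z.

Fixpoint chain_inv (s : seq 'I_d) (z : V) : V :=
  if s is i :: s' then chain_inv s' (z - b i z z) else z.

Lemma chainK s : cancel (chain s) (chain_inv s).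
Proof.
elim: s => [//|i s ih] z /=; move: (ih z); move: (chain s z) => y ihz.
by rewrite bS addrK.
Qed.

Lemma chain_invK s : cancel (chain_inv s) (chain s).
Proof.
elim: s => [//|i s ih] z /=; by rewrite ih bS' subrK.
Qed.

Lemma chain_diff s z : differentiable (chain s) z.
Proof.
elim: s z => [|i s ih] z /=; first exact: (@ex_diff _ _ _ _ _ _ _ (is_diff_id z)).
exact: (@diff_comp_val R d d d _ _ z 0 (ih z) (diff_id_add _ Kf0 (bb i) (bK i))).1.
Qed.

Lemma chain_inv_diff s z : differentiable (chain_inv s) z.
Proof.
elim: s z => [|i s ih] z /=; first exact: (@ex_diff _ _ _ _ _ _ _ (is_diff_id z)).
exact: (@diff_comp_val R d d d _ _ z 0 (diff_id_sub _ Kf0 (bb i) (bK i)) (ih _)).1.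
Qed.

Lemma chain_inv0 s : chain_inv s 0 = 0.
Proof. by elim: s => [//|i s ih] /=; rewrite (bil0l (bb i)) subr0. Qed.

(** The recursion of [chain_jet], in terms of the length and of [Kf] only, hence uniform over the
    jump times. *)
Fixpoint jetK m : R := if m is m'.+1 then
  jetK m' + Kf * (m'%:R * Kf + jetK m') * (2 + m'%:R * Kf + jetK m') else 0.

Lemma jetK_ge0 m : 0 <= jetK m.
Proof.
elim: m => [//|m ih] /=; have h : 0 <= m%:R * Kf by rewrite mulr_ge0.
by rewrite addr_ge0 // !mulr_ge0 //; lra.
Qed.

Lemma bbd_sum s : bbd (fun u v => \sum_(i <- s) b i u v) ((size s)%:R * Kf).
Proof.
elim: s => [|i s ih] u v; first by rewrite big_nil en0 !mul0r.
rewrite big_cons; apply: le_trans (enD _ _) _; rewrite /= -natr1 !mulrDl addrC mul1r.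
by apply: lerD; [exact: ih|exact: bK].
Qed.

(** Adding a factor replaces [b i z z] by [b i y y] with [y - z] already quadratic, so the cross
    terms are cubic. *)
Lemma chain_jet s z : en z <= 1 ->
  en (chain s z - z - \sum_(i <- s) b i z z) <= jetK (size s) * en z ^+ 3.
Proof.
move=> z1; have z0 := en_ge0 z.
elim: s => [|i s ih]; first by rewrite big_nil /= subrr subr0 en0 mul0r.
rewrite big_cons /=; set y := chain s z in ih *; set S := \sum_(j <- s) _ in ih *.
set m := size s in ih *; have j0 := jetK_ge0 m; have m0 : 0 <= m%:R * Kf by rewrite mulr_ge0.
have hS : en S <= m%:R * Kf * en z ^+ 2 by rewrite expr2; exact: (bbd_sum s z z).
have z32 : en z ^+ 3 <= en z ^+ 2 by rewrite exprS ler_piMl ?exprn_ge0.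
have z21 : en z ^+ 2 <= en z by rewrite expr2 ler_piMl.
have hyz : en (y - z) <= (m%:R * Kf + jetK m) * en z ^+ 2.
  have -> : y - z = (y - z - S) + S by rewrite subrK.
  apply: le_trans (enD _ _) _; rewrite mulrDl addrC; apply: lerD => //.
  by apply: le_trans ih _; apply: ler_wpM2l.
have hy : en y <= (1 + m%:R * Kf + jetK m) * en z.
  have h1 : en y <= en (y - z) + en z by rewrite -{1}[y](subrK z); exact: enD.
  have h2 : (m%:R * Kf + jetK m) * en z ^+ 2 <= (m%:R * Kf + jetK m) * en z.
    by apply: ler_wpM2l => //; rewrite addr_ge0.
  have -> : (1 + m%:R * Kf + jetK m) * en z = en z + (m%:R * Kf + jetK m) * en z by ring.
  lra.
have -> : y + b i y y - z - (b i z z + S) = (y - z - S) + (b i (y - z) y + b i z (y - z)).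
  rewrite (bilBl (bb i)) (bilBr (bb i)).
  move: (b i y y) (b i z z) (b i z y) => p q r.
  by apply/rowP => j; rewrite !mxE; ring.
apply: le_trans (enD _ _) _; rewrite mulrDl; apply: lerD => //.
apply: le_trans (enD _ _) _.
pose a := (m%:R * Kf + jetK m); have a0 : 0 <= a by rewrite addr_ge0.
apply: le_trans (_ : Kf * ((a * en z ^+ 2) * ((1 + m%:R * Kf + jetK m) * en z)) + Kf * (en z * (a * en z ^+ 2)) <= _).
  apply: lerD; apply: le_trans (bK _ _ _) _; apply: ler_wpM2l => //; apply: ler_pM; rewrite ?en_ge0 //.
by rewrite -/a le_eqVlt; apply/orP; left; apply/eqP; rewrite /a; ring.
Qed.

Fixpoint growK m : R := if m is m'.+1 then (1 + Kf) * growK m' ^+ 2 else 1.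

Lemma growK_ge1 m : 1 <= growK m.
Proof.
have Kf0' := Kf0; elim: m => [//|m ih] /=; have : 1 <= growK m ^+ 2 by apply: exprn_ege1.
move: (growK m ^+ 2) => x x1; rewrite -[leLHS]mulr1; apply: ler_pM => //; lra.
Qed.

(** Every quadratic factor at most squares a bound that is at least 1, up to the constant
    [1 + Kf]. *)
Lemma chain_growth s z (r : R) : 1 <= r -> en z <= r -> en (chain s z) <= growK (size s) * r ^+ (2 ^ size s).
Proof.
move=> r1 zr; elim: s => [|i s ih] /=; first by rewrite mul1r expn0 expr1.
move: ih; set y := chain s z; set g := growK _; set x := r ^+ (2 ^ size s) => ih.
have gx1 : 1 <= g * x.
  rewrite -[leLHS]mulr1; apply: ler_pM => //; first exact: growK_ge1.
  exact: exprn_ege1.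
apply: le_trans (enD _ _) _.
apply: le_trans (_ : g * x + Kf * ((g * x) * (g * x)) <= _).
  apply: lerD => //; apply: le_trans (bK _ _ _) _; apply: ler_wpM2l => //.
  by apply: ler_pM; rewrite ?en_ge0.
have -> : r ^+ (2 ^ (size s).+1) = x ^+ 2 by rewrite expnS mulnC exprM.
have -> : (1 + Kf) * g ^+ 2 * x ^+ 2 = (g * x) * (g * x) + Kf * ((g * x) * (g * x)) by ring.
by rewrite lerD2r ler_peMl // (le_trans ler01).
Qed.

End Chain.

(** The radius [del] is chosen before the factors [b], so that one radius serves all times. The
    outer factor costs [ep / 2] and at most doubles distances, whence [ep / 4] for the remaining
    ones. *)
Lemma chain_lip (Kf : R) m (ep : R) : 0 <= Kf -> 0 < ep -> ep <= 1 ->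
  exists del : R, [/\ 0 < del, del <= 1 & forall b : 'I_d -> V -> V -> V,
  (forall i, bil (b i)) -> (forall i, bbd (b i) Kf) ->
  forall s, size s = m -> forall x y, en x <= del -> en y <= del ->
  en (chain_inv b s x - chain_inv b s y - (x - y)) <= ep * en (x - y)].
Proof.
move=> Kf0; elim: m ep => [|m ih] ep ep0 ep1.
  exists 1; split => // b _ _ [] // _ x y _ _ /=; rewrite subrr en0 mulr_ge0 ?en_ge0 //; exact: ltW.
have [||del [del0 del1 hdel]] := ih (ep / 4); [lra|lra|].
have K1 : 0 < 2 * Kf + 1 by lra.
pose del' := Num.min (del / 2) (ep / 2 / (2 * Kf + 1)).
have d'1 : del' <= del / 2 by rewrite ge_min lexx.
have d'2 : del' <= ep / 2 / (2 * Kf + 1) by rewrite ge_min lexx orbT.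
have d'0 : 0 < del' by rewrite lt_min !divr_gt0.
have d'3 : 2 * Kf * del' <= ep / 2.
  apply: le_trans (_ : (2 * Kf + 1) * del' <= _); first by rewrite ler_wpM2r ?(ltW d'0) //; lra.
  by rewrite mulrC -ler_pdivlMr.
exists del'; split => //; first lra.
move=> b hb bK [//|i s] [sm] x y xd yd /=.
set x1 := x + _; set y1 := y + _.
have lip1 : en (x1 - y1 - (x - y)) <= ep / 2 * en (x - y).
  have -> : x1 - y1 - (x - y) = - (b i x x - b i y y).
    rewrite /x1 /y1; move: (b i x x) (b i y y) => p q.
    by apply/rowP => j; rewrite !mxE; ring.
  rewrite enN; apply: le_trans (bil_quad_lip Kf0 (hb i) (bK i) xd yd) _.
  by rewrite ler_wpM2r ?en_ge0.
have inb w : en w <= del' -> en (w - b i w w) <= del.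
  move=> wd; apply: le_trans (enB _ _) _.
  have h0 : en (0 : V) <= del' by rewrite en0 ltW.
  have := bil_quad_lip Kf0 (hb i) (bK i) wd h0; rewrite (bil0l (hb i)) !subr0.
  have : 2 * Kf * del' * en w <= ep / 2 * en w by rewrite ler_wpM2r ?en_ge0.
  have : ep / 2 * en w <= 1 * en w by rewrite ler_wpM2r ?en_ge0 //; lra.
  lra.
have h2 := hdel b hb bK s sm x1 y1 (inb _ xd) (inb _ yd).
have h3 : en (x1 - y1) <= 2 * en (x - y).
  have -> : x1 - y1 = (x1 - y1 - (x - y)) + (x - y) by rewrite subrK.
  apply: le_trans (enD _ _) _.
  have : ep / 2 * en (x - y) <= 1 * en (x - y) by rewrite ler_wpM2r ?en_ge0 //; lra.
  lra.
have -> : chain_inv b s x1 - chain_inv b s y1 - (x - y) =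
   (chain_inv b s x1 - chain_inv b s y1 - (x1 - y1)) + (x1 - y1 - (x - y)) by rewrite addrA subrK.
apply: le_trans (enD _ _) _.
have : ep / 4 * en (x1 - y1) <= ep / 4 * (2 * en (x - y)) by apply: ler_wpM2l => //; lra.
lra.
Qed.

Lemma kill_delta i (c : C) (z : V) : kill i (z + c *: delta_mx 0 i) = kill i z.
Proof.
apply/rowP => j; rewrite !mxE; case: eqVneq => // /negbTE ji.
by rewrite andbF mulr0 addr0.
Qed.

Definition shear_comp (X X' : 'M[C]_d) (G : V -> V -> V) i (u v : V) : V :=
  (G (kill i u *m X') (kill i v *m X') *m X) ord0 i *: delta_mx 0 i.

Lemma shear_comp_sum X X' G u v :
  shear_part X X' G u v = (\sum_(i <- enum 'I_d) shear_comp X X' G i (u *m X) (v *m X)) *m X'.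
Proof.
rewrite big_enum /=; congr (_ *m _); rewrite [LHS]row_sum_delta; apply: eq_bigr => i _.
by rewrite mxE.
Qed.

Lemma bil_shear_comp X X' G i : bil G -> bil (shear_comp X X' G i).
Proof.
move=> hG; split=> c u u' v; rewrite /shear_comp kill_lin mulmxDl -scalemxAl ?hG.1 ?hG.2;
  by rewrite mulmxDl -scalemxAl [X in X *: _]mxE [X in (X + _) *: _]mxE scalerDl scalerA.
Qed.

Lemma bbd_shear_comp X X' G i (k K : R) : 0 <= K -> 0 <= k -> bbd G K ->
  (forall z, en (z *m X) <= k * en z) -> (forall z, en (z *m X') <= k * en z) ->
  bbd (shear_comp X X' G i) (k ^+ 3 * K).
Proof.
move=> K0 k0 bG hX hX' u v; rewrite enZ.
apply: le_trans (_ : (k * (K * ((k * en u) * (k * en v)))) * 1 <= _).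
  apply: ler_pM; rewrite ?nr_ge0 ?en_ge0 ?en_delta //.
  apply: le_trans (nr_coord_en _ _) _; apply: le_trans (hX _) _; apply: ler_wpM2l => //.
  apply: le_trans (bG _ _) _; apply: ler_wpM2l => //; apply: ler_pM; rewrite ?en_ge0 //;
  by apply: le_trans (hX' _) _; apply: ler_wpM2l => //; exact: en_kill.
by rewrite le_eqVlt; apply/orP; left; apply/eqP; ring.
Qed.

Lemma shear_comp_inv X X' G i (z : V) c :
  shear_comp X X' G i (z + c *: delta_mx 0 i) (z + c *: delta_mx 0 i) = shear_comp X X' G i z z.
Proof. by rewrite /shear_comp kill_delta. Qed.

(** [J] is the chain of the [d] shears, one for each frame coordinate, conjugated by the frame. All
    constants precede [X], [X'] and [G], and the last clause makes the model linear at times without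
    a jump. *)
Lemma shear_map (k Kg ep : R) : 1 <= k -> 0 <= Kg -> 0 < ep -> ep <= 1 ->
  exists E Cg del : R, [/\ 0 <= E, 1 <= Cg, 0 < del & del <= 1] /\
  forall (X X' : 'M[C]_d) (G : V -> V -> V), X *m X' = 1%:M -> X' *m X = 1%:M ->
  (forall z, en (z *m X) <= k * en z) -> (forall z, en (z *m X') <= k * en z) ->
  bil G -> bbd G Kg ->
  exists J J' : V -> V, [/\ [/\ cancel J J', cancel J' J, forall z, differentiable J z & forall z, differentiable J' z],
     forall z, en z <= del -> en (J z - z - shear_part X X' G z z) <= E * en z ^+ 3,
     forall z r, 1 <= r -> en z <= r -> en (J z) <= Cg * r ^+ (2 ^ d),
     (J' 0 = 0 /\ forall x y, en x <= del -> en y <= del -> en (J' x - J' y - (x - y)) <= ep * en (x - y)) &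
     ((forall u v, G u v = 0) -> forall z, J z = z)].
Proof.
move=> k1 Kg0 ep0 ep1; pose Kf := k ^+ 3 * Kg.
have k0 : 0 <= k by lra.
have k00 : 0 < k by lra.
have Kf0 : 0 <= Kf by rewrite mulr_ge0 ?exprn_ge0.
have k2 : 1 <= k ^+ 2 by apply: exprn_ege1.
(* The division by [k ^+ 2] pays for the passage to the frame and back. *)
have [||del [del0 del1 hdel]] := @chain_lip Kf d (ep / k ^+ 2) Kf0.
- by rewrite divr_gt0 // exprn_gt0.
- by rewrite ler_pdivrMr ?exprn_gt0 // mul1r; lra.
exists (k ^+ 4 * jetK Kf d), (k * growK Kf d * k ^+ (2 ^ d)), (del / k).
have g1 := growK_ge1 Kf0 d.
split.
  split; [by rewrite mulr_ge0 ?exprn_ge0 ?jetK_ge0| |by rewrite divr_gt0|by rewrite ler_pdivrMr // mul1r; lra].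
  have h : 1 <= k ^+ (2 ^ d) by apply: exprn_ege1.
  by rewrite -[leLHS]mulr1 -[X in X * 1]mulr1; do !apply: ler_pM => //.
move=> X X' G XX' X'X hX hX' hG bG.
pose b := shear_comp X X' G.
have bb i : bil (b i) by exact: bil_shear_comp.
have bK i : bbd (b i) Kf by exact: bbd_shear_comp.
have bS i z w : b i (z + b i w w) (z + b i w w) = b i z z by exact: shear_comp_inv.
have bS' i z w : b i (z - b i w w) (z - b i w w) = b i z z
  by have := shear_comp_inv X X' G i z (- (G (kill i w *m X') (kill i w *m X') *m X) ord0 i); rewrite scaleNr.
pose s := enum 'I_d.
have ss : size s = d by rewrite size_enum_ord.
have inX z : en z <= del / k -> en (z *m X) <= del.
  by rewrite ler_pdivlMr // mulrC; exact: le_trans (hX z).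
exists (fun z => chain b s (z *m X) *m X'), (fun z => chain_inv b s (z *m X) *m X'); split.
- split.
  + by move=> z; rewrite -mulmxA X'X mulmx1 chainK // -mulmxA XX' mulmx1.
  + by move=> z; rewrite -mulmxA X'X mulmx1 chain_invK // -mulmxA XX' mulmx1.
  + move=> z; have h1 := (diff_comp_val 0 (diff_mulmxr X z) (chain_diff Kf0 bb bK s _)).1.
    exact: (diff_comp_val 0 h1 (diff_mulmxr X' _)).1.
  + move=> z; have h1 := (diff_comp_val 0 (diff_mulmxr X z) (chain_inv_diff Kf0 bb bK s _)).1.
    exact: (diff_comp_val 0 h1 (diff_mulmxr X' _)).1.
- move=> z /inX zd; rewrite shear_comp_sum -/b -/s -{2}[z]mulmx1 -XX' mulmxA -!mulmxBl.
  have zX1 : en (z *m X) <= 1 by lra.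
  apply: le_trans (hX' _) _; apply: le_trans (_ : k * (jetK Kf d * (k * en z) ^+ 3) <= _).
    apply: ler_wpM2l => //; have := chain_jet Kf0 bb bK s zX1; rewrite ss => h; apply: le_trans h _.
    by apply: ler_wpM2l; rewrite ?jetK_ge0 // lerXn2r ?nnegrE ?mulr_ge0 ?en_ge0.
  by rewrite le_eqVlt; apply/orP; left; apply/eqP; ring.
- move=> z r r1 zr; apply: le_trans (hX' _) _; rewrite -!mulrA; apply: ler_wpM2l => //.
  have kr1 : 1 <= k * r by rewrite -[leLHS]mulr1; apply: ler_pM.
  have zXr : en (z *m X) <= k * r by apply: le_trans (hX _) _; apply: ler_wpM2l.
  by have := chain_growth Kf0 bK s kr1 zXr; rewrite ss exprMn.
- split; first by rewrite mul0mx chain_inv0 // mul0mx.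
  move=> x y /inX xd /inX yd.
  have -> : chain_inv b s (x *m X) *m X' - chain_inv b s (y *m X) *m X' - (x - y) =
     (chain_inv b s (x *m X) - chain_inv b s (y *m X) - (x *m X - y *m X)) *m X'.
    by rewrite !mulmxBl -!mulmxA XX' !mulmx1.
  apply: le_trans (hX' _) _.
  apply: le_trans (_ : k * (ep / k ^+ 2 * (k * en (x - y))) <= _).
    apply: ler_wpM2l => //; apply: le_trans (hdel b bb bK s ss _ _ xd yd) _.
    apply: ler_wpM2l; first by rewrite divr_ge0 ?exprn_ge0 // ltW.
    by rewrite -mulmxBl.
  have kn : k != 0 by rewrite gt_eqF.
  by rewrite le_eqVlt; apply/orP; left; apply/eqP; move: (en _) => t; field.
move=> G0 z; have b0 i u v : b i u v = 0 by rewrite /b /shear_comp G0 mul0mx mxE scale0r.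
suff -> : chain b s (z *m X) = z *m X by rewrite -mulmxA XX' mulmx1.
by elim: s {ss} => [//|i s ih] /=; rewrite b0 ih addr0.
Qed.

End Shears.

(** * Convergence of the conjugation *)

Section Conjugation.
Context {R : realType}.
Local Notation C := (Cplx R).
Variable d : nat.
Local Notation V := 'rV[C]_d.
Local Notation en := (@enorm R d).

Variables (phi J J' : nat -> V -> V) (A A' : nat -> 'M[C]_d) (B P K : nat -> V -> V -> V).
Variables (lam mu th K0 F tau del rho : R).
Hypothesis lam_bd : 0 <= lam <= 1.
Hypothesis mu_bd : 0 <= mu <= K0.
Hypothesis th0 : 0 <= th.
Hypothesis K01 : 1 <= K0.
Hypothesis F0 : 0 <= F.
Hypothesis tau_bd : 0 <= tau <= 1.
Hypothesis del0 : 0 < del.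
Hypothesis del1 : del <= 1.
Hypothesis rho0 : 0 < rho.
Hypothesis rho1 : rho <= 1.
Hypothesis AA' : forall n, A n *m A' n = 1%:M.
Hypothesis A'A : forall n, A' n *m A n = 1%:M.
Hypothesis hA : forall n z, en (z *m A n) <= lam * en z.
Hypothesis hA' : forall n z, en (z *m A' n) <= mu * en z.
Hypothesis phi_jet : forall n z, en z <= rho -> en (phi n z - z *m A n - B n z z) <= K0 * en z ^+ 3.
Hypothesis phi_lam : forall n z, en z <= rho -> en (phi n z) <= lam * en z.
Hypothesis phi_diff : forall n z, en z <= rho -> differentiable (phi n) z.
Hypothesis bilP : forall n, bil (P n).
Hypothesis bilK : forall n, bil (K n).
Hypothesis bB : forall n, bbd (B n) K0.
Hypothesis bP : forall n, bbd (P n) K0.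
Hypothesis bK : forall n, bbd (K n) K0.
Hypothesis jetT : forall n z,
  en ((P n.+1 (z *m A n) (z *m A n) + B n z z) *m A' n - K n z z - P n z z) <= F * tau ^+ n * en z ^+ 2.
Hypothesis JK : forall n, cancel (J n) (J' n).
Hypothesis J'K : forall n, cancel (J' n) (J n).
Hypothesis J'd : forall n z, differentiable (J' n) z.
Hypothesis J_jet : forall n z, en z <= del -> en (J n z - z - K n z z) <= K0 * en z ^+ 3.
Hypothesis J'_lip : forall n x y, en x <= del -> en y <= del -> en (J' n x - J' n y) <= th * en (x - y).
Hypothesis contr3 : th * mu * lam ^+ 3 < 1.
Hypothesis contr2 : th * mu * lam ^+ 2 * tau < 1.

Let lam0 : 0 <= lam. Proof. by case/andP: lam_bd. Qed.
Let lam1 : lam <= 1. Proof. by case/andP: lam_bd. Qed.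
Let mu0 : 0 <= mu. Proof. by case/andP: mu_bd. Qed.
Let muK : mu <= K0. Proof. by case/andP: mu_bd. Qed.
Let tau0 : 0 <= tau. Proof. by case/andP: tau_bd. Qed.
Let tau1 : tau <= 1. Proof. by case/andP: tau_bd. Qed.
Let K00 : 0 <= K0. Proof. exact: le_trans ler01 K01. Qed.
Let K1 := 1 + K0.
Let K1_1 : 1 <= K1. Proof. by rewrite /K1 lerDl. Qed.
Let K1_0 : 0 <= K1. Proof. exact: le_trans ler01 K1_1. Qed.
Let thmu : 0 <= th * mu. Proof. exact: mulr_ge0. Qed.

Let p n z := z + P n z z.
Let g' n z := J' n (z *m A' n).

Let en_p n z : en z <= 1 -> en (p n z) <= K1 * en z.
Proof.
move=> z1; apply: le_trans (enD _ _) _; rewrite /K1 mulrDl mul1r lerD2l.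
apply: le_trans (bP _ _ _) _; rewrite mulrA; apply: ler_piMr => //.
by rewrite mulr_ge0 ?en_ge0.
Qed.

Let en_p_sub n z : en (p n z - z) <= K0 * en z ^+ 2.
Proof. by rewrite /p addrC addKr expr2; exact: bP. Qed.

Let g'_lip n x y : en x * K0 <= del -> en y * K0 <= del -> en (g' n x - g' n y) <= th * mu * en (x - y).
Proof.
have hd z : en z * K0 <= del -> en (z *m A' n) <= del.
  move=> h; apply: le_trans (hA' _ _) _; apply: le_trans h; rewrite mulrC.
  by apply: ler_wpM2l; rewrite ?en_ge0.
move=> /hd xd /hd yd; apply: le_trans (J'_lip n xd yd) _; rewrite -mulrA; apply: ler_wpM2l => //.
by rewrite -mulmxBl.
Qed.

(** Three cubic errors, in this order: replacing [phi n] by its 2-jet inside [p n.+1], the remainder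
    of [J n] at [p n z], and evaluating [K n] at [p n z] instead of [z]. *)
Let Ej := K0 * (K0 + 4 * K0 ^+ 2) + K0 * K1 ^+ 3 + 2 * K0 ^+ 2 * K1.
Let r1 := Num.min rho (del / (K1 ^+ 3)).

Let Ej0 : 0 <= Ej.
Proof. by rewrite /Ej !addr_ge0 ?mulr_ge0 ?exprn_ge0 ?addr_ge0 ?mulr_ge0 ?exprn_ge0. Qed.

Let r1_0 : 0 < r1.
Proof. by rewrite lt_min rho0 divr_gt0 // exprn_gt0 // (lt_le_trans ltr01). Qed.
Let r1_rho : r1 <= rho. Proof. by rewrite ge_min lexx. Qed.
Let r1_1 : r1 <= 1. Proof. exact: le_trans r1_rho rho1. Qed.
Let r1_del : K1 ^+ 3 * r1 <= del.
Proof.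
rewrite mulrC -ler_pdivlMr ?exprn_gt0 ?(lt_le_trans ltr01) //.
by rewrite ge_min lexx orbT.
Qed.

(** The two sides are compared before [J' n] is applied, that is [Y] with [J n (p n z)]. Their
    linear parts agree, their quadratic parts differ by the jet error, the rest is cubic; [J' n]
    then costs the factor [th]. *)
Lemma local_error n z : en z <= r1 ->
  en (g' n (p n.+1 (phi n z)) - p n z) <= th * Ej * en z ^+ 3 + th * F * tau ^+ n * en z ^+ 2.
Proof.
move=> zr; set x := en z; have x0 : 0 <= x := en_ge0 z.
have x1 : x <= 1 := le_trans zr r1_1.
have zrho : en z <= rho := le_trans zr r1_rho.
set b := phi n z - z *m A n.
set r := phi n z - z *m A n - B n z z.
have hr : en r <= K0 * x ^+ 3 by exact: phi_jet.
have x32 : x ^+ 3 <= x ^+ 2 by rewrite exprS ler_piMl ?exprn_ge0.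
have hb : en b <= 2 * K0 * x ^+ 2.
  have -> : b = r + B n z z by rewrite /r subrK.
  apply: le_trans (enD _ _) _; apply: le_trans (_ : K0 * x ^+ 3 + K0 * x ^+ 2 <= _).
    by apply: lerD => //; rewrite expr2; exact: bB.
  have : K0 * x ^+ 3 <= K0 * x ^+ 2 by exact: ler_wpM2l.
  lra.
have hphi : en (phi n z) <= x.
  by apply: le_trans (phi_lam _ zrho) _; rewrite ler_piMl.
have hzA : en (z *m A n) <= x by apply: le_trans (hA _ _) _; rewrite ler_piMl.
pose Y := p n.+1 (phi n z) *m A' n.
have eY : Y - (z + (P n.+1 (z *m A n) (z *m A n) + B n z z) *m A' n) =
   (r + (P n.+1 (phi n z) b + P n.+1 b (z *m A n))) *m A' n.
  have ez : z = z *m A n *m A' n by rewrite -mulmxA AA' mulmx1.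
  rewrite {1}ez /Y -mulmxDl -mulmxBl; congr (_ *m _).
  rewrite /r /b /p (bilBl (bilP _)) (bilBr (bilP _)).
  have ab (q1 q2 q3 q4 q5 q6 : V) :
      q1 + q4 - (q2 + (q5 + q3)) = q1 - q2 - q3 + (q4 - q6 + (q6 - q5)).
    by apply/rowP => j; rewrite !mxE; ring.
  exact: ab.
have hY : en (Y - (z + (P n.+1 (z *m A n) (z *m A n) + B n z z) *m A' n)) <= K0 * (K0 + 4 * K0 ^+ 2) * x ^+ 3.
  rewrite eY; apply: le_trans (hA' _ _) _.
  apply: le_trans (_ : K0 * (K0 * x ^+ 3 + (K0 * (x * (2 * K0 * x ^+ 2)) + K0 * ((2 * K0 * x ^+ 2) * x))) <= _).
    apply: ler_pM => //; first exact: en_ge0.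
    apply: le_trans (enD _ _) _; apply: lerD => //; apply: le_trans (enD _ _) _.
    apply: lerD; apply: le_trans (bP _ _ _) _; apply: ler_wpM2l => //; apply: ler_pM => //; exact: en_ge0.
  by rewrite le_eqVlt; apply/orP; left; apply/eqP; ring.
have hpz : en (p n z) <= K1 * x by exact: en_p.
have K1K : K1 <= K1 ^+ 3 by rewrite -[leLHS]expr1; apply: ler_weXn2l.
have K12K : K1 ^+ 2 <= K1 ^+ 3 by apply: ler_weXn2l.
have xdel k : k <= K1 ^+ 3 -> k * x <= del.
  move=> h; apply: le_trans r1_del; apply: le_trans (_ : K1 ^+ 3 * x <= _).
    exact: ler_wpM2r.
  by apply: ler_wpM2l => //; rewrite exprn_ge0.
have pzd : en (p n z) <= del by apply: le_trans hpz _; exact: xdel.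
have hJ : en (J n (p n z) - p n z - K n (p n z) (p n z)) <= K0 * K1 ^+ 3 * x ^+ 3.
  apply: le_trans (J_jet _ pzd) _; rewrite -mulrA; apply: ler_wpM2l => //.
  by rewrite -exprMn lerXn2r ?nnegrE ?en_ge0 ?mulr_ge0.
have hK : en (K n (p n z) (p n z) - K n z z) <= 2 * K0 ^+ 2 * K1 * x ^+ 3.
  have zK1 : en z <= K1 * x by rewrite ler_peMl.
  apply: le_trans (bil_quad_lip K00 (bilK n) (bK n) hpz zK1) _.
  apply: le_trans (_ : 2 * K0 * (K1 * x) * (K0 * x ^+ 2) <= _).
    by apply: ler_wpM2l; [rewrite !mulr_ge0|exact: en_p_sub].
  by rewrite le_eqVlt; apply/orP; left; apply/eqP; ring.
have key : en (Y - J n (p n z)) <= Ej * x ^+ 3 + F * tau ^+ n * x ^+ 2.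
  set Z := (P n.+1 (z *m A n) (z *m A n) + B n z z) *m A' n in hY *.
  have -> : Y - J n (p n z) = (Y - (z + Z)) - (J n (p n z) - p n z - K n (p n z) (p n z))
     - (K n (p n z) (p n z) - K n z z) + (Z - K n z z - P n z z).
    have ab (y w q1 q2 q3 q4 : V) :
        y - q1 = y - (z + w) - (q1 - (z + q4) - q2) - (q2 - q3) + (w - q3 - q4).
      by apply/rowP => j; rewrite !mxE; ring.
    exact: ab.
  have hT := jetT n z; rewrite -/Z -/x in hT.
  apply: le_trans (enD _ _) _; apply: lerD hT.
  apply: le_trans (enB _ _) _; rewrite /Ej [(_ + 2 * K0 ^+ 2 * K1) * _]mulrDl; apply: lerD hK.
  by apply: le_trans (enB _ _) _; rewrite [(_ + K0 * K1 ^+ 3) * _]mulrDl; exact: lerD hY hJ.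
have Yd : en Y <= del.
  apply: le_trans (hA' _ _) _; apply: le_trans (_ : K0 * (K1 * x) <= _).
    apply: ler_pM => //; first exact: en_ge0.
    by apply: le_trans (en_p _ (le_trans hphi x1)) _; apply: ler_wpM2l.
  rewrite mulrA; apply: xdel; apply: le_trans K12K; rewrite expr2; apply: ler_wpM2r => //.
  by rewrite /K1 lerDr.
have Jd : en (J n (p n z)) <= del.
  have -> : J n (p n z) = (J n (p n z) - p n z - K n (p n z) (p n z)) + (p n z + K n (p n z) (p n z)).
    by move: (J n _) (K n _ _) => q1 q2; apply/rowP => j; rewrite !mxE; ring.
  have pz1 : en (p n z) <= 1 := le_trans pzd del1.
  apply: le_trans (enD _ _) _; apply: le_trans (lerD (J_jet _ pzd) (enD _ _)) _.
  apply: le_trans (lerD (lexx _) (lerD (lexx _) (bK n _ _))) _.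
  have e1 : en (p n z) ^+ 3 <= en (p n z) by rewrite exprS ler_piMr ?en_ge0 // expr2 mulr_ile1 ?en_ge0.
  have e2 : en (p n z) * en (p n z) <= en (p n z) by rewrite ler_piMr ?en_ge0.
  apply: le_trans (_ : (1 + 2 * K0) * en (p n z) <= _).
    have := ler_wpM2l K00 e1; have := ler_wpM2l K00 e2; lra.
  apply: le_trans (_ : (1 + 2 * K0) * (K1 * x) <= _).
    by apply: ler_wpM2l => //; have := K00; lra.
  rewrite mulrA; apply: xdel; rewrite exprS mulrC; apply: ler_wpM2l => //.
  by rewrite /K1; have := sqr_ge0 K0; rewrite expr2 => h; rewrite expr2; lra.
have e : p n z = J' n (J n (p n z)) by rewrite JK.
rewrite [X in _ - X]e; apply: le_trans (J'_lip n Yd Jd) _.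
have -> : th * Ej * x ^+ 3 + th * F * tau ^+ n * x ^+ 2 = th * (Ej * x ^+ 3 + F * tau ^+ n * x ^+ 2).
  by ring.
exact: ler_wpM2l.
Qed.

(** The graph transform applied to the 2-jets: [N] steps forward along [phi] to where [p] is
    accurate, then [N] steps back along the model. *)
Fixpoint conj_approx n N z : V :=
  if N is N'.+1 then g' n (conj_approx n.+1 N' (phi n z)) else p n z.

Let k3 := th * mu * lam ^+ 3.
Let k2 := th * mu * lam ^+ 2 * tau.
Let k3_0 : 0 <= k3. Proof. by rewrite mulr_ge0 ?exprn_ge0. Qed.
Let k2_0 : 0 <= k2. Proof. by rewrite !mulr_ge0 ?exprn_ge0. Qed.
(** [E2] and [F2] solve [E2 = k3 * E2 + th * Ej] and [F2 = k2 * F2 + th * F], so that the bound on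
    [conj_approx] reproduces itself from one step to the next. *)
Let E2 := th * Ej / (1 - k3).
Let F2 := th * F / (1 - k2).
Let E2_0 : 0 <= E2. Proof. by rewrite divr_ge0 ?mulr_ge0 // subr_ge0 ltW. Qed.
Let F2_0 : 0 <= F2. Proof. by rewrite divr_ge0 ?mulr_ge0 // subr_ge0 ltW. Qed.
Let H2 := K1 + E2 + F2.
Let H2_1 : 1 <= H2. Proof. by rewrite /H2 -[leLHS]addr0 -[X in X + 0]addr0; apply: lerD => //; exact: lerD. Qed.
Let H2_0 : 0 <= H2. Proof. exact: le_trans ler01 H2_1. Qed.
Let r2 := Num.min r1 (del / (H2 * K0)).
Let HK0 : 0 < H2 * K0. Proof. by rewrite mulr_gt0 // (lt_le_trans ltr01). Qed.
Let r2_0 : 0 < r2. Proof. by rewrite lt_min r1_0 divr_gt0. Qed.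
Let r2_1 : r2 <= r1. Proof. by rewrite ge_min lexx. Qed.
Let r2_del : H2 * K0 * r2 <= del.
Proof. by rewrite mulrC -ler_pdivlMr // ge_min lexx orbT. Qed.

Let tauX n : 0 <= tau ^+ n <= 1.
Proof. by rewrite exprn_ge0 // exprn_ile1. Qed.

Let phi_r2 n z : en z <= r2 -> en (phi n z) <= r2.
Proof.
move=> zr; have zrho : en z <= rho by apply: le_trans zr (le_trans r2_1 r1_rho).
apply: le_trans (phi_lam _ zrho) _; apply: le_trans zr; by rewrite ler_piMl ?en_ge0.
Qed.

Let H2bound n (w : V) z : en z <= r2 ->
  en (w - p n z) <= E2 * en z ^+ 3 + F2 * tau ^+ n * en z ^+ 2 -> en w <= H2 * en z.
Proof.
move=> zr h; have z1 : en z <= 1 := le_trans zr (le_trans r2_1 r1_1).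
have z0 := en_ge0 z.
have z2 : en z ^+ 2 <= en z by rewrite expr2 ler_piMl.
have z3 : en z ^+ 3 <= en z by rewrite exprS ler_piMr // exprn_ile1.
have /andP[t0 t1] := tauX n.
rewrite -[w](subrK (p n z)); apply: le_trans (enD _ _) _.
apply: le_trans (lerD h (en_p n z1)) _; rewrite addrC addrA /H2 !mulrDl; apply: lerD.
  by rewrite lerD2l; exact: ler_wpM2l.
rewrite -mulrA; apply: ler_wpM2l => //; apply: le_trans z2; by rewrite ler_piMl ?exprn_ge0.
Qed.

Let H2del (w z : V) : en z <= r2 -> en w <= H2 * en z -> en w * K0 <= del.
Proof.
move=> zr h; apply: le_trans r2_del; rewrite mulrAC; apply: ler_wpM2r => //.
by apply: le_trans h _; exact: ler_wpM2l.
Qed.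

Let p_H2 n z : en z <= r2 -> en (p n z) <= H2 * en z.
Proof.
move=> zr; have z1 : en z <= 1 := le_trans zr (le_trans r2_1 r1_1).
apply: le_trans (en_p n z1) _; apply: ler_wpM2r; first exact: en_ge0.
by rewrite /H2 -addrA lerDl addr_ge0.
Qed.

Lemma conj_approx_bound N n z : en z <= r2 ->
  en (conj_approx n N z - p n z) <= E2 * en z ^+ 3 + F2 * tau ^+ n * en z ^+ 2.
Proof.
elim: N n z => [|N ih] n z zr /=.
  have z0 := en_ge0 z; rewrite subrr en0; apply: addr_ge0; apply: mulr_ge0; rewrite ?exprn_ge0 //.
  by apply: mulr_ge0 => //; exact: exprn_ge0.
have zrho : en z <= rho := le_trans zr (le_trans r2_1 r1_rho).
have wr := phi_r2 n zr; set w := phi n z in wr *.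
have hw : en w <= lam * en z := phi_lam n zrho.
have h1 := ih n.+1 w wr.
have h2 := g'_lip n (H2del wr (H2bound wr h1)) (H2del wr (p_H2 n.+1 wr)).
have h3 := local_error n (le_trans zr r2_1).
rewrite -[_ - p n z](subrKA (g' n (p n.+1 w))); apply: le_trans (enD _ _) _.
apply: le_trans (lerD (le_trans h2 (ler_wpM2l thmu h1)) h3) _.
have z0 := en_ge0 z; have w0 := en_ge0 w.
have e3 : en w ^+ 3 <= lam ^+ 3 * en z ^+ 3 by rewrite -exprMn lerXn2r ?nnegrE ?mulr_ge0.
have e2 : en w ^+ 2 <= lam ^+ 2 * en z ^+ 2 by rewrite -exprMn lerXn2r ?nnegrE ?mulr_ge0.
have eE : E2 = k3 * E2 + th * Ej.
  by rewrite /E2; field; rewrite gt_eqF // subr_gt0.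
have eF : F2 = k2 * F2 + th * F.
  by rewrite /F2; field; rewrite gt_eqF // subr_gt0.
rewrite {2}eE {2}eF.
have -> : (k3 * E2 + th * Ej) * en z ^+ 3 + (k2 * F2 + th * F) * tau ^+ n * en z ^+ 2 =
  th * mu * (E2 * (lam ^+ 3 * en z ^+ 3) + F2 * tau ^+ n.+1 * (lam ^+ 2 * en z ^+ 2)) +
   (th * Ej * en z ^+ 3 + th * F * tau ^+ n * en z ^+ 2).
  by rewrite /k3 /k2 [tau ^+ n.+1]exprS; ring.
rewrite lerD2r; apply: ler_wpM2l => //; apply: lerD; first exact: ler_wpM2l.
by apply: ler_wpM2l => //; rewrite mulr_ge0 ?exprn_ge0.
Qed.

(** Consecutive approximations differ by the local error at time [n + N], transported back by [N]
    steps of the model. Each step costs [th * mu], while the cubic and quadratic terms gain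
    [lam ^+ 3] and [lam ^+ 2 * tau]. *)
Lemma conj_approx_diff N n z : en z <= r2 ->
  en (conj_approx n N.+1 z - conj_approx n N z) <=
  k3 ^+ N * (th * Ej * en z ^+ 3) + k2 ^+ N * (th * F * tau ^+ n * en z ^+ 2).
Proof.
elim: N n z => [|N ih] n z zr.
  by rewrite !expr0 !mul1r /=; apply: local_error; exact: le_trans r2_1.
have zrho : en z <= rho := le_trans zr (le_trans r2_1 r1_rho).
have wr := phi_r2 n zr.
have eqS m : conj_approx n m.+1 z = g' n (conj_approx n.+1 m (phi n z)) by [].
rewrite (eqS N.+1) (eqS N); set w := phi n z in wr *.
have hw : en w <= lam * en z := phi_lam n zrho.
have hd m := H2del wr (H2bound wr (conj_approx_bound m n.+1 wr)).
apply: le_trans (g'_lip n (hd _) (hd _)) _.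
apply: le_trans (ler_wpM2l thmu (ih n.+1 w wr)) _.
have z0 := en_ge0 z; have w0 := en_ge0 w.
have e3 : en w ^+ 3 <= lam ^+ 3 * en z ^+ 3 by rewrite -exprMn lerXn2r ?nnegrE ?mulr_ge0.
have e2 : en w ^+ 2 <= lam ^+ 2 * en z ^+ 2 by rewrite -exprMn lerXn2r ?nnegrE ?mulr_ge0.
have -> : k3 ^+ N.+1 * (th * Ej * en z ^+ 3) + k2 ^+ N.+1 * (th * F * tau ^+ n * en z ^+ 2) =
  th * mu * (k3 ^+ N * (th * Ej * (lam ^+ 3 * en z ^+ 3)) + k2 ^+ N * (th * F * tau ^+ n.+1 * (lam ^+ 2 * en z ^+ 2))).
  by rewrite [k3 ^+ N.+1]exprS [k2 ^+ N.+1]exprS {1}/k3 {1}/k2 [tau ^+ n.+1]exprS; ring.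
apply: ler_wpM2l => //; apply: lerD.
  by rewrite ler_wpM2l ?exprn_ge0 // ler_wpM2l // mulr_ge0.
by rewrite ler_wpM2l ?exprn_ge0 // ler_wpM2l // !mulr_ge0 ?exprn_ge0.
Qed.

Let en_r2_nr z : nr z < r2 / (d%:R + 1) -> en z <= r2.
Proof.
have d1 : (0 : R) < d%:R + 1 by rewrite ltr_wpDl.
rewrite ltr_pdivlMr // => h; apply: le_trans (en_le_nr z) _; apply: le_trans (ltW h).
by rewrite mulrC; apply: ler_wpM2l; rewrite ?nr_ge0 // lerDl.
Qed.

Let p_diff n z : differentiable (p n) z.
Proof. exact: diff_id_add K00 (bilP n) (bP n). Qed.

Let g'_diff n z : differentiable (g' n) z.
Proof. exact: (diff_comp_val 0 (diff_mulmxr (A' n) z) (J'd n _)).1. Qed.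

Let conj_approx_differentiable n N z : en z <= r2 -> differentiable (conj_approx n N) z.
Proof.
elim: N n z => [|N ih] n z zr; first exact: p_diff.
have zrho : en z <= rho := le_trans zr (le_trans r2_1 r1_rho).
have h1 := (diff_comp_val 0 (phi_diff n zrho) (ih n.+1 _ (phi_r2 n zr))).1.
exact: (diff_comp_val 0 h1 (g'_diff n _)).1.
Qed.

(** The limits are holomorphic by [holo_limit] and tangent to the identity with a quadratic error
    uniform in [n]. Hence they are injective on a common ball, and their images contain a common
    ball. *)
Theorem conjugation_limit : exists (r rho' : R) (h : nat -> V -> V),
  [/\ 0 < r, r <= rho & 0 < rho'] /\
  forall n, [/\ forall z, en z < r -> differentiable (h n) z,
    forall z w, en z < r -> en w < r -> h n z = h n w -> z = w,
    forall y, nr y < rho' -> exists2 z, en z < r & h n z = y &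
    forall z, en z < r -> h n.+1 (phi n z) = J n (h n z) *m A n].
Proof.
pose q := Num.max k3 k2.
have q0 : 0 <= q by rewrite le_max k3_0.
have q1 : q < 1 by rewrite gt_max contr3 contr2.
pose A0 := th * Ej + th * F.
have A00 : 0 <= A0 by rewrite addr_ge0 ?mulr_ge0.
pose A1 := 2 * A0 / (1 - q).
have A10 : 0 <= A1 by rewrite divr_ge0 ?mulr_ge0 // subr_ge0 ltW.
have step n N z : en z <= r2 -> nr (conj_approx n N.+1 z - conj_approx n N z) <= A0 * q ^+ N.
  move=> zr; apply: le_trans (nr_le_en _) _; apply: le_trans (conj_approx_diff N n zr) _.
  have z0 := en_ge0 z; have z1 : en z <= 1 := le_trans zr (le_trans r2_1 r1_1).
  have /andP[t0 t1] := tauX n.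
  rewrite /A0 mulrDl; apply: lerD; rewrite mulrC; apply: ler_pM; rewrite ?exprn_ge0 ?mulr_ge0 ?exprn_ge0 //.
  - by rewrite ler_piMr ?mulr_ge0 // exprn_ile1.
  - by apply: lerXn2r; rewrite ?nnegrE // le_max lexx.
  - by rewrite -mulrA ler_piMr ?mulr_ge0 // mulr_ile1 ?exprn_ge0 // exprn_ile1.
  - by apply: lerXn2r; rewrite ?nnegrE // le_max lexx orbT.
have /choice[h0 hh0] (x : nat * V) : exists l, en x.2 <= r2 -> forall N, nr (conj_approx x.1 N x.2 - l) <= A1 * q ^+ N.
  case: (leP (en x.2) r2) => xr; last by exists 0.
  have [l hl] := geo_limit_mx q0 q1 (fun N => step x.1 N x.2 xr).
  exists l => _ N; apply: le_trans (hl N) _; rewrite /A1 le_eqVlt; apply/orP; left; apply/eqP; ring.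
pose h n z := h0 (n, z).
have hh n z N : en z <= r2 -> nr (conj_approx n N z - h n z) <= A1 * q ^+ N.
  by move=> zr; exact: (hh0 (n, z)).
have hhe n z N : en z <= r2 -> en (conj_approx n N z - h n z) <= d%:R * (A1 * q ^+ N).
  by move=> zr; apply: le_trans (en_le_nr _) _; apply: ler_wpM2l => //; exact: hh.
have lim_le (x y K' : R) : (forall N, x <= y + K' * q ^+ N) -> x <= y.
  move=> hx; apply: (@le_small _ _ _ 1) => // e e0 _; have [N hN] := geo_small K' q0 q1 e0.
  by apply: le_trans (hx N) _; rewrite lerD2l mul1r ltW // hN.
have h_H2 n z : en z <= r2 -> en (h n z) <= H2 * en z.
  move=> zr; apply: (lim_le _ _ (d%:R * A1)) => N.
  have := en_sub (h n z) (conj_approx n N z); rewrite enBC => h1.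
  have := hhe n z N zr; have := H2bound zr (conj_approx_bound N n zr); rewrite mulrA; lra.
pose Kq := E2 + F2 + K0.
have Kq0 : 0 <= Kq by rewrite !addr_ge0.
have h_quad n z : en z <= r2 -> nr (h n z - z) <= Kq * en z ^+ 2.
  move=> zr; have z0 := en_ge0 z; have z1 : en z <= 1 := le_trans zr (le_trans r2_1 r1_1).
  have /andP[t0 t1] := tauX n.
  apply: (lim_le _ _ A1) => N.
  have -> : h n z - z = - (conj_approx n N z - h n z) + (conj_approx n N z - p n z) + (p n z - z).
    have ab (a b c e : V) : a - e = - (b - a) + (b - c) + (c - e).
      by apply/rowP => j; rewrite !mxE; ring.
    exact: ab.
  apply: le_trans (nrD _ _) _; apply: le_trans (lerD (nrD _ _) (le_trans (nr_le_en _) (en_p_sub n z))) _.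
  rewrite nrN; apply: le_trans (lerD (lerD (hh n z N zr) (le_trans (nr_le_en _) (conj_approx_bound N n zr))) (lexx _)) _.
  rewrite /Kq -addrA addrC lerD2r !mulrDl lerD2r; apply: lerD.
    by apply: ler_wpM2l => //; rewrite exprS ler_piMl ?exprn_ge0.
  by rewrite -mulrA; apply: ler_wpM2l => //; rewrite ler_piMl ?exprn_ge0.
(* The limit of the recursion that defines [conj_approx], solved for [h n.+1] by inverting
   [g' n]. *)
have h_conj n z : en z <= r2 -> h n.+1 (phi n z) = J n (h n z) *m A n.
  move=> zr; have wr := phi_r2 n zr.
  have hE : h n z = g' n (h n.+1 (phi n z)).
    apply/eqP; rewrite -subr_eq0 -nr_eq0 eq_le nr_ge0 andbT; apply: (lim_le _ 0 (A1 * q + th * mu * (d%:R * A1))) => N; rewrite add0r.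
    rewrite -(subrKA (conj_approx n N.+1 z)).
    apply: le_trans (nrD _ _) _; rewrite mulrDl; apply: lerD.
      by rewrite nrBC -mulrA -exprS; exact: hh.
    apply: le_trans (nr_le_en _) _.
    have d1 := H2del wr (H2bound wr (conj_approx_bound N n.+1 wr)).
    have d2 := H2del wr (h_H2 n.+1 _ wr).
    apply: le_trans (g'_lip n d1 d2) _; rewrite -[leRHS]mulrA; apply: ler_wpM2l => //.
    by rewrite -mulrA; exact: hhe.
  by rewrite hE /g' J'K -mulmxA A'A mulmx1.
have d1 : (0 : R) < d%:R + 1 by rewrite ltr_wpDl.
pose ro := r2 / (d%:R + 1).
have ro0 : 0 < ro by rewrite divr_gt0.
have ror2 : ro <= r2 by rewrite ler_pdivrMr // ler_peMr ?(ltW r2_0) // lerDr.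
have h_diff n z : nr z < ro / 2 -> differentiable (h n) z.
  move=> zr; have := @holo_limit R d d (conj_approx n) (h n) 0 ro (H2 * r2) A1 q ro0 q0 q1.
  apply; rewrite ?subr0 // => N w; rewrite subr0 => /en_r2_nr wr.
  - exact: conj_approx_differentiable.
  - apply: le_trans (nr_le_en _) _; apply: le_trans (H2bound wr (conj_approx_bound N n wr)) _.
    exact: ler_wpM2l.
  - exact: hh.
pose K3 := Kq * d%:R ^+ 2.
have K30 : 0 <= K3 by rewrite mulr_ge0 ?exprn_ge0.
(* Small enough for the Lipschitz constant [32 * K3 * r3] of [h n z - z] to be at most 1/2. *)
pose r3 := Num.min (ro / 4) ((64 * (K3 + 1))^-1).
have K31 : 0 < K3 + 1 by lra.
have r30 : 0 < r3 by rewrite lt_min divr_gt0 // invr_gt0 mulr_gt0.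
have r3ro4 : r3 <= ro / 4 by rewrite ge_min lexx.
have r3ro : 2 * r3 <= ro / 2 by lra.
have r3K : 32 * K3 * r3 <= 1 / 2.
  have : r3 <= (64 * (K3 + 1))^-1 by rewrite ge_min lexx orbT.
  rewrite -[X in _ <= X]mul1r ler_pdivlMr ?mulr_gt0 // => h1.
  have : 0 <= r3 by exact: ltW.
  lra.
have h_lip n z w : nr z < r3 -> nr w < r3 -> nr (h n z - h n w - (z - w)) <= nr (z - w) / 2.
  move=> zr wr; have -> : h n z - h n w - (z - w) = (h n z - z) - (h n w - w).
    by rewrite -!addrA; congr (_ + _); rewrite !opprD !opprK addrCA.
  have := @small_lip R d (fun z => h n z - z) (ro / 2) K3 r3 r30 r3ro K30 _ _ z w zr wr.
  move=> /(_ _ _) hs; apply: le_trans (hs _ _) _.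
  - move=> y yr; apply: differentiableB; first exact: h_diff.
    exact: (@ex_diff _ _ _ _ _ _ _ (is_diff_id y)).
  - move=> y yr; apply: le_trans (h_quad n y _) _; first by apply: en_r2_nr; rewrite -/ro; lra.
    rewrite /K3 -mulrA; apply: ler_wpM2l => //; rewrite -exprMn.
    by rewrite lerXn2r ?nnegrE ?mulr_ge0 ?nr_ge0 ?en_ge0 // en_le_nr.
  by have := ler_wpM2r (nr_ge0 (z - w)) r3K; lra.
have h00 n : h n 0 = 0.
  have := h_quad n 0; rewrite en0 expr0n mulr0 subr0 => /(_ (ltW r2_0)) h1.
  by apply: nr0_eq0; apply/eqP; rewrite eq_le nr_ge0 h1.
have r3r2 : r3 <= r2 by lra.
exists r3, (r3 / (2 * (d%:R + 1))), h; split.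
  split => //; last by rewrite divr_gt0 // mulr_gt0.
  exact: le_trans r3r2 (le_trans r2_1 r1_rho).
have ennr z : en z < r3 -> nr z < r3 by apply: le_lt_trans; exact: nr_le_en.
move=> n; split.
- by move=> z /ennr zr; apply: h_diff; lra.
- by move=> z w /ennr zr /ennr wr; exact: (lip_inj (h_lip n)).
- move=> y; rewrite ltr_pdivlMr ?mulr_gt0 // => yr.
  have y0 := nr_ge0 y.
  have yr2 : nr y < r3 / 2.
    have : nr y * 1 <= nr y * (d%:R + 1) by apply: ler_wpM2l => //; rewrite lerDr.
    lra.
  have [z zy hz] := lip_surj r30 (h00 n) (h_lip n) yr2.
  exists z => //; apply: le_lt_trans (en_le_nr z) _; apply: le_lt_trans yr.
  apply: le_trans (_ : (d%:R + 1) * (2 * nr y) <= _); last by rewrite le_eqVlt; apply/orP; left; apply/eqP; ring.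
  by apply: ler_pM; rewrite ?nr_ge0 // lerDl.
by move=> z zr; apply: h_conj; apply: le_trans r3r2; exact: ltW.
Qed.

End Conjugation.

(** * Second-order Taylor expansion in several variables *)

Section SecondJet.
Context {R : realType}.
Local Notation C := (Cplx R).

(** Only the identification of the second coefficient with [b] is at stake. Subtracting the
    quadratic polynomial leaves [G] with derivative [o(t)], and the mean value inequality makes its
    increment [o(t^2)]. *)
Lemma taylor_coef2 (u D : C -> C) (rho r K : R) (b : C) : 0 < r -> r < rho ->
  (forall z, nr z < rho -> differentiable u z) ->
  (forall z, nr z = r -> nr (u z) <= K) ->
  (forall t, nr t < rho -> 'd u t 1 = D t) -> hasd D 0 (fun w => w * (2 * b)) ->
  forall a : C, nr a <= r / 2 ->
  nr (u a - (u 0 + D 0 * a + b * a ^+ 2)) <= 2 * K * (nr a / r) ^+ 3.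
Proof.
move=> r0 rrho ud uK uD hD.
have K0 := K_ge0 r0 uK.
have [c [c0 c1 _ hc]] := taylor_half r0 rrho ud uK.
have n00 : nr (0 : C) < rho by rewrite nr0; lra.
rewrite (uD 0 n00) in c1.
have hc3 a : nr a <= r / 2 -> nr (u a - (u 0 + D 0 * a + c 2%N * a ^+ 2)) <= 2 * K * (nr a / r) ^+ 3.
  move=> ar; have := hc 3%N a ar.
  have -> : \sum_(j < 3) c j * a ^+ j = c 0%N + c 1%N * a + c 2%N * a ^+ 2.
    by rewrite !big_ord_recr big_ord0 /= add0r expr0 mulr1 expr1.
  by rewrite c0 c1.
suff <- : c 2%N = b by exact: hc3.
apply: (@nr_small_eq _ _ _ _ (1 + 2 * K / r ^+ 3)) => [|e e0 e1].
  by rewrite addr_ge0 // divr_ge0 ?mulr_ge0 ?exprn_ge0 // ltW.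
have [del del0 hdel] := hD e e0.
pose t := Num.min (r / 2) (Num.min (del / 2) e).
have t0 : 0 < t by rewrite !lt_min !divr_gt0.
have tr : t <= r / 2 by rewrite ge_min lexx.
have tdel : t <= del / 2 by rewrite !ge_min lexx orbT.
have te : t <= e by rewrite !ge_min lexx !orbT.
have nt : nr (cr t) = t by rewrite nr_cr gtr0_norm.
pose G (w : C) := u w - (D 0 * w + b * w ^+ 2).
have hG w : nr w < rho -> hasd G w (fun x => x * (D w - (D 0 + 2 * b * w))).
  move=> wr; have h1 := hasd_diff (ud w wr).
  have h2 : hasd (fun w => D 0 * w + b * w ^+ 2) w (fun x => x * (D 0 + 2 * b * w)).
    apply: (@hasd_sq _ _ _ _ _ _ 1 (nr b)) => //; first exact: nr_ge0.
    move=> x _; rewrite -nrX -nrM le_eqVlt; apply/orP; left; apply/eqP; congr nr; ring.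
  have := hasdB h1 h2; congr (hasd _ _ _); apply/funext => x.
  have e3 : 'd u w x = x * D w := etrans (diff_scal x (ud w wr)) (congr1 ( *%R x) (uD w wr)).
  by rewrite e3 mulrBr.
have key : nr (G (cr t) - G 0) <= e * t * t.
  have := @rder_mvt _ (fun x => G (cr x)) (fun x => D (cr x) - (D 0 + 2 * b * cr x)) 0 t (e * t) (ltW t0).
  rewrite subr0; apply.
    move=> x /andP[x0 xt]; have xr : nr (cr x : C) < rho by rewrite nr_cr ger0_norm //; lra.
    by have := rder_comp (hG _ xr) (rder_id x); rewrite mul1r.
  move=> x /andP[x0 xt]; have nx : nr (cr x : C) = x by rewrite nr_cr ger0_norm.
  have := hdel (cr x); rewrite nx add0r => h; rewrite opprD addrA.
  have -> : D (cr x) - D 0 - 2 * b * cr x = D (cr x) - D 0 - cr x * (2 * b) by rewrite [cr x * _]mulrC.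
  apply: le_trans (h _) _; first lra.
  by apply: ler_wpM2l; rewrite ?(ltW e0).
have := hc3 (cr t); rewrite nt => /(_ tr) h3.
have e2 : (c 2%N - b) * cr t ^+ 2 = (G (cr t) - G 0) - (u (cr t) - (u 0 + D 0 * cr t + c 2%N * cr t ^+ 2)).
  by rewrite /G !expr0n /= !mulr0 addr0 subr0; ring.
have : nr (c 2%N - b) * t ^+ 2 <= (e + 2 * K / r ^+ 3 * t) * t ^+ 2.
  rewrite -{1}nt -nrX -nrM e2; apply: le_trans (nrB _ _) _; apply: le_trans (lerD key h3) _.
  by rewrite expr_div_n le_eqVlt; apply/orP; left; apply/eqP; ring.
rewrite ler_pM2r ?exprn_gt0 // => h; apply: le_trans h _; rewrite [leRHS]mulrDl mul1r lerD2l.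
by apply: ler_wpM2l => //; rewrite divr_ge0 ?mulr_ge0 ?exprn_ge0 // ltW.
Qed.

Variable d : nat.
Local Notation V := 'rV[C]_d.
Local Notation en := (@enorm R d).

Lemma dd_linear (f : V -> V) (rho : R) (k : C) u u' v : 0 < rho ->
  (forall z, nr z < rho -> differentiable f z) ->
  'd (fun z => 'd f z (k *: u + u')) 0 v = k *: 'd (fun z => 'd f z u) 0 v + 'd (fun z => 'd f z u') 0 v.
Proof.
move=> rho0 fd.
have fd' z : nr (z - 0) < rho -> differentiable f z by rewrite subr0; exact: fd.
have h1 := hasd_diff (dd_diff u rho0 fd'); have h2 := hasd_diff (dd_diff u' rho0 fd').
have h3 := dd_diff (k *: u + u') rho0 fd'.
have e : (fun z => 'd f z (k *: u + u')) = (fun z => k *: 'd f z u + 'd f z u').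
  by apply/funext => z; rewrite linearP.
have h4 := hasdD (hasdZ k h1) h2; rewrite -e in h4.
have aux (F : V -> V) (L1 L2 : {linear V -> V}) : differentiable F 0 ->
    hasd F 0 (fun w => k *: L1 w + L2 w) -> 'd F 0 v = k *: L1 v + L2 v.
  move=> a b; apply: (hasd_val v a b) => c x; rewrite !linearZ /=.
  by rewrite scalerDr !scalerA [c * k]mulrC.
exact: aux h3 h4.
Qed.

(** [B] is half the second derivative. By Cauchy's estimates the constant depends on [d] alone,
    which makes the jets of all the [f n] uniformly bounded. *)
Lemma second_jet : exists2 K0 : R, 0 <= K0 & forall f : V -> V, f 0 = 0 ->
  (forall z, en z < 1 -> differentiable f z) -> (forall z, en z < 1 -> en (f z) <= 1) ->
  exists B : V -> V -> V, [/\ bil B, bbd B K0 &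
   forall z, en z <= 1 / 4 -> en (f z - 'd f 0 z - B z z) <= K0 * en z ^+ 3].
Proof.
have d1 : (0 : R) < d%:R + 1 by rewrite ltr_wpDl.
pose rho : R := (d%:R + 1)^-1.
have rho0 : 0 < rho by rewrite invr_gt0.
pose K0 : R := d%:R * (16 / rho ^+ 2) + d%:R * 16.
have K00 : 0 <= K0 by rewrite addr_ge0 ?mulr_ge0 ?invr_ge0 ?exprn_ge0 // ltW.
exists K0 => // f f0 fd fb.
have inb z : nr z < rho -> en z < 1.
  rewrite /rho -[X in _ < X]mul1r ltr_pdivlMr // => h; apply: le_lt_trans (en_le_nr z) _.
  by apply: le_lt_trans h; rewrite mulrC; apply: ler_wpM2l; rewrite ?nr_ge0 // lerDl.
have fd' z : nr z < rho -> differentiable f z by move=> /inb; exact: fd.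
have fd0 z : nr (z - 0) < rho -> differentiable f z by rewrite subr0; exact: fd'.
pose B (u v : V) : V := (2^-1 : C) *: 'd (fun z => 'd f z u) 0 v.
have bilB' : bil B.
  apply: (@bilS _ _ _ (fun u v => 'd (fun z => 'd f z u) 0 v)); split=> k u u' v.
    exact: dd_linear rho0 fd'.
  exact: linearP.
have n2 : nr (2^-1 : C) = 2^-1.
  by rewrite nrV; congr (_^-1); have := @nr_cr R 2; rewrite ger0_norm // => <-; congr nr; rewrite /cr rmorph_nat.
have bB u v : en (B u v) <= d%:R * (16 / rho ^+ 2) * (en u * en v).
  rewrite /B enZ n2.
  have fb' z : nr (z - 0) < rho -> nr (f z) <= 1.
    by rewrite subr0 => /inb zr; apply: le_trans (nr_le_en _) _; exact: fb.
  have rho20 : 0 < rho / 2 by rewrite divr_gt0.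
  have Fd z : nr (z - 0) < rho / 2 -> differentiable (fun z => 'd f z u) z.
    rewrite subr0 => zr; have r'0 : 0 < rho / 2 by [].
    by apply: (dd_diff u r'0) => w wr; apply: fd'; have := nrD (w - z) z; rewrite subrK; lra.
  have Fb z : nr (z - 0) < rho / 2 -> nr ('d f z u) <= 4 / rho * nr u.
    by move=> zr; have := dbound rho0 fd0 fb' u zr; rewrite mulr1.
  have z00 : nr (0 - 0 : V) < rho / 2 / 2 by rewrite subr0 nr0 !divr_gt0.
  have h := dbound rho20 Fd Fb v z00.
  apply: le_trans (_ : 2^-1 * (d%:R * (4 * (4 / rho * nr u) / (rho / 2) * nr v)) <= _).
    by apply: ler_wpM2l => //; apply: le_trans (en_le_nr _) _; apply: ler_wpM2l.
  have -> : 2^-1 * (d%:R * (4 * (4 / rho * nr u) / (rho / 2) * nr v)) = d%:R * (16 / rho ^+ 2) * (nr u * nr v).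
    by field; rewrite gt_eqF.
  apply: ler_wpM2l; first by rewrite mulr_ge0 ?divr_ge0 ?exprn_ge0 // ltW.
  by apply: ler_pM; rewrite ?nr_ge0 // nr_le_en.
exists B; split => //.
  apply: bbdW bB; rewrite /K0 lerDl mulr_ge0 //.
move=> z zr; have [->|z0] := eqVneq z 0.
  by rewrite f0 (bil0l bilB') linear0 !subr0 en0 mulr_ge0 ?exprn_ge0.
have x0 : 0 < en z.
  by rewrite lt_neqAle en_ge0 andbT eq_sym; apply: contraNneq z0 => /en0_eq0 ->.
set x := en z in zr x0 *.
apply: le_trans (en_le_nr _) _; apply: le_trans (_ : d%:R * (16 * x ^+ 3) <= _); last first.
  rewrite mulrA; apply: ler_wpM2r; first by rewrite exprn_ge0 // ltW.
  by rewrite /K0 lerDr mulr_ge0 // divr_ge0 ?exprn_ge0 // ltW.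
apply: ler_wpM2l => //; apply: nr_mx_le; first by rewrite mulr_ge0 // exprn_ge0 // ltW.
move=> i j; rewrite (ord1 i).
pose u (t : C) : C := f (0 + t *: z) ord0 j.
pose D (t : C) : C := 'd f (0 + t *: z) z ord0 j.
(* The line through [z] stays in the unit ball for parameters below [1 / x]. The expansion on the
   circle of radius [1 / (2 x)] is valid up to half that radius, which reaches the parameter 1
   because [x <= 1 / 4]. *)
have rr : (2 * x)^-1 < x^-1 by rewrite ltf_pV2 ?posrE ?mulr_gt0 //; lra.
have r0 : 0 < (2 * x)^-1 by rewrite invr_gt0 mulr_gt0.
have int (t : C) : nr t < x^-1 -> en (0 + t *: z) < 1.
  by rewrite add0r enZ -/x -[X in _ < X]mul1r ltr_pdivlMr.
have ud (t : C) : nr t < x^-1 -> differentiable u t.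
  by move=> /int tr; exact: (line_coord j (fd _ tr)).1.
have uD (t : C) : nr t < x^-1 -> 'd u t 1 = D t.
  by move=> /int tr; exact: (line_coord j (fd _ tr)).2.
have uK (t : C) : nr t = (2 * x)^-1 -> nr (u t) <= 1.
  move=> te; apply: le_trans (nr_mx_entry _ _ _) _; apply: le_trans (nr_le_en _) _; apply: fb; apply: int.
  by rewrite te.
have hD : hasd D 0 (fun w => w * (2 * B z z ord0 j)).
  have h : differentiable (fun y => 'd f y z) (0 + (0 : C) *: z).
    by rewrite scale0r addr0; exact: dd_diff rho0 fd0.
  have [k1 k2] := line_coord j h.
  have := hasd_diff k1; congr (hasd _ _ _); apply/funext => w.
  have nn2 : (2 : C) != 0 by rewrite -nr_gt0 -invr_gt0 -nrV n2 invr_gt0.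
  have sc (y : V) : 2 * ((2^-1 : C) *: y) ord0 j = y ord0 j by rewrite mxE mulrA divff // mul1r.
  have eB : 2 * B z z ord0 j = 'd (fun y => 'd f y z) 0 z ord0 j by exact: sc.
  by rewrite diff_scal // k2 scale0r addr0 eB.
have n1 : nr (1 : C) <= (2 * x)^-1 / 2.
  rewrite nr1 -invfM -[leLHS]invr1 lef_pV2 ?posrE ?mulr_gt0 //; lra.
have := taylor_coef2 r0 rr ud uK uD hD n1.
rewrite nr1 expr1n mulr1 /u /D scale0r !addr0 f0 scale1r !add0r mulr1 [(0 : V) _ _]mxE add0r.
have -> : 2 * 1 * (1 / (2 * x)^-1) ^+ 3 = 16 * x ^+ 3.
  by rewrite div1r invrK; ring.
by apply: le_trans; rewrite le_eqVlt; apply/orP; left; apply/eqP; congr nr; rewrite !mxE opprD addrA.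
Qed.

End SecondJet.

(** * Decay of the orbits of the model *)

Section Growth.
Context {R : realType}.

(** Between two jumps there are at least [D ^ k.+1] contractions by [nu ^+ 2]. Half of this power
    eventually absorbs [Cg]; the other half multiplies the [D ^ k.+1]-th root of the bound by [nu],
    although the jump has degree [D]. *)
Lemma orbit_decay (x : nat -> R) (lam Cg nu : R) (D m : nat) : (1 < D)%N ->
  0 < nu -> nu < 1 -> 0 <= lam -> lam <= nu ^+ 2 -> 1 <= Cg -> (forall n, 0 <= x n) ->
  (forall n, (m <= n)%N -> (forall k, n <> (2 * D ^ k)%N) -> x n.+1 <= lam * x n) ->
  (forall k r, (m <= 2 * D ^ k)%N -> 1 <= r -> x (2 * D ^ k)%N <= r ->
     x (2 * D ^ k).+1 <= lam * (Cg * r ^+ D)) ->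
  forall e : R, 0 < e -> exists2 n, (m <= n)%N & x n < e.
Proof.
move=> D1 nu0 nu1 lam0 lamnu Cg1 x0 hoff hjump e e0.
have Dk k : (0 < D ^ k)%N by rewrite expn_gt0 (ltnW D1).
have mk k : (k < D ^ k)%N by exact: ltn_expl.
have lin k j : (m <= 2 * D ^ k)%N -> ((2 * D ^ k).+1 + j <= 2 * D ^ k.+1)%N ->
    x ((2 * D ^ k).+1 + j)%N <= lam ^+ j * x (2 * D ^ k).+1.
  move=> mk0; elim: j => [|j ih] h; first by rewrite addn0 expr0 mul1r.
  have h' : ((2 * D ^ k).+1 + j <= 2 * D ^ k.+1)%N by move: h; rewrite addnS; exact: ltnW.
  rewrite addnS exprS -mulrA; apply: le_trans (hoff _ _ _) _.
  - by apply: leq_trans mk0 _; rewrite addSn -addnS leq_addr.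
  - move=> k' ek'; have h1 : (2 * D ^ k < 2 * D ^ k')%N by rewrite -ek' addSn ltnS leq_addr.
    have h2 : (2 * D ^ k' < 2 * D ^ k.+1)%N by rewrite -ek'; move: h; rewrite addnS.
    move: h1 h2; rewrite !ltn_pmul2l // !ltn_exp2l //; lia.
  - by apply: ler_wpM2l => //; exact: ih.
have step k r : (m <= 2 * D ^ k)%N -> 1 <= r -> x (2 * D ^ k)%N <= r ->
    Cg * nu ^+ (D ^ k.+1) <= 1 -> x (2 * D ^ k.+1)%N <= nu ^+ (D ^ k.+1) * r ^+ D.
  move=> mk0 r1 xr hC.
  have e1 : (2 * D ^ k.+1 = (2 * D ^ k).+1 + (2 * D ^ k.+1 - (2 * D ^ k).+1))%N.
    by rewrite subnKC // expnS; apply: jump_lt.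
  have h1 := lin k _ mk0 (eq_leq (esym e1)); rewrite -e1 in h1.
  apply: le_trans h1 _; set j := (_ - _)%N.
  apply: le_trans (ler_wpM2l (exprn_ge0 j lam0) (hjump k r mk0 r1 xr)) _.
  have -> : lam ^+ j * (lam * (Cg * r ^+ D)) = lam ^+ j.+1 * Cg * r ^+ D by rewrite exprS; ring.
  apply: ler_wpM2r; first by rewrite exprn_ge0 // (le_trans ler01).
  have hj : (D ^ k.+1 <= j.+1)%N.
    rewrite /j expnS; have := Dk k; move: (D ^ k)%N => N N0; nia.
  apply: le_trans (_ : (nu ^+ 2) ^+ j.+1 * Cg <= _).
    apply: ler_wpM2r; first exact: le_trans Cg1.
    by rewrite lerXn2r ?nnegrE // exprn_ge0 // ltW.
  rewrite -exprM; apply: le_trans (_ : nu ^+ (D ^ k.+1 + D ^ k.+1) * Cg <= _).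
    apply: ler_wpM2r; first exact: le_trans Cg1.
    by apply: ler_wiXn2l; rewrite ?ltW //; lia.
  rewrite exprD -mulrA; apply: ler_piMr; first by rewrite exprn_ge0 // ltW.
  by rewrite mulrC.
have [k1 hk1] := geo_small Cg (ltW nu0) nu1 ltr01.
pose k2 := maxn k1 m.
have mk2 k : (k2 <= k)%N -> (m <= 2 * D ^ k)%N.
  by rewrite geq_max => /andP[_ mk']; have := mk k; lia.
have Ck k : (k2 <= k)%N -> Cg * nu ^+ (D ^ k.+1) <= 1.
  rewrite geq_max => /andP[h _]; apply/ltW/hk1; have := mk k.+1; lia.
pose rho := Num.max 1 (x (2 * D ^ k2)%N).
have rho1 : 1 <= rho by rewrite le_max lexx.
have claim j : x (2 * D ^ (k2 + j))%N <= (Num.max 1 (rho * nu ^+ j)) ^+ (D ^ (k2 + j)).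
  elim: j => [|j ih].
    rewrite addn0 expr0 mulr1; have -> : Num.max 1 rho = rho by apply/max_idPr.
    apply: le_trans (_ : rho <= _); first by rewrite /rho le_max lexx orbT.
    by rewrite -[leLHS]expr1; apply: ler_weXn2l.
  set y := Num.max 1 (rho * nu ^+ j) in ih.
  have y1 : 1 <= y by rewrite le_max lexx.
  rewrite addnS; apply: le_trans (step _ _ (mk2 _ (leq_addr _ _)) _ ih (Ck _ (leq_addr _ _))) _.
    exact: exprn_ege1.
  rewrite -exprM -(mulnC D) -expnS -exprMn; apply: lerXn2r; rewrite ?nnegrE.
  - by rewrite mulr_ge0 ?ltW // (lt_le_trans ltr01).
  - by rewrite le_max ler01.
  have [->|->] : y = 1 \/ y = rho * nu ^+ j by rewrite /y; case: leP; [right|left].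
    by rewrite mulr1 le_max ltW.
  by rewrite mulrCA -exprS le_max lexx orbT.
have [j1 hj1] := geo_small rho (ltW nu0) nu1 ltr01.
have [j2 hj2] := geo_small 1 (ltW nu0) nu1 e0.
pose j := maxn j1 j2.
have xj : x (2 * D ^ (k2 + j))%N <= 1.
  apply: le_trans (claim j) _; have -> : Num.max 1 (rho * nu ^+ j) = 1.
    by apply/max_idPl; apply/ltW/hj1; rewrite leq_maxl.
  by rewrite expr1n.
exists (2 * D ^ (k2 + j).+1)%N; first by apply: mk2; rewrite -addnS leq_addr.
apply: le_lt_trans (step _ _ (mk2 _ (leq_addr _ _)) (lexx 1) xj (Ck _ (leq_addr _ _))) _.
rewrite expr1n mulr1 -[X in X < _]mul1r; apply: hj2.
have := mk (k2 + j).+1; have := leq_maxr j1 j2; rewrite -/j; lia.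
Qed.

End Growth.

Section DerivativeBounds.
Context {R : realType}.
Local Notation C := (Cplx R).
Variable d : nat.
Local Notation V := 'rV[C]_d.
Local Notation en := (@enorm R d).

Lemma derivative_bounds (f : V -> V) (Lam M : R) : 0 <= M -> f 0 = 0 -> differentiable f 0 ->
  (forall z, en z < 1 -> en (f z) <= Lam * en z) -> (forall z, en z < 1 -> en z <= M * en (f z)) ->
  forall v, en ('d f 0 v) <= Lam * en v /\ en v <= M * en ('d f 0 v).
Proof.
move=> M0 f0 df fL fM v; have hdf := hasd_diff df; move: ('d f 0) hdf => L hL.
have dv : 0 <= d%:R * nr v by rewrite mulr_ge0 ?nr_ge0.
have small (e : R) : 0 < e -> exists t : R, [/\ 0 < t, en (cr t *: v) < 1 &
   en (f (cr t *: v) - cr t *: L v) <= d%:R * nr v * e * t].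
  move=> e0; have [r r0 hr] := hL e e0.
  have v1 : 0 < en v + 1 by rewrite ltr_wpDl ?en_ge0.
  pose t : R := Num.min r 1 / 2 / (en v + 1).
  have m0 : 0 < Num.min r 1 by rewrite lt_min r0 ltr01.
  have t0 : 0 < t by rewrite !divr_gt0.
  have tv : en (cr t *: v) < Num.min r 1.
    rewrite enZ nr_cr gtr0_norm //; apply: le_lt_trans (_ : t * (en v + 1) < _).
      by apply: ler_wpM2l; [exact: ltW|lra].
    by rewrite /t divfK ?gt_eqF //; lra.
  have tr : en (cr t *: v) < r by apply: lt_le_trans tv _; rewrite ge_min lexx.
  have t1 : en (cr t *: v) < 1 by apply: lt_le_trans tv _; rewrite ge_min lexx orbT.
  clearbody t.
  exists t; split; [exact: t0|exact: t1|].
  apply: le_trans (en_le_nr _) _; have := hr _ (le_lt_trans (nr_le_en _) tr).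
  rewrite add0r f0 subr0 linearZ nrZ nr_cr gtr0_norm // => h.
  apply: le_trans (ler_wpM2l _ h) _ => //.
  by rewrite le_eqVlt; apply/orP; left; apply/eqP; ring.
split.
  apply: (le_small dv) => e e0 _; have [t [t0 t1 ht]] := small e e0.
  rewrite -(ler_pM2l t0); have nt : nr (cr t) = t by rewrite nr_cr gtr0_norm.
  have h0 : en (cr t *: L v) = t * en (L v) by rewrite enZ nt.
  have h1 : en (f (cr t *: v)) <= Lam * (t * en v) by have := fL _ t1; rewrite enZ nt.
  have := en_sub (cr t *: L v) (f (cr t *: v)); rewrite enBC h0; lra.
have Mdv : 0 <= M * (d%:R * nr v) by rewrite mulr_ge0.
apply: (le_small Mdv) => e e0 _; have [t [t0 t1 ht]] := small e e0.
rewrite -(ler_pM2l t0); have nt : nr (cr t) = t by rewrite nr_cr gtr0_norm.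
have h0 : en (cr t *: L v) = t * en (L v) by rewrite enZ nt.
have h1 : t * en v <= M * en (f (cr t *: v)) by have := fM _ t1; rewrite enZ nt.
apply: le_trans h1 _.
have h2 := en_sub (f (cr t *: v)) (cr t *: L v); rewrite h0 in h2.
have : en (f (cr t *: v)) <= t * en (L v) + d%:R * nr v * e * t by lra.
move=> /(ler_wpM2l M0) h3; apply: le_trans h3 _.
by rewrite le_eqVlt; apply/orP; left; apply/eqP; ring.
Qed.

End DerivativeBounds.

(** * The polynomial model *)

Section ModelConstants.
Context {R : realType}.
Variables (al Lam M th : R) (D : nat).
Hypothesis D1 : (1 < D)%N.
Hypothesis al1 : 1 < al.
Hypothesis Lam0 : 0 <= Lam.
Hypothesis LamD : Lam <= al^-1 ^+ (6 * D).
Hypothesis M0 : 0 < M.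
Hypothesis th0 : 0 <= th.
Hypothesis thM : th * M <= al ^+ (12 * D + 2).
Let s := al ^+ (3 * D - 2).

Let al0 : 0 < al. Proof. exact: lt_trans ltr01 al1. Qed.
Let be0 : 0 <= al^-1. Proof. by rewrite invr_ge0 ltW. Qed.
Let be1 : al^-1 < 1. Proof. by rewrite invf_lt1. Qed.
Let s0 : 0 < s. Proof. by rewrite exprn_gt0. Qed.

Lemma model_lam : s * Lam <= al^-1 ^+ (3 * D + 2).
Proof.
apply: le_trans (ler_wpM2l (ltW s0) LamD) _.
have -> : (6 * D = (3 * D - 2) + (3 * D + 2))%N by lia.
by rewrite pow_cancel.
Qed.

Lemma model_contr3 : th * (M / s) * (s * Lam) ^+ 3 < 1.
Proof.
have -> : th * (M / s) * (s * Lam) ^+ 3 = (th * M) * s ^+ 2 * Lam ^+ 3 by field; rewrite gt_eqF.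
apply: le_lt_trans (_ : al ^+ (12 * D + 2) * s ^+ 2 * (al^-1 ^+ (6 * D)) ^+ 3 < 1).
  have s20 := exprn_ge0 2 (ltW s0).
  apply: ler_pM.
  - exact: mulr_ge0 (mulr_ge0 th0 (ltW M0)) s20.
  - exact: exprn_ge0.
  - exact: ler_wpM2r.
  by apply: lerXn2r; rewrite ?nnegrE ?exprn_ge0.
rewrite /s -!exprM -exprD.
have -> : (6 * D * 3 = (12 * D + 2 + (3 * D - 2) * 2) + 2)%N by lia.
by rewrite pow_cancel // exprn_ilt1.
Qed.

(** The powers of [s] cancel: the rescaling helps the cubic terms only, and the quadratic error must
    bring its own decay [al^-1 ^+ 3]. *)
Lemma model_contr2 : th * (M / s) * (s * Lam) ^+ 2 * (s^-1 * al^-1 ^+ 3) < 1.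
Proof.
have -> : th * (M / s) * (s * Lam) ^+ 2 * (s^-1 * al^-1 ^+ 3) = (th * M) * (Lam ^+ 2 * al^-1 ^+ 3).
  by field; rewrite !gt_eqF.
apply: le_lt_trans (_ : al ^+ (12 * D + 2) * ((al^-1 ^+ (6 * D)) ^+ 2 * al^-1 ^+ 3) < 1).
  apply: ler_pM => //.
  - exact: mulr_ge0 th0 (ltW M0).
  - by rewrite mulr_ge0 ?exprn_ge0.
  apply: ler_wpM2r; first by rewrite exprn_ge0.
  by apply: lerXn2r; rewrite ?nnegrE ?exprn_ge0.
rewrite -exprM -exprD.
have -> : (6 * D * 2 + 3 = (12 * D + 2) + 1)%N by lia.
by rewrite pow_cancel // expr1.
Qed.

End ModelConstants.

Section Model.
Context {R : realType}.
Local Notation C := (Cplx R).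
Variable d : nat.
Local Notation V := 'rV[C]_d.
Local Notation en := (@enorm R d).

Let quarter : ((1 / 4 <= 1 :> R) * (1 / 4 < 1 :> R)) * (0 < 1 / 4 :> R).
Proof. by do !split; lra. Qed.

Let sum6_bounds (a b c e f : R) : 0 <= a -> 0 <= b -> 0 <= c -> 0 <= e -> 0 <= f ->
  [/\ b <= a + b + c + e + f + 1, 1 <= a + b + c + e + f + 1, a <= a + b + c + e + f + 1,
      c <= a + b + c + e + f + 1 & e <= a + b + c + e + f + 1] /\ f <= a + b + c + e + f + 1.
Proof. by move=> ? ? ? ? ?; split; [split|]; lra. Qed.

Lemma diff_scale (c : C) (z : V) : differentiable (fun z : V => c *: z) z.
Proof.
have -> : (fun z : V => c *: z) = mulmx^~ (c%:M) by apply/funext => w; rewrite mul_mx_scalar.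
exact: diff_mulmxr.
Qed.

Lemma shear_partZ (X X' : 'M[C]_d) (c : C) (G : V -> V -> V) u v :
  shear_part X X' (fun u v => c *: G u v) u v = c *: shear_part X X' G u v.
Proof.
rewrite /shear_part scalemxAl; congr (_ *m _); apply/rowP => i.
by rewrite [RHS]mxE ![(\row_i _) _ _]mxE -scalemxAl mxE.
Qed.

Variables (f : nat -> V -> V) (Lam M al : R).
Hypothesis d0 : (0 < d)%N.
Hypothesis al1 : 1 < al.
Hypothesis Lam0 : 0 < Lam.
Hypothesis Lam1 : Lam < 1.
Hypothesis LamD : Lam <= al^-1 ^+ (6 * 2 ^ d).
Hypothesis M0 : 0 < M.
Hypothesis MD : M < al ^+ (12 * 2 ^ d + 2).
Hypothesis fd : forall n z, en z < 1 -> differentiable (f n) z.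
Hypothesis fL : forall n z, en z < 1 -> en (f n z) <= Lam * en z.
Hypothesis fM : forall n z, en z < 1 -> en z <= M * en (f n z).

(** At time [n] the coordinate is rescaled to [s ^+ n *: z]. Bilinear terms of size [s ^+ n] become
    bounded, and [conjugation_limit] applies with constants independent of [n]. The model lives in
    the rescaled coordinates, so the domains of [h n] shrink like [s^-1 ^+ n]. *)
Theorem polynomial_model : exists (g g' h : nat -> V -> V) (r : nat -> R),
  [/\ forall n, [/\ cancel (g n) (g' n), cancel (g' n) (g n),
         forall z, differentiable (g n) z & forall z, differentiable (g' n) z],
     forall n, [/\ 0 < r n, r n <= 1,
         forall z, en z < r n -> differentiable (h n) z,
         forall z w, en z < r n -> en w < r n -> h n z = h n w -> z = w &
         forall z, en z < r n -> en (f n z) < r n.+1 /\ h n.+1 (f n z) = g n (h n z)],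
     forall m (z : nat -> V), en (z m) < 1 -> (forall n, (m <= n)%N -> z n.+1 = f n (z n)) ->
         exists2 n, (m <= n)%N & en (z n) < r n &
     forall m (w : nat -> V), (forall n, (m <= n)%N -> w n.+1 = g n (w n)) ->
         exists2 n, (m <= n)%N & exists2 z, en z < r n & h n z = w n].
Proof.
have al0 : 0 < al by exact: lt_trans ltr01 al1.
have Lam0' := ltW Lam0.
pose D := (2 ^ d)%N.
have D2 : (1 < D)%N by rewrite /D -{1}(expn0 2) ltn_exp2l.
have f00 n : f n 0 = 0.
  apply: en0_eq0; apply/eqP; rewrite eq_le en_ge0 andbT.
  by have := @fL n 0; rewrite en0 mulr0; apply.
have [K2 K20 hK2] := @second_jet R d.
have /choice[B hB] n : exists B : V -> V -> V, [/\ bil B, bbd B K2 &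
   forall z, en z <= 1 / 4 -> en (f n z - 'd (f n) 0 z - B z z) <= K2 * en z ^+ 3].
  apply: hK2 => //; first exact: fd.
  move=> z z1; apply: le_trans (fL n z1) _; apply: mulr_ile1 => //; rewrite ?en_ge0 //; exact: ltW.
pose A n := lin1_mx ('d (f n) 0).
have AE n z : z *m A n = 'd (f n) 0 z by rewrite /A lin1_mxE.
have dbd n z : en (z *m A n) <= Lam * en z /\ en z <= M * en (z *m A n).
  rewrite AE; apply: derivative_bounds => //; first exact: ltW.
  - by apply: fd; rewrite en0.
  - exact: fL.
  - exact: fM.
have Aunit n : A n \in unitmx.
  apply: injective_unitmx => v vA; apply: en0_eq0; apply/eqP; rewrite eq_le en_ge0 andbT.
  by have := (dbd n v).2; rewrite vA en0 mulr0.
pose A' n := invmx (A n).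
have AA' n : A n *m A' n = 1%:M by exact: mulmxV.
have A'A n : A' n *m A n = 1%:M by exact: mulVmx.
have hA n z : en (z *m A n) <= Lam * en z := (dbd n z).1.
have hA' n z : en (z *m A' n) <= M * en z.
  by have := (dbd n (z *m A' n)).2; rewrite -mulmxA A'A mulmx1.
have bilB n : bil (B n) by case: (hB n).
have bB n : bbd (B n) K2 by case: (hB n).
have jetB n z : en z <= 1 / 4 -> en (f n z - z *m A n - B n z z) <= K2 * en z ^+ 3.
  by rewrite AE; case: (hB n) => _ _; apply.
have [K1 [P [G [K [T [X [X' [K11 hj]]]]]]]] :=
  jets D2 al1 Lam0' LamD (ltW M0) (ltW MD) K20 A'A hA hA' bilB bB.
have K10 : 0 <= K1 by exact: le_trans ler01 K11.
have [s sE] : exists s, s = al ^+ (3 * D - 2) by eexists.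
have s1 : 1 <= s by rewrite sE; apply: exprn_ege1; exact: ltW.
have s0 : 0 < s by exact: lt_le_trans ltr01 s1.
have sn : s != 0 by rewrite gt_eqF.
have sV : s * s^-1 = 1 by rewrite divff.
have sVX n : s ^+ n * s^-1 ^+ n = 1 by rewrite -exprMn sV expr1n.
have si0 : 0 <= s^-1 by rewrite invr_ge0 ltW.
have si1 : s^-1 <= 1 by rewrite invf_le1.
have siX n : 0 <= s^-1 ^+ n <= 1 by rewrite exprn_ge0 // exprn_ile1.
have sX1 n : 1 <= s ^+ n by exact: exprn_ege1.
have nrs n : nr (cr (s^-1 ^+ n) : C) = s^-1 ^+ n by rewrite nr_cr ger0_norm // exprn_ge0.
have nrsX n : nr (cr (s ^+ n) : C) = s ^+ n by rewrite nr_cr ger0_norm // exprn_ge0 // ltW.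
(* The strict bound on [M] leaves room for the Lipschitz constant [1 + ep] of the inverse shears in
   the contraction conditions. *)
have thE : 1 < al ^+ (12 * D + 2) / M by rewrite ltr_pdivlMr // mul1r.
pose ep := Num.min 1 (al ^+ (12 * D + 2) / M - 1).
have ep0 : 0 < ep by rewrite lt_min ltr01 subr_gt0.
have ep1 : ep <= 1 by rewrite ge_min lexx.
have epM : (1 + ep) * M <= al ^+ (12 * D + 2).
  rewrite -ler_pdivlMr //; have : ep <= al ^+ (12 * D + 2) / M - 1 by rewrite ge_min lexx orbT.
  lra.
have [E [Cg [del [[E0 Cg1 del0 del1] hJ]]]] := @shear_map R d K1 K1 ep K11 K10 ep0 ep1.
pose Gt n (u v : V) : V := cr (s^-1 ^+ n) *: G n u v.
have hJ' n : exists JJ : (V -> V) * (V -> V),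
  [/\ [/\ cancel JJ.1 JJ.2, cancel JJ.2 JJ.1, forall z, differentiable JJ.1 z & forall z, differentiable JJ.2 z],
     forall z, en z <= del -> en (JJ.1 z - z - shear_part (X n) (X' n) (Gt n) z z) <= E * en z ^+ 3,
     forall z r, 1 <= r -> en z <= r -> en (JJ.1 z) <= Cg * r ^+ (2 ^ d),
     (JJ.2 0 = 0 /\ forall x y, en x <= del -> en y <= del -> en (JJ.2 x - JJ.2 y - (x - y)) <= ep * en (x - y)) &
     ((forall u v, Gt n u v = 0) -> forall z, JJ.1 z = z)].
  have [[_ bG _ _] [h1 h2 h3 h4] [_ bG' _] _] := hj n.
  have [||J [J' hJJ]] := hJ (X n) (X' n) (Gt n) h1 h2 h3 h4.
  - exact: bilS.
  - have := bbdS (cr (s^-1 ^+ n)) bG'; rewrite nrs exprM -sE mulrCA [s^-1 ^+ n * _]mulrC sVX mulr1.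
    exact.
  by exists (J, J').
have {hJ hJ'} [JJ hJ] := choice hJ'.
pose J n := (JJ n).1; pose J' n := (JJ n).2.
(* The target is rescaled by one power more than the source: the linear part gains a factor [s], its
   inverse loses one, and a bilinear part is multiplied by [s * s^-1 ^+ n]. *)
pose phi n z := cr (s ^+ n.+1) *: f n (cr (s^-1 ^+ n) *: z).
pose At n := cr s *: A n; pose At' n := cr s^-1 *: A' n.
pose Bt n (u v : V) : V := cr (s * s^-1 ^+ n) *: B n u v.
pose Pt n (u v : V) : V := cr (s^-1 ^+ n) *: P n u v.
pose Kt n := shear_part (X n) (X' n) (Gt n).
pose KK := s * K2 + M / s + K1 + d%:R * K1 ^+ 6 * K1 + E + 1.
have [p1 p2 p3] : [/\ 0 <= s * K2, 0 <= M / s & 0 <= d%:R * K1 ^+ 6 * K1].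
  split; first by rewrite mulr_ge0 // ltW.
    by rewrite divr_ge0 // ltW.
  by rewrite mulr_ge0 // mulr_ge0 // exprn_ge0.
have [[MK KKo sK2K KK1 KKp] KKE] : [/\ M / s <= KK, 1 <= KK, s * K2 <= KK, K1 <= KK &
    d%:R * K1 ^+ 6 * K1 <= KK] /\ E <= KK.
  exact: sum6_bounds p1 p2 K10 p3 E0.
have zAt n (z : V) : z *m At n = cr s *: (z *m A n) by rewrite -scalemxAr.
have zAt' n (z : V) : z *m At' n = cr s^-1 *: (z *m A' n) by rewrite -scalemxAr.
have c1 : cr s * cr s^-1 = 1 :> C by rewrite -crM sV.
have AtAt' n : At n *m At' n = 1%:M by rewrite /At /At' -scalemxAl -scalemxAr scalerA c1 scale1r AA'.
have At'At n : At' n *m At n = 1%:M by rewrite /At /At' -scalemxAl -scalemxAr scalerA mulrC c1 scale1r A'A.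
have lam_bd : 0 <= s * Lam <= al^-1 ^+ (3 * D + 2).
  apply/andP; split; first exact: mulr_ge0 (ltW s0) Lam0'.
  have th0 : 0 <= 1 + ep by exact: addr_ge0 ler01 (ltW ep0).
  by rewrite sE; exact: (model_lam D2 al1 Lam0' LamD M0 th0 epM).
have be0 : 0 <= al^-1 by rewrite invr_ge0 ltW.
have be1 : al^-1 < 1 by rewrite invf_lt1.
have lam1 : s * Lam <= 1.
  by case/andP: lam_bd => _ h; apply: le_trans h _; apply: exprn_ile1 => //; exact: ltW.
have lam_lt1 : s * Lam < 1.
  by case/andP: lam_bd => _ h; apply: le_lt_trans h _; rewrite exprn_ilt1 // addn2.
have lam0 : 0 <= s * Lam by case/andP: lam_bd.
have inv_en n z : en (cr (s^-1 ^+ n) *: z) = s^-1 ^+ n * en z by rewrite enZ nrs.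
have le_inv n z (x : R) : en z <= x -> en (cr (s^-1 ^+ n) *: z) <= x.
  by move=> h; rewrite inv_en; apply: le_trans h; rewrite ler_piMl ?en_ge0 //; case/andP: (siX n).
have [||||||||||||||||||||||||||||||r [rho' [h [[r0 rrho rho'0] hh]]]] :=
  @conjugation_limit R d phi J J' At At' Bt Pt Kt (s * Lam) (M / s) (1 + ep) KK K1 (s^-1 * al^-1 ^+ 3) del (1 / 4).
- by rewrite lam0 lam1.
- by rewrite p2; exact: MK.
- exact: addr_ge0 ler01 (ltW ep0).
- exact: KKo.
- exact: K10.
- by rewrite mulr_ge0 ?exprn_ge0 //= mulr_ile1 ?exprn_ge0 // exprn_ile1 // ltW.
- exact: del0.
- exact: del1.
- exact: quarter.2.
- exact: quarter.1.1.
- exact: AtAt'.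
- exact: At'At.
- move=> n z; rewrite zAt enZ nr_cr gtr0_norm // -mulrA; apply: ler_wpM2l; [exact: ltW|exact: hA].
- move=> n z; rewrite zAt' enZ nr_cr ger0_norm // [M / s]mulrC -mulrA; apply: ler_wpM2l => //; exact: hA'.
- move=> n z z4; rewrite zAt /Bt /phi.
  have := jetB n _ (le_inv n z _ z4); set y := cr (s^-1 ^+ n) *: z => hy.
  have -> : cr (s ^+ n.+1) *: f n y - cr s *: (z *m A n) - cr (s * s^-1 ^+ n) *: B n z z =
     cr (s ^+ n.+1) *: (f n y - y *m A n - B n y y).
    rewrite !scalerBr /y -scalemxAl scalerA -crM (bilZl (bilB n)) (bilZr (bilB n)) !scalerA -!crM.
    by rewrite exprS -!mulrA !mulrA -(mulrA s) sVX mulr1.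
  rewrite enZ nrsX; apply: le_trans (ler_wpM2l (exprn_ge0 _ (ltW s0)) hy) _.
  rewrite /y inv_en; apply: le_trans (_ : s * K2 * en z ^+ 3 <= _); last first.
    by apply: ler_wpM2r; [exact: exprn_ge0 (en_ge0 z)|exact: sK2K].
  have -> : s ^+ n.+1 * (K2 * (s^-1 ^+ n * en z) ^+ 3) =
     (s * K2 * en z ^+ 3) * ((s ^+ n * s^-1 ^+ n) * (s^-1 ^+ n) ^+ 2) by rewrite exprS; ring.
  rewrite sVX mul1r; apply: ler_piMr; first by rewrite !mulr_ge0 ?exprn_ge0 ?en_ge0 ?(ltW s0).
  by case/andP: (siX n) => *; rewrite exprn_ile1.
- move=> n z z4; rewrite /phi enZ nrsX.
  have y1 : en (cr (s^-1 ^+ n) *: z) < 1 by apply: le_lt_trans (le_inv n z _ z4) quarter.1.2.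
  apply: le_trans (ler_wpM2l (exprn_ge0 _ (ltW s0)) (fL n y1)) _; rewrite inv_en.
  have -> : s ^+ n.+1 * (Lam * (s^-1 ^+ n * en z)) = (s ^+ n * s^-1 ^+ n) * (s * Lam * en z) by rewrite exprS; ring.
  by rewrite sVX mul1r.
- move=> n z z4; have y1 : en (cr (s^-1 ^+ n) *: z) < 1 by apply: le_lt_trans (le_inv n z _ z4) quarter.1.2.
  have h1 := (diff_comp_val 0 (diff_scale (cr (s^-1 ^+ n)) z) (fd n y1)).1.
  exact: (diff_comp_val 0 h1 (diff_scale (cr (s ^+ n.+1)) _)).1.
- by move=> n; case: (hj n) => -[bP _ _ _] _ _ _; exact: bilS.
- by move=> n; apply: bil_shear_part; case: (hj n) => -[_ bG _ _] _ _ _; exact: bilS.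
- move=> n; apply: bbdW (bbdS (cr (s * s^-1 ^+ n)) (bB n)).
  rewrite nr_cr ger0_norm; last by rewrite mulr_ge0 ?(ltW s0) ?exprn_ge0.
  apply: le_trans (_ : s * K2 <= _); last exact: sK2K.
  by apply: ler_wpM2r => //; rewrite ler_piMr ?(ltW s0) //; case/andP: (siX n).
- move=> n; case: (hj n) => _ _ [bP _ _] _.
  apply: bbdW (bbdS (cr (s^-1 ^+ n)) bP); rewrite nrs exprM -sE mulrCA [s^-1 ^+ n * _]mulrC sVX mulr1.
  exact: KK1.
- move=> n; case: (hj n) => _ [_ _ h3 h4] [_ bG _] _.
  have bGt : bbd (Gt n) K1.
    have := bbdS (cr (s^-1 ^+ n)) bG; rewrite nrs exprM -sE mulrCA [s^-1 ^+ n * _]mulrC sVX mulr1.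
    exact.
  by apply: bbdW (bbd_shear_part K11 h3 h4 K10 bGt); exact: KKp.
- move=> n z; case: (hj n) => -[bP _ KE TE] _ [_ _ bT] _.
  have bPS : bil (P n.+1) by case: (hj n.+1) => -[].
  have -> : (Pt n.+1 (z *m At n) (z *m At n) + Bt n z z) *m At' n - Kt n z z - Pt n z z = cr (s^-1 ^+ n) *: T n z z.
    rewrite TE !zAt zAt' /Pt /Bt (bilZl bPS) (bilZr bPS) /Kt shear_partZ -KE !scalerA !scalerBr -!crM.
    have key (a b : V) : cr s^-1 *: ((cr (s^-1 ^+ n.+1 * s * s) *: a + cr (s * s^-1 ^+ n) *: b) *m A' n) =
        cr (s^-1 ^+ n) *: ((a + b) *m A' n).
      have -> : s^-1 ^+ n.+1 * s * s = s * s^-1 ^+ n by rewrite exprS; field.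
      by rewrite -scalerDr -scalemxAl scalerA -crM mulrA mulVf // mul1r.
    by rewrite key.
  rewrite enZ nrs; apply: le_trans (ler_wpM2l _ (bT z z)) _; first by case/andP: (siX n).
  rewrite exprMn -exprM expr2 le_eqVlt; apply/orP; left; apply/eqP; ring.
- by move=> n; case: (hJ n) => -[].
- by move=> n; case: (hJ n) => -[].
- by move=> n z; have [[_ _ _ h1] _ _ _ _] := hJ n; exact: h1.
- move=> n z zd; case: (hJ n) => _ hj2 _ _ _; apply: le_trans (hj2 z zd) _.
  by apply: ler_wpM2r; [exact: exprn_ge0 (en_ge0 z)|exact: KKE].
- move=> n x y xd yd; case: (hJ n) => _ _ _ [_ /(_ x y xd yd)] h _.
  rewrite -[_ - _](subrK (x - y)); apply: le_trans (enD _ _) _; rewrite /J' mulrDl mul1r addrC lerD2l.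
  exact: h.
- have th0 : 0 <= 1 + ep by exact: addr_ge0 ler01 (ltW ep0).
  by rewrite sE; exact: (model_contr3 D2 al1 Lam0' LamD M0 th0 epM).
- have th0 : 0 <= 1 + ep by exact: addr_ge0 ler01 (ltW ep0).
  by rewrite sE; exact: (model_contr2 D2 al1 Lam0' LamD M0 th0 epM).
have scK n (z : V) : cr (s^-1 ^+ n) *: (cr (s ^+ n) *: z) = z.
  by rewrite scalerA -crM mulrC sVX scale1r.
have scK' n (z : V) : cr (s ^+ n) *: (cr (s^-1 ^+ n) *: z) = z by rewrite scalerA -crM sVX scale1r.
have sn0 n : 0 < s ^+ n by exact: exprn_gt0.
have si_gt0 n : 0 < s^-1 ^+ n by rewrite exprn_gt0 // invr_gt0.
have sc n z : en z < r * s^-1 ^+ n -> en (cr (s ^+ n) *: z) < r.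
  by move=> zr; rewrite enZ nrsX -[ltRHS]mulr1 -(sVX n) mulrCA ltr_pM2l.
have r1 n : r * s^-1 ^+ n <= 1.
  apply: le_trans (_ : r <= _); last by exact: le_trans rrho quarter.1.1.
  by apply: ler_piMr; [exact: ltW|case/andP: (siX n)].
exists (fun n z => J n z *m At n), (fun n z => J' n (z *m At' n)), (fun n z => h n (cr (s ^+ n) *: z)),
  (fun n => r * s^-1 ^+ n); split.
- move=> n; have [[h1 h2 h3 h4] _ _ _ _] := hJ n; split.
  + by move=> z; rewrite -mulmxA AtAt' mulmx1; exact: h1.
  + by move=> z; rewrite -[RHS]mulmx1 -(At'At n) mulmxA; congr (_ *m _); exact: h2.
  + move=> z; exact: (diff_comp_val 0 (h3 z) (diff_mulmxr (At n) _)).1.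
  + move=> z; exact: (diff_comp_val 0 (diff_mulmxr (At' n) z) (h4 _)).1.
- move=> n; have [hd hi _ hc] := hh n; split.
  + exact: mulr_gt0.
  + exact: r1.
  + move=> z /sc zr; exact: (diff_comp_val 0 (diff_scale (cr (s ^+ n)) z) (hd _ zr)).1.
  + by move=> z w /sc zr /sc wr /(hi _ _ zr wr) e; rewrite -(scK n z) e scK.
  + move=> z zr; have z1 : en z < 1 by exact: lt_le_trans zr (r1 n).
    split.
      apply: le_lt_trans (fL n z1) _; apply: le_lt_trans (_ : s^-1 * en z < _).
        apply: ler_wpM2r; first exact: en_ge0.
        by rewrite -[leRHS]mulr1 mulrC ler_pdivlMr // mulrC.
      by rewrite exprS mulrCA ltr_pM2l // invr_gt0.
    by rewrite -(hc _ (sc n z zr)) /phi scK.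
(* Orbits of [f] shrink like [Lam ^+ n], faster than the domains of radius [r * s^-1 ^+ n], because
   [s * Lam < 1]. *)
- move=> m z zm hz; have [N hN] := geo_small (s ^+ m) lam0 lam_lt1 r0.
  have dec j : en (z (m + j)%N) <= Lam ^+ j /\ en (z (m + j)%N) < 1.
    elim: j => [|j [ih1 ih2]]; first by rewrite addn0 expr0; split => //; exact: ltW.
    rewrite addnS hz ?leq_addr //; have h1 := fL (m + j) ih2; split.
      by apply: le_trans h1 _; rewrite exprS; apply: ler_wpM2l.
    by apply: le_lt_trans h1 _; apply: mulr_ilt1 => //; exact: en_ge0.
  exists (m + N)%N; first exact: leq_addr.
  apply: le_lt_trans (dec N).1 _; have := hN N (leqnn N).
  rewrite exprMn -(ltr_pM2r (si_gt0 (m + N)%N)); congr (_ < _).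
  have := sVX (m + N)%N; rewrite [s ^+ (m + N)]exprD => e.
  by rewrite mulrA mulrAC e mul1r.
(* [orbit_decay] is used with [nu = al^-1]; once the orbit is below [rho'], it lies in the image of
   [h]. *)
move=> m w hw; have lamnu : s * Lam <= al^-1 ^+ 2.
  case/andP: lam_bd => _ h1; apply: le_trans h1 _; apply: ler_wiXn2l => //; first exact: ltW.
  by rewrite addn2.
have be_gt0 : 0 < al^-1 by rewrite invr_gt0.
have [||n mn wn] := @orbit_decay R (fun n => en (w n)) (s * Lam) Cg al^-1 D m D2 be_gt0 be1 lam0 lamnu Cg1
   (fun n => en_ge0 (w n)) _ _ rho' rho'0.
- move=> n mn hn; have [_ _ _ _ hG] := hJ n; have [_ _ _ hG0] := hj n.
  have Jid : J n (w n) = w n by apply: hG => u v; rewrite /Gt hG0 // scaler0.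
  by rewrite hw // Jid zAt enZ nr_cr gtr0_norm // -mulrA; apply: ler_wpM2l; [exact: ltW|exact: hA].
- move=> k x mk x1 wx; have [_ _ hg _ _] := hJ (2 * D ^ k)%N.
  rewrite hw // zAt enZ nr_cr gtr0_norm // -mulrA; apply: ler_wpM2l; first exact: ltW.
  apply: le_trans (hA _ _) _; apply: ler_wpM2l => //; exact: hg.
have [_ _ hs _] := hh n; have [z zr hz] := hs (w n) (le_lt_trans (nr_le_en _) wn).
exists n => //; exists (cr (s^-1 ^+ n) *: z); last by rewrite scK'.
by rewrite enZ nrs mulrC ltr_pM2r.
Qed.

End Model.

(** * From the bunching condition to the base [al] *)

Section Bunching.
Context {R : realType}.

(** For [d = 2] the product is 12/14. Otherwise, with [x = 2^(d-1)] and [y = 2^(d (d-1)^2)], it is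
    [6 x (x - 1) / (y^2 - y - x + 1)], and [y >= 8 x^2] suffices. *)
Lemma bunching_eps_bound d : (2 <= d)%N ->
  0 <= bunching_eps R d /\ 3 * (2 ^ d)%:R * bunching_eps R d <= 1.
Proof.
move=> d2; rewrite /bunching_eps; case: eqVneq => [->|dn2].
  by split; [rewrite divr_ge0|rewrite (_ : (2 ^ 2)%N = 4%N) //; lra].
have d3 : (3 <= d)%N by rewrite ltn_neqAle eq_sym dn2.
pose x := 2 ^+ (d - 1) : R; pose y := 2 ^+ (d * (d - 1) ^ 2) : R.
have x4 : 4 <= x.
  have -> : (4 : R) = 2 ^+ 2 by rewrite -natrX.
  by apply: ler_weXn2l => //; [lra|lia].
have yx : 8 * x ^+ 2 <= y.
  have -> : 8 * x ^+ 2 = 2 ^+ (3 + (d - 1) * 2) :> R by rewrite exprD exprM; congr (_ * _); rewrite -natrX.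
  by apply: ler_weXn2l; [lra|nia].
have yy : 2 ^+ (2 * d * (d - 1) ^ 2) = y ^+ 2 :> R.
  by rewrite /y -exprM; congr (_ ^+ _); lia.
rewrite yy -/x -/y.
have x2 : 4 * x <= x ^+ 2 by rewrite expr2; apply: ler_wpM2r => //; lra.
have y2 : 2 * y <= y ^+ 2 by rewrite expr2; apply: ler_wpM2r; lra.
have den : 0 < y ^+ 2 - y - x + 1 by lra.
split; first by rewrite divr_ge0 ?(ltW den) //; lra.
have -> : (2 ^ d)%:R = 2 * x.
  by rewrite natrX /x -exprS; congr (_ ^+ _); lia.
rewrite [leLHS]mulrA ler_pdivrMr // mul1r.
have : 3 * (2 * x) * (x - 1) = 6 * x ^+ 2 - 6 * x by ring.
lra.
Qed.

(** With [al] the power of [Lam] of exponent [-1 / (6 D)] the bound on [Lam] is an equality.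
    Bunching gives [M < al^(6 D (2 + eps))], and [6 D eps <= 2]. *)
Lemma bunching_base (Lam M eps : R) (D : nat) : (0 < D)%N -> 0 < Lam -> Lam < 1 -> 0 < M ->
  0 <= eps -> 3 * D%:R * eps <= 1 -> Lam `^ (2 + eps) * M < 1 ->
  exists al : R, [/\ 1 < al, Lam <= al^-1 ^+ (6 * D) & M < al ^+ (12 * D + 2)].
Proof.
move=> D0 L0 L1 M0 eps0 epsD bunch.
have D0' : (0 : R) < D%:R by rewrite ltr0n.
have n0 : (0 : R) < (6 * D)%:R by rewrite ltr0n; lia.
pose al := Lam `^ (- ((6 * D)%:R)^-1).
have al0 : 0 < al by exact: powR_gt0.
have alV : al^-1 = Lam `^ (((6 * D)%:R)^-1) by rewrite /al powRN invrK.
have alX : al^-1 ^+ (6 * D) = Lam.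
  by rewrite alV -powR_mulrn ?powR_ge0 // -powRrM mulVf ?gt_eqF // powRr1 // ltW.
have al1 : 1 < al.
  rewrite ltNge; apply/negP => h.
  have : 1 <= al^-1 by rewrite invf_ge1.
  move=> /(exprn_ege1 (6 * D)); rewrite alX => ?; lra.
exists al; split => //; first by rewrite alX.
have Lp : 0 < Lam `^ (2 + eps) by exact: powR_gt0.
have MV : M < Lam `^ (- (2 + eps)).
  by rewrite powRN -[X in _ < X]mul1r ltr_pdivlMr // mulrC.
apply: lt_le_trans MV _.
rewrite -powR_mulrn ?(ltW al0) // /al -powRrM.
have L01 : 0 < Lam <= 1 by rewrite L0 ltW.
apply: (ger_powR L01); rewrite mulNr lerN2.
have -> : ((6 * D)%:R)^-1 * (12 * D + 2)%:R = 2 + (3 * D%:R)^-1 :> R.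
  by rewrite natrD !natrM; field; rewrite gt_eqF.
rewrite lerD2l -[leRHS]mul1r ler_pdivlMr ?mulr_gt0 // mulrC.
exact: epsD.
Qed.

End Bunching.

(** * Holomorphic bijections onto C^d *)

Section Topology.
Context {R : realType}.
Local Notation C := (Cplx R).
Variable d : nat.
Local Notation V := 'rV[C]_d.
Local Notation en := (@enorm R d).

Lemma open_nr (A : set V) : open A <-> forall x, A x -> exists2 e : R, 0 < e & forall y, nr (y - x) < e -> A y.
Proof.
rewrite openE; split=> h x /h; first by move=> /nbhs_nr.
by move=> ?; apply/nbhs_nr.
Qed.

Lemma open_set_type (T : topologicalType) (U : set T) (A : set U) :
  open A <-> exists2 Q, open Q & A = set_val @^-1` Q.
Proof. by split=> -[Q oQ e]; exists Q. Qed.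

Lemma open_en z (s : R) : en z < s -> exists2 e : R, 0 < e & forall w, nr (w - z) < e -> en w < s.
Proof.
move=> z1; have d1 : (0 : R) < d%:R + 1 by rewrite ltr_wpDl.
exists ((s - en z) / (d%:R + 1)); first by rewrite divr_gt0 // subr_gt0.
move=> w; rewrite ltr_pdivlMr // => h; rewrite -(subrK z w); apply: le_lt_trans (enD _ _) _.
rewrite -ltrBrDr; apply: le_lt_trans (en_le_nr _) _; apply: le_lt_trans h.
by rewrite mulrC; apply: ler_wpM2l; rewrite ?nr_ge0 // lerDl.
Qed.

Lemma open_unit_ball : open (@unit_ball R d).
Proof. by apply/open_nr => x; exact: open_en. Qed.

Lemma rat_approx (x e : R) : 0 < e -> exists q : rat, `|x - ratr q| < e.
Proof.
move=> e0; have [|q] := @rat_in_itvoo R (x - e) (x + e); first by lra.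
rewrite in_itv /= => /andP[h1 h2]; exists q; rewrite ltr_norml; apply/andP; split; lra.
Qed.

Let half_lt (a : R) : 0 < a -> a / 4 + a / 4 < a. Proof. lra. Qed.

Lemma second_countable_rV : @second_countable V.
Proof.
pose q (p : 'rV[rat]_d * 'rV[rat]_d) : V := \row_j (cr (ratr (p.1 ord0 j)) + 'i%C * cr (ratr (p.2 ord0 j))).
pose b (p : 'rV[rat]_d * 'rV[rat]_d * nat) : set V := [set y | nr (y - q p.1) < (p.2.+1%:R)^-1].
exists (range b); first by apply: card_le_trans (card_image_le b setT) _; exact: countableP.
split.
  move=> _ [p _ <-]; apply/open_nr => x xp; exists ((p.2.+1%:R)^-1 - nr (x - q p.1)).
    by rewrite subr_gt0.
  by move=> y yx; apply: le_lt_trans (nr_tri y x (q p.1)) _; rewrite -ltrBrDr.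
move=> x A /nbhs_nr[e e0 he].
have [n hn] : exists n, 2 / (n.+1%:R) < e.
  exists (Num.truncn (2 / e)); rewrite ltr_pdivrMr ?ltr0n // mulrC -ltr_pdivrMr //.
  by apply: truncnS_gt; rewrite divr_ge0 // ltW.
have n0 : (0 : R) < (n.+1%:R)^-1 by rewrite invr_gt0 ltr0n.
pose dl : R := (n.+1%:R)^-1 / 4.
have dl0 : 0 < dl by rewrite divr_gt0.
have /choice[a ha] (j : 'I_d) := rat_approx (complex.Re (x ord0 j : R[i])) dl0.
have /choice[c hc] (j : 'I_d) := rat_approx (complex.Im (x ord0 j : R[i])) dl0.
pose p : 'rV[rat]_d * 'rV[rat]_d := (\row_j a j, \row_j c j).
have xq : nr (x - q p) < (n.+1%:R)^-1.
  apply: le_lt_trans (_ : dl + dl < _); last exact: half_lt n0.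
  apply: nr_mx_le; first by rewrite addr_ge0 // ltW.
  move=> i j; rewrite (ord1 i) !mxE /=; apply: le_trans (nr_ReIm _) _.
  have -> : complex.Re (x ord0 j - (cr (ratr (a j)) + 'i%C * cr (ratr (c j))) : R[i]) = complex.Re (x ord0 j : R[i]) - ratr (a j).
    rewrite ReB; congr (_ - _); rewrite /cr /=; ring.
  have -> : complex.Im (x ord0 j - (cr (ratr (a j)) + 'i%C * cr (ratr (c j))) : R[i]) = complex.Im (x ord0 j : R[i]) - ratr (c j).
    rewrite ImB; congr (_ - _); rewrite /cr /=; ring.
  by rewrite lerD // ltW.
exists (b (p, n)); first by split; [exists (p, n)|].
move=> y yb; apply: he; apply: lt_trans hn.
apply: le_lt_trans (nr_tri y (q p) x) _; rewrite (nrBC (q p)) mulrDl mul1r; exact: ltrD.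
Qed.

Lemma diff_local e (f g : V -> 'rV[C]_e) z (r : R) : 0 < r ->
  (forall w, nr (w - z) < r -> f w = g w) -> differentiable f z -> differentiable g z.
Proof.
move=> r0 h df; exact: (hasd_rV (hasd_local r0 h (hasd_diff df))).1.
Qed.

Lemma complex_space_manifold : is_complex_manifold (complex_space R d).
Proof.
split.
- by split; [exact: norm_hausdorff|exact: second_countable_rV].
- by move=> i; exact: openT.
- move=> i; split.
  + by move=> z w; exact: val_inj.
  + by apply/continuousP => A oA; apply/open_set_type; exists A.
  + move=> A /open_set_type[Q oQ ->]; apply/open_nr => _ [z Qz <-].
    move/open_nr: oQ => /(_ _ Qz)[e e0 he]; exists e => // y /he Qy.
    by exists (SigSub (mem_set (I : setT y))).
- by move=> x; exists tt, (SigSub (mem_set (I : setT x))).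
by move=> i j; exists id => z w e; split; [exact: e|]; exact: (@ex_diff _ _ _ _ _ _ _ (is_diff_id _)).
Qed.

Section GlobalChart.
Variables (W : topologicalType) (I : Type) (c : I -> set_type (@unit_ball R d) -> W) (F : W -> V).
Variable (u : I -> V -> V).
Hypothesis openW : forall A : set W, open A <-> forall i, open (c i @^-1` A).
Hypothesis coverW : forall x, exists i z, c i z = x.
Hypothesis Finj : injective F.
Hypothesis Fsurj : forall y, exists x, F x = y.
Hypothesis uE : forall i z, F (c i z) = u i (\val z).
Hypothesis ud : forall i z, en z < 1 -> differentiable (u i) z.
Hypothesis ui : forall i z w, en z < 1 -> en w < 1 -> u i z = u i w -> z = w.

Let en_val (z : set_type (@unit_ball R d)) : en (\val z) < 1. Proof. by case: z => z zP /=; exact: set_mem zP. Qed.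

(** Here Osgood's theorem enters: injectivity of [u i] alone yields holomorphic local inverses. *)
Lemma local_inverse i z0 (rho : R) : en z0 < 1 -> 0 < rho -> exists sig : R, exists psi : V -> V, 0 < sig /\
  forall y, nr (y - u i z0) < sig -> [/\ en (psi y) < 1, nr (psi y - z0) < rho, u i (psi y) = y & differentiable psi y].
Proof.
move=> z01 rho0; have [e e0 he] := open_en z01.
pose r := Num.min e rho; have r0 : 0 < r by rewrite lt_min e0.
have inb z : nr (z - z0) < r -> en z < 1 by rewrite lt_min => /andP[/he].
have uid z : nr (z - z0) < r -> differentiable (u i) z by move=> /inb; exact: ud.
have uii z w : nr (z - z0) < r -> nr (w - z0) < r -> u i z = u i w -> z = w by move=> /inb zr /inb; exact: ui.
have ji := osgood r0 uid uii.
have [tau [sig [psi [/andP[tau0 taur] sig0 h _]]]] := inverse_function r0 uid ji.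
exists sig, psi; split => // y /h[h1 h2 h3].
have h4 := lt_le_trans h1 taur; split => //; first exact: inb.
by apply: lt_le_trans h4 _; rewrite ge_min lexx orbT.
Qed.

(** The inverse of [u i], extended by 0 because [local_holomorphic] asks for a map on the whole of
    C^d. *)
Definition chart_back i (y : V) : V :=
  if pselect (exists z, en z < 1 /\ u i z = y) is left e then projT1 (cid e) else 0.

Lemma chart_backK i z : en z < 1 -> chart_back i (u i z) = z.
Proof.
move=> z1; rewrite /chart_back; case: pselect => [e|]; last by case; exists z.
by case: (cid e) => w [w1 ew] /=; exact: ui ew.
Qed.

Lemma chart_back_diff i z : en z < 1 -> differentiable (chart_back i) (u i z).
Proof.
move=> z1; have [sig [psi [sig0 h]]] := local_inverse i z1 ltr01.
have h0 : nr (u i z - u i z) < sig by rewrite subrr nr0.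
have [_ _ _ dpsi] := h _ h0; apply: (diff_local sig0 _ dpsi) => y /h[h1 _ h2 _].
by rewrite -{2}h2 chart_backK.
Qed.

Lemma open_preimage_chart (Q : set V) : open Q -> open (F @^-1` Q).
Proof.
move=> oQ; apply/openW => i; apply/open_set_type.
exists [set z | en z < 1 /\ Q (u i z)]; last first.
  apply/seteqP; split=> z /=; rewrite /preimage /= uE; first by move=> h; split => //; exact: en_val.
  by case.
apply/open_nr => z [z1 Qz]; have [e e0 he] := open_en z1.
move/open_nr: oQ => /(_ _ Qz)[s s0 hs].
have /continuous_nrP /(_ s s0)[t t0 ht] := differentiable_continuous (ud i z1).
exists (Num.min e t); first by rewrite lt_min e0.
by move=> y; rewrite lt_min => /andP[/he y1 /ht yt]; split => //; exact: hs.
Qed.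

Lemma open_image_chart (A : set W) : open A -> open (F @` A).
Proof.
move=> /openW oA; apply/open_nr => _ [x Ax <-]; have [i [z ez]] := coverW x.
have /open_set_type[Q oQ eQ] := oA i.
have Qz : Q (\val z).
  by have : (set_val @^-1` Q) z by rewrite -eQ /preimage /= ez.
move/open_nr: oQ => /(_ _ Qz)[e e0 he].
have [sig [psi [sig0 h]]] := local_inverse i (en_val z) e0.
exists sig => // y; rewrite -ez uE => /h[h1 /he h2 h3 _].
have pb : (@unit_ball R d) (psi y) by [].
exists (c i (SigSub (mem_set pb))); last by rewrite uE.
have : (set_val @^-1` Q) (SigSub (mem_set pb) : set_type (@unit_ball R d)) by [].
by rewrite -eQ.
Qed.

Definition chart_space := @ChartedSpace R d W I (fun=> @unit_ball R d) c.

Let G (y : V) : W := projT1 (cid (Fsurj y)).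
Let GK y : F (G y) = y. Proof. by rewrite /G; case: (cid _). Qed.
Let FK x : G (F x) = x. Proof. by apply: Finj; rewrite GK. Qed.

(** [F] is a homeomorphism onto C^d, from which separation and a countable base are transported; the
    transition maps are [chart_back j \o u i]. *)
Lemma chart_space_manifold : is_complex_manifold chart_space.
Proof.
split.
- split.
    rewrite open_hausdorff => x y xy.
    have : F x != F y by apply: contra_neq xy; exact: Finj.
    have := @norm_hausdorff _ V; rewrite open_hausdorff => /[apply] -[[A B] /= [xA yB] [oA oB AB]].
    exists (F @^-1` A, F @^-1` B) => /=.
      by rewrite !inE; rewrite !inE in xA yB.
    split; [exact: open_preimage_chart|exact: open_preimage_chart|].
    by rewrite -preimage_setI; move/eqP: AB => ->; rewrite preimage_set0.
  have [B cB [oB hB]] := second_countable_rV.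
  exists ((fun b => F @^-1` b) @` B).
    exact: card_le_trans (card_image_le _ _) cB.
  split; first by move=> _ [b Bb <-]; apply: open_preimage_chart; exact: oB.
  move=> x A; rewrite nbhsE => -[A' [oA' A'x] A'A].
  have nF : nbhs (F x) (F @` A').
    by apply: open_nbhs_nbhs; split; [exact: open_image_chart|exists x].
  have [b [Bb bx] bA'] := hB (F x) _ nF.
  exists (F @^-1` b); first by split => //; exists b.
  by move=> y by'; apply: A'A; have [y' A'y' /Finj <-] := bA' _ by'.
- by move=> i; exact: open_unit_ball.
- move=> i; split.
  + by move=> z w e; have e' : c i z = c i w := e; apply: val_inj; apply: ui (en_val z) (en_val w) _; exact: etrans (esym (uE i z)) (etrans (congr1 F e') (uE i w)).
  + by apply/continuousP => A /openW; exact.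
  + move=> A /open_set_type[Q oQ ->].
    suff -> : c i @` (set_val @^-1` Q) = F @^-1` (u i @` [set z | en z < 1 /\ Q z]).
      apply: open_preimage_chart; apply/open_nr => _ [z [z1 Qz] <-].
      move/open_nr: oQ => /(_ _ Qz)[e e0 he].
      have [sig [psi [sig0 h]]] := local_inverse i z1 e0.
      by exists sig => // y /h[h1 /he h2 h3 _]; exists (psi y).
    apply/seteqP; split=> [_ [z Qz <-]|x [z [z1 Qz] e]].
      by exists (\val z); [split => //; exact: en_val|rewrite uE].
    have pb : (@unit_ball R d) z by [].
    by exists (SigSub (mem_set pb)) => //; apply: Finj; rewrite uE.
- exact: coverW.
move=> i j; exists (chart_back j \o u i) => z w /= e.
have eu : u i (\val z) = u j (\val w) by rewrite -!uE; congr F.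
split; first by rewrite /= eu chart_backK.
apply: (diff_comp_val 0 (ud i (en_val z)) _).1; rewrite eu; exact: chart_back_diff.
Qed.

Lemma global_chart : biholomorphic chart_space (complex_space R d).
Proof.
split; [exact: chart_space_manifold|exact: complex_space_manifold|].
exists F, G; split => //.
  split; first by apply/continuousP => A; exact: open_preimage_chart.
  move=> i j; exists (u i) => z w /= e; split; first by rewrite -uE.
  exact: (ud i (en_val z)).
split.
  apply/continuousP => A /open_image_chart; suff -> : F @` A = G @^-1` A by [].
  apply/seteqP; split=> [_ [x Ax <-]|y Ay]; first by rewrite /preimage /= FK.
  by exists (G y).
move=> i j; exists (chart_back j) => z w /= e.
have eu : \val z = u j (\val w) by rewrite -uE -e GK.
by rewrite eu; split; [exact: chart_backK|exact: chart_back_diff].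
Qed.

End GlobalChart.
End Topology.

(** * The map from the basin to C^d *)

Section BasinMap.
Context {R : realType} {d : nat}.
Local Notation C := (Cplx R).
Local Notation V := 'rV[C]_d.
Local Notation en := (@enorm R d).
Local Notation ball := (@unit_ball R d).
Variable f : nat -> {injfun ball >-> ball}.
Variables (g g' h : nat -> V -> V) (r : nat -> R).
Hypothesis fd : forall n z, en z < 1 -> differentiable (f n) z.
Hypothesis gK : forall n, cancel (g n) (g' n).
Hypothesis g'K : forall n, cancel (g' n) (g n).
Hypothesis g'd : forall n z, differentiable (g' n) z.
Hypothesis r1 : forall n, r n <= 1.
Hypothesis hd : forall n z, en z < r n -> differentiable (h n) z.
Hypothesis hi : forall n z w, en z < r n -> en w < r n -> h n z = h n w -> z = w.
Hypothesis hc : forall n z, en z < r n -> en (f n z) < r n.+1 /\ h n.+1 (f n z) = g n (h n z).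
Hypothesis attract : forall m (z : nat -> V), en (z m) < 1 -> (forall n, (m <= n)%N -> z n.+1 = f n (z n)) ->
  exists2 n, (m <= n)%N & en (z n) < r n.
Hypothesis model_orbit : forall m (w : nat -> V), (forall n, (m <= n)%N -> w n.+1 = g n (w n)) ->
  exists2 n, (m <= n)%N & exists2 z, en z < r n & h n z = w n.

Local Notation orb := (tail_orbit (U := fun=> ball) f).
Local Notation W := (basin_set (U := fun=> ball) f).
Local Notation chart m := (@f_infty R d (fun=> ball) f m).
Local Notation iter := (@f_iter R d (fun=> ball) f).

Fixpoint gback n (y : V) : V := if n is k.+1 then gback k (g' k y) else y.
Fixpoint gfwd n (y : V) : V := if n is k.+1 then g k (gfwd k y) else y.

Let ptB (t : orb) n : (start t <= n)%N -> en (pt t n) < 1.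
Proof. by move=> tn; have [] := @ptP R d (fun=> ball) f t n tn. Qed.

Let ptS (t : orb) n : (start t <= n)%N -> pt t n.+1 = f n (pt t n).
Proof. by move=> tn; have [] := @ptP R d (fun=> ball) f t n tn. Qed.

Let gfwdK n : cancel (gfwd n) (gback n).
Proof. by elim: n => [|n ih] y //=; rewrite gK ih. Qed.

Let gback_inj n : injective (gback n).
Proof. by elim: n => [|n ih] y z //= /ih e; rewrite -(g'K n y) e g'K. Qed.

Let gback_diff n z : differentiable (gback n) z.
Proof.
elim: n z => [|n ih] z /=; first exact: (@ex_diff _ _ _ _ _ _ _ (is_diff_id _)).
exact: (diff_comp_val 0 (g'd n z) (ih _)).1.
Qed.

Lemma linearized_tail (t : orb) n k : (start t <= n)%N -> en (pt t n) < r n ->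
  en (pt t (n + k)) < r (n + k) /\ gback (n + k) (h (n + k) (pt t (n + k))) = gback n (h n (pt t n)).
Proof.
move=> tn rn; elim: k => [|k [ih1 ih2]]; first by rewrite addn0.
rewrite addnS (ptS (leq_trans tn (leq_addr k n))); have [h1 h2] := hc ih1.
by split => //=; rewrite h2 gK.
Qed.

Let linval (t : orb) y := exists n, [/\ (start t <= n)%N, en (pt t n) < r n & gback n (h n (pt t n)) = y].

Let linval_ex t : exists y, linval t y.
Proof.
have [n tn rn] := attract (ptB (leqnn (start t))) (@ptS t).
by exists (gback n (h n (pt t n))), n.
Qed.

(** One direction makes the value independent of the representative, the other gives injectivity on
    classes: equal values force equal [h k] of the two orbits at all late times [k]. *)
Let linval_eq t t' y y' : linval t y -> linval t' y' -> tail_eq t t' <-> y = y'.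
Proof.
move=> [n [tn rn <-]] [n' [tn' rn' <-]]; split.
  move=> /asboolP[N _ hN]; pose k := maxn (maxn n n') N.
  have nk : (n <= k)%N by rewrite /k -maxnA leq_maxl.
  have nk' : (n' <= k)%N by rewrite /k maxnAC leq_maxr.
  have := (linearized_tail (k - n) tn rn).2; have := (linearized_tail (k - n') tn' rn').2.
  by rewrite !subnKC // (hN k) /= ?leq_maxr // => -> ->.
move=> e; apply/asboolP; exists (maxn n n') => // k /=; rewrite geq_max => /andP[nk nk'].
have [a1 a2] := linearized_tail (k - n) tn rn; have [b1 b2] := linearized_tail (k - n') tn' rn'.
rewrite !subnKC // in a1 a2 b1 b2; apply: (hi a1 b1); apply: (@gback_inj k); exact: etrans a2 (etrans e (esym b2)).
Qed.

Local Open Scope quotient_scope.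

Definition basin_map (x : W) : V := projT1 (cid (linval_ex (repr x))).

Let repr_tail (t : orb) : tail_eq (repr (\pi_W t)) t.
Proof. by apply/eqmodP; rewrite reprK. Qed.

Lemma basin_mapE (t : orb) n : (start t <= n)%N -> en (pt t n) < r n ->
  basin_map (\pi_W t) = gback n (h n (pt t n)).
Proof.
move=> tn rn; rewrite /basin_map; case: cid => y hy /=.
have ht : linval t (gback n (h n (pt t n))) by exists n.
exact/(linval_eq hy ht)/repr_tail.
Qed.

Lemma basin_map_inj : injective basin_map.
Proof.
move=> x x'; rewrite /basin_map; case: cid => y hy; case: cid => y' hy' /=.
move/(linval_eq hy hy').2 => e; rewrite -(reprK x) -(reprK x'); exact/eqmodP.
Qed.

Lemma chart_eq m (z : set_type ball) n : (m <= n)%N -> en (iter m (n - m) (\val z)) < r n ->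
  basin_map (chart m z) = gback n (h n (iter m (n - m) (\val z))).
Proof. by move=> mn rn; exact: (@basin_mapE (@TailOrbit R d (fun=> ball) f m _ (@f_iter_orbit R d (fun=> ball) f m z)) n). Qed.

(** The model orbit of [y] enters the image of some [h n]; its preimage there, taken as a point of
    the chart of index [n], represents the class. *)
Lemma basin_map_surj y : exists x, basin_map x = y.
Proof.
have [//|n _ [z zr e]] := @model_orbit 0 (gfwd^~ y) _.
have zb : ball z := lt_le_trans zr (r1 n).
exists (chart n (SigSub (mem_set zb))); rewrite (@chart_eq n _ n (leqnn n)) subnn //=.
by rewrite e gfwdK.
Qed.

Lemma basin_cover (x : W) : exists m z, chart m z = x.
Proof.
have tb : ball (pt (repr x) (start (repr x))) := ptB (leqnn _).
exists (start (repr x)), (SigSub (mem_set tb)); rewrite -[RHS]reprK; apply/eqmodP/asboolP.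
exists (start (repr x)) => // n /= /subnKC <-; rewrite addKn.
elim: (n - _)%N => [|k ih]; first by rewrite addn0.
by rewrite /= ih addnS (ptS (leq_addr _ _)).
Qed.

Let iter_ball m k z : en z < 1 -> en (iter m k z) < 1.
Proof.
by move=> z1; elim: k => [|k ih] //=; have : ball (f (m + k) (iter m k z)) by exact: (@funS _ _ _ _ (f (m + k)) _ ih).
Qed.

Let iter_inj m k z w : en z < 1 -> en w < 1 -> iter m k z = iter m k w -> z = w.
Proof.
move=> z1 w1; elim: k => [|k ih] //= e; apply: ih.
by apply: (inj (f := f (m + k)) _ _ e); apply/mem_set; exact: iter_ball.
Qed.

Let iter_diff m k z : en z < 1 -> differentiable (iter m k) z.
Proof.
move=> z1; elim: k => [|k ih] /=; first exact: (@ex_diff _ _ _ _ _ _ _ (is_diff_id _)).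
exact: (diff_comp_val 0 ih (fd (m + k) (iter_ball m k z1))).1.
Qed.

Definition chart_map m (z : V) : V :=
  if pselect (ball z) is left zb then basin_map (chart m (SigSub (mem_set zb))) else 0.

Lemma chart_mapE m (z : set_type ball) : basin_map (chart m z) = chart_map m (\val z).
Proof.
rewrite /chart_map; case: pselect => [zb|[]]; last by case: z => z zP /=; exact: set_mem zP.
by congr (basin_map (chart m _)); exact: val_inj.
Qed.

Lemma chart_map_inj m z w : en z < 1 -> en w < 1 -> chart_map m z = chart_map m w -> z = w.
Proof.
move=> z1 w1; rewrite /chart_map; case: pselect => // zb; case: pselect => // wb /basin_map_inj.
move/eqmodP/asboolP => -[N _ hN]; have := hN (maxn N m); rewrite /= leq_maxl => /(_ isT).
exact: iter_inj.
Qed.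

(** The time [n] at which the orbit of [z] enters the domain of [h n] serves all nearby points as
    well, by continuity of the iterate, so one formula holds near [z]. *)
Lemma chart_map_diff m z : en z < 1 -> differentiable (chart_map m) z.
Proof.
move=> z1; have zb : ball z := z1.
have [||n mn rn] := @attract m (fun n => iter m (n - m) z); first by rewrite subnn.
  by move=> n mn; rewrite subSn //= subnKC.
have [e e0 he] := open_en z1.
have /continuous_nrP hcont := differentiable_continuous (iter_diff m (n - m) z1).
have [t t0 ht] := open_en rn.
have [s s0 hs] := hcont t t0.
apply: (@diff_local _ _ _ (gback n \o (h n \o iter m (n - m))) _ z (Num.min e s)).
- by rewrite lt_min e0.
- move=> w; rewrite lt_min => /andP[/he w1 /hs/ht wr]; rewrite /chart_map.
  case: pselect => [wb|[]//]; rewrite (@chart_eq m _ n) //.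
- have h1 := (diff_comp_val 0 (iter_diff m (n - m) z1) (hd rn)).1.
  exact: (diff_comp_val 0 h1 (gback_diff n _)).1.
Qed.

Lemma basin_biholomorphic : biholomorphic (abstract_basin (U := fun=> ball) f) (complex_space R d).
Proof.
(* This is the definition of the inductive limit topology. *)
have openW (A : set W) : open A <-> forall m, open (chart m @^-1` A) by [].
exact: (global_chart openW basin_cover basin_map_inj basin_map_surj chart_mapE chart_map_diff chart_map_inj).
Qed.

End BasinMap.

Theorem theorem6p1 (R : realType) (d : nat) (hd : (2 <= d)%N)
  (f : nat -> {injfun (@unit_ball R d) >-> (@unit_ball R d)})
  (f_holo : forall n, holomorphic_on (@unit_ball R d) (f n))
  (Lambda M : R) (Lambda_gt0 : 0 < Lambda) (Lambda_lt1 : Lambda < 1)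
  (M_gt1 : 1 < M)
  (f_bounds : forall (n : nat) (z : 'C[R]_d), unit_ball z ->
     M^-1 * enorm z <= enorm (f n z) /\ enorm (f n z) <= Lambda * enorm z)
  (bunching : Lambda `^ (2 + bunching_eps R d) * M < 1) :
  biholomorphic (abstract_basin (U := fun=> @unit_ball R d) f)
                (complex_space R d).
Proof.
have M0 : 0 < M by exact: lt_trans ltr01 M_gt1.
have d0 : (0 < d)%N by exact: leq_trans hd.
have D0 : (0 < 2 ^ d)%N by rewrite expn_gt0.
have [eps0 eps1] := @bunching_eps_bound R d hd.
have [al [al1 LamD MD]] := bunching_base D0 Lambda_gt0 Lambda_lt1 M0 eps0 eps1 bunching.
have fd n z : enorm z < 1 -> differentiable (f n) z by exact: f_holo.
have fL n z : enorm z < 1 -> enorm (f n z) <= Lambda * enorm z by move=> z1; exact: (f_bounds n z z1).2.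
have fM n z : enorm z < 1 -> enorm z <= M * enorm (f n z).
  by move=> z1; have := (f_bounds n z z1).1; rewrite -ler_pdivrMl.
have [g [g' [h [r [hg hh hatt horb]]]]] := polynomial_model d0 al1 Lambda_gt0 Lambda_lt1 LamD M0 MD fd fL fM.
apply: (@basin_biholomorphic R d f g g' h r) => //.
- by move=> n; case: (hg n).
- by move=> n; case: (hg n).
- by move=> n; case: (hg n).
- by move=> n; case: (hh n).
- by move=> n; case: (hh n).
- by move=> n; case: (hh n).
- by move=> n; case: (hh n).
Qed.
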